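(* Let $T>0$, $I_T=[0,T]$, and consider the equation $$\frac{dv}{dx}=\sum_{i=1}^{\infty}a_i(w,x)\,v^{i+1},\qquad x\in I_T,\ w\in\mathbb{C}^k,$$ where $A(w):=(a_1(w,\cdot),a_2(w,\cdot),\dots)\in X$ for all $w\in\mathbb{C}^k$ and, for some $\alpha\in\mathbb{N}^k$, every $a_i$ is an $\alpha$-homogeneous polynomial in $w$ whose coefficients are either (all) polynomials in $x$ or (all) polynomials in $e^{2\pi i x/T}$ and $e^{-2\pi i x/T}$. Assume that the set of universal centers $\mathcal{U}_A$ equals $\{0\}\subset\mathbb{C}^k$. Then there exist moments $m_1,\dots,m_N\in\mathcal{M}$ and holomorphic polynomials $p_1,\dots,p_N$ on $\mathbb{C}^N$ such that $$\mathcal{C}_A=\{w\in\mathbb{C}^k:\ p_n(m_1(A(w)),\dots,m_N(A(w)))=0\ \text{for all }1\le n\le N\}.$$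
   Context: A holomorphic polynomial $p$ on $\mathbb{C}^k$ is $\alpha$-homogeneous, $\alpha=(\alpha_1,\dots,\alpha_k)\in\mathbb{N}^k$, if $p(w_1^{\alpha_1},\dots,w_k^{\alpha_k})$ is a homogeneous polynomial. $L^\infty(I_T)$ is the space of bounded measurable complex functions on $I_T$. $X$ is the space of sequences $a=(a_1,a_2,\dots)$ with $a_i\in L^\infty(I_T)$ and $\sup_{x\in I_T,\,i}|a_i(x)|^{1/i}<\infty$. For $a\in X$, the equation $dv/dx=\sum_{i\ge1}a_i(x)v^{i+1}$ determines a center if every solution with sufficiently small initial value satisfies $v(T)=v(0)$; $\mathcal{C}\subset X$ is the set of centers and $\mathcal{C}_A:=A^{-1}(\mathcal{C})$. Iterated integrals: $I_{i_1,\dots,i_k}(a)=\int\cdots\int_{0\le s_1\le\dots\le s_k\le T}a_{i_k}(s_k)\cdots a_{i_1}(s_1)\,ds_k\cdots ds_1$; $\mathcal{U}$ is the set of $a\in X$ at which all these vanish ($k\ge1$), and $\mathcal{U}_A:=A^{-1}(\mathcal{U})$. With $\tilde a_i(x)=\int_0^xa_i(s)ds$, a moment is $m(a)=\int_0^T(\tilde a_{i_1}(s))^{n_1}\cdots(\tilde a_{i_k}(s))^{n_k}a_{i_{k+1}}(s)\,ds$ for some $k\ge0$ and natural numbers $n_j,i_j$; $\mathcal{M}$ is the set of moments. *)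

(* Defs.v *)
From Stdlib Require Import Reals List ZArith.
From Coquelicot Require Import Coquelicot.
Import ListNotations.
Open Scope R_scope.

Notation CC := Complex.C.

Definition Csum (l : list CC) : CC := fold_right Cplus (RtoC 0) l.

Fixpoint Cpow (z : CC) (n : nat) : CC :=
  match n with O => RtoC 1 | S m => Cmult z (Cpow z m) end.

Definition cis (theta : R) : CC := (cos theta, sin theta).

(* Vectors w in C^k are represented by w : nat -> CC, only w 0 .. w (k-1)
   being relevant.  Monomial w^beta = prod_{j<k} w_j^{beta_j}. *)
Fixpoint mono (k : nat) (beta : nat -> nat) (w : nat -> CC) : CC :=
  match k with
  | O => RtoC 1
  | S k' => Cmult (mono k' beta w) (Cpow (w k') (beta k'))
  end.

(* weighted degree sum_{j<k} alpha_j beta_j: the monomial w^beta becomes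
   a monomial of degree wdeg after substituting w_j := w_j^{alpha_j}. *)
Fixpoint wdeg (k : nat) (alpha beta : nat -> nat) : nat :=
  match k with
  | O => O
  | S k' => (wdeg k' alpha beta + alpha k' * beta k')%nat
  end.

Definition coef_kind (T : R) (b : bool) (c : R -> CC) : Prop :=
  if b then
    exists l : list (CC * nat),
      forall x, c x = Csum (map (fun p => Cmult (fst p) (RtoC (x ^ snd p))) l)
  else
    exists l : list (CC * Z),
      forall x, c x = Csum (map (fun p =>
                 Cmult (fst p) (cis (2 * PI * IZR (snd p) * x / T))) l).

Definition alpha_homog (T : R) (k : nat) (alpha : nat -> nat) (b : bool)
    (f : (nat -> CC) -> R -> CC) : Prop :=
  exists (d : nat) (l : list ((R -> CC) * (nat -> nat))),
    (forall c beta, In (c, beta) l -> wdeg k alpha beta = d /\ coef_kind T b c) /\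
    forall w x, 0 <= x <= T ->
      f w x = Csum (map (fun p => Cmult (fst p x) (mono k (snd p) w)) l).

(* A sequence a = (a_1, a_2, ...) is a : nat -> R -> CC (a 0 is unused). *)

(* membership in X: sup_{x in I_T, i >= 1} |a_i(x)|^{1/i} < oo *)
Definition in_X (T : R) (a : nat -> R -> CC) : Prop :=
  exists M : R, forall i x, (1 <= i)%nat -> 0 <= x <= T ->
    Cmod (a i x) <= M ^ i.

Definition is_solution (T : R) (a : nat -> R -> CC) (v : R -> CC) : Prop :=
  forall x, 0 <= x <= T ->
    exists l : CC, is_derive v x l /\
      is_series (fun n => Cmult (a (S n) x) (Cpow (v x) (n + 2))) l.

Definition is_center (T : R) (a : nat -> R -> CC) : Prop :=
  exists eps : R, 0 < eps /\
    forall v : R -> CC, Cmod (v 0) < eps -> is_solution T a v -> v T = v 0.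

(* iterated integrals: for the index list [i_1; ...; i_k],
   iter_int a [i_1;...;i_k] t =
     int_{0 <= s_1 <= ... <= s_k <= t} a_{i_k}(s_k) ... a_{i_1}(s_1). *)
Fixpoint iter_int_rev (a : nat -> R -> CC) (rl : list nat) (t : R) : CC :=
  match rl with
  | [] => RtoC 1
  | i :: rl' => RInt (V := C_R_CompleteNormedModule)
                  (fun s => Cmult (a i s) (iter_int_rev a rl' s)) 0 t
  end.
Definition iter_int (T : R) (a : nat -> R -> CC) (l : list nat) : CC :=
  iter_int_rev a (rev l) T.

Definition is_universal_center (T : R) (a : nat -> R -> CC) : Prop :=
  forall l : list nat, l <> [] -> (forall i, In i l -> (1 <= i)%nat) ->
    iter_int T a l = RtoC 0.

(* moments: data ([(i_1,n_1);...;(i_k,n_k)], i_{k+1}),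
   m(a) = int_0^T prod_j (atilde_{i_j}(s))^{n_j} a_{i_{k+1}}(s) ds,
   atilde_i(x) = int_0^x a_i. *)
Definition moment_data : Type := (list (nat * nat) * nat)%type.

Definition valid_moment (md : moment_data) : Prop :=
  (forall p, In p (fst md) -> (1 <= fst p)%nat /\ (1 <= snd p)%nat) /\
  (1 <= snd md)%nat.

Definition atilde (a : nat -> R -> CC) (i : nat) (x : R) : CC :=
  RInt (V := C_R_CompleteNormedModule) (a i) 0 x.

Definition moment (T : R) (md : moment_data) (a : nat -> R -> CC) : CC :=
  RInt (V := C_R_CompleteNormedModule)
    (fun s => Cmult
       (fold_right Cmult (RtoC 1)
          (map (fun p => Cpow (atilde a (fst p) s) (snd p)) (fst md)))
       (a (snd md) s)) 0 T.

Definition eval_poly (N : nat) (p : list (CC * (nat -> nat))) (z : nat -> CC) : CC :=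
  Csum (map (fun q => Cmult (fst q) (mono N (snd q) z)) p).

(* Main.v *)
(* The solutions of v' = sum a_i v^(i+1) have a formal first integral
   v (1 + H_1 v + H_2 v^2 + ...), whose coefficients H_n(x) are obtained from the a_i by repeated
   integration; the equation is a center iff H_n(T) = 0 for all n >= 1, and more generally as soon as
   some first integral of this form has all its coefficients taking equal values at 0 and T.  For a
   homogeneous family the H_n(T) and the moments are polynomials in w.

   Key step: two parameters with the same moments are both centers or both not.  Let f_i and g_i be
   the primitives of the two sequences of coefficients; equality of moments means that the integral of
   P(f) dQ(f) equals that of P(g) dQ(g) for all polynomials P and Q.  If some P(f) vanishes with
   m := P(g) nonzero, then every integral of m R(g) dQ(g) vanishes, and all iterated integrals of g
   close up.  Otherwise P(f) |-> P(g) extends to an isomorphism of differential fields, which sends the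
   first integral of f to one of g.  A conductor D, for which D H_n^j is a polynomial in f for all j,
   converts equality of moments into equality of the integrals of q(H_n) r(H_n) dH_n for a fixed q
   and all r, which separates the endpoint values of H_n.  In the trigonometric case the f_i are
   Laurent polynomials in z = exp(2 pi i x / T) plus multiples of x.  If these multiples vanish, the
   isomorphism preserves Laurent polynomials; if not, the residue of the first integral forces (by
   Kummer theory) a power of z into the field, and the moments weighted by 1, f_0 and f_0^2 give f = g.

   The moments of positive degree vanish simultaneously only at a universal center, that is, at w = 0.
   By the Nullstellensatz and homogeneity, C[w] is then a finite module over the algebra generated by
   finitely many moments m_i.  If w0 is not a center, the key step and the Nullstellensatz give
   1 = sum_i g_i (m_i - m_i(w0)) on the center set; expanding the g_i in module generators, the
   determinant trick yields a polynomial in the m_i that vanishes on the center set but not at w0. *)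
Require Import Defs.
From Stdlib Require Import Reals List ZArith.
From Coquelicot Require Import Coquelicot.
Open Scope R_scope.
From Stdlib Require Import Lra Lia Psatz.
From Stdlib Require Classical_Prop Classical_Pred_Type ClassicalEpsilon.
From HB Require Import structures.
From mathcomp Require all_boot all_order all_algebra fraction ring zify ssrZ mpoly.
From mathcomp Require Rstruct complex.

(** * Pairs of functions satisfying the same algebraic relations *)

(** Moments see only polynomials in the path, whereas [H_n] comes from repeated integration and need
    not be one. What helps is that everything lives in a function field of one variable: the
    derivative of an element is fixed by any separable algebraic relation with a nonconstant [t],
    and a primitive in that field of an element of the subfield generated by [f] differs by a
    constant from a normalized trace. So [H_n] lies in this subfield and the isomorphism applies to
    it, although it knows nothing of the endpoints. For polynomial coefficients the endpoints return
    through the moments alone, and clearing the denominators of [H_n] is the price. The partner of a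
    normalized [H_n] carries uncontrolled constants of integration and no growth bound in [n]. Hence
    the criterion for centers must accept any first integral with equal end values, and it passes
    through infinite-order flatness of the return map instead of convergence of the series. Equality
    of all moments is a condition on pairs of parameters; Noetherianity in doubled variables reduces
    it to finitely many moments. *)

Module FracDer.
Import all_boot all_algebra fraction ring zify.
Set Implicit Arguments. Unset Strict Implicit. Unset Printing Implicit Defensive.
Import GRing.Theory.
Local Open Scope ring_scope.
Local Open Scope quotient_scope.

Notation "p %:F" := (@FracField.tofrac _ p) (at level 1, format "p %:F").

Section FieldIdentities.
Variable K : fieldType.
Implicit Types p q r s n d : K.

Lemma quot_cross p q d : q != 0 -> p / q * d * q = p * d.
Proof. by move=> q0; field. Qed.

Lemma quot_der_eq p q n d p' q' n' d' : q != 0 -> d != 0 ->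
  n * q = p * d -> n' * q + n * q' = p' * d + p * d' ->
  (n' * d - n * d') / d ^+ 2 = (p' * q - p * q') / q ^+ 2.
Proof.
move=> q0 d0 e1 e2.
have n1 : n = p * d / q by rewrite -e1 mulfK.
have n2 : n' = (p' * d + p * d' - n * q') / q.
  by apply: (mulIf q0); rewrite mulfVK // -e2 addrK.
by rewrite n2 n1; field; rewrite q0 d0.
Qed.

Lemma quot_add p q r s : q != 0 -> s != 0 -> p / q + r / s = (p * s + r * q) / (q * s).
Proof. by move=> q0 s0; field; rewrite q0 s0. Qed.

Lemma quot_add_der p q r s p' q' r' s' : q != 0 -> s != 0 ->
  ((p' * s + p * s' + (r' * q + r * q')) * (q * s)
    - (p * s + r * q) * (q' * s + q * s')) / (q * s) ^+ 2 =
  (p' * q - p * q') / q ^+ 2 + (r' * s - r * s') / s ^+ 2.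
Proof. by move=> q0 s0; field; rewrite q0 s0. Qed.

Lemma quot_mul_der p q r s p' q' r' s' : q != 0 -> s != 0 ->
  ((p' * r + p * r') * (q * s) - p * r * (q' * s + q * s')) / (q * s) ^+ 2 =
  (p' * q - p * q') / q ^+ 2 * (r / s) + p / q * ((r' * s - r * s') / s ^+ 2).
Proof. by move=> q0 s0; field; rewrite q0 s0. Qed.
End FieldIdentities.

(* [F(X)] with its derivation, as an interface, so that unification never unfolds the quotient construction. *)
Record ratfun (F : fieldType) := RatFun {
  rE :> fieldType;
  rI : {rmorphism {poly F} -> rE};
  rD : rE -> rE;
  rI_eq0 : forall p, rI p = 0 -> p = 0;
  rP : forall x, exists n d, [/\ d != 0, x = rI n / rI d &
    rD x = (rI n^`() * rI d - rI n * rI d^`()) / rI d ^+ 2] }.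

Section RatfunExists.
Variable F : fieldType.
Notation E := {fraction {poly F}}.

Lemma frac_repr (x : E) : x * (\d_(repr x))%:F = (\n_(repr x))%:F.
Proof.
rewrite -{1}[x]reprK; unlock FracField.tofrac; rewrite -[LHS]FracField.pi_mul.
apply/eqmodP => /=.
rewrite FracField.equivfE /FracField.mulf !numden_Ratio ?mulr1 ?oner_eq0 ?denom_ratioP //.
by rewrite mulrC.
Qed.

(** The quotient rule on the representative chosen by [repr]; [derE] extends it to every
    representative. *)
Definition frac_der (x : E) : E :=
  ((\n_(repr x))^`()%:F * (\d_(repr x))%:F
    - (\n_(repr x))%:F * (\d_(repr x))^`()%:F) / (\d_(repr x))%:F ^+ 2.

Lemma tofrac_inj0 (p : {poly F}) : (@FracField.tofrac {poly F}) p = 0 -> p = 0.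
Proof. by move/eqP; rewrite tofrac_eq0 => /eqP. Qed.

Lemma frac_derP x : exists n d, [/\ d != 0, x = n%:F / d%:F &
    frac_der x = (n^`()%:F * d%:F - n%:F * d^`()%:F) / d%:F ^+ 2].
Proof.
exists \n_(repr x), \d_(repr x).
have nd : \d_(repr x) != 0 by exact: denom_ratioP.
split=> //.
have dE : (\d_(repr x))%:F != 0 :> E by rewrite tofrac_eq0.
by apply: (mulIf dE); rewrite mulfVK // frac_repr.
Qed.

Definition frac_ratfun : ratfun F := RatFun tofrac_inj0 frac_derP.
End RatfunExists.

Section Abstract.
Variables (F : fieldType) (E : ratfun F).
Notation iota := (rI E).
Notation der := (@rD F E).
Hypothesis ch0 : forall n, n.+1%:R != 0 :> F.

Lemma iota_eq0E p : (iota p == 0) = (p == 0).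
Proof. by apply/eqP/eqP=> [/rI_eq0|->] //; rewrite rmorph0. Qed.

Lemma iota_neq0 p : p != 0 -> iota p != 0.
Proof. by apply: contra_neq => /rI_eq0. Qed.

Lemma fracE (x : E) : exists p q, q != 0 /\ x = iota p / iota q.
Proof. by have [p [q [q0 xE _]]] := rP x; exists p, q. Qed.

(** Two representatives satisfy [n q = p d]; differentiating this identity of polynomials makes
    their quotient rules agree. *)
Lemma derE p q : q != 0 ->
  der (iota p / iota q) = (iota p^`() * iota q - iota p * iota q^`()) / iota q ^+ 2.
Proof.
move=> q0; have [n [d [d0 xE ->]]] := rP (iota p / iota q).
have qE := iota_neq0 q0; have dE := iota_neq0 d0.
have e1 : n * q = p * d.
  apply/eqP; rewrite -subr_eq0; apply/eqP/(@rI_eq0 _ E).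
  have nE : iota n = iota p / iota q * iota d by rewrite xE mulfVK.
  by rewrite rmorphB !rmorphM /= nE quot_cross ?subrr.
have e2 : n^`() * q + n * q^`() = p^`() * d + p * d^`() by rewrite -!derivM e1.
move/(congr1 iota): e1; move/(congr1 iota): e2.
rewrite !rmorphD !rmorphM /= => e2 e1.
exact: quot_der_eq.
Qed.

Lemma der_iota p : der (iota p) = iota p^`().
Proof.
by rewrite -{1}[iota p]divr1 -(rmorph1 iota) derE ?oner_eq0 //
  !rmorph1 expr1n divr1 mulr1 derivE rmorph0 mulr0 subr0.
Qed.

Lemma derD (x y : E) : der (x + y) = der x + der y.
Proof.
have [p [q [q0 ->]]] := fracE x; have [r [s [s0 ->]]] := fracE y.
have qE := iota_neq0 q0; have sE := iota_neq0 s0.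
rewrite quot_add // -!rmorphM -rmorphD.
rewrite !derE ?mulf_neq0 // !derivE ?(rmorphD, rmorphM) /= ?(rmorphD, rmorphM) /= ?(rmorphD, rmorphM) /=.
exact: quot_add_der.
Qed.

Lemma derM (x y : E) : der (x * y) = der x * y + x * der y.
Proof.
have [p [q [q0 ->]]] := fracE x; have [r [s [s0 ->]]] := fracE y.
have qE := iota_neq0 q0; have sE := iota_neq0 s0.
rewrite mulf_div -!rmorphM.
rewrite !derE ?mulf_neq0 // !derivE ?(rmorphD, rmorphM) /= ?(rmorphD, rmorphM) /= ?(rmorphD, rmorphM) /=.
exact: quot_mul_der.
Qed.

Lemma frac_coprime (x : E) :
  exists p q, [/\ q != 0, coprimep p q & x = iota p / iota q].
Proof.
have [p [q [q0 ->]]] := fracE x.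
pose d := gcdp p q.
have d0 : d != 0 by rewrite gcdp_eq0 negb_and q0 orbT.
have dp : p = p %/ d * d by rewrite divpK // dvdp_gcdl.
have dq : q = q %/ d * d by rewrite divpK // dvdp_gcdr.
have q'0 : q %/ d != 0 by apply: contraNneq q0 => e; rewrite dq e mul0r.
exists (p %/ d), (q %/ d); split=> //.
  by apply: coprimep_div_gcd; rewrite q0 orbT.
rewrite {1}dp {1}dq !rmorphM /= -mulf_div divff ?mulr1 //.
exact: iota_neq0.
Qed.

Definition cst (c : F) : E := iota c%:P.
Lemma cst_zmod_morphism : zmod_morphism cst.
Proof. by move=> x y; rewrite /cst !rmorphB. Qed.
Lemma cst_monoid_morphism : monoid_morphism cst.
Proof. by split=> [|x y]; rewrite /cst ?rmorph1 ?rmorphM. Qed.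
HB.instance Definition _ := GRing.isZmodMorphism.Build F E cst cst_zmod_morphism.
HB.instance Definition _ := GRing.isMonoidMorphism.Build F E cst cst_monoid_morphism.

Lemma der_cst c : der (cst c) = 0.
Proof. by rewrite der_iota derivC rmorph0. Qed.
Lemma der0 : der 0 = 0.
Proof. by have := der_cst 0; rewrite rmorph0. Qed.
Lemma der1 : der 1 = 0.
Proof. by have := der_cst 1; rewrite rmorph1. Qed.
Lemma derN x : der (- x) = - der x.
Proof.
by apply/eqP; rewrite -subr_eq0 opprK -derD addNr der0.
Qed.
Lemma derB x y : der (x - y) = der x - der y.
Proof. by rewrite derD derN. Qed.
Lemma derV x : x != 0 -> der x^-1 = - der x / x ^+ 2.
Proof.
move=> x0; have := der1; rewrite -(divff x0) derM => e.
have -> : der x^-1 = (der x / x + x * der x^-1 - der x / x) / x.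
  by field.
by rewrite e; field.
Qed.
Lemma derf x y : y != 0 -> der (x / y) = (der x * y - x * der y) / y ^+ 2.
Proof. by move=> y0; rewrite derM derV //; field. Qed.
Lemma derX x n : der (x ^+ n) = x ^+ n.-1 * der x *+ n.
Proof.
elim: n => [|[|n] IH]; first by rewrite expr0 der1 mulr0n.
  by rewrite expr1 expr0 mul1r.
by rewrite exprS derM IH /= !exprS [in RHS]mulrS; ring.
Qed.
Lemma der_sum (I : Type) (r : seq I) (P : pred I) (f : I -> E) :
  der (\sum_(i <- r | P i) f i) = \sum_(i <- r | P i) der (f i).
Proof. by apply: (big_morph der derD der0). Qed.

Definition evt (t : E) (p : {poly F}) : E := (map_poly cst p).[t].
Lemma evt_zmod_morphism t : zmod_morphism (evt t).
Proof. by move=> x y; rewrite /evt rmorphB /= hornerD hornerN. Qed.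
Lemma evt_monoid_morphism t : monoid_morphism (evt t).
Proof. by split=> [|x y]; rewrite /evt ?rmorph1 ?hornerC // rmorphM /= hornerM. Qed.
HB.instance Definition _ t := GRing.isZmodMorphism.Build {poly F} E (evt t) (evt_zmod_morphism t).
HB.instance Definition _ t := GRing.isMonoidMorphism.Build {poly F} E (evt t) (evt_monoid_morphism t).

Lemma evtC t c : evt t c%:P = cst c.
Proof. by rewrite /evt map_polyC hornerC. Qed.
Lemma evtX t : evt t 'X = t.
Proof. by rewrite /evt map_polyX hornerX. Qed.

Lemma evt_X p : evt (iota (polyX F)) p = iota p.
Proof.
elim/poly_ind: p => [|p c IH]; first by rewrite !rmorph0.
by rewrite !rmorphD !rmorphM /= IH evtX evtC.
Qed.

Lemma evt_comp p q : evt (iota q) p = iota (p \Po q).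
Proof.
elim/poly_ind: p => [|p c IH]; first by rewrite !(rmorph0, comp_poly0).
by rewrite comp_polyD comp_polyM comp_polyX comp_polyC !rmorphD !rmorphM /= IH evtX evtC.
Qed.

Lemma der_evt t p : der (evt t p) = evt t p^`() * der t.
Proof.
elim/poly_ind: p => [|p c IH]; first by rewrite deriv0 !rmorph0 der0 mul0r.
rewrite derivD derivM derivX derivC !rmorphD !rmorphM /= !rmorph1 rmorph0 evtX evtC.
by rewrite derD derM der_cst IH; ring.
Qed.

Definition ev2 (t x : E) (R : {poly {poly F}}) : E := (map_poly (evt t) R).[x].
Lemma ev2_zmod_morphism t x : zmod_morphism (ev2 t x).
Proof. by move=> p q; rewrite /ev2 rmorphB /= hornerD hornerN. Qed.
Lemma ev2_monoid_morphism t x : monoid_morphism (ev2 t x).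
Proof. by split=> [|p q]; rewrite /ev2 ?rmorph1 ?hornerC // rmorphM /= hornerM. Qed.
HB.instance Definition _ t x := GRing.isZmodMorphism.Build {poly {poly F}} E (ev2 t x) (ev2_zmod_morphism t x).
HB.instance Definition _ t x := GRing.isMonoidMorphism.Build {poly {poly F}} E (ev2 t x) (ev2_monoid_morphism t x).
Lemma ev2C t x c : ev2 t x c%:P = evt t c.
Proof. by rewrite /ev2 map_polyC hornerC. Qed.
Lemma ev2X t x : ev2 t x 'X = x.
Proof. by rewrite /ev2 map_polyX hornerX. Qed.

Lemma deriv_eq0 (p : {poly F}) : p^`() = 0 -> exists c, p = c%:P.
Proof.
move=> p0; exists p`_0; apply/polyP=> -[|i]; rewrite coefC //=.
have := congr1 (fun q : {poly F} => q`_i) p0; rewrite coef_deriv coef0 => /eqP.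
by rewrite -mulr_natr mulf_eq0 (negPf (ch0 i)) orbF => /eqP.
Qed.

Lemma natE n : n.+1%:R != 0 :> E.
Proof. by rewrite -(rmorph_nat cst) fmorph_eq0 ch0. Qed.

(** In lowest terms [p' q = p q'] makes [q] divide [q'], so [q' = 0] by degree and then [p' = 0]. *)
Lemma der_eq0 x : der x = 0 -> exists c, x = cst c.
Proof.
have [p [q [q0 cpq ->]]] := frac_coprime x; rewrite derE //.
have qE : iota q != 0 :> E by exact: iota_neq0.
move/eqP; rewrite mulf_eq0 invr_eq0 expf_eq0 /= (negPf qE) orbF.
rewrite -!rmorphM -rmorphB iota_eq0E /= subr_eq0 => /eqP e.
have qd : q %| q^`().
  by rewrite -(Gauss_dvdpr _ (_ : coprimep q p)) 1?coprimep_sym // -e dvdp_mull.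
have q'0 : q^`() = 0.
  apply/eqP; case: eqP => // /eqP nz; have := dvdp_leq nz qd.
  by rewrite leqNgt lt_size_deriv.
have [c qc] := deriv_eq0 q'0.
have p'0 : p^`() = 0.
  by move/eqP: e; rewrite q'0 mulr0 mulf_eq0 (negPf q0) orbF => /eqP.
have [d pd] := deriv_eq0 p'0; exists (d / c).
by rewrite fmorph_div /= pd qc.
Qed.

(** A nonconstant [t] is transcendental: differentiating a relation for [t] yields one of lower
    degree. *)
Lemma evt_inj t : der t != 0 -> forall p, evt t p = 0 -> p = 0.
Proof.
move=> dt p; have [n] := ubnP (size p); elim: n p => // n IH p sp ep.
have p'0 : p^`() = 0.
  have [->|nz] := eqVneq p 0; first by rewrite deriv0.
  apply: IH; first by rewrite (leq_trans (lt_size_deriv nz)) // -ltnS.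
  by apply: (mulIf dt); rewrite -der_evt ep der0 mul0r.
have [c pc] := deriv_eq0 p'0; move: ep; rewrite pc evtC => /eqP.
by rewrite fmorph_eq0 => /eqP ->.
Qed.

(** Transcendence degree one by counting: over a common denominator the products [t^i x^j] with
    [i, j <= N] number about [N^2] but lie in a space of dimension linear in [N]. *)
Lemma algdep x t : exists2 R : {poly {poly F}}, R != 0 & ev2 t x R = 0.
Proof.
have [A [B [B0 xE]]] := fracE x; have [C [D [D0 tE]]] := fracE t.
(* The numerators [P i j] have size at most [k = 2 d N + 1], and [N = 4 (d + 1)] makes
   [k < m = (N + 1)^2]. The index [u < m] encodes the pair [(i, j)] by division by [N + 1]. *)
pose d := (size A + size B + size C + size D)%N.
pose N := (4 * d.+1)%N.
pose m := (N.+1 * N.+1)%N.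
pose k := (2 * (d * N)).+1.
pose P (i j : nat) : {poly F} := C ^+ i * D ^+ (N - i) * (A ^+ j * B ^+ (N - j)).
have sz1 (U V : {poly F}) i : (i <= N)%N -> (size U <= d)%N -> (size V <= d)%N ->
    (size (U ^+ i * V ^+ (N - i))%R <= (d * N).+1)%N.
  move=> iN hU hV; apply: leq_trans (size_polyMleq _ _) _.
  have h3 := size_poly_exp_leq U i; have h4 := size_poly_exp_leq V (N - i).
  have h1 : ((size U).-1 * i <= d * i)%N by rewrite leq_mul2r (leq_trans (leq_pred _)) ?orbT.
  have h2 : ((size V).-1 * (N - i) <= d * (N - i))%N by rewrite leq_mul2r (leq_trans (leq_pred _)) ?orbT.
  have h5 : (d * N = d * i + d * (N - i))%N by rewrite -mulnDr subnKC.
  by move: h1 h2 h3 h4 h5; lia.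
have szP i j : (i <= N)%N -> (j <= N)%N -> (size (P i j) <= k)%N.
  move=> iN jN; apply: leq_trans (size_polyMleq _ _) _.
  have hC : (size C <= d)%N by rewrite /d; lia.
  have hD : (size D <= d)%N by rewrite /d; lia.
  have hA : (size A <= d)%N by rewrite /d; lia.
  have hB : (size B <= d)%N by rewrite /d; lia.
  have := sz1 _ _ _ jN hA hB; have := sz1 _ _ _ iN hC hD; rewrite /k /P.
  set a := size (C ^+ i * _); set b := size (A ^+ j * _).
  by move: a b (d * N)%N => a b c; clear; lia.
pose ix (u : 'I_m) : nat := (u %/ N.+1)%N; pose jx (u : 'I_m) : nat := (u %% N.+1)%N.
have ixN u : (ix u <= N)%N by rewrite -ltnS ltn_divLR.
have jxN u : (jx u <= N)%N by rewrite -ltnS ltn_mod.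
pose M := \matrix_(u < m, v < k) (P (ix u) (jx u))`_v.
have rk : (\rank M < m)%N.
  apply: leq_ltn_trans (rank_leq_col _) _; rewrite /k /m /N.
  by nia.
have : kermx M != 0.
  by rewrite kermx_eq0 -row_leq_rank -ltnNge.
case/rowV0Pn=> g; rewrite sub_kermx => /eqP gM g0.
pose R : {poly {poly F}} := \sum_(u < m) (g 0 u)%:P%:P * ('X ^+ ix u)%:P * 'X ^+ jx u.
exists R.
  have [u gu] := rV0Pn _ g0.
  apply/eqP=> R0; move: gu; have := congr1 (fun q : {poly {poly F}} => q`_(jx u)`_(ix u)) R0.
  rewrite !coef0 /R !coef_sum (bigD1 u) //= big1 => [|v vu].
    rewrite addr0 -polyCM coefCM coefXn eqxx mulr1 coefCM coefXn eqxx mulr1.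
    by move=> ->; rewrite eqxx.
  rewrite -polyCM coefCM coefXn.
  case: eqP => [ej|]; last by rewrite mulr0 coef0.
  rewrite mulr1 coefCM coefXn; case: eqP => [ei|]; last by rewrite mulr0.
  case/eqP: vu; apply: val_inj => /=.
  by rewrite (divn_eq u N.+1) (divn_eq v N.+1) -/(ix u) -/(ix v) ei -/(jx u) ej.
have BE : iota B != 0 :> E by exact: iota_neq0.
have DE : iota D != 0 :> E by exact: iota_neq0.
have PE u : iota (P (ix u) (jx u)) = t ^+ ix u * x ^+ jx u * (iota B ^+ N * iota D ^+ N).
  rewrite /P !rmorphM !rmorphXn /= xE tE !expr_div_n.
  have -> : iota B ^+ N = iota B ^+ jx u * iota B ^+ (N - jx u) :> E by rewrite -exprD subnKC.
  have -> : iota D ^+ N = iota D ^+ ix u * iota D ^+ (N - ix u) :> E by rewrite -exprD subnKC.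
  by field; rewrite !expf_neq0.
have nz : iota B ^+ N * iota D ^+ N != 0 :> E by rewrite mulf_neq0 ?expf_neq0.
apply: (mulIf nz); rewrite mul0r /R rmorph_sum mulr_suml /=.
have -> : \sum_(u < m) ev2 t x ((g 0 u)%:P%:P * ('X ^+ ix u)%:P * 'X ^+ jx u) * (iota B ^+ N * iota D ^+ N)
   = iota (\sum_(u < m) (g 0 u)%:P * P (ix u) (jx u)).
  rewrite rmorph_sum; apply: eq_bigr => u _ /=.
  by rewrite [RHS]rmorphM PE !rmorphM /= !rmorphXn /= !ev2C ev2X ?rmorphXn /= evtX evtC /cst; ring.
suff -> : \sum_(u < m) (g 0 u)%:P * P (ix u) (jx u) = 0 by rewrite rmorph0.
apply/polyP=> v; rewrite coef0 coef_sum.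
have [vk|kv] := ltnP v k; last first.
  apply: big1 => u _; rewrite coefCM nth_default ?mulr0 //.
  by apply: leq_trans kv; apply: szP.
have := congr1 (fun X : 'rV_k => X 0 (Ordinal vk)) gM; rewrite !mxE => e; rewrite -[RHS]e.
by apply: eq_bigr => u _; rewrite coefCM mxE.
Qed.

End Abstract.
End FracDer.

(** * The differential field isomorphism between two families of functions *)

Module FunPair.
Import all_boot all_algebra ring.
Import FracDer.
Set Implicit Arguments. Unset Strict Implicit. Unset Printing Implicit Defensive.
Import GRing.Theory.
Local Open Scope ring_scope.

Section Pair.
Variables (F : fieldType) (E : ratfun F).
Hypothesis ch0 : forall n, n.+1%:R != 0 :> F.
Notation der := (@rD F E).
Notation cst := (@cst F E).

Lemma der_ev2 (t x : E) R :
  der (ev2 t x R) = ev2 t x (map_poly deriv R) * der t + ev2 t x R^`() * der x.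
Proof.
elim/poly_ind: R => [|R c IH].
  by rewrite map_poly0 deriv0 !rmorph0 der0 !mul0r addr0.
have -> : map_poly deriv (R * 'X + c%:P) = map_poly deriv R * 'X + (c^`())%:P.
  apply/polyP=> i; rewrite coef_map /= !(coefD, coefMX, coefC).
  by case: eqP => _; rewrite ?derivD ?deriv0 ?coef_map ?add0r ?addr0.
rewrite derivD derivM derivX derivC addr0 mulr1.
rewrite !rmorphD !rmorphM /= !ev2X !ev2C derD derM IH der_evt.
by ring.
Qed.

(** Dividing an algebraic relation by the highest power of [x] in it leaves a nonzero constant term
    [q(t)]. *)
Lemma algdep0 (x t : E) : x != 0 -> der t != 0 ->
  exists (q : {poly F}) R, q != 0 /\ evt t q + x * ev2 t x R = 0.
Proof.
move=> x0 dt; have [R R0 eR] := algdep x t.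
have [n] := ubnP (size R); elim: n R R0 eR => // n IH R R0 eR sR.
move: R0 eR sR; elim/poly_ind: R => [|R c _]; first by rewrite eqxx.
move=> R0 eR sR; have [c0|c0] := eqVneq c 0; last first.
  exists c, R; split=> //.
  by move: eR; rewrite rmorphD rmorphM /= ev2X ev2C addrC mulrC.
have Rn : R != 0 by apply: contraNneq R0 => ->; rewrite c0 mul0r add0r.
move: eR; rewrite c0 addr0 rmorphM /= ev2X => /eqP; rewrite mulf_eq0 (negPf x0) orbF => /eqP eR.
by apply: IH eR _ => //; move: sR; rewrite c0 addr0 size_mulX.
Qed.

Lemma ev2N (x y : E) R : ev2 x y (- R) = - ev2 x y R.
Proof.
have := ev2_zmod_morphism x y 0 R; rewrite sub0r => ->.
by rewrite {1}/ev2 map_poly0 horner0 sub0r.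
Qed.

Lemma evtN (x : E) p : evt x (- p) = - evt x p.
Proof.
have := evt_zmod_morphism x 0 p; rewrite sub0r => ->.
by rewrite {1}/evt map_poly0 horner0 sub0r.
Qed.

Variables f g : nat -> E.

(* Pairs [(P(f), P(g))] for one and the same polynomial [P]. *)
Inductive alg2 : E -> E -> Prop :=
 | alg2C c : alg2 (cst c) (cst c)
 | alg2V i : alg2 (f i) (g i)
 | alg2D x y x' y' : alg2 x y -> alg2 x' y' -> alg2 (x + x') (y + y')
 | alg2M x y x' y' : alg2 x y -> alg2 x' y' -> alg2 (x * x') (y * y').

Lemma alg2_0 : alg2 0 0. Proof. by have := alg2C 0; rewrite !rmorph0. Qed.
Lemma alg2_1 : alg2 1 1. Proof. by have := alg2C 1; rewrite !rmorph1. Qed.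
Lemma alg2N x y : alg2 x y -> alg2 (- x) (- y).
Proof. by move/(alg2M (alg2C (-1))); rewrite !rmorphN !rmorph1 !mulN1r. Qed.
Lemma alg2B x y x' y' : alg2 x y -> alg2 x' y' -> alg2 (x - x') (y - y').
Proof. by move=> h /alg2N; apply: alg2D. Qed.
Lemma alg2X x y n : alg2 x y -> alg2 (x ^+ n) (y ^+ n).
Proof.
move=> h; elim: n => [|n IH]; first by rewrite !expr0; apply: alg2_1.
by rewrite !exprS; apply: alg2M.
Qed.
Lemma alg2_sum (I : Type) (r : seq I) (P : pred I) (u v : I -> E) :
  (forall i, P i -> alg2 (u i) (v i)) ->
  alg2 (\sum_(i <- r | P i) u i) (\sum_(i <- r | P i) v i).
Proof.
by move=> h; apply: (big_ind2 alg2 alg2_0 _ h) => ????; apply: alg2D.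
Qed.
Lemma alg2_evt t s p : alg2 t s -> alg2 (evt t p) (evt s p).
Proof.
move=> h; elim/poly_ind: p => [|p c IH]; first by rewrite !rmorph0; apply: alg2_0.
rewrite !rmorphD !rmorphM /= !evtX !evtC.
by apply: alg2D; [apply: alg2M | apply: alg2C].
Qed.
Lemma alg2_ev2 t s x y R : alg2 t s -> alg2 x y -> alg2 (ev2 t x R) (ev2 s y R).
Proof.
move=> h1 h2; elim/poly_ind: R => [|p c IH]; first by rewrite !rmorph0; apply: alg2_0.
rewrite !rmorphD !rmorphM /= !ev2X !ev2C.
by apply: alg2D; [apply: alg2M | apply: alg2_evt].
Qed.

(* A nonzero [x] is algebraic over [F(t)]: [q(t) + x R(t, x) = 0] with [q != 0].  If the partner of [x]
   vanished, [q(s)] would vanish too, although [s] is transcendental. *)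
Lemma alg2_iff t s : (forall x y, alg2 x y -> x = 0 -> y = 0) ->
  alg2 t s -> der s != 0 -> der t != 0 /\ (forall x y, alg2 x y -> (x = 0 <-> y = 0)).
Proof.
move=> h ts ds.
have dt : der t != 0.
  apply/eqP=> /(der_eq0 ch0) [c tc].
  have := h _ _ (alg2B ts (alg2C c)); rewrite tc subrr => /(_ erefl)/eqP.
  by rewrite subr_eq0 => /eqP sc; move: ds; rewrite sc der_cst eqxx.
split=> // x y xy; split; first exact: h.
move=> y0; apply/eqP; apply/negPn/negP=> x0.
have [q [R [q0 e]]] := algdep0 x0 dt.
have := h _ _ (alg2D (alg2_evt q ts) (alg2M xy (alg2_ev2 R ts xy))) e.
rewrite y0 mul0r addr0 => /(evt_inj ch0 ds) q0'.
by move: q0; rewrite q0' eqxx.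
Qed.

Hypothesis iffB : forall x y, alg2 x y -> (x = 0 <-> y = 0).

Lemma alg2_neq0 x y : alg2 x y -> x != 0 -> y != 0.
Proof. by move=> /iffB h; apply: contra_neq => /h. Qed.

(** The graph of the isomorphism from the field of quotients of polynomials in [f] to that of [g];
    [b' != 0] follows from [alg2_neq0]. *)
Definition frac2 (x y : E) : Prop := exists a b a' b',
  [/\ alg2 a a', alg2 b b', b != 0 & x = a / b /\ y = a' / b'].

Lemma frac2_alg x y : alg2 x y -> frac2 x y.
Proof.
move=> h; exists x, 1, y, 1; split=> //; first exact: alg2_1.
  exact: oner_neq0.
by rewrite !divr1.
Qed.
Lemma frac2C c : frac2 (cst c) (cst c). Proof. exact/frac2_alg/alg2C. Qed.
Lemma frac2_0 : frac2 0 0. Proof. exact/frac2_alg/alg2_0. Qed.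
Lemma frac2_1 : frac2 1 1. Proof. exact/frac2_alg/alg2_1. Qed.
Lemma frac2D x y x' y' : frac2 x y -> frac2 x' y' -> frac2 (x + x') (y + y').
Proof.
move=> [a [b [a1 [b1 [ha hb nb [-> ->]]]]]] [c [d [c1 [d1 [hc hd nd [-> ->]]]]]].
have nb1 := alg2_neq0 hb nb; have nd1 := alg2_neq0 hd nd.
exists (a * d + c * b), (b * d), (a1 * d1 + c1 * b1), (b1 * d1); split.
- by apply: alg2D; apply: alg2M.
- exact: alg2M.
- exact: mulf_neq0.
- by rewrite !quot_add.
Qed.
Lemma frac2M x y x' y' : frac2 x y -> frac2 x' y' -> frac2 (x * x') (y * y').
Proof.
move=> [a [b [a1 [b1 [ha hb nb [-> ->]]]]]] [c [d [c1 [d1 [hc hd nd [-> ->]]]]]].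
exists (a * c), (b * d), (a1 * c1), (b1 * d1); split; try exact: alg2M.
  exact: mulf_neq0.
by rewrite !mulf_div.
Qed.
Lemma frac2N x y : frac2 x y -> frac2 (- x) (- y).
Proof. by move/(frac2M (frac2C (-1))); rewrite !rmorphN !rmorph1 !mulN1r. Qed.
Lemma frac2B x y x' y' : frac2 x y -> frac2 x' y' -> frac2 (x - x') (y - y').
Proof. by move=> h /frac2N; apply: frac2D. Qed.
Lemma frac2V x y : frac2 x y -> frac2 x^-1 y^-1.
Proof.
move=> [a [b [a1 [b1 [ha hb nb [-> ->]]]]]].
have [a0|a0] := eqVneq a 0.
  rewrite a0 ((iffB ha).1 a0) !mul0r invr0; exact: frac2_0.
exists b, a, b1, a1; split=> //.
by rewrite !invf_div.
Qed.
Lemma frac2f x y x' y' : frac2 x y -> frac2 x' y' -> frac2 (x / x') (y / y').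
Proof. by move=> h /frac2V; apply: frac2M. Qed.
Lemma frac2X x y n : frac2 x y -> frac2 (x ^+ n) (y ^+ n).
Proof.
move=> h; elim: n => [|n IH]; first by rewrite !expr0; apply: frac2_1.
by rewrite !exprS; apply: frac2M.
Qed.
Lemma frac2_sum (I : Type) (r : seq I) (P : pred I) (u v : I -> E) :
  (forall i, P i -> frac2 (u i) (v i)) ->
  frac2 (\sum_(i <- r | P i) u i) (\sum_(i <- r | P i) v i).
Proof.
by move=> h; apply: (big_ind2 frac2 frac2_0 _ h) => ????; apply: frac2D.
Qed.
Lemma frac2_evt t s p : frac2 t s -> frac2 (evt t p) (evt s p).
Proof.
move=> h; elim/poly_ind: p => [|p c IH]; first by rewrite !rmorph0; apply: frac2_0.
rewrite !rmorphD !rmorphM /= !evtX !evtC.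
by apply: frac2D; [apply: frac2M | apply: frac2C].
Qed.
Lemma frac2_ev2 t s x y R : frac2 t s -> frac2 x y -> frac2 (ev2 t x R) (ev2 s y R).
Proof.
move=> h1 h2; elim/poly_ind: R => [|p c IH]; first by rewrite !rmorph0; apply: frac2_0.
rewrite !rmorphD !rmorphM /= !ev2X !ev2C.
by apply: frac2D; [apply: frac2M | apply: frac2_evt].
Qed.
Lemma frac2_iff x y : frac2 x y -> (x = 0 <-> y = 0).
Proof.
move=> [a [b [a1 [b1 [ha hb nb [-> ->]]]]]].
have nb1 := alg2_neq0 hb nb.
split=> /eqP; rewrite mulf_eq0 invr_eq0 ?(negPf nb) ?(negPf nb1) orbF => /eqP a0.
  by rewrite ((iffB ha).1 a0) mul0r.
by rewrite ((iffB ha).2 a0) mul0r.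
Qed.
Lemma frac2_neq0 x y : frac2 x y -> x != 0 -> y != 0.
Proof. by move=> /frac2_iff h; apply: contra_neq => /h. Qed.
Lemma frac2_fun x y y' : frac2 x y -> frac2 x y' -> y = y'.
Proof.
move=> h h'; apply/eqP; rewrite -subr_eq0; apply/eqP.
by apply: (frac2_iff (frac2B h h')).1; rewrite subrr.
Qed.

Variables t s : E.
Hypotheses (ts : alg2 t s) (dt : der t != 0) (ds : der s != 0).

(** Separability: as long as the derivative in the outer variable also vanishes at [x], it is a
    relation of smaller degree. *)
Lemma min_rel (x : E) : exists R : {poly {poly F}}, ev2 t x R = 0 /\ ev2 t x R^`() != 0.
Proof.
have [R R0 eR] := algdep x t.
have [n] := ubnP (size R); elim: n R R0 eR => // n IH R R0 eR sR.
have [e|e] := eqVneq (ev2 t x R^`()) 0; last by exists R.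
apply: (IH R^`()) => //; last by rewrite (leq_trans (lt_size_deriv R0)).
apply/eqP=> R'0; have Rc : R = (R`_0)%:P.
  apply/polyP=> -[|i]; rewrite coefC //=.
  have := congr1 (fun q : {poly {poly F}} => q`_i) R'0; rewrite coef_deriv coef0 => /eqP.
  by rewrite -mulr_natl mulf_eq0 -!polyC_natr !polyC_eq0 (negPf (ch0 i)) => /eqP.
move: eR R0; rewrite Rc ev2C => /(evt_inj ch0 dt) ->.
by rewrite eqxx.
Qed.

(** Implicit differentiation of [R(t, x) = 0] gives [dx/dt = - R_t / R_x], a formula preserved by
    the isomorphism. *)
Lemma frac2_der x y : frac2 x y -> frac2 (der x / der t) (der y / der s).
Proof.
move=> xy; have [R [R0 R1]] := min_rel x.
have ts' := frac2_alg ts.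
have S0 : ev2 s y R = 0 := (frac2_iff (frac2_ev2 R ts' xy)).1 R0.
have h1 := frac2_ev2 R^`() ts' xy.
have S1 := frac2_neq0 h1 R1.
have h2 := frac2_ev2 (map_poly deriv R) ts' xy.
have e (u v : E) : der u != 0 -> ev2 u v R = 0 -> ev2 u v R^`() != 0 ->
    der v / der u = - (ev2 u v (map_poly deriv R) / ev2 u v R^`()).
  move=> du e0 e1; have := der_ev2 u v R; rewrite e0 der0 => /esym/eqP.
  rewrite addr_eq0 => /eqP e2.
  have -> : ev2 u v (map_poly deriv R) = - (ev2 u v R^`() * der v) / der u by rewrite -e2 mulfK.
  by field; rewrite du e1.
rewrite !e //; exact/frac2N/frac2f.
Qed.

(* The minimal polynomial of [x] over the first projection of [frac2]. *)
Lemma min_poly (x : E) : exists n (c : nat -> E),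
  [/\ (0 < n)%N, (forall i, exists y, frac2 (c i) y),
      x ^+ n = \sum_(i < n) c i * x ^+ i &
      (forall c' : nat -> E, (forall i, exists y, frac2 (c' i) y) ->
         \sum_(i < n) c' i * x ^+ i = 0 -> forall i, (i < n)%N -> c' i = 0)].
Proof.
pose P n := exists c : nat -> E, (forall i, exists y, frac2 (c i) y) /\
         \sum_(i < n) c i * x ^+ i = 0 /\ exists2 i, (i < n)%N & c i != 0.
have [n0 Pn0] : exists n, P n.
  have [R R0 eR] := algdep x t; exists (size R), (fun i => evt t R`_i); split.
    by move=> i; eexists; apply: frac2_evt; apply: frac2_alg ts.
  split.
    rewrite -[RHS]eR /ev2 horner_coef size_map_inj_poly ?rmorph0 //.
      by apply: eq_bigr => i _; rewrite coef_map.
    by move=> p q /eqP; rewrite -subr_eq0 -rmorphB => /eqP/(evt_inj ch0 dt)/eqP; rewrite subr_eq0 => /eqP.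
  exists (size R).-1; first by rewrite prednK // lt0n size_poly_eq0.
  apply/eqP=> /(evt_inj ch0 dt) /eqP; rewrite -/(lead_coef R) lead_coef_eq0.
  by rewrite (negPf R0).
have [m [Pm mmin]] : exists m, P m /\ forall k, (k < m)%N -> ~ P k.
  have [N] := ubnP n0; elim: N n0 Pn0 => // N IH n0 Pn0 nN.
  have [h|h] := Classical_Prop.classic (exists2 k, (k < n0)%N & P k).
    by have [k kn Pk] := h; apply: (IH k) => //; apply: leq_trans kn _.
  by exists n0; split=> // k kn Pk; apply: h; exists k.
have mind k : (k < m)%N -> forall c' : nat -> E, (forall i, exists y, frac2 (c' i) y) ->
         \sum_(i < k) c' i * x ^+ i = 0 -> forall i, (i < k)%N -> c' i = 0.
  move=> km c' hc' e i ik; apply/eqP; apply/negPn/negP=> ci.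
  by apply: (mmin k km); exists c'; split=> //; split=> //; exists i.
have {Pm} [c [hc [e [i im ci]]]] := Pm.
case: m mmin mind c hc e im ci => // n mmin mind c hc; rewrite big_ord_recr /= => e im ci.
have cn : c n != 0.
  apply/eqP=> cn0; move: e; rewrite cn0 mul0r addr0 => e.
  case/negP: ci; move: im; rewrite ltnS leq_eqVlt => /orP[/eqP->|im]; first by rewrite cn0.
  by rewrite (mind n (ltnSn n) c hc e i im).
exists n, (fun i => - (c i / c n)); split.
- rewrite lt0n; apply/eqP=> n0'; move: e; rewrite n0' big_ord0 add0r expr0 mulr1 => c0.
  by move: cn; rewrite n0' c0 eqxx.
- move=> k; have [y hy] := hc k; have [z hz] := hc n.
  by exists (- (y / z)); apply/frac2N/frac2f.
- apply: (mulfI cn); rewrite mulr_sumr; move/eqP: e; rewrite addrC addr_eq0 => /eqP ->.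
  by rewrite -sumrN; apply: eq_bigr => k _; field.
- exact: mind (ltnSn n).
Qed.

(* Differentiating the minimal polynomial of [x] shows that [x] differs from its normalized trace by a constant. *)
Lemma frac2_prim x k k' : frac2 k k' -> der x = k * der t -> exists y, frac2 x y.
Proof.
move=> kk' dx; have [n [c [n0 hc e ind]]] := min_poly x.
case: n n0 e ind => // n _ e ind.
(* The coefficients of the minimal equation [x^(n+1) = sum c_i x^i] differentiated by [t]. This
   relation has degree at most [n], so it is trivial, and its top coefficient says
   [dc_n/dt = (n+1) k]. *)
pose c' i := der (c i) / der t + (if (i < n)%N then k * c i.+1 *+ i.+1 else - (k *+ n.+1)).
have hc' i : exists y, frac2 (c' i) y.
  have [y hy] := hc i; have [z hz] := hc i.+1.
  exists (der y / der s + (if (i < n)%N then k' * z *+ i.+1 else - (k' *+ n.+1))).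
  have fn u v m : frac2 u v -> frac2 (u *+ m) (v *+ m).
    by move=> h; rewrite -mulr_natl -[v *+ m]mulr_natl -!(rmorph_nat cst); apply: frac2M (frac2C _) h.
  apply: frac2D; first by apply: frac2_der.
  by case: ifP => _; [apply/fn/frac2M | apply/frac2N/fn].
have e' : \sum_(i < n.+1) c' i * x ^+ i = 0.
  have := congr1 der e; rewrite der_sum derX /= dx => e1.
  have e2 : x ^+ n * k *+ n.+1 = \sum_(i < n.+1) (der (c i) / der t * x ^+ i + c i * (x ^+ i.-1 * k *+ i)).
    apply: (mulIf dt); rewrite mulrnAl -mulrA e1 mulr_suml; apply: eq_bigr => i _.
    rewrite derM derX dx [RHS]mulrDl; congr (_ + _); first by rewrite mulrAC mulfVK.
    by move: (der t) => u; ring.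
  under eq_bigr do rewrite mulrDl.
  rewrite big_split /= [X in _ + X]big_ord_recr /= ltnn mulNr mulrnAl [k * _]mulrC e2.
  rewrite big_split /= [X in _ - (_ + X)]big_ord_recl /= mulr0n mulr0 add0r.
  have aux (A B C : E) : B = C -> A + (B - (A + C)) = 0 by move=> ->; ring.
  apply: aux; apply: eq_bigr => i _.
  by rewrite ltn_ord /= /bump /= add1n add0n; ring.
have := ind c' hc' e' n (ltnSn n); rewrite /c' ltnn => /eqP.
rewrite subr_eq0 => /eqP e3.
have nz := natE E ch0 n.
have d0 : der (x - c n / n.+1%:R) = 0.
  rewrite derB dx derM -(rmorph_nat cst) -fmorphV der_cst mulr0 addr0 fmorphV rmorph_nat.
  have -> : der (c n) = k *+ n.+1 * der t by rewrite -e3 mulfVK.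
  have -> : k *+ n.+1 = k * n.+1%:R by rewrite mulr_natr.
  by rewrite -mulrA -mulrA [n.+1%:R * _]mulrC -!mulrA mulVf // mulr1 subrr.
have [a xa] := der_eq0 ch0 d0; have [y hy] := hc n.
exists (cst a + y / n.+1%:R).
have -> : x = cst a + c n / n.+1%:R by rewrite -xa subrK.
by apply: frac2D (frac2C _) _; apply: frac2f hy _; rewrite -!(rmorph_nat cst); apply: frac2C.
Qed.

Lemma frac2_prim_der x y k k' : frac2 x y -> frac2 k k' -> der x = k * der t -> der y = k' * der s.
Proof.
move=> xy kk' dx; have := frac2_der xy; rewrite dx mulfK // => h.
by rewrite (frac2_fun kk' h) mulfVK.
Qed.

(** With [x = a / b], the denominator [b^n] clears [x^j] for [j < n], and the integral equation
    reduces all higher powers to these. *)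
Lemma conductor x y n (P : nat -> {poly F}) : frac2 x y -> (0 < n)%N ->
  x ^+ n = \sum_(i < n) evt t (P i) * x ^+ i ->
  exists D D', [/\ alg2 D D', D != 0 & forall j, alg2 (D * x ^+ j) (D' * y ^+ j)].
Proof.
move=> xy n0 e; have [a [b [a' [b' [ha hb nb [xE yE]]]]]] := xy.
have nb' := alg2_neq0 hb nb.
have e' : y ^+ n = \sum_(i < n) evt s (P i) * y ^+ i.
  apply: (@frac2_fun (x ^+ n)); first exact: frac2X.
  rewrite e; apply: frac2_sum => i _; apply: frac2M; last exact: frac2X.
  exact/frac2_evt/frac2_alg.
exists (b ^+ n), (b' ^+ n); split; first exact: alg2X; first exact: expf_neq0.
move=> j; have [m] := ubnP j; elim: m j => // m IH j jm.
have [jn|nj] := ltnP j n.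
  rewrite xE yE !expr_div_n.
  have aux (u v : E) : v != 0 -> v ^+ n * (u ^+ j / v ^+ j) = v ^+ (n - j) * u ^+ j.
    by move=> v0; rewrite -{1}(subnK (ltnW jn)) exprD; field; rewrite expf_neq0.
  by rewrite !aux //; apply: alg2M; apply: alg2X.
rewrite -(subnK nj) exprD e exprD e' !mulr_sumr.
apply: alg2_sum => i _.
have h : (j - n + i < m)%N by rewrite -ltnS (leq_trans _ jm) // ltnS -{2}(subnK nj) ltn_add2l.
have := alg2M (alg2_evt (P i) ts) (IH _ h); rewrite !exprD.
by congr (alg2 _ _); ring.
Qed.

(* Eliminating [D] from an algebraic relation between [D] and [x]: a multiple of [D] is a polynomial in [x]. *)
Lemma norm_rel x y D D' : frac2 x y -> der x != 0 -> alg2 D D' -> D != 0 ->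
  exists (q : {poly F}) S, [/\ q != 0, D * ev2 x D S = evt x q & D' * ev2 y D' S = evt y q].
Proof.
move=> xy dx hD D0; have [q [R [q0 e]]] := algdep0 D0 dx.
exists q, (- R); split=> //.
  by apply/eqP; rewrite ev2N mulrN eq_sym -addr_eq0 e.
apply/eqP; rewrite ev2N mulrN eq_sym -addr_eq0; apply/eqP.
have h : frac2 (evt x q + D * ev2 x D R) (evt y q + D' * ev2 y D' R).
  apply: frac2D; first exact: frac2_evt.
  by apply: frac2M (frac2_alg hD) _; apply: frac2_ev2 => //; apply: frac2_alg.
exact: (frac2_iff h).1.
Qed.

End Pair.

Section Diagonal.
Variables (F : fieldType) (E : ratfun F).

Lemma alg2_diag (g : nat -> E) x y : alg2 g g x y -> x = y.
Proof. by elim=> // [x1 y1 x2 y2 _ -> _ -> //|x1 y1 x2 y2 _ -> _ -> //]. Qed.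

Lemma alg2_sym (f g : nat -> E) x y : alg2 f g x y -> alg2 g f y x.
Proof.
elim=> [c|i|x1 y1 x2 y2 _ h1 _ h2|x1 y1 x2 y2 _ h1 _ h2]; [exact: alg2C|exact: alg2V| |].
- exact: alg2D.
- exact: alg2M.
Qed.

Lemma alg2_left (f g : nat -> E) x y : alg2 f g x y -> alg2 f f x x.
Proof.
elim=> [c|i|x1 y1 x2 y2 _ h1 _ h2|x1 y1 x2 y2 _ h1 _ h2]; [exact: alg2C|exact: alg2V| |].
- exact: alg2D.
- exact: alg2M.
Qed.

(** The expression that builds [x] from [f] is read in [g]. The partner may depend on the
    expression, which is harmless where only some partner is wanted. *)
Lemma alg2_lift (f g : nat -> E) x y : alg2 f f x y -> exists x', alg2 f g x x'.
Proof.
elim=> [c|i|x1 y1 x2 y2 _ [z1 h1] _ [z2 h2]|x1 y1 x2 y2 _ [z1 h1] _ [z2 h2]].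
- by exists (cst E c); apply: alg2C.
- by exists (g i); apply: alg2V.
- by exists (z1 + z2); apply: alg2D.
- by exists (z1 * z2); apply: alg2M.
Qed.

Lemma frac2_diag (g : nat -> E) x y : frac2 g g x y -> frac2 g g x x.
Proof.
move=> [a [b [a' [b' [ha hb nb [e1 e2]]]]]].
move: (ha) (hb); rewrite -(alg2_diag ha) -(alg2_diag hb) => ha' hb'.
by exists a, b, a, b.
Qed.
End Diagonal.
End FunPair.

(** * Endpoint values on polynomial paths *)

Module PolyPath.
Import all_boot all_algebra ring.
Import FracDer FunPair.
Set Implicit Arguments. Unset Strict Implicit. Unset Printing Implicit Defensive.
Import GRing.Theory.
Local Open Scope ring_scope.

(** Write [q = Q1 (X - b)^m]. By Bezout some [H = u U = 1 - v W] is 0 at [a] and 1 at [b]; the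
    square in [U] makes [Q1] divide [H'], and the exponent [m + 1] in [W] makes [(X - b)^m] divide
    it. *)
Lemma separating_primitive (F : fieldType) (q : {poly F}) (a b : F) : q != 0 -> a != b ->
  exists H r : {poly F}, H^`() = q * r /\ H.[a] != H.[b].
Proof.
move=> q0 ab; have [m [Q1 rQ1 qE]] := multiplicity_XsubC q b.
move: rQ1; rewrite q0 /= => rQ1.
pose U := (Q1 * ('X - a%:P)) ^+ 2; pose W := ('X - b%:P) ^+ m.+1.
have cUW : coprimep U W.
  rewrite coprimep_expl // coprimep_expr // coprimep_XsubC rootM negb_or rQ1.
  by rewrite root_XsubC eq_sym.
have [[u v] /= e] := Bezout_eq1_coprimepP _ _ cUW.
have Hv : u * U = 1 - v * W by rewrite -e addrK.
have d1 : Q1 %| (u * U)^`().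
  pose V := Q1 * ('X - a%:P).
  have -> : (u * U)^`() = u^`() * (V * V) + u * (V^`() * V + V * V^`()).
    by rewrite /U expr2 derivM [(_ * _ : {poly F})^`()]derivM.
  move: V^`() => z; rewrite /V.
  have -> : u^`() * (Q1 * ('X - a%:P) * (Q1 * ('X - a%:P))) +
    u * (z * (Q1 * ('X - a%:P)) + Q1 * ('X - a%:P) * z) =
    Q1 * (u^`() * ('X - a%:P) * (Q1 * ('X - a%:P)) +
    u * (z * ('X - a%:P) + ('X - a%:P) * z)) by ring.
  by rewrite dvdp_mulIl.
have d2 : ('X - b%:P) ^+ m %| (u * U)^`().
  have -> : (u * U)^`() = ('X - b%:P) ^+ m * - (v^`() * ('X - b%:P) + v *+ m.+1).
    rewrite Hv derivB derivC sub0r derivM /W deriv_exp derivXsubC exprS /=.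
    by move: (('X - b%:P) ^+ m) => z; ring.
  by rewrite dvdp_mulIl.
have d : q %| (u * U)^`().
  rewrite qE Gauss_dvdp ?d1 ?d2 //.
  by rewrite coprimep_expr // coprimep_XsubC.
exists (u * U), ((u * U)^`() %/ q); split; first by rewrite [RHS]mulrC divpK.
have Ua : U.[a] = 0 by rewrite /U expr2 !hornerM hornerXsubC subrr !(mulr0, mul0r).
have Wb : W.[b] = 0 by rewrite /W exprS hornerM hornerXsubC subrr mul0r.
have h1 : (u * U).[a] = 0 by rewrite hornerM Ua mulr0.
have h2 : (u * U).[b] = 1 by rewrite Hv hornerD hornerN hornerM Wb mulr0 subr0 hornerC.
by rewrite h1 h2 eq_sym oner_eq0.
Qed.

Section Core.
Variables (F : fieldType) (E : ratfun F).
Hypothesis ch0 : forall n, n.+1%:R != 0 :> F.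
Notation der := (@rD F E).
Notation iota := (rI E).
Notation cst := (@cst F E).

Variables f g : nat -> E.
Notation alg2 := (alg2 f g).
Notation frac2 := (frac2 f g).
Hypothesis iffB : forall x y, alg2 x y -> (x = 0 <-> y = 0).
Variables t s : E.
Hypotheses (ts : alg2 t s) (dt : der t != 0) (ds : der s != 0).
(** Stands for equality of the two integrals ([bal]) or for vanishing of the second one ([bal1]).
    The multiplier [m] is 1 in the regular case and the nonzero partner of 0 in the degenerate
    one. *)
Variable BB : E -> E -> Prop.
Hypothesis BBD : forall x y x' y', BB x y -> BB x' y' -> BB (x + x') (y + y').
Variables m m' : E.
Hypotheses (hm : alg2 m m') (m0 : m != 0).
Hypothesis HB : forall a a' b b', alg2 a a' -> alg2 b b' ->
  BB (m * a * der b) (m' * a' * der b').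

(** With [e = m D], the identity [e d(e x) - e x de = e^2 dx] expresses the weighted differential of
    [x] through differentials of polynomials in [f]. *)
Lemma BB_conductor x y D D' :
  (forall j, alg2 (D * x ^+ j) (D' * y ^+ j)) ->
  forall j a a', alg2 a a' ->
  BB ((m * D) ^+ 2 * a * x ^+ j * der x) ((m' * D') ^+ 2 * a' * y ^+ j * der y).
Proof.
move=> hD j a a' ha.
have h0 : alg2 D D' by have := hD 0; rewrite !expr0 !mulr1.
have h1 : alg2 (D * x) (D' * y) by have := hD 1%N; rewrite !expr1.
have e1 := HB (alg2M ha (hD j)) (alg2M hm h1).
have e2 := HB (alg2N (alg2M ha (hD j.+1))) (alg2M hm h0).
have := BBD e1 e2; congr (BB _ _); rewrite !derM !exprS; ring.
Qed.

Lemma BB_poly x y D D' : (forall j, alg2 (D * x ^+ j) (D' * y ^+ j)) ->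
  forall c j a a', alg2 a a' ->
  BB ((m * D) ^+ 2 * a * evt x c * x ^+ j * der x) ((m' * D') ^+ 2 * a' * evt y c * y ^+ j * der y).
Proof.
move=> hD; elim/poly_ind=> [|c d IH] j a a' ha.
  have := BB_conductor hD j (alg2_0 f g); rewrite !rmorph0.
  by congr (BB _ _); ring.
have := BBD (IH j.+1 _ _ ha) (BB_conductor hD j (alg2M (alg2C f g d) ha)).
by congr (BB _ _); rewrite rmorphD rmorphM /= evtX evtC !exprS; ring.
Qed.

Lemma BB_norm x y D D' : (forall j, alg2 (D * x ^+ j) (D' * y ^+ j)) ->
  forall W a a', alg2 a a' ->
  BB ((m * D) ^+ 2 * a * ev2 x (m * D) W * der x) ((m' * D') ^+ 2 * a' * ev2 y (m' * D') W * der y).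
Proof.
move=> hD; have h0 : alg2 D D' by have := hD 0; rewrite !expr0 !mulr1.
elim/poly_ind=> [|W c IH] a a' ha.
  have e0 (u v : E) : ev2 u v 0 = 0 by rewrite /ev2 map_poly0 horner0.
  have e1 (u : E) : evt u 0 = 0 by rewrite rmorph0.
  have := BB_poly hD 0 0 ha; rewrite !e0 !e1.
  by congr (BB _ _); ring.
have := BBD (IH _ _ (alg2M ha (alg2M hm h0))) (BB_poly hD c 0 ha).
by congr (BB _ _); rewrite rmorphD rmorphM /= ev2X ev2C expr0; ring.
Qed.

(** The weight [(m D)^2] of [BB_norm] is not a function of [x]; multiplying by [S(x, m D)^2], where
    [m D S(x, m D) = q(x)], turns it into [q(x)^2]. *)
Lemma core_lemma x y n (P : nat -> {poly F}) : frac2 x y -> (0 < n)%N ->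
  x ^+ n = \sum_(i < n) evt t (P i) * x ^+ i -> der x != 0 ->
  exists2 q : {poly F}, q != 0 &
    forall r, BB (evt x (q * r) * der x) (evt y (q * r) * der y).
Proof.
move=> xy n0 e dx.
have [D [D' [_ D0 hD]]] := conductor iffB ts xy n0 e.
have h0 : alg2 D D' by have := hD 0; rewrite !expr0 !mulr1.
have mD0 : m * D != 0 by apply: mulf_neq0.
have [q [S [q0 e1 e2]]] := norm_rel iffB xy dx (alg2M hm h0) mD0.
exists (q ^+ 2); first exact: expf_neq0.
move=> r; have := BB_norm hD (S ^+ 2 * r%:P) (alg2_1 f g).
have e3 (u v : E) : u * ev2 v u S = evt v q ->
    u ^+ 2 * 1 * ev2 v u (S ^+ 2 * r%:P) = evt v (q ^+ 2 * r).
  by move=> h; rewrite !expr2 !rmorphM /= ev2C -h; ring.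
by rewrite !e3.
Qed.
End Core.

Section PolyCase.
Variables (F : fieldType) (E : ratfun F).
Hypothesis ch0 : forall n, n.+1%:R != 0 :> F.
Notation der := (@rD F E).
Notation iota := (rI E).
Notation cst := (@cst F E).

Lemma poly_prim (w : {poly F}) : exists P : {poly F}, P^`() = w.
Proof.
exists (\poly_(i < (size w).+1) (w`_i.-1 / i%:R)).
apply/polyP=> i; rewrite coef_deriv coef_poly ltnS.
case: ltnP => [_|h]; last by rewrite mul0rn nth_default.
by rewrite -[LHS]mulr_natr divfK.
Qed.

Lemma poly_of_der (x : E) w : der x = iota w -> exists X, x = iota X.
Proof.
have [P <-] := poly_prim w.
rewrite -der_iota => /eqP; rewrite -subr_eq0 -derB => /eqP/(der_eq0 ch0) [c e].
by exists (P + c%:P); rewrite rmorphD -[iota c%:P]e addrC subrK.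
Qed.

Definition evtm (t : E) : {rmorphism {poly F} -> E} := evt t.

Lemma integral_rel t x : integralOver (evtm t) x ->
  exists n (P : nat -> {poly F}), (0 < n)%N /\ x ^+ n = \sum_(i < n) evt t (P i) * x ^+ i.
Proof.
move=> [Q mQ rQ].
have sQ : (0 < size Q)%N by rewrite size_poly_gt0 monic_neq0.
exists (size Q).-1, (fun i => - Q`_i); split.
  rewrite ltn_predRL ltn_neqAle sQ andbT eq_sym; apply/negP=> /size_poly1P [c c0 Qc].
  move: mQ rQ; rewrite Qc monicE lead_coefC => /eqP->.
  by rewrite rmorph1 rootC oner_eq0.
move: rQ; rewrite /root horner_coef size_map_poly_id0; last by rewrite (monicP mQ) rmorph1 oner_neq0.
rewrite -(prednK sQ) big_ord_recr /= coef_map /= -/(lead_coef Q) (monicP mQ).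
have -> : evtm t 1 = 1 by rewrite rmorph1.
rewrite mul1r addrC addr_eq0 => /eqP ->.
rewrite -sumrN; apply: eq_bigr => i _; rewrite coef_map /=.
by rewrite evtN mulNr.
Qed.

(** Since [Q] has lower degree, [P(x) - t Q(x) = 0] is monic over [F[t]] up to a constant factor. *)
Lemma integralOver_ratio t x (P Q : {poly F}) : (size Q < size P)%N ->
  evt x P = t * evt x Q -> integralOver (evtm t) x.
Proof.
move=> sz ePQ; have P0 : P != 0 by rewrite -size_poly_gt0 (leq_ltn_trans _ sz).
have l0 : lead_coef P != 0 by rewrite lead_coef_eq0.
have sQ : (size (('X%:P * map_poly polyC Q)%R : {poly {poly F}}) < size P)%N.
  apply: leq_ltn_trans (size_polyMleq _ _) _; rewrite size_map_polyC.
  apply: leq_ltn_trans sz; have := size_polyC_leq1 ('X : {poly F}).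
  by case: (size _) => [|[|//]] _; rewrite ?add0n ?leq_pred.
pose R := (lead_coef P)^-1%:P%:P * (map_poly polyC P - 'X%:P * map_poly polyC Q).
exists R.
  apply/monicP; rewrite lead_coefM lead_coefC.
  rewrite lead_coefDl ?size_map_polyC ?size_polyN //.
  by rewrite lead_coef_map_inj //= -?polyCM ?mulVf //; apply: polyC_inj.
have mE p : (map_poly (evt t) (map_poly polyC p)).[x] = evt x p.
  rewrite -map_poly_comp; congr (_.[_]).
  by apply: eq_map_poly => c /=; rewrite evtC.
rewrite /root /R rmorphM rmorphB /= hornerM hornerD hornerN rmorphM hornerM !map_polyC !hornerC /=.
have YE : (map_poly (evt t) ('X%:P : {poly {poly F}})).[x] = t by rewrite map_polyC hornerC /= evtX.
by rewrite YE !mE ePQ subrr mulr0.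
Qed.

(* [F[X]] is integral over [F[t0]] for nonconstant [t0]. *)
Lemma poly_integral (t0 X : {poly F}) : t0^`() != 0 ->
  exists n (P : nat -> {poly F}), (0 < n)%N /\
    iota X ^+ n = \sum_(i < n) evt (iota t0) (P i) * iota X ^+ i.
Proof.
move=> t1; apply: integral_rel.
have hX : integralOver (evtm (iota t0)) (iota 'X).
  apply: (@integralOver_ratio _ _ t0 1); rewrite ?size_poly1 ?evt_X ?rmorph1 ?mulr1 //.
  by rewrite ltnNge; apply: contra t1 => /size1_polyC ->; rewrite derivC.
elim/poly_ind: X => [|p c IH].
  by rewrite rmorph0 -(rmorph0 (evtm (iota t0))); apply: integral_id.
rewrite rmorphD rmorphM; apply: integral_add; first exact: integral_mul.
by have := integral_id (evtm (iota t0)) c%:P; rewrite {2}/evtm /= evtC.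
Qed.

Section Endpoints.
Variables (a0 a1 : F).

(* [x dX] and [y dX] have equal integrals from [a0] to [a1]. *)
Definition bal (x y : E) := exists u v : {poly F},
  [/\ x = der (iota u), y = der (iota v) & u.[a1] - u.[a0] = v.[a1] - v.[a0]].

Lemma balD x y x' y' : bal x y -> bal x' y' -> bal (x + x') (y + y').
Proof.
move=> [u [v [-> -> e]]] [u' [v' [-> -> e']]]; exists (u + u'), (v + v').
rewrite !rmorphD !derD; split=> //.
by rewrite !hornerD !opprD addrACA e e' [RHS]addrACA.
Qed.

(** The one-path counterpart of [bal], shaped to instantiate [BB]: the integral of [y dX] between
    the endpoints vanishes. *)
Definition bal1 (x y : E) := exists2 v : {poly F}, y = der (iota v) & v.[a1] = v.[a0].

Lemma bal1D x y x' y' : bal1 x y -> bal1 x' y' -> bal1 (x + x') (y + y').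
Proof.
move=> [v -> e] [v' -> e']; exists (v + v'); first by rewrite rmorphD derD.
by rewrite !hornerD e e'.
Qed.

Lemma iota_der_inj u v : der (iota u) = der (iota v) -> exists c, u = v + c%:P.
Proof.
move/eqP; rewrite -subr_eq0 -derB -rmorphB => /eqP/(der_eq0 ch0) [c].
rewrite /cst => /eqP; rewrite -subr_eq0 -rmorphB iota_eq0E subr_eq0 => /eqP e.
by exists c; rewrite -e addrC subrK.
Qed.

Lemma der_comp (H X : {poly F}) : der (iota (H \Po X)) = evt (iota X) H^`() * der (iota X).
Proof. by rewrite -evt_comp der_evt. Qed.

Variables p q : nat -> {poly F}.
Notation f := (fun i => iota (p i)).
Notation g := (fun i => iota (q i)).

(* The integrals of [q(X) r(X) dX] vanish for all [r] since [X] is closed; were [Y] not closed, a suitable [r] would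
   make the integral of [q(Y) r(Y) dY] nonzero. *)
Lemma closed_transfer : (forall x y, alg2 f g x y -> (x = 0 <-> y = 0)) ->
  (forall a a' b b', alg2 f g a a' -> alg2 f g b b' -> bal (a * der b) (a' * der b')) ->
  forall i0, (q i0)^`() != 0 ->
  forall X Y, frac2 f g (iota X) (iota Y) -> X.[a1] = X.[a0] -> Y.[a1] = Y.[a0].
Proof.
move=> iffB HB i0 ds X Y XY eX.
have hs : der (iota (q i0)) != 0 by rewrite der_iota iota_neq0.
have [ht _] := alg2_iff ch0 (fun x y h => (iffB x y h).1) (alg2V f g i0) hs.
have dt : (p i0)^`() != 0 by rewrite -(iota_eq0E E) -der_iota.
have [x0|dx] := eqVneq (der (iota X)) 0.
  have [c xc] := der_eq0 ch0 x0; move: XY; rewrite xc => XY.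
  have := frac2_fun iffB (frac2C f g c) XY.
  rewrite /cst => /eqP; rewrite -subr_eq0 -rmorphB iota_eq0E subr_eq0 => /eqP <-.
  by rewrite !hornerC.
have [n [P [n0 e]]] := poly_integral X dt.
have HB' a a' b b' : alg2 f g a a' -> alg2 f g b b' -> bal (1 * a * der b) (1 * a' * der b').
  by move=> h1 h2; rewrite !mul1r; apply: HB.
have [Q Q0 HQ] := core_lemma iffB (alg2V f g i0) balD (alg2_1 f g) (oner_neq0 E) HB' XY n0 e dx.
apply/eqP/negPn/negP=> Yne.
have [H [r [Hd Hne]]] := separating_primitive Q0 Yne.
have [u [v [eu ev euv]]] := HQ r.
case/eqP: Hne; move: eu ev; rewrite -Hd -!der_comp.
move=> /esym/iota_der_inj [c uE] /esym/iota_der_inj [c' vE].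
have aux (z1 z2 z3 : F) : (z1 + z3) - (z2 + z3) = z1 - z2 by ring.
move: euv; rewrite uE vE !hornerD !hornerC !horner_comp !aux eX subrr => /esym/eqP.
by rewrite subr_eq0 => /eqP.
Qed.
End Endpoints.

Section Single.
Variables (a0 a1 : F) (q : nat -> {poly F}).
Notation g := (fun i => iota (q i)).

(** Iterated integrals of the path, with arbitrary constants of integration. *)
Inductive tow : {poly F} -> Prop :=
 | towC c : tow c%:P
 | towD x y : tow x -> tow y -> tow (x + y)
 | towM c x : tow x -> tow (c%:P * x)
 | towI x i y : tow x -> y^`() = x * (q i)^`() -> tow y.

(** By [frac2_prim] on the diagonal every iterated integral is a quotient of polynomials in the
    path. [core_lemma] with multiplier [m] then gives a [q] for which all integrals of
    [q(X) r(X) dX] vanish, so [X] is closed by [separating_primitive]. *)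
Lemma tow_closed m : m != 0 -> alg2 g g m m ->
  (forall a b, alg2 g g a a -> alg2 g g b b -> bal1 a0 a1 0 (m * a * der b)) ->
  forall X, tow X -> X.[a1] = X.[a0].
Proof.
move=> m0 hm HB.
have iffB x y : alg2 g g x y -> (x = 0 <-> y = 0) by move/alg2_diag => ->.
have HB' a a' b b' : alg2 g g a a' -> alg2 g g b b' -> bal1 a0 a1 (m * a * der b) (m * a' * der b').
  move=> h1 h2; move: (h1) (h2); rewrite (alg2_diag h1) (alg2_diag h2) => h3 h4.
  by have [v e1 e2] := HB _ _ h3 h4; exists v.
have [[i0 ds]|h] := Classical_Prop.classic (exists i0, (q i0)^`() != 0); last first.
  have cq i : (q i)^`() = 0 by apply/eqP/negPn/negP => hi; apply: h; exists i.
  move=> X; elim=> [c|x y _ e _ e'|c x _ e|x i y _ _]; rewrite ?hornerC //.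
  - by rewrite !hornerD e e'.
  - by rewrite !hornerM !hornerC e.
  - by rewrite cq mulr0 => /(deriv_eq0 ch0) [c ->]; rewrite !hornerC.
have hs : der (iota (q i0)) != 0 by rewrite der_iota iota_neq0.
have ts := alg2V g g i0.
have fr X : tow X -> frac2 g g (iota X) (iota X).
  elim=> [c|x y _ e _ e'|c x _ e|x i y _ e e1].
  - exact: frac2C.
  - by rewrite rmorphD; apply: frac2D.
  - by rewrite rmorphM; apply: frac2M => //; apply: frac2C.
  - have h2 := frac2_der ch0 iffB ts hs hs (frac2_alg (alg2V g g i)).
    have h3 := frac2M e h2.
    have [|z hz] := @frac2_prim _ _ ch0 _ _ iffB _ _ ts hs hs (iota y) _ _ h3.
      by rewrite -mulrA mulfVK // !der_iota e1 rmorphM.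
    exact: frac2_diag hz.
move=> X /fr hX.
have [x0|dx] := eqVneq (der (iota X)) 0.
  have := x0; rewrite der_iota => /(@rI_eq0 _ E) /(deriv_eq0 ch0) [c ->].
  by rewrite !hornerC.
have [n [P [n0 e]]] := poly_integral X ds.
have [Q Q0 HQ] := core_lemma iffB ts (@bal1D a0 a1) hm m0 HB' hX n0 e dx.
apply/eqP/negPn/negP=> Xne.
have [H [r [Hd Hne]]] := separating_primitive Q0 Xne.
have [v ev euv] := HQ r.
case/eqP: Hne; move: ev; rewrite -Hd -!der_comp.
move=> /esym/iota_der_inj [c vE].
by move: euv; rewrite vE !hornerE !horner_comp => /addIr.
Qed.
End Single.
End PolyCase.
End PolyPath.

(** * Laurent polynomial paths *)

Module Kummer.
Import all_boot all_algebra ring.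
Import FracDer FunPair.
Set Implicit Arguments. Unset Strict Implicit. Unset Printing Implicit Defensive.
Import GRing.Theory.
Local Open Scope ring_scope.

Section NoLog.
Variables (F : fieldType) (E : ratfun F).
Hypothesis ch0 : forall n, n.+1%:R != 0 :> F.
Notation der := (@rD F E).
Notation cst := (@cst F E).

(** The hypothesis says [X (A/B)' = r]. If [A/B] is regular at 0 the left side vanishes there;
    otherwise it has a pole there. *)
Lemma poly_no_log (A B : {poly F}) r : B != 0 -> coprimep A B ->
  'X * (A^`() * B - A * B^`()) = r%:P * B ^+ 2 -> r = 0.
Proof.
move=> B0 cAB e; apply/eqP/negPn/negP => r0.
have [m [B1 rB1 BE]] := multiplicity_XsubC B 0.
move: rB1; rewrite B0 /= => rB1; rewrite polyC0 subr0 in BE.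
have B10 : B1.[0] != 0 by exact: rB1.
case: m BE => [|m] BE.
  move: e; rewrite BE expr0 mulr1 => /(congr1 (fun p => p.[0])).
  rewrite expr2 !hornerM hornerX hornerC mul0r => /esym/eqP.
  by rewrite !mulf_eq0 (negPf r0) (negPf B10).
have A0 : A.[0] != 0.
  apply/negP => A0; move: cAB; rewrite BE coprimep_sym coprimepMl => /andP[_].
  rewrite exprS coprimepMl coprimep_sym => /andP[+ _].
  by rewrite -[in coprimep _ 'X](subr0 'X) -polyC0 coprimep_XsubC /root A0.
have e' : 'X * A^`() * B1 - A * B1 *+ m.+1 - 'X * A * B1^`() = r%:P * B1 ^+ 2 * 'X * 'X ^+ m.
  have nz : 'X ^+ m.+1 != 0 :> {poly F} by rewrite expf_neq0 ?polyX_eq0.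
  apply: (mulIf nz); move: e; rewrite BE derivM derivXn exprS /= => e.
  have -> : r%:P * B1 ^+ 2 * 'X * 'X ^+ m * ('X * 'X ^+ m) = r%:P * (B1 * ('X * 'X ^+ m)) ^+ 2 by ring.
  by rewrite -e; move: ('X ^+ m) => z; ring.
have := congr1 (fun p => p.[0]) e'.
rewrite !hornerD !hornerN !hornerMn !hornerM hornerX !mul0r subr0 add0r mulr0 mul0r => /eqP.
by rewrite oppr_eq0 -mulr_natr !mulf_eq0 (negPf A0) (negPf B10) (negPf (ch0 m)).
Qed.

(** If [g] were nonconstant, [frac2_prim] for the constant family [g] would make [W] a rational
    function of [g]; as [g] is transcendental, [poly_no_log] applies with [g] as variable. *)
Lemma no_log (W g : E) r : g != 0 -> r != 0 -> der W = cst r * der g / g -> der g = 0.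
Proof.
move=> g0 r0 e; apply/eqP/negPn/negP=> dg.
pose f := fun _ : nat => g.
have alg_evt x y : alg2 f f x y -> exists2 p, x = evt g p & y = evt g p.
  elim=> [c|i|? ? ? ? _ [p -> ->] _ [q -> ->]|? ? ? ? _ [p -> ->] _ [q -> ->]].
  - by exists c%:P; rewrite evtC.
  - by exists 'X; rewrite evtX.
  - by exists (p + q); rewrite rmorphD.
  - by exists (p * q); rewrite rmorphM.
have iffB x y : alg2 f f x y -> (x = 0 <-> y = 0) by move/alg_evt=> [p -> ->].
have gg := alg2V f f 0%N.
have h : frac2 f f (cst r / g) (cst r / g).
  by apply: (frac2f iffB) (frac2_alg gg); apply: frac2C.
have [|y hy] := @frac2_prim _ _ ch0 _ _ iffB _ _ gg dg dg W _ _ h.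
  by rewrite e mulrAC.
have [a [b [a' [b' [/alg_evt[A aA _] /alg_evt[B bB _] nb [WE _]]]]]] := hy.
have B0 : B != 0 by apply: contraNneq nb => B0; rewrite bB B0 rmorph0.
pose G := gcdp A B.
have G0 : G != 0 by rewrite gcdp_eq0 negb_and B0 orbT.
have AG : A = A %/ G * G by rewrite divpK // dvdp_gcdl.
have BG : B = B %/ G * G by rewrite divpK // dvdp_gcdr.
have cAB : coprimep (A %/ G) (B %/ G) by apply: coprimep_div_gcd; rewrite B0 orbT.
have B1 : B %/ G != 0 by apply: contraNneq B0 => e1; rewrite BG e1 mul0r.
have eG : evt g G != 0 by apply: contra_neq G0 => /(evt_inj ch0 dg).
have eB : evt g (B %/ G) != 0 by apply: contra_neq B1 => /(evt_inj ch0 dg).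
move: cAB B1 eB; set A1 := A %/ G; set B1 := B %/ G => cAB B10 eB.
have W1 : W = evt g A1 / evt g B1.
  by rewrite WE aA bB AG BG !rmorphM /= -mulf_div divff // mulr1.
case/eqP: r0; apply: (poly_no_log B10 cAB); apply/eqP.
rewrite -subr_eq0; apply/eqP/(evt_inj ch0 dg)/eqP.
rewrite expr2 rmorphB subr_eq0 !rmorphM rmorphB !rmorphM /= evtX evtC -expr2.
have := e; rewrite W1 derf // !der_evt => e1.
have : (evt g A1^`() * evt g B1 - evt g A1 * evt g B1^`()) * der g * g / evt g B1 ^+ 2
      = cst r * der g.
  have -> : cst r * der g = cst r * der g / g * g by rewrite mulfVK.
  rewrite -e1; move: (evt g A1) (evt g B1) (evt g A1^`()) (evt g B1^`()) (der g) => x1 x2 x3 x4 x5; ring.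
move: (evt g A1) (evt g B1) (evt g A1^`()) (evt g B1^`()) (der g) dg eB => x1 x2 x3 x4 x5 dg eB e2.
have nz : x2 ^+ 2 != 0 by apply: expf_neq0.
apply/eqP; apply: (mulIf dg).
have -> : cst r * x2 ^+ 2 * x5 = cst r * x5 * x2 ^+ 2 by ring.
by rewrite -e2 mulfVK //; ring.
Qed.
End NoLog.

Section Trace.
Variables (F : fieldType) (E : ratfun F).
Hypothesis ch0 : forall n, n.+1%:R != 0 :> F.
Notation der := (@rD F E).
Notation cst := (@cst F E).
Notation iota := (rI E).
Notation z := (rI E 'X).
(** In the application [K] is the field of quotients of polynomials in the path. It is stable under
    [d], and below [F(X)] is an extension of [K] with basis [1, z, ..., z^e]. *)
Variable K : E -> Prop.
Hypothesis KC : forall c, K (cst c).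
Hypothesis KD : forall x y, K x -> K y -> K (x + y).
Hypothesis KM : forall x y, K x -> K y -> K (x * y).
Hypothesis KV : forall x, K x -> K x^-1.
Variable t : E.
Hypothesis dt : der t != 0.
Definition d (x : E) := der x / der t.
Hypothesis Kd : forall x, K x -> K (d x).
Hypothesis mp : forall x, exists n (c : nat -> E),
  [/\ (0 < n)%N, (forall i, K (c i)),
      x ^+ n = \sum_(i < n) c i * x ^+ i &
      (forall c' : nat -> E, (forall i, K (c' i)) ->
         \sum_(i < n) c' i * x ^+ i = 0 -> forall i, (i < n)%N -> c' i = 0)].

Lemma dM x y : d (x * y) = d x * y + x * d y.
Proof. by rewrite /d derM mulrDl mulrAC mulrA. Qed.
Lemma dX x n : d (x ^+ n) = x ^+ n.-1 * d x *+ n.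
Proof. by rewrite /d derX mulrnAl -mulrA. Qed.
Lemma d_sum (I : Type) (r : seq I) (P : pred I) (f : I -> E) :
  d (\sum_(i <- r | P i) f i) = \sum_(i <- r | P i) d (f i).
Proof. by rewrite /d der_sum mulr_suml. Qed.
Lemma K0 : K 0. Proof. by have := KC 0; rewrite rmorph0. Qed.
Lemma K1 : K 1. Proof. by have := KC 1; rewrite rmorph1. Qed.
Lemma KN x : K x -> K (- x).
Proof. by move/(KM (KC (-1))); rewrite rmorphN rmorph1 mulN1r. Qed.

Variables (e : nat) (c : nat -> E).
Hypothesis Kc : forall i, K (c i).
Hypothesis ze : z ^+ e.+1 = \sum_(i < e.+1) c i * z ^+ i.
Hypothesis ind : forall c' : nat -> E, (forall i, K (c' i)) ->
  \sum_(i < e.+1) c' i * z ^+ i = 0 -> forall i, (i < e.+1)%N -> c' i = 0.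

Definition isco (x : E) (u : nat -> E) := (forall i, K (u i)) /\ x = \sum_(i < e.+1) u i * z ^+ i.

Lemma iscoD x y u v : isco x u -> isco y v -> isco (x + y) (fun i => u i + v i).
Proof.
move=> [h1 ->] [h2 ->]; split; first by move=> i; apply: KD.
by rewrite -big_split; apply: eq_bigr => i _; rewrite /= mulrDl.
Qed.
Lemma iscoM k x u : K k -> isco x u -> isco (k * x) (fun i => k * u i).
Proof.
move=> kk [h1 ->]; split; first by move=> i; apply: KM.
by rewrite mulr_sumr; apply: eq_bigr => i _; rewrite /= mulrA.
Qed.
Lemma isco0 : isco 0 (fun=> 0).
Proof. by split=> [i|]; [apply: K0 | rewrite big1 // => i _; rewrite mul0r]. Qed.
(** Multiplication by [z] acts on coordinates through the companion matrix of [c]: a shift plus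
    [c i] times the top coordinate. *)
Lemma isco_z x u : isco x u ->
  isco (z * x) (fun i => (if i is j.+1 then u j else 0) + c i * u e).
Proof.
move=> [h1 ->]; split.
  by move=> [|i]; apply: KD => //; [exact: K0|apply: KM|apply: KM].
under [RHS]eq_bigr do rewrite mulrDl.
rewrite big_split /= [X in _ = X + _]big_ord_recl /= mul0r add0r mulr_sumr.
rewrite [LHS]big_ord_recr /= addrC mulrCA -exprS ze mulr_sumr [RHS]addrC.
congr (_ + _); apply: eq_bigr => i _; first by ring.
by rewrite /bump /= add1n exprS; ring.
Qed.
Lemma isco_zn n : exists u, isco (z ^+ n) u.
Proof.
elim: n => [|n [u hu]]; last by rewrite exprS; eexists; apply: isco_z hu.
exists (fun i => if i is 0%N then 1 else 0); split.
  by move=> [|i]; [exact: K1|exact: K0].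
by rewrite big_ord_recl /= big1 ?addr0 ?mulr1 ?expr0 // => i _; rewrite mul0r.
Qed.
Lemma isco_sum (I : Type) (r : seq I) (P : pred I) (f : I -> E) :
  (forall i, P i -> exists u, isco (f i) u) -> exists u, isco (\sum_(i <- r | P i) f i) u.
Proof.
apply: (big_ind (fun x => exists u, isco x u)); first by exists (fun=> 0); apply: isco0.
by move=> x y [u hu] [v hv]; eexists; apply: iscoD hu hv.
Qed.
Lemma isco_mul x y : (exists u, isco x u) -> (exists u, isco y u) -> exists u, isco (x * y) u.
Proof.
move=> [u [hu ->]] [v hv]; rewrite mulr_suml; apply: isco_sum => i _.
suff h n : exists w, isco (z ^+ n * y) w.
  have [w hw] := h i; rewrite -mulrA; eexists; exact: iscoM (hu i) hw.
elim: n => [|n [w hw]]; first by rewrite mul1r; exists v.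
by rewrite exprS -mulrA; eexists; apply: isco_z hw.
Qed.
Lemma isco_K k : K k -> exists u, isco k u.
Proof.
move=> kk; have [u hu] := isco_zn 0; exists (fun i => k * u i).
by have := iscoM kk hu; rewrite expr0 mulr1.
Qed.
Lemma isco_iota p : exists u, isco (iota p) u.
Proof.
elim/poly_ind: p => [|p a hp]; first by rewrite rmorph0; exists (fun=> 0); apply: isco0.
rewrite rmorphD rmorphM /=; have [u hu] : exists u, isco (iota p * z) u.
  by apply: isco_mul hp _; have := isco_zn 1; rewrite expr1.
by have [v hv] := isco_K (KC a); eexists; apply: iscoD hu hv.
Qed.
(** The minimal equation of [x] has nonzero constant term, by minimality, and solving it for this
    term writes the inverse as a polynomial in [x]. *)
Lemma isco_inv x : x != 0 -> (exists u, isco x u) -> exists u, isco x^-1 u.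
Proof.
move=> x0 hx; have hxn n : exists u, isco (x ^+ n) u.
  elim: n => [|n IH]; first by rewrite expr0; apply: isco_K K1.
  by rewrite exprS; apply: isco_mul.
have [n [b [n0 Kb xn indb]]] := mp x.
case: n n0 xn indb => // n _; rewrite big_ord_recl /= expr0 mulr1 => xn indb.
have b0 : b 0%N != 0.
  apply/eqP => b0; move: xn; rewrite b0 add0r => xn.
  pose b' i := (if i == n then 1 else 0) - (if (i < n)%N then b i.+1 else 0).
  have Kb' i : K (b' i).
    by apply: KD; [case: ifP => _; [apply: K1|apply: K0]|apply: KN; case: ifP => _; [|apply: K0]].
  have : \sum_(i < n.+1) b' i * x ^+ i = 0.
    apply: (mulIf x0); rewrite mul0r mulr_suml big_ord_recr /= /b' eqxx ltnn subr0 mul1r.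
    rewrite -exprSr xn -big_split big1 //= => i _.
    by rewrite (ltn_eqF (ltn_ord i)) ltn_ord /bump /= add1n exprS; ring.
  by move/(indb b' Kb')/(_ n (ltnSn n))/eqP; rewrite /b' eqxx ltnn subr0 oner_eq0.
have -> : x^-1 = (b 0%N)^-1 * (x ^+ n - \sum_(i < n) b i.+1 * x ^+ i).
  apply: (mulIf x0); rewrite mulVf // -mulrA mulrBl -exprSr xn mulr_suml.
  have -> : \sum_(i < n) b i.+1 * x ^+ i * x = \sum_(i < n) b (bump 0 i) * x ^+ bump 0 i.
    by apply: eq_bigr => i _; rewrite /bump /= add1n exprSr mulrA.
  by rewrite addrK mulVf.
apply: isco_mul; first by apply: isco_K; apply: KV.
have [u hu] := hxn n; have [v hv] : exists u, isco (- \sum_(i < n) b i.+1 * x ^+ i) u.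
  rewrite -sumrN; apply: isco_sum => i _; rewrite -mulNr; apply: isco_mul => //.
  by apply: isco_K; apply: KN.
by eexists; apply: iscoD hu hv.
Qed.
Lemma isco_ex x : exists u, isco x u.
Proof.
have [p [q [q0 ->]]] := fracE x; apply: isco_mul; first exact: isco_iota.
by apply: isco_inv (isco_iota q); apply: iota_neq0.
Qed.

Definition co (x : E) : nat -> E :=
  proj1_sig (ClassicalEpsilon.constructive_indefinite_description _ (isco_ex x)).
Lemma coP x : isco x (co x).
Proof. by rewrite /co; case: ClassicalEpsilon.constructive_indefinite_description. Qed.
Lemma co_uniq x u i : isco x u -> (i < e.+1)%N -> co x i = u i.
Proof.
move=> [h1 e1] ie; have [h2 e2] := coP x; apply/eqP; rewrite -subr_eq0; apply/eqP.
apply: (ind (c' := fun j => co x j - u j)) ie.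
  by move=> j; apply: KD => //; apply: KN.
under eq_bigr do rewrite mulrBl.
by rewrite sumrB -e1 -e2 subrr.
Qed.
Lemma Kco x i : K (co x i). Proof. by have [h _] := coP x. Qed.
Lemma coD x y i : (i < e.+1)%N -> co (x + y) i = co x i + co y i.
Proof. by move=> ie; rewrite (co_uniq (iscoD (coP x) (coP y))). Qed.
Lemma coM k x i : K k -> (i < e.+1)%N -> co (k * x) i = k * co x i.
Proof. by move=> kk ie; rewrite (co_uniq (iscoM kk (coP x))). Qed.
Lemma co0 i : (i < e.+1)%N -> co 0 i = 0.
Proof. by move=> ie; rewrite (co_uniq isco0). Qed.
Lemma co_sum (n : nat) (f : 'I_n -> E) i : (i < e.+1)%N ->
  co (\sum_j f j) i = \sum_j co (f j) i.
Proof.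
move=> ie; elim: n f => [|n IH] f; first by rewrite !big_ord0 co0.
by rewrite !big_ord_recr /= coD // IH.
Qed.
Lemma co_z x i : (i < e.+1)%N -> co (z * x) i = (if i is j.+1 then co x j else 0) + c i * co x e.
Proof. by move=> ie; rewrite (co_uniq (isco_z (coP x))). Qed.

Definition tr (x : E) := \sum_(i < e.+1) co (x * z ^+ i) i.

Lemma trD x y : tr (x + y) = tr x + tr y.
Proof. by rewrite /tr -big_split; apply: eq_bigr => i _; rewrite mulrDl coD. Qed.
Lemma trM k x : K k -> tr (k * x) = k * tr x.
Proof. by move=> kk; rewrite /tr mulr_sumr; apply: eq_bigr => i _; rewrite -mulrA coM. Qed.
Lemma co_zz (i : 'I_e.+1) : co (z ^+ i) i = 1.
Proof.
rewrite (@co_uniq _ (fun j => if j == i :> nat then 1 else 0)) ?eqxx //; split.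
  by move=> j; case: ifP => _; [apply: K1|apply: K0].
rewrite (bigD1 i) //= eqxx mul1r big1 ?addr0 // => j ji.
by case: ifP => [/eqP h|_]; [case/eqP: ji; apply: val_inj|rewrite mul0r].
Qed.
Lemma trK k : K k -> tr k = k *+ e.+1.
Proof.
move=> kk; rewrite /tr; under eq_bigr do rewrite coM // co_zz mulr1.
by rewrite sumr_const card_ord.
Qed.

(* In coordinates, [d] acts as entrywise derivation plus a matrix [G]; the trace of a commutator with [G] vanishes. *)
Lemma tr_d y : tr (d y) = d (tr y).
Proof.
pose G (i j : nat) := co (d (z ^+ i)) j; pose M (i j : nat) := co (y * z ^+ i) j.
have h (i : 'I_e.+1) : co (d y * z ^+ i) i = d (M i i) + \sum_(j < e.+1) M i j * G j i
     - \sum_(j < e.+1) G i j * M j i.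
  apply/eqP; rewrite -subr_eq opprK; apply/eqP.
  have -> : \sum_(j < e.+1) G i j * M j i = co (y * d (z ^+ i)) i.
    have [_ ->] := coP (d (z ^+ i)); rewrite mulr_sumr co_sum //; apply: eq_bigr => j _.
    by rewrite mulrCA coM //; apply: Kco.
  rewrite -coD // -dM; have [_ {1}->] := coP (y * z ^+ i).
  rewrite d_sum co_sum //.
  have hj (j : 'I_e.+1) : co (d (co (y * z ^+ i) j * z ^+ j)) i
      = co (d (M i j) * z ^+ j) i + M i j * G j i.
    by rewrite dM coD // [X in _ + X = _]coM //; apply: Kco.
  rewrite (eq_bigr _ (fun j _ => hj j)) big_split /=; congr (_ + _).
  have : co (\sum_(j < e.+1) d (M i j) * z ^+ j) i = d (M i i).
    by apply: (@co_uniq _ (fun j => d (M i j))) => //; split=> // j; apply/Kd/Kco.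
  by rewrite co_sum // => <-; apply: eq_bigr => j _; rewrite coM //; apply/Kd/Kco.
rewrite /tr; under eq_bigr do rewrite h.
rewrite sumrB big_split /= d_sum [X in _ + X - _]exchange_big /=.
by under [X in _ + X - _]eq_bigr => j _ do under eq_bigr do rewrite mulrC; rewrite addrK.
Qed.

(** Used for the diagonal entries of a multiplication matrix, which the companion action links by
    such a recursion. *)
Lemma abel_sum (X a : nat -> E) n : (forall j, (j.+1 < n)%N -> X j.+1 = X j + a j.+1) ->
  \sum_(j < n) X j = X 0%N *+ n + \sum_(j < n.-1) a j.+1 *+ (n - j.+1).
Proof.
elim: n => [|n IH] h; first by rewrite !big_ord0 mulr0n addr0.
have Xn : X n = X 0%N + \sum_(j < n) a j.+1.
  have : (n <= n)%N by []; elim: {-2}n => [|k IHk] kn; first by rewrite big_ord0 addr0.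
  by rewrite big_ord_recr /= h // IHk ?addrA // ltnW.
rewrite big_ord_recr /= IH; last by move=> j jn; apply: h; apply: ltnW.
rewrite Xn addrACA -mulrSr; congr (_ + _).
case: n {IH h Xn} => [|n]; first by rewrite !big_ord0 addr0.
rewrite [in RHS]big_ord_recr [X in _ + X = _]big_ord_recr /= addrA -big_split /=.
rewrite subSnn mulr1n; congr (_ + _); apply: eq_bigr => i _.
by rewrite [in RHS]subSn ?mulrSr // ltnS ltnW.
Qed.

(* [c 0] is the norm of [z] up to sign, and the trace of the logarithmic derivative is that of the norm. *)
Lemma tr_dlog : c 0%N * tr (d z / z) = d (c 0%N).
Proof.
have z0 : z != 0 by apply: iota_neq0; rewrite polyX_eq0.
set w := d z / z; pose x (j m : nat) := co (z ^+ m * w) j.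
have dzn n : d (z ^+ n) = z ^+ n * w *+ n.
  rewrite dX; case: n => [|n]; first by rewrite !mulr0n.
  by rewrite /w /= exprS; congr (_ *+ _); field.
have e1 : \sum_(i < e.+1) d (c i) * z ^+ i = \sum_(i < e.+1) c i * (z ^+ i * w) *+ (e.+1 - i).
  have := congr1 d ze; rewrite dzn ze d_sum.
  under [X in _ = X]eq_bigr do rewrite dM dzn.
  rewrite big_split /= => h.
  have -> : \sum_(i < e.+1) d (c i) * z ^+ i =
     (\sum_(i < e.+1) c i * z ^+ i) * w *+ e.+1 - \sum_(i < e.+1) c i * (z ^+ i * w *+ i).
    by rewrite h addrK.
  rewrite mulr_suml -sumrMnl -sumrB; apply: eq_bigr => i _.
  by rewrite mulrnBr 1?ltnW // -mulrA mulrnAr.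
(* The coordinate at [z^0] of the differentiated minimal equation: the left side is [d (c 0)]; on
   the right [xS] and [xSS] move the coordinates of [z^i w] onto the diagonal, where they sum to the
   trace. *)
have := congr1 (fun y => co y 0%N) e1.
rewrite (@co_uniq _ (fun i => d (c i))) //; last by split=> // i; apply: Kd.
move=> ->; rewrite co_sum //.
have h0 (i : 'I_e.+1) : co (c i * (z ^+ i * w) *+ (e.+1 - i)) 0%N = c i * x 0%N i *+ (e.+1 - i).
  elim: (e.+1 - i)%N => [|n IH]; first by rewrite !mulr0n co0.
  by rewrite !mulrS coD // IH coM.
under eq_bigr do rewrite h0.
have xS m : x 0%N m.+1 = c 0%N * x e m.
  by rewrite /x exprS -mulrA co_z //= add0r.
have xSS j m : (j.+1 < e.+1)%N -> x j.+1 m.+1 = x j m + c j.+1 * x e m.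
  by move=> je; rewrite /x exprS -mulrA co_z.
rewrite big_ord_recl /= subn0.
have -> : tr w = \sum_(j < e.+1) x j j.
  by apply: eq_bigr => i _; rewrite /x mulrC.
rewrite (@abel_sum (fun j => x j j) (fun j => c j * x e j.-1)); last by move=> j je; apply: xSS.
rewrite mulrDr mulrnAr; congr (_ + _); rewrite mulr_sumr; apply: eq_bigr => i _.
by rewrite /bump /= add1n xS mulrnAr; congr (_ *+ _); ring.
Qed.

Lemma c0_neq0 : c 0%N != 0.
Proof.
have z0 : z != 0 by apply: iota_neq0; rewrite polyX_eq0.
apply/eqP => c0; pose b' i := (if i == e then 1 else 0) - (if (i < e)%N then c i.+1 else 0).
have Kb' i : K (b' i).
  by apply: KD; [case: ifP => _; [apply: K1|apply: K0]|apply: KN; case: ifP => _; [|apply: K0]].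
have : \sum_(i < e.+1) b' i * z ^+ i = 0.
  apply: (mulIf z0); rewrite mul0r mulr_suml big_ord_recr /= /b' eqxx ltnn subr0 mul1r.
  rewrite -exprSr ze big_ord_recl /= c0 mul0r add0r -big_split big1 //= => i _.
  by rewrite (ltn_eqF (ltn_ord i)) ltn_ord /bump /= add1n exprS; ring.
by move/(ind Kb')/(_ e (ltnSn e))/eqP; rewrite /b' eqxx ltnn subr0 oner_eq0.
Qed.

(* Taking traces to [K], [z^(e+1) / c 0] has a logarithmic derivative which, divided by [r], is a derivative;
   it must be constant, since a logarithmic derivative has no antiderivative in [F(X)] otherwise. *)
Lemma kummer_gen k Y r : K k -> r != 0 -> k * der t = der Y + cst r / z -> K (z ^+ e.+1).
Proof.
move=> kk r0 ek.
have z0 : z != 0 by apply: iota_neq0; rewrite polyX_eq0.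
have c00 := c0_neq0.
have ek' : k = d Y + cst r * (d z / z).
  rewrite /d der_iota derivX rmorph1; apply: (mulIf dt).
  by rewrite ek; move: (der t) dt (der Y) => u u0 y; field; rewrite u0 z0.
have e1 : k *+ e.+1 = d (tr Y) + cst r * (d (c 0%N) / c 0%N).
  by rewrite -trK // {1}ek' trD trM // tr_d -tr_dlog [c 0%N * _]mulrC mulfK.
pose g := z ^+ e.+1 / c 0%N.
have g0 : g != 0 by rewrite mulf_neq0 ?invr_neq0 ?expf_neq0.
have dgE : der g / g = der z / z *+ e.+1 - der (c 0%N) / c 0%N.
  rewrite /g derf // derX exprS /= -[_ *+ e.+1]mulr_natr -[_ / _ *+ e.+1]mulr_natr.
  move: (z ^+ e) (expf_neq0 e z0) (e.+1%:R : E) (der z) (der (c 0%N)) => y y0 l u v.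
  by field; rewrite c00 z0.
have dg0 : der g = 0.
  apply: (@no_log _ _ ch0 (tr Y - Y *+ e.+1) g r) => //.
  rewrite -mulrA dgE derB.
  have -> : der (Y *+ e.+1) = der Y *+ e.+1.
    by elim: (e.+1) => [|n IH]; rewrite ?mulr0n ?der0 // !mulrS derD IH.
  move: e1; rewrite ek' /d; move: (der (tr Y)) (der Y) (der z) (der (c 0%N)) => u v y w e1.
  apply: (mulIf (invr_neq0 dt)).
  have -> : (u - v *+ e.+1) / der t = u / der t - (v / der t) *+ e.+1 by rewrite mulrBl mulrnAl.
  have -> : u / der t = (v / der t + cst r * (y / der t / z)) *+ e.+1 - cst r * (w / der t / c 0%N).
    by rewrite e1 addrK.
  by rewrite mulrnDl; ring.
have [a ga] := der_eq0 ch0 dg0.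
have -> : z ^+ e.+1 = cst a * c 0%N by rewrite -ga divfK.
exact: KM.
Qed.

(** Sort the monomials of [p] by exponent modulo [e + 1]; as [z^(e+1)] is in [K], these are the
    coordinates of [p], and for an element of [K] only the first is nonzero. *)
Lemma kummer_poly p : K (z ^+ e.+1) -> K (iota p) -> exists V, iota p = evt (z ^+ e.+1) V.
Proof.
move=> Kh Kp.
have Kev V : K (evt (z ^+ e.+1) V).
  elim/poly_ind: V => [|V a IH]; first by rewrite rmorph0; apply: K0.
  by rewrite rmorphD rmorphM /= evtX evtC; apply: KD => //; apply: KM.
have [V hV] : exists V : nat -> {poly F}, iota p = \sum_(i < e.+1) evt (z ^+ e.+1) (V i) * z ^+ i.
  elim/poly_ind: p {Kp} => [|p a [V hV]].
    by exists (fun=> 0); rewrite rmorph0 big1 // => i _; rewrite rmorph0 mul0r.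
  exists (fun i => if i is j.+1 then V j else V e * 'X + a%:P).
  rewrite rmorphD rmorphM /= hV mulr_suml [RHS]big_ord_recl [X in X + _ = _]big_ord_recr /=.
  rewrite rmorphD rmorphM /= evtX evtC expr0 mulr1 -mulrA -exprSr addrAC [RHS]addrC.
  rewrite -addrA [iota _ + _]addrC addrA [RHS]addrA; congr (_ + _); congr (_ + _).
  by apply: eq_bigr => i _; rewrite -mulrA -exprSr.
exists (V 0%N).
have h : isco (iota p) (fun i => evt (z ^+ e.+1) (V i)) by split.
have [u0 eu] := coP (iota p).
have h' : isco (iota p) (fun i => if i is 0%N then iota p else 0).
  split; first by case=> [|i]; [|exact: K0].
  by rewrite big_ord_recl /= expr0 mulr1 big1 ?addr0 // => i _; rewrite mul0r.
by rewrite -(co_uniq h (ltn0Sn e)) (co_uniq h' (ltn0Sn e)).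
Qed.

End Trace.
End Kummer.

(** * Laurent polynomials and their linear functionals *)

Module Laurent.
Import all_boot all_order all_algebra ring.
Import FracDer FunPair PolyPath Kummer.
Set Implicit Arguments. Unset Strict Implicit. Unset Printing Implicit Defensive.
Import GRing.Theory Num.Theory Order.TTheory.
Local Open Scope ring_scope.

Section Lau.
Variables (F : fieldType) (E : ratfun F).
Hypothesis ch0 : forall n, n.+1%:R != 0 :> F.
Notation der := (@rD F E).
Notation iota := (rI E).
Notation cst := (@cst F E).
Notation z := (rI E 'X).

Lemma z_neq0 : z != 0.
Proof. by apply: iota_neq0; rewrite polyX_eq0. Qed.

Definition lau (x : E) := exists p s, x = iota p / z ^+ s.

(* [lf j] is the linear functional on Laurent polynomials sending [z ^ n] to [j n]
   (a junk value outside Laurent polynomials). *)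
Definition lf (j : int -> F) (x : E) : F :=
  let ps := ClassicalEpsilon.epsilon (inhabits (0 : {poly F}, 0%N))
    (fun ps => x = iota ps.1 / z ^+ ps.2) in
  \sum_(i < size ps.1) ps.1`_i * j (i%:Z - ps.2%:Z).

Definition pf (j : int -> F) (p : {poly F}) (s : nat) :=
  \sum_(i < size p) p`_i * j (i%:Z - s%:Z).

Lemma pf_widen j (p : {poly F}) s N : (size p <= N)%N -> pf j p s = \sum_(i < N) p`_i * j (i%:Z - s%:Z).
Proof.
move=> h; rewrite /pf (big_ord_widen N (fun i => p`_i * j (i%:Z - s%:Z)) h) big_mkcond.
by apply: eq_bigr => i _; case: ltnP => // ?; rewrite nth_default ?mul0r.
Qed.

Lemma pf_shift j p s k : pf j (p * 'X^k) (s + k) = pf j p s.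
Proof.
rewrite (@pf_widen _ _ _ (k + size p)%N); last first.
  by apply: leq_trans (size_polyMleq _ _) _; rewrite size_polyXn addnS /= addnC.
rewrite big_split_ord /= big1 ?add0r => [|i _]; last by rewrite coefMXn ltn_ord mul0r.
apply: eq_bigr => i _; rewrite coefMXn ltnNge leq_addr /= addKn.
by congr (_ * j _); rewrite !PoszD; ring.
Qed.

Lemma lfE j p s : lf j (iota p / z ^+ s) = pf j p s.
Proof.
rewrite /lf; set ps := ClassicalEpsilon.epsilon _ _.
have : iota p / z ^+ s = iota ps.1 / z ^+ ps.2.
  by apply: (ClassicalEpsilon.epsilon_spec _ (fun ps => _ = iota ps.1 / z ^+ ps.2)); exists (p, s).
case: ps => q r /=; rewrite -/(pf j q r) => e.
have zn k : z ^+ k != 0 by rewrite expf_neq0 ?z_neq0.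
have : p * 'X^r = q * 'X^s.
  apply/eqP; rewrite -subr_eq0 -(iota_eq0E E) rmorphB !rmorphM !rmorphXn /= subr_eq0.
  have := e; move: (iota p) (iota q) (z ^+ s) (z ^+ r) (zn s) (zn r) => P Q u v u0 v0 e'.
  by rewrite -[P](divfK u0) e' mulrAC divfK.
by move=> e2; rewrite -(pf_shift _ _ s r) e2 addnC pf_shift.
Qed.

Lemma eq_lf j j' x : j =1 j' -> lf j x = lf j' x.
Proof. by move=> e; apply: eq_bigr => i _; rewrite e. Qed.

Lemma lau_iota p : lau (iota p).
Proof. by exists p, 0%N; rewrite expr0 divr1. Qed.
Lemma lau_cst c : lau (cst c). Proof. exact: lau_iota. Qed.
Lemma lauDE p s q r : iota p / z ^+ s + iota q / z ^+ r = iota (p * 'X^r + q * 'X^s) / z ^+ (s + r).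
Proof.
rewrite rmorphD !rmorphM !rmorphXn /= exprD.
by have := z_neq0; move: z => u u0; field; rewrite !expf_neq0.
Qed.
Lemma lauD x y : lau x -> lau y -> lau (x + y).
Proof. by move=> [p [s ->]] [q [r ->]]; rewrite lauDE; eexists; eexists. Qed.
Lemma lauM x y : lau x -> lau y -> lau (x * y).
Proof.
move=> [p [s ->]] [q [r ->]]; exists (p * q), (s + r)%N.
by rewrite rmorphM exprD mulf_div.
Qed.
Lemma lauN x : lau x -> lau (- x).
Proof. by move=> [p [s ->]]; exists (- p), s; rewrite rmorphN mulNr. Qed.
Lemma lauX x n : lau x -> lau (x ^+ n).
Proof.
move=> hx; elim: n => [|n IH]; last by rewrite exprS; apply: lauM.
by have := lau_cst 1; rewrite rmorph1.
Qed.
Lemma lau0 : lau 0. Proof. by have := lau_cst 0; rewrite rmorph0. Qed.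
Lemma lau_sum (I : Type) (r : seq I) (P : pred I) (f : I -> E) :
  (forall i, P i -> lau (f i)) -> lau (\sum_(i <- r | P i) f i).
Proof. by move=> h; apply: (big_ind lau lau0 lauD h). Qed.
Lemma lau_zn (n : int) : lau (z ^ n).
Proof.
case: n => n; first by rewrite -exprnP; apply/lauX/lau_iota.
by exists 1, n.+1; rewrite rmorph1 div1r.
Qed.

Lemma lfD j x y : lau x -> lau y -> lf j (x + y) = lf j x + lf j y.
Proof.
move=> [p [s ->]] [q [r ->]]; rewrite lauDE !lfE.
rewrite -(pf_shift _ p s r) -(pf_shift _ q r s) [(r + s)%N]addnC.
set P := p * _; set Q := q * _; pose N := maxn (size P) (size Q).
rewrite (@pf_widen _ _ _ N) ?size_polyD // (@pf_widen _ P _ N) ?leq_maxl //.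
rewrite (@pf_widen _ Q _ N) ?leq_maxr // -big_split.
by apply: eq_bigr => i _; rewrite coefD mulrDl.
Qed.
Lemma lfZ j c x : lau x -> lf j (cst c * x) = c * lf j x.
Proof.
move=> [p [s ->]]; rewrite mulrA -[cst c]/(iota c%:P) -rmorphM !lfE mul_polyC.
rewrite (@pf_widen _ _ _ (size p)) ?size_scale_leq // mulr_sumr.
by apply: eq_bigr => i _; rewrite coefZ mulrA.
Qed.
Lemma lf0 j : lf j 0 = 0.
Proof. by have := lfZ j 0 lau0; rewrite mulr0 mul0r. Qed.
Lemma lfN j x : lau x -> lf j (- x) = - lf j x.
Proof. by move=> h; rewrite -[RHS]mulN1r -lfZ // rmorphN rmorph1 mulN1r. Qed.
Lemma lf_zn j n : lf j (z ^ n) = j n.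
Proof.
case: n => n.
  rewrite -exprnP -rmorphXn -[iota _]divr1 -(expr0 z) lfE /pf size_polyXn big_ord_recr /=.
  rewrite coefXn eqxx mul1r subr0 big1 ?add0r // => i _.
  by rewrite coefXn ltn_eqF ?mul0r.
rewrite -[z ^ Negz n]/(z ^- n.+1) -div1r -(rmorph1 iota) lfE /pf size_poly1 big_ord1 coef1 mul1r.
by rewrite sub0r NegzE.
Qed.
Lemma lau_expand p s : iota p / z ^+ s = \sum_(i < size p) cst p`_i * z ^ (i%:Z - s%:Z).
Proof.
rewrite -{1}[p]coefK poly_def rmorph_sum mulr_suml; apply: eq_bigr => i _.
rewrite /= -mul_polyC rmorphM rmorphXn /= -mulrA expfzDr ?z_neq0 //.
by rewrite exprnN.
Qed.

Lemma lau_ind (P : E -> Prop) : P 0 ->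
  (forall c n x, lau x -> P x -> P (cst c * z ^ n + x)) -> forall x, lau x -> P x.
Proof.
move=> P0 PS x [p [s ->]]; rewrite lau_expand.
suff : lau (\sum_(i < size p) cst p`_i * z ^ (i%:Z - s%:Z)) /\ P (\sum_(i < size p) cst p`_i * z ^ (i%:Z - s%:Z)) by case.
elim: (size p) => [|n [IH1 IH2]]; first by rewrite big_ord0; split=> //; apply: lau0.
rewrite big_ord_recr /= addrC; split; last exact: PS.
by apply: lauD => //; apply: lauM; [apply: lau_cst|apply: lau_zn].
Qed.

Lemma lfS j c n x : lau x -> lf j (cst c * z ^ n + x) = c * j n + lf j x.
Proof.
move=> hx; rewrite lfD ?lfZ ?lf_zn //; first exact: lau_zn.
by apply: lauM; [apply: lau_cst|apply: lau_zn].
Qed.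

Lemma lf_shift j x n : lau x -> lf j (x * z ^ n) = lf (fun m => j (m + n)) x.
Proof.
move: x; apply: lau_ind => [|c m x hx IH]; first by rewrite mul0r !lf0.
rewrite mulrDl -mulrA -expfzDr ?z_neq0 // !lfS //; first by rewrite IH.
by apply: lauM => //; apply: lau_zn.
Qed.

Lemma lf_lin x c d j j' : lf (fun n => c * j n + d * j' n) x = c * lf j x + d * lf j' x.
Proof.
rewrite /lf !mulr_sumr -big_split; apply: eq_bigr => i _ /=.
by ring.
Qed.

(** For multiplicative [j] the functional is evaluation at a point; this makes the value at [x] of a
    trigonometric polynomial multiplicative. *)
Lemma lf_mul j x y : (forall m n, j (m + n) = j m * j n) -> lau x -> lau y ->
  lf j (x * y) = lf j x * lf j y.
Proof.
move=> jM hx hy; move: x hx; apply: lau_ind => [|c m x hx IH]; first by rewrite mul0r lf0 mul0r.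
rewrite mulrDl -mulrA [z ^ m * y]mulrC lfD ?lfZ ?lf_shift ?lfS ?IH //; try exact: lauM; first last.
- by apply: lauM; [apply: lau_cst|apply: lauM => //; apply: lau_zn].
- by apply: lauM => //; apply: lau_zn.
rewrite mulrDl; congr (_ + _).
rewrite (@eq_lf _ (fun n => j m * j n + 0 * j n)) => [|n]; last by rewrite jM; ring.
by rewrite lf_lin; ring.
Qed.

(** The Euler derivation multiplies [z^n] by [n], so on Laurent polynomials the obstruction to
    integrating is exactly the constant term, here called the residue. *)
Definition del (x : E) := z * der x.
Lemma delD x y : del (x + y) = del x + del y. Proof. by rewrite /del derD mulrDr. Qed.
Lemma delM x y : del (x * y) = del x * y + x * del y.
Proof. by rewrite /del derM; ring. Qed.
Lemma del_cst c : del (cst c) = 0. Proof. by rewrite /del der_cst mulr0. Qed.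
Lemma delZ c x : del (cst c * x) = cst c * del x.
Proof. by rewrite delM del_cst mul0r add0r. Qed.
Lemma del0 : del 0 = 0. Proof. by rewrite /del der0 mulr0. Qed.
Lemma delN x : del (- x) = - del x. Proof. by rewrite /del derN mulrN. Qed.
Lemma der_z : der z = 1. Proof. by rewrite der_iota derivX rmorph1. Qed.
Lemma delX x n : x != 0 -> del (x ^+ n) = x ^+ n * (del x / x) *+ n.
Proof.
move=> x0; rewrite /del derX; case: n => [|n]; first by rewrite !mulr0n mulr0.
by rewrite /= mulrnAr exprS; congr (_ *+ _); move: (der x) (x ^+ n) => u v; field.
Qed.
Lemma delV x : x != 0 -> del x^-1 = - x^-1 * (del x / x).
Proof. by move=> x0; rewrite /del derV //; field. Qed.
Lemma delXz x (n : int) : x != 0 -> del (x ^ n) = x ^ n * (del x / x) *~ n.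
Proof.
move=> x0; case: n => n; first by rewrite -!exprnP delX.
rewrite -[x ^ Negz n]/(x ^- n.+1) delV ?expf_neq0 // delX // NegzE mulrNz -pmulrn.
have : x ^+ n.+1 != 0 by rewrite expf_neq0.
by move: (x ^+ n.+1) (del x / x) => u v u0; rewrite mulrnAl mulrnAr [u * v]mulrC mulfK // mulNr mulNrn.
Qed.
Lemma del_zn (n : int) : del (z ^ n) = z ^ n *~ n.
Proof. by rewrite delXz ?z_neq0 // /del der_z mulr1 divff ?z_neq0 // mulr1. Qed.
Lemma del_term c (n : int) : del (cst c * z ^ n) = cst (c * n%:~R) * z ^ n.
Proof. by rewrite delZ del_zn rmorphM rmorph_int -mulrzr -mulrA [n%:~R * _]mulrC. Qed.

Lemma lau_del x : lau x -> lau (del x).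
Proof.
move: x; apply: lau_ind => [|c n x hx IH]; first by rewrite del0; apply: lau0.
rewrite delD del_term; apply: lauD => //; apply: lauM; [exact: lau_cst|exact: lau_zn].
Qed.

Lemma lf_del j x : lau x -> lf j (del x) = lf (fun n => n%:~R * j n) x.
Proof.
move: x; apply: lau_ind => [|c n x hx IH]; first by rewrite del0 !lf0.
by rewrite delD del_term !lfS ?IH ?mulrA //; apply: lau_del.
Qed.

Definition ct := lf (fun n => (n == 0)%:R).
Definition co n := lf (fun m => (m == n)%:R).

Lemma ct_del x : lau x -> ct (del x) = 0.
Proof.
move=> hx; rewrite /ct lf_del // (@eq_lf _ (fun n => 0 * n%:~R + 0 * n%:~R)) => [|n].
  by rewrite lf_lin; ring.
by case: eqP => [->|_]; rewrite ?mulr0 !mul0r addr0.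
Qed.

Lemma lau_prim w : lau w -> exists2 y, lau y & w = del y + cst (ct w).
Proof.
move: w; apply: lau_ind => [|c n x hx [y hy e]].
  by exists 0; [exact: lau0 | rewrite del0 /ct lf0 rmorph0 addr0].
rewrite /ct lfS // -/(ct x) rmorphD /=; have [n0|n0] := eqVneq n 0.
  exists y => //; rewrite {1}e n0 (_ : z ^ 0 = 1) ?mulr1 1?mulr1; last exact: expr0z.
    by rewrite addrCA.
have nz : n%:~R != 0 :> F.
  case: (n) n0 => [[|m]|m] // _; first exact: ch0.
  by rewrite NegzE mulrNz oppr_eq0; apply: ch0.
exists (cst (c / n%:~R) * z ^ n + y).
  by apply: lauD => //; apply: lauM; [exact: lau_cst|exact: lau_zn].
by rewrite delD del_term divfK // mulr0 rmorph0 {1}e; ring.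
Qed.

Lemma coE p s i : co (i%:Z - s%:Z) (iota p / z ^+ s) = p`_i.
Proof.
rewrite /co lfE /pf; have [ip|ip] := ltnP i (size p); last first.
  rewrite nth_default // big1 // => j _; rewrite (inj_eq (addIr _)) eqz_nat.
  by rewrite ltn_eqF ?mulr0 // (leq_trans (ltn_ord j)).
rewrite (bigD1 (Ordinal ip)) //= eqxx mulr1 big1 ?addr0 // => j.
by rewrite -val_eqE /= (inj_eq (addIr _)) eqz_nat => /negPf ->; rewrite mulr0.
Qed.

Lemma lau_eq0 x : lau x -> (forall n, co n x = 0) -> x = 0.
Proof.
move=> [p [s ->]] h; have -> : p = 0 by apply/polyP=> i; rewrite -(coE p s) h coef0.
by rewrite rmorph0 mul0r.
Qed.

Lemma mul_X_coprime (B : {poly F}) k : B.[0] != 0 -> coprimep B ('X^k).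
Proof.
move=> B0; apply: coprimep_expr; rewrite coprimep_sym.
by rewrite -['X]subr0 -polyC0 coprimep_sym coprimep_XsubC.
Qed.

Lemma split_X (B : {poly F}) : B != 0 -> exists b B1, B1.[0] != 0 /\ B = B1 * 'X^b.
Proof.
move=> B0; have [b [B1 rB1 BE]] := multiplicity_XsubC B 0.
by rewrite B0 in rB1; exists b, B1; split=> //; rewrite BE polyC0 subr0.
Qed.

(** Write [x = A / (B1 X^b)] in lowest terms with [B1(0) != 0]. Differentiation would raise the
    order of every pole away from 0, so [B1] divides [B1'] and is constant. *)
Lemma lau_of_der x : lau (der x) -> lau x.
Proof.
move=> [w [s]]; have [A [B [B0 cAB ->]]] := frac_coprime x; rewrite derE // => e.
have [b [B1 [B10 BE]]] := split_X B0.
have cAB1 : coprimep B1 A by move: cAB; rewrite BE coprimep_sym coprimepMl => /andP[].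
have e1 : (A^`() * B - A * B^`()) * 'X^s = w * B ^+ 2.
  apply/eqP; rewrite -subr_eq0 -(iota_eq0E E) rmorphB !expr2 !rmorphM rmorphB !rmorphM !rmorphXn /= subr_eq0.
  rewrite -expr2; have zs : z ^+ s != 0 by rewrite expf_neq0 ?z_neq0.
  have B2 : iota B ^+ 2 != 0 by rewrite expf_neq0 ?iota_neq0.
  apply/eqP; apply: (mulIf (invr_neq0 zs)); rewrite mulfK //; apply: (mulIf (invr_neq0 B2)).
  by rewrite e mulrAC mulfK.
have d1 : B1 %| B1^`().
  have : B1 %| A * B^`() * 'X^s.
    have -> : A * B^`() * 'X^s = B1 * ('X^b * (A^`() * 'X^s - w * B)).
      move: (A^`()) (B^`()) ('X^b) ('X^s) e1 BE => a b' y y' e1 BE; move: e1; rewrite BE => e1.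
      have -> : A * b' * y' = a * (B1 * y) * y' - (a * (B1 * y) - A * b') * y' by ring.
      by rewrite e1; ring.
    by rewrite dvdp_mulr.
  rewrite Gauss_dvdpl ?mul_X_coprime // Gauss_dvdpr //.
  rewrite BE derivM dvdp_addl; last by rewrite dvdp_mulr.
  by rewrite Gauss_dvdpl ?mul_X_coprime.
have [c Bc] : exists c, B1 = c%:P.
  apply: (deriv_eq0 ch0); apply/eqP/negPn/negP => nz.
  by have := dvdp_leq nz d1; rewrite leqNgt lt_size_deriv //; apply: contraNneq nz => ->; rewrite deriv0.
have c0 : c != 0 by move: B10; rewrite Bc hornerC.
exists (A * c^-1%:P), b; rewrite BE Bc [in RHS]rmorphM [in LHS]rmorphM rmorphXn /=.
rewrite -[iota c%:P]/(cst c) -[iota c^-1%:P]/(cst c^-1); by rewrite fmorphV invfM mulrA.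
Qed.

End Lau.
End Laurent.

(** * Iterated integrals and residues of Laurent polynomial paths *)

Module LaurentPath.
Import all_boot all_order all_algebra ring zify.
Import FracDer FunPair PolyPath Kummer Laurent.
Set Implicit Arguments. Unset Strict Implicit. Unset Printing Implicit Defensive.
Import GRing.Theory Num.Theory Order.TTheory.
Local Open Scope ring_scope.

(** Dependent choice on the whole history: [R G n] consults only the terms before [n], and the list
    [l n] records the first [n] choices. *)
Lemma seq_choice (A : Type) (x0 : A) (Q : A -> Prop) (R : (nat -> A) -> nat -> A -> Prop) :
  (forall n G G' y, (forall k, (k < n)%N -> G k = G' k) -> R G n y -> R G' n y) ->
  (forall n G, (forall k, (k < n)%N -> Q (G k)) -> exists y, Q y /\ R G n y) ->
  exists G, forall n, Q (G n) /\ R G n (G n).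
Proof.
move=> ext ex; pose D l n y := Q y /\ R (nth x0 l) n y.
pose st l := ClassicalEpsilon.epsilon (inhabits x0) (D l (size l)).
pose l n := iter n (fun l => rcons l (st l)) [::].
have sl n : size (l n) = n by elim: n => //= n IH; rewrite size_rcons -/(l n) IH.
pose G n := st (l n).
have nl n k : (k < n)%N -> nth x0 (l n) k = G k.
  elim: n => // n IH; rewrite ltnS leq_eqVlt /= nth_rcons sl => /orP[/eqP->|kn].
    by rewrite ltnn eqxx.
  by rewrite kn IH.
suff h n : forall k, (k < n)%N -> Q (G k) /\ R G k (G k) by exists G => n; apply: (h n.+1).
elim: n => // n IH k; rewrite ltnS leq_eqVlt => /orP[/eqP->|]; last exact: IH.
have [|y [Qy Ry]] := ex n (nth x0 (l n)) _.
  by move=> j jn; rewrite nl //; case: (IH j jn).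
have [h1 h2] : D (l n) n (G n).
  by rewrite /G /st sl; apply: (ClassicalEpsilon.epsilon_spec _ (D (l n) n)); exists y.
by split=> //; apply: ext h2 => j jn; rewrite nl.
Qed.

Section Path.
Variables (F : fieldType) (E : ratfun F).
Hypothesis ch0 : forall n, n.+1%:R != 0 :> F.
Notation der := (@rD F E).
Notation iota := (rI E).
Notation cst := (@cst F E).
Notation z := (rI E 'X).
Notation lau := (@lau F E).
Notation ct := (@ct F E).
Notation co := (@co F E).
Notation del := (@del F E).

Lemma evtZ (t : E) c p : evt t (c *: p) = cst c * evt t p.
Proof. by rewrite -mul_polyC rmorphM /= evtC. Qed.

Lemma lau_evt t p : lau t -> lau (evt t p).
Proof.
move=> ht; elim/poly_ind: p => [|p c IH]; first by rewrite rmorph0; apply: lau0.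
by rewrite rmorphD rmorphM /= evtX evtC; apply: lauD (lau_cst _ _); apply: lauM.
Qed.

Lemma intr_neq0 (n : int) : n != 0 -> n%:~R != 0 :> F.
Proof.
case: n => [[|m]|m] // _; first exact: ch0.
by rewrite NegzE mulrNz oppr_eq0; apply: ch0.
Qed.

Lemma evt_rev (p : {poly F}) n : (size p <= n.+1)%N ->
  iota p / z ^+ n = evt z^-1 (\poly_(i < n.+1) p`_(n - i)).
Proof.
move=> sp; rewrite poly_def rmorph_sum /=.
have -> : iota p = \sum_(i < n.+1) cst p`_i * z ^+ i.
  rewrite -{1}[p](@take_poly_id _ n.+1) // /take_poly poly_def rmorph_sum /=.
  by apply: eq_bigr => i _; rewrite -mul_polyC rmorphM rmorphXn.
rewrite mulr_suml (reindex_inj rev_ord_inj) /=; apply: eq_bigr => i _.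
rewrite evtZ rmorphXn /= evtX subSS -mulrA; congr (_ * _).
have zi : z ^+ i != 0 by rewrite expf_neq0 ?z_neq0.
have e : z ^+ n = z ^+ (n - i) * z ^+ i by rewrite -exprD subnK // -ltnS.
rewrite e invfM mulrA divff ?mul1r ?exprVn //.
by rewrite expf_neq0 ?z_neq0.
Qed.

Lemma lau_nonneg x : lau x -> (forall n, n < 0 -> co n x = 0) -> exists p, x = evt z p.
Proof.
move=> [p [s ->]] h; have t0 : take_poly s p = 0.
  apply/polyP=> i; rewrite coef_take_poly coef0; case: ltnP => // ip.
  by rewrite -(coE E p s) h // subr_lt0 ltz_nat.
exists (drop_poly s p); rewrite evt_X -{1}(poly_take_drop s p) t0 add0r rmorphM rmorphXn /= mulfK //.
by rewrite expf_neq0 ?z_neq0.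
Qed.

Lemma lau_nonpos x : lau x -> (forall n, 0 < n -> co n x = 0) -> exists p, x = evt z^-1 p.
Proof.
move=> [p [s ->]] h; exists (\poly_(i < s.+1) p`_(s - i)); apply: evt_rev.
apply/leq_sizeP => j js.
by rewrite -(coE E p s) h // subr_gt0 ltz_nat.
Qed.

Section HalfLine.
Variable m : int.
Hypothesis m0 : m != 0.
Notation u := (z ^ m).

Lemma del_u : del u = cst m%:~R * u.
Proof. by rewrite del_zn rmorph_int mulrzl. Qed.
Lemma del_evt p : del (evt u p) = evt u (m%:~R *: ('X * p^`())).
Proof. by rewrite evtZ rmorphM /= evtX /Laurent.del der_evt mulrCA -/(del u) del_u; ring. Qed.
Lemma ct_evt p : ct (evt u ('X * p)) = 0.
Proof.
rewrite rmorphM /= evtX mulrC -(expr1 u).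
suff h k : ct (evt u p * u ^+ k.+1) = 0 by exact: h.
elim/poly_ind: p k => [|p c IH] k; first by rewrite rmorph0 mul0r /ct lf0.
have lu := lau_zn E m.
rewrite rmorphD rmorphM /= evtX evtC mulrDl -mulrA -exprS /ct lfD -/(ct _) ?IH ?add0r.
- rewrite lfZ ?[u ^+ _]exprnP ?exprz_exp ?lf_zn; last exact: lau_zn.
  by rewrite mulf_eq0 (negPf m0) /= mulr0.
- by apply: lauM; [apply: lau_evt|apply: lauX].
- by apply: lauM; [apply: lau_cst|apply: lauX].
Qed.
Lemma evt_prim p : exists P, del (evt u P) = evt u ('X * p).
Proof.
have [P PE] := poly_prim ch0 (m%:~R^-1 *: p).
exists P; rewrite del_evt PE; congr (evt _ _).
by rewrite -scalerAr scalerA divff ?scale1r // intr_neq0.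
Qed.
End HalfLine.

(** Iterated integrals that remain Laurent polynomials. [ltI] integrates a whole sum at once, as the
    recursion for the first integral does. *)
Inductive ltow (v : nat -> E) : E -> Prop :=
 | ltC c : ltow v (cst c)
 | ltD x y : ltow v x -> ltow v y -> ltow v (x + y)
 | ltM c x : ltow v x -> ltow v (cst c * x)
 | ltI n (xs : nat -> E) y : (forall i, ltow v (xs i)) -> lau y ->
     del y = \sum_(i < n) xs i * del (v i) -> ltow v y.

Lemma ltow_lau v x : ltow v x -> lau x.
Proof.
elim=> [c|x1 y1 _ h1 _ h2|c x1 _ h|//]; [exact: lau_cst|exact: lauD|].
by apply: lauM => //; apply: lau_cst.
Qed.

Lemma del_eq0 x : del x = 0 -> exists c, x = cst c.
Proof.
by move=> /eqP; rewrite mulf_eq0 (negPf (z_neq0 E)) => /eqP/(der_eq0 ch0).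
Qed.

(** Within polynomials in one monomial every integrand [x del v_i] is divisible by this monomial, so
    integration meets no residue. *)
Lemma ltow_half m v x : m != 0 -> (forall i, exists p, v i = evt (z ^ m) p) -> ltow v x ->
  exists p, x = evt (z ^ m) p.
Proof.
move=> m0 hv; elim=> [c|x1 y1 _ [p ->] _ [q ->]|c x1 _ [p ->]|n xs y _ hx _ e].
- by exists c%:P; rewrite evtC.
- by exists (p + q); rewrite rmorphD.
- by exists (c%:P * p); rewrite rmorphM /= evtC.
- have [p ep] : exists p, del y = evt (z ^ m) ('X * p).
    rewrite e; elim: n {e} => [|n [p IH]].
      by exists 0; rewrite big_ord0 mulr0 rmorph0.
    have [q hq] := hx n; have [r hr] := hv n.
    exists (p + m%:~R *: (q * r^`())); rewrite big_ord_recr /= IH hq hr del_evt -rmorphM -rmorphD.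
    by congr (evt _ _); rewrite mulrDr -!scalerAr mulrCA.
  have [P hP] := evt_prim m0 p.
  have : del (y - evt (z ^ m) P) = 0 by rewrite delD delN ep hP subrr.
  move/del_eq0=> [c hc]; exists (P + c%:P); rewrite rmorphD /= evtC -hc.
  by rewrite addrC subrK.
Qed.

Lemma half_residue m v x i : m != 0 -> (forall i, exists p, v i = evt (z ^ m) p) -> ltow v x ->
  ct (x * del (v i)) = 0.
Proof.
move=> m0 hv /(ltow_half m0 hv) [p ->]; have [q ->] := hv i.
by rewrite del_evt -rmorphM -scalerAr mulrCA scalerAr; apply: ct_evt.
Qed.

Definition two_sided t := [/\ lau t, exists2 n, n < 0 & co n t != 0 & exists2 n, 0 < n & co n t != 0].

Lemma coD n x y : lau x -> lau y -> co n (x + y) = co n x + co n y.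
Proof. exact: lfD. Qed.

(* A family of Laurent polynomials generates one with both positive and negative exponents unless
   all its members are polynomials in the same monomial. *)
Lemma two_sided_or f g : (forall i, lau (f i)) ->
  (exists2 m, m != 0 & forall i, exists p, f i = evt (z ^ m) p) \/
  exists t s, alg2 f g t s /\ two_sided t.
Proof.
move=> hf; have [|nt] := Classical_Prop.classic (exists t s, alg2 f g t s /\ two_sided t); first by right.
left; have [|/Classical_Pred_Type.not_all_ex_not [i hi]] :=
  Classical_Prop.classic (forall i, exists p, f i = evt (z ^ 1) p); first by exists 1.
exists (-1) => // j; apply: Classical_Prop.NNPP => hj; apply: nt.
have [n n0 hn] : exists2 n, n < 0 & co n (f i) != 0.
  apply: Classical_Prop.NNPP => h; apply: hi; apply: lau_nonneg => // n n0.
  by apply/eqP/negPn/negP => h'; apply: h; exists n.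
have [m m0 hm] : exists2 n, 0 < n & co n (f j) != 0.
  apply: Classical_Prop.NNPP => h; apply: hj; apply: lau_nonpos => // k k0.
  by apply/eqP/negPn/negP => h'; apply: h; exists k.
have [h1|h1] := Classical_Prop.classic (two_sided (f i)).
  by exists (f i), (g i); split=> //; apply: alg2V.
have [h2|h2] := Classical_Prop.classic (two_sided (f j)).
  by exists (f j), (g j); split=> //; apply: alg2V.
exists (f i + f j), (g i + g j); split; first by apply: alg2D; apply: alg2V.
split; first exact: lauD.
- exists n => //; rewrite coD // (_ : co n (f j) = 0) ?addr0 //.
  apply/eqP/negPn/negP => h; apply: h2; split=> //; first by exists n.
  by exists m.
- exists m => //; rewrite coD // (_ : co m (f i) = 0) ?add0r //.
  apply/eqP/negPn/negP => h; apply: h1; split=> //; first by exists n.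
  by exists m.
Qed.

Lemma co_cst n c : n != 0 -> co n (cst c) = 0.
Proof.
move=> n0; rewrite -[cst c]mulr1 -(expr0z z) /Laurent.co lfZ ?lf_zn; last exact: lau_zn.
by rewrite eq_sym (negPf n0) mulr0.
Qed.

Lemma two_sided_der t : two_sided t -> der t != 0.
Proof.
move=> [_ [n n0 h] _]; apply: contraNneq h => /(der_eq0 ch0) [c ->].
by rewrite co_cst // ltr0_neq0.
Qed.

(** Such a [t] has poles both at 0 and at infinity. With [t = q / z^r], the equation [q(z) = t z^r]
    is monic for [z], and its reversal is monic for [1/z]. *)
Lemma two_sided_integral t : two_sided t ->
  integralOver (evtm t) z /\ integralOver (evtm t) z^-1.
Proof.
move=> [[p [s tE]] [n n0 hn] [m m0 hm]].
have p0 : p != 0.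
  by apply: contraNneq hn => p0; rewrite tE p0 rmorph0 mul0r /Laurent.co lf0.
have [b [q [q0 pE]]] := split_X p0.
have zb k : z ^+ k != 0 by rewrite expf_neq0 ?z_neq0.
have bs : (b < s)%N.
  rewrite ltnNge; apply/negP => sb; move: hn.
  have -> : t = iota (q * 'X^(b - s)) / z ^+ 0.
    by rewrite expr0 divr1 tE pE !rmorphM !rmorphXn /= -(subnK sb) exprD mulrA mulfK ?addnK.
  case: n n0 => [//|k] _; rewrite /Laurent.co lfE /pf big1 ?eqxx // => i _.
  by rewrite subr0 mulr0.
have sE : s = (b + (s - b))%N by rewrite subnKC // ltnW.
have t1 : t = iota q / z ^+ (s - b).
  rewrite tE pE {1}sE rmorphM rmorphXn exprD /=.
  by rewrite invfM mulrA mulfK.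
have r0 : (0 < s - b)%N by rewrite subn_gt0.
move: (s - b)%N r0 t1 => r r0 t1 {sE bs}.
have szq : (r.+1 < size q)%N.
  case: m m0 hm => // k k0; rewrite t1 -[Posz k](addrK (Posz r)) -PoszD coE.
  by case: (ltnP r.+1 (size q)) => // h; rewrite nth_default ?eqxx // (leq_trans h) // -addn1 addnC leq_add2r.
split.
  apply: (@integralOver_ratio _ _ _ _ q 'X^r); first by rewrite size_polyXn.
  by rewrite evt_X rmorphXn /= evtX t1 divfK.
pose n1 := (size q).-1; have szn : size q = n1.+1 by rewrite prednK // (leq_trans _ szq).
apply: (@integralOver_ratio _ _ _ _ (\poly_(i < n1.+1) q`_(n1 - i)) 'X^(n1 - r)).
  rewrite size_polyXn size_poly_eq; last by rewrite subnn -horner_coef0.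
  by move: szq; rewrite szn ltnS; lia.
rewrite -evt_rev ?szn // rmorphXn /= evtX exprVn t1.
have -> : z ^+ n1 = z ^+ r * z ^+ (n1 - r) by rewrite -exprD subnKC // -ltnS -szn ltnW.
by rewrite invfM mulrA.
Qed.

Lemma integralOver_exp (t x : E) n : integralOver (evtm t) x -> integralOver (evtm t) (x ^+ n).
Proof.
move=> h; elim: n => [|n IH]; last by rewrite exprS; apply: integral_mul.
by rewrite expr0 -(rmorph1 (evtm t)); apply: integral_id.
Qed.

Section KummerPair.
Variables f g : nat -> E.
Hypothesis lf : forall i, lau (f i).
Hypothesis iffB : forall x y, alg2 f g x y -> (x = 0 <-> y = 0).
Variables t s : E.
Hypotheses (ts : alg2 f g t s) (tt : two_sided t).

Lemma partner_der : der s != 0.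
Proof.
apply: contraNneq (two_sided_der tt) => /(der_eq0 ch0) [c sc].
have := alg2B ts (alg2C f g c); rewrite sc subrr => /iffB [_ /(_ erefl)] /eqP.
by rewrite subr_eq0 => /eqP ->; rewrite der_cst.
Qed.

(** The nonzero residue feeds [kummer_gen], which puts [h = z^(e+1)] in the field. Since [h] and
    [1/h] are both integral over [F[t]], the product of their conductors serves all integer powers
    of [h]. *)
Lemma kummer_pair k k' : frac2 f g k k' -> lau (k * del t) -> ct (k * del t) != 0 ->
  exists e h' D D', [/\ frac2 f g (z ^+ e.+1) h', alg2 f g D D', D != 0,
    forall n : int, alg2 f g (D * (z ^+ e.+1) ^ n) (D' * h' ^ n) &
    forall x y, alg2 f g x y -> exists V j, x = evt (z ^+ e.+1) V / (z ^+ e.+1) ^+ j].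
Proof.
move=> hk lk ck; have dt := two_sided_der tt; have ds := partner_der.
have [n [c [n0 Kc ze ind]]] := min_poly ch0 iffB ts dt z.
case: n n0 ze ind => // e _ ze ind.
pose K x := exists y, frac2 f g x y.
have KC a : K (cst a) by exists (cst a); apply: frac2C.
have KD x y : K x -> K y -> K (x + y) by move=> [x' hx] [y' hy]; exists (x' + y'); apply: frac2D.
have KM x y : K x -> K y -> K (x * y) by move=> [x' hx] [y' hy]; exists (x' * y'); apply: frac2M.
have KV x : K x -> K x^-1 by move=> [x' hx]; exists x'^-1; apply: frac2V.
have Kd x : K x -> K (d t x) by move=> [x' hx]; exists (der x' / der s); apply: frac2_der.
have [Y lY eY] := lau_prim ch0 lk.
have ek : k * der t = der Y + cst (ct (k * del t)) / z.
  apply: (mulIf (z_neq0 E)); rewrite mulrDl divfK ?z_neq0 // -mulrA [der t * z]mulrC.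
  by rewrite -/(del t) {1}eY /Laurent.del mulrC.
have mp := min_poly ch0 iffB ts dt.
have Kk : K k by exists k'.
have Kh : K (z ^+ e.+1) := kummer_gen ch0 KC KD KM KV dt Kd mp Kc ze ind Kk ck ek.
have [h' hh'] := Kh.
have [iz izV] := two_sided_integral tt.
have h0 : z ^+ e.+1 != 0 by rewrite expf_neq0 ?z_neq0.
have [n1 [P1 [n10 r1]]] := integral_rel (integralOver_exp e.+1 iz).
have [n2 [P2 [n20 r2]]] := integral_rel (integralOver_exp e.+1 izV).
have [D1 [D1' [D1a D10 D1h]]] := conductor iffB ts hh' n10 r1.
have hV := frac2V iffB hh'; rewrite -exprVn in hV.
have [D2 [D2' [D2a D20 D2h]]] := conductor iffB ts hV n20 r2.
exists e, h', (D1 * D2), (D1' * D2'); split=> //.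
- exact: alg2M.
- by rewrite mulf_neq0.
- case=> n.
    by rewrite -!exprnP [D1 * D2]mulrC [D1' * D2']mulrC -!mulrA; apply: alg2M.
  rewrite /exprz /= -!exprVn -!mulrA; apply: alg2M => //.
move=> x y; elim=> [a|i|x1 y1 x2 y2 _ [V1 [j1 ->]] _ [V2 [j2 ->]]|x1 y1 x2 y2 _ [V1 [j1 ->]] _ [V2 [j2 ->]]].
- by exists a%:P, 0%N; rewrite evtC expr0 divr1.
- have [p [j fE]] := lf i.
  (* Multiplying [f i = p / z^j] by [h^j = z^(e j) z^j] gives a polynomial in [z] that lies in the
     field, to which [kummer_poly] applies. *)
  have Kfi : K (iota (p * 'X^(e * j))).
    have -> : iota (p * 'X^(e * j)) = f i * (z ^+ e.+1) ^+ j.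
      rewrite fE rmorphM rmorphXn /= -exprM mulSn exprD mulrA divfK //.
      by rewrite expf_neq0 ?z_neq0.
    apply: (KM); first by exists (g i); apply: frac2_alg => //; apply: alg2V.
    elim: (j) => [|j1 IH]; first by have := KC 1; rewrite rmorph1.
    by rewrite exprS; apply: KM.
  have [V hV2] := kummer_poly KC KD KM KV mp Kc ze ind Kh Kfi.
  exists V, j; rewrite -hV2 fE rmorphM rmorphXn /=.
  rewrite -exprM mulSn exprD.
  have : z ^+ (e * j) != 0 by rewrite expf_neq0 ?z_neq0.
  have : z ^+ j != 0 by rewrite expf_neq0 ?z_neq0.
  by move: (z ^+ (e * j)) (z ^+ j) (iota p) => u w P u0 w0; field; rewrite u0 w0.
- exists (V1 * 'X^j2 + V2 * 'X^j1), (j1 + j2)%N.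
  rewrite rmorphD !rmorphM !rmorphXn /= !evtX exprD.
  move: (z ^+ e.+1) h0 => h h0; rewrite addf_div ?expf_neq0 //.
- exists (V1 * V2), (j1 + j2)%N; rewrite rmorphM /= exprD mulf_div //.
Qed.
End KummerPair.

Lemma lf_sum j (n : nat) (u : 'I_n -> E) : (forall i, lau (u i)) ->
  lf j (\sum_i u i) = \sum_i lf j (u i).
Proof.
elim: n u => [|n IH] u hu; first by rewrite !big_ord0 lf0.
by rewrite !big_ord_recr /= lfD ?IH //; apply: lau_sum.
Qed.

Lemma mono_exp (c : F) (M n : int) : (cst c * z ^ M) ^ n = cst (c ^ n) * z ^ (M * n).
Proof. by rewrite expfzMl exprz_exp fmorphXz. Qed.

Lemma lau_mono (c : F) (M n : int) : lau ((cst c * z ^ M) ^ n).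
Proof. by rewrite mono_exp; apply: lauM; [apply: lau_cst|apply: lau_zn]. Qed.

Lemma lf_evt j (c : F) (M : int) q n : c != 0 ->
  lf j (evt (cst c * z ^ M) q * (cst c * z ^ M) ^ n) =
  \sum_(i < size q) q`_i * (c ^ (i%:Z + n) * j (M * (i%:Z + n))).
Proof.
move=> c0; set h := cst c * z ^ M.
have h0 : h != 0 by rewrite mulf_neq0 ?fmorph_eq0 ?expfz_neq0 ?z_neq0.
have -> : evt h q * h ^ n = \sum_(i < size q) cst q`_i * h ^ (i%:Z + n).
  rewrite -{1}[q]coefK poly_def rmorph_sum mulr_suml; apply: eq_bigr => i _ /=.
  by rewrite evtZ rmorphXn /= evtX expfzDr // mulrA.
rewrite lf_sum => [|i]; last by apply: lauM; [apply: lau_cst|apply: lau_mono].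
apply: eq_bigr => i _; rewrite lfZ; last exact: lau_mono.
by rewrite mono_exp lfZ ?lf_zn //; apply: lau_zn.
Qed.

(** Constant terms against negative powers of a monomial read off the coefficients of [q]. *)
Lemma ct_pick (c : F) (M : int) q (n : nat) : c != 0 -> M != 0 ->
  ct (evt (cst c * z ^ M) q * (cst c * z ^ M) ^ (- n%:Z)) = q`_n.
Proof.
move=> c0 M0; rewrite /Laurent.ct lf_evt //.
have h (i : nat) : (M * (i%:Z - n%:Z) == 0) = (i == n).
  by rewrite mulf_eq0 (negPf M0) subr_eq0 eqz_nat.
under eq_bigr do rewrite h.
have [nq|nq] := ltnP n (size q); last first.
  rewrite nth_default // big1 // => i _; rewrite ltn_eqF ?mulr0 //.
  exact: leq_trans nq.
rewrite (bigD1 (Ordinal nq)) //= eqxx subrr expr0z !mulr1 big1 ?addr0 // => i.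
by rewrite -val_eqE /= => /negPf ->; rewrite !mulr0.
Qed.

Lemma alg2_lau f g x y : (forall i, lau (f i)) -> alg2 f g x y -> lau x.
Proof.
move=> lf; elim=> [c|i|x1 y1 x2 y2 _ h1 _ h2|x1 y1 x2 y2 _ h1 _ h2] //.
- exact: lau_cst.
- exact: lauD.
- exact: lauM.
Qed.

Lemma ltow_frac2 f g t s x : (forall x y, alg2 f g x y -> (x = 0 <-> y = 0)) ->
  alg2 f g t s -> der t != 0 -> der s != 0 -> ltow f x -> exists y, frac2 f g x y.
Proof.
move=> iffB ts dt ds; elim=> [c|x1 y1 _ [u1 h1] _ [u2 h2]|c x1 _ [u1 h1]|n xs y1 _ hx _ e].
- by exists (cst c); apply: frac2C.
- by exists (u1 + u2); apply: frac2D.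
- by exists (cst c * u1); apply: frac2M => //; apply: frac2C.
pose ys i := ClassicalEpsilon.epsilon (inhabits 0) (frac2 f g (xs i)).
have hy i : frac2 f g (xs i) (ys i) := ClassicalEpsilon.epsilon_spec _ _ (hx i).
apply: (@frac2_prim _ _ ch0 _ _ iffB _ _ ts dt ds y1 (\sum_(j < n) xs j * (der (f j) / der t))
  (\sum_(j < n) ys j * (der (g j) / der s))).
- apply: frac2_sum => // j _; apply: frac2M => //.
  by apply: frac2_der => //; apply: frac2_alg => //; apply: alg2V.
- apply: (mulfI (z_neq0 E)); rewrite -/(del y1) e mulr_suml mulr_sumr; apply: eq_bigr => j _.
  by rewrite -!mulrA mulVf // mulr1 mulrCA.
Qed.

(* A nonzero residue would put a power of [z] in the field of quotients of polynomials in [v], and the conductor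
   estimate would then make the residue vanish. *)
Lemma tow_residue v m : (forall i, lau (v i)) -> alg2 v v m m -> m != 0 ->
  (forall a b, alg2 v v a a -> alg2 v v b b -> ct (m * a * del b) = 0) ->
  forall x i, ltow v x -> ct (x * del (v i)) = 0.
Proof.
move=> lv hm m0 HB x i hx.
have [[M M0 hv]|[t [s [ts tt]]]] := two_sided_or v lv; first exact: (half_residue _ M0 hv hx).
have iffB x' y' : alg2 v v x' y' -> (x' = 0 <-> y' = 0) by move/alg2_diag => ->.
have dt := two_sided_der tt; have st := alg2_diag ts; rewrite -st in ts.
have fr y : ltow v y -> frac2 v v y y.
  by move/(ltow_frac2 iffB ts dt dt) => [y' hy]; apply: frac2_diag hy.
have dv : frac2 v v (der (v i) / der t) (der (v i) / der t).
  by apply: frac2_der => //; apply: frac2_alg => //; apply: alg2V.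
apply/eqP/negPn/negP => c0.
have xE : x * (der (v i) / der t) * del t = x * del (v i).
  by rewrite /Laurent.del; move: (der t) (der (v i)) dt => u w u0; field.
have lx : lau (x * del (v i)) by apply: lauM; [apply: ltow_lau hx|apply: lau_del].
have [] := kummer_pair lv iffB ts tt (frac2M (fr _ hx) dv); rewrite ?xE //.
move=> e [h' [D [D' [hh' hD D0 hDn hV]]]].
have hE : h' = z ^+ e.+1.
  exact: (frac2_fun iffB hh' (frac2_diag hh')).
have DE := alg2_diag hD; rewrite -hE in hDn hV hh'.
have h0 : h' != 0 by rewrite hE expf_neq0 ?z_neq0.
have dh : del h' = e.+1%:R * h'.
  by rewrite hE exprnP del_zn mulrC mulr_natr.
have hDd n : alg2 v v (D * h' ^ n) (D * h' ^ n) by have := hDn n; rewrite -DE.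
(* [D h^(n-1) del(D h) - D h^n del D = (e+1) D^2 h^n], and both terms on the left are covered by
   [HB]. So every coefficient of [m D^2], a Laurent polynomial in [h], vanishes. *)
have key (n : int) : ct (m * D ^+ 2 * h' ^ n) = 0.
  have e1 := HB _ _ (hDd (n - 1)) (hDd 1).
  have e2 := HB _ _ (hDd n) (hDd 0).
  have lD k : lau (D * h' ^ k) := alg2_lau lv (hDd k).
  have lm : lau m := alg2_lau lv hm.
  have lD0 : lau D by have := lD 0; rewrite expr0z mulr1.
  have lk : lau (m * D ^+ 2 * h' ^ n).
    by rewrite expr2 mulrA -mulrA; apply: lauM => //; apply: lauM.
  have : e.+1%:R * ct (m * D ^+ 2 * h' ^ n) = 0.
    rewrite /Laurent.ct -lfZ // -[X in _ = X](subrr 0) -{1}e1 -e2 /Laurent.ct -lfN; last first.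
      by apply: lauM; [apply: lauM|apply: lau_del].
    rewrite -lfD; [|by apply: lauM; [apply: lauM|apply: lau_del]|by apply: lauN; apply: lauM; [apply: lauM|apply: lau_del]].
    congr (lf _ _); rewrite expr0z mulr1 expr1z delM dh rmorph_nat.
    have -> : h' ^ n = h' ^ (n - 1) * h' by rewrite -{3}[h']expr1z -expfzDr // subrK.
    by move: (del D) (h' ^ (n - 1)) => u w; ring.
  by move/eqP; rewrite mulf_eq0 (negPf (ch0 e)) => /eqP.
have [V [j]] := hV _ _ (alg2M hm (alg2M hD hD)); rewrite -?hE => VE.
have V0 : V = 0.
  apply/polyP=> k; rewrite coef0 -(@ct_pick 1 e.+1 V k) ?oner_neq0 // rmorph1 mul1r.
  rewrite -exprnP -hE -(key (j%:Z - k%:Z)) expfzDr // mulrA; congr (ct (_ * _)).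
  by rewrite -exprnP expr2 mulrA -[m * D * D]mulrA VE divfK // expf_neq0.
have := mulf_neq0 m0 (mulf_neq0 D0 D0).
by rewrite VE V0 rmorph0 mul0r eqxx.
Qed.

(** The coefficient of [y^(n+2)] in the derivative of [sum H_n y^(n+1)] along the equation, set to
    zero; [v i] is a primitive of the coefficient numbered [i + 1]. *)
Definition hseq (v H : nat -> E) := H 0%N = 1 /\
  forall n, del (H n.+1) = - \sum_(i < n.+1) (H (n - i)%N *+ (n - i).+1) * del (v i).

(** Each [H n.+1] is a primitive of an element of the field, so it has a partner by [frac2_prim];
    the partners obey the recursion because the isomorphism commutes with [d/dt] and [d/ds]. *)
Lemma hseq_partner f g t s H : (forall x y, alg2 f g x y -> (x = 0 <-> y = 0)) ->
  alg2 f g t s -> der t != 0 -> der s != 0 -> hseq f H ->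
  exists2 G, hseq g G & forall n, frac2 f g (H n) (G n).
Proof.
move=> iffB ts dt ds [H0 HS].
have hk (n : nat) (H' G : nat -> E) : (forall k, (k <= n)%N -> frac2 f g (H' k) (G k)) ->
    frac2 f g (- \sum_(i < n.+1) (H' (n - i)%N *+ (n - i).+1) * (der (f i) / der t))
              (- \sum_(i < n.+1) (G (n - i)%N *+ (n - i).+1) * (der (g i) / der s)).
  move=> h; apply: frac2N => //; apply: frac2_sum => // i _; apply: frac2M => //.
    have hi := h (n - i)%N (leq_subr _ _).
    elim: (n - i).+1 => [|m IH]; first by rewrite !mulr0n; apply: frac2_0.
    by rewrite !mulrS; apply: frac2D.
  by apply: frac2_der => //; apply: frac2_alg => //; apply: alg2V.
have eH n : der (H n.+1) = (- \sum_(i < n.+1) (H (n - i)%N *+ (n - i).+1) * (der (f i) / der t)) * der t.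
  apply: (mulfI (z_neq0 E)); rewrite -/(del (H n.+1)) HS mulNr mulrN mulr_suml mulr_sumr.
  by congr (- _); apply: eq_bigr => i _; rewrite -mulrA divfK // mulrCA.
have ex n : exists y, frac2 f g (H n) y.
  have [m] := ubnP n; elim: m n => // m IH [|n]; first by rewrite H0 => _; exists 1; apply: frac2_1.
  rewrite ltnS => nm.
  have IH' k : exists y, (k <= n)%N -> frac2 f g (H k) y.
    have [kn|kn] := leqP k n; last by exists 0.
    by have [|y hy] := IH k; [apply: leq_trans nm|exists y].
  pose G k := ClassicalEpsilon.epsilon (inhabits 0) (fun y => (k <= n)%N -> frac2 f g (H k) y).
  have hG k : (k <= n)%N -> frac2 f g (H k) (G k).
    exact: (ClassicalEpsilon.epsilon_spec _ _ (IH' k)).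
  by apply: (frac2_prim ch0 iffB ts dt ds (hk n H G hG) (eH n)).
pose G k := ClassicalEpsilon.epsilon (inhabits 0) (frac2 f g (H k)).
have hG k : frac2 f g (H k) (G k) := ClassicalEpsilon.epsilon_spec _ _ (ex k).
exists G => //; split.
  by have := hG 0%N; rewrite H0 => h; apply: (frac2_fun iffB h); apply: frac2_1.
move=> n; have := frac2_prim_der ch0 iffB ts dt ds (hG n.+1) (hk n H G (fun k _ => hG k)) (eH n).
rewrite /Laurent.del => ->; rewrite mulNr mulrN mulr_suml mulr_sumr.
by congr (- _); apply: eq_bigr => i _; rewrite -mulrA divfK // mulrCA.
Qed.

(** Without residues the recursion can be integrated forever inside Laurent polynomials. *)
Lemma hseq_tow v : (forall x i, ltow v x -> ct (x * del (v i)) = 0) -> (forall i, lau (v i)) ->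
  exists2 G, hseq v G & forall n, ltow v (G n).
Proof.
move=> hct lv.
pose R (G : nat -> E) n y := if n is m.+1 then
  del y = - \sum_(i < m.+1) (G (m - i)%N *+ (m - i).+1) * del (v i) else y = 1.
have [||G hG] := @seq_choice E 0 (ltow v) R.
- move=> [|n] G G' y e //= ->; congr (- _); apply: eq_bigr => i _.
  by rewrite e // ltnS leq_subr.
- move=> [|n] G hG; first by exists 1; split=> //; have := ltC v 1; rewrite rmorph1.
  have hx i : ltow v (- (G (n - i)%N *+ (n - i).+1)).
    rewrite -mulr_natl -mulNr.
    have := ltM (- (n - i).+1%:R) (hG (n - i)%N _); rewrite rmorphN rmorph_nat; apply.
    by rewrite ltnS leq_subr.
  have lw : lau (\sum_(i < n.+1) - (G (n - i)%N *+ (n - i).+1) * del (v i)).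
    by apply: lau_sum => i _; apply: lauM; [apply: ltow_lau (hx i)|apply: lau_del].
  have [y ly ey] := lau_prim ch0 lw.
  have c0 : ct (\sum_(i < n.+1) - (G (n - i)%N *+ (n - i).+1) * del (v i)) = 0.
    rewrite /Laurent.ct lf_sum => [|i]; last by apply: lauM; [apply: ltow_lau (hx i)|apply: lau_del].
    by rewrite big1 // => i _; apply: hct.
  rewrite c0 rmorph0 addr0 in ey.
  exists y; split; first exact: (ltI hx ly (esym ey)).
  by rewrite /R -ey -sumrN; apply: eq_bigr => i _; rewrite mulNr.
exists G => [|n]; last by case: (hG n).
by split=> [|n]; [case: (hG 0%N)|case: (hG n.+1)].
Qed.

(** Laurent polynomials are automatically closed, so closedness of a first integral amounts to being
    Laurent. In the degenerate case the partner of 0 serves as the multiplier of [tow_residue];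
    otherwise the partners of the [H n] are used. *)
Theorem trig_transfer_periodic f g H : (forall i, lau (f i)) -> (forall i, lau (g i)) ->
  (forall a a' b b', alg2 f g a a' -> alg2 f g b b' -> ct (a * del b) = ct (a' * del b')) ->
  hseq f H -> (forall n, lau (H n)) -> exists2 G, hseq g G & forall n, lau (G n).
Proof.
move=> lf lg HB hH lH.
have [h0|] := Classical_Prop.classic (forall x y, alg2 f g x y -> x = 0 -> y = 0); last first.
  move=> /Classical_Pred_Type.not_all_ex_not [x] /Classical_Pred_Type.not_all_ex_not [y h].
  have [hxy [x0 y0]] : alg2 f g x y /\ x = 0 /\ y <> 0.
    have [hxy h1] := Classical_Prop.imply_to_and _ _ h; split=> //.
    exact: Classical_Prop.imply_to_and h1.
  have hy : alg2 g g y y := alg2_left (alg2_sym hxy).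
  have hct x1 i : ltow g x1 -> ct (x1 * del (g i)) = 0.
    apply: (tow_residue lg hy); first exact/eqP.
    move=> a b ha0 hb0; have [a1 /alg2_sym ha] := alg2_lift f ha0; have [b1 /alg2_sym hb] := alg2_lift f hb0.
    by rewrite -(HB _ _ _ _ (alg2M hxy ha) hb) x0 !mul0r /Laurent.ct lf0.
  have [G hG tG] := hseq_tow hct lg; exists G => // n; exact: ltow_lau (tG n).
have [[i0 ds]|hc] := Classical_Prop.classic (exists i, der (g i) != 0); last first.
  exists (fun n => (n == 0%N)%:R) => [|n].
    split=> // n; rewrite /Laurent.del der0 mulr0 big1 ?oppr0 // => i _.
    suff -> : der (g i) = 0 by rewrite !mulr0.
    by apply/eqP/negPn/negP => h; apply: hc; exists i.
  by rewrite -(rmorph_nat cst); apply: lau_cst.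
have [dt iffB] := alg2_iff ch0 h0 (alg2V f g i0) ds.
have [G hG _] := hseq_partner iffB (alg2V f g i0) dt ds hH.
exists G => // n; have [m] := ubnP n; elim: m n => // m IH [|n] nm.
  by rewrite hG.1 -(rmorph1 cst); apply: lau_cst.
have ld : lau (del (G n.+1)).
  rewrite hG.2; apply: lauN; apply: lau_sum => i _; apply: lauM; last exact: lau_del.
  rewrite -mulr_natl -(rmorph_nat cst); apply: lauM; first exact: lau_cst.
  by apply: IH; apply: leq_ltn_trans (leq_subr _ _) _.
(* The partner is a rational function of [z] by construction, and its derivative is Laurent by
   induction; hence it is Laurent itself. *)
apply: (lau_of_der ch0); have -> : der (G n.+1) = z ^ (-1) * del (G n.+1).
  by rewrite /Laurent.del mulrA mulVf ?mul1r // z_neq0.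
by apply: lauM => //; apply: lau_zn.
Qed.

End Path.
End LaurentPath.

(** * Paths with a linear term: rigidity from three weighted moments *)

Module LinearGrowth.
Import all_boot all_order all_algebra ring zify.
Import FracDer FunPair PolyPath Kummer Laurent LaurentPath.
Set Implicit Arguments. Unset Strict Implicit. Unset Printing Implicit Defensive.
Import GRing.Theory Num.Theory Order.TTheory.
Local Open Scope ring_scope.

Section PartialFractions.
Variable F : fieldType.
Hypothesis ch0 : forall n, n.+1%:R != 0 :> F.

Lemma natr_inj0 : injective (fun n : nat => n%:R : F).
Proof.
have h m n : (m < n)%N -> m%:R = n%:R :> F -> False.
  move=> mn e; have := ch0 (n - m.+1); rewrite -subSn // subSS natrB ?(ltnW mn) //.
  by rewrite e subrr eqxx.
by move=> m n e; case: (ltngtP m n) => // l; [case: (h m n l e)|case: (h n m l (esym e))].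
Qed.

Lemma poly_vanish (p : {poly F}) N : (forall n, (N <= n)%N -> p.[n%:R] = 0) -> p = 0.
Proof.
move=> h; apply/eqP/negPn/negP => p0.
have := max_poly_roots p0 (rs := [seq (N + i)%:R | i <- index_iota 0 (size p)]).
rewrite size_map size_iota subn0 ltnn => /(_ _ _)/negP; case => //.
  by apply/allP => x /mapP [i _ ->]; rewrite /root h // leq_addr.
by rewrite map_inj_uniq ?iota_uniq // => i j /natr_inj0 /addnI.
Qed.

Variables (s : nat) (b : nat -> F).
Definition pnum (a : nat -> F) : {poly F} :=
  \sum_(i < s) a i *: \prod_(k < s | k != i) ('X + (b k)%:P).

Lemma pnumE a x : (forall k, (k < s)%N -> x + b k != 0) ->
  (pnum a).[x] = (\prod_(k < s) (x + b k)) * \sum_(i < s) a i / (x + b i).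
Proof.
move=> h; rewrite /pnum horner_sum mulr_sumr; apply: eq_bigr => i _.
rewrite hornerZ horner_prod [X in _ = X * _](bigD1 i) //=.
under eq_bigr do rewrite hornerD hornerX hornerC.
have := h i (ltn_ord i); move: (\prod_(_ < s | _) _) => P; move: (x + b i) => y y0.
by field.
Qed.

Hypothesis b_inj : forall i k, (i < s)%N -> (k < s)%N -> b i = b k -> i = k.

Lemma pnum_eq0 a i : pnum a = 0 -> (i < s)%N -> a i = 0.
Proof.
move=> p0 si; have := congr1 (fun p => p.[- b i]) p0; rewrite horner0 /pnum horner_sum.
rewrite (bigD1 (Ordinal si)) //= [X in _ + X]big1 => [|k ki]; last first.
  rewrite hornerZ horner_prod (bigD1 (Ordinal si)) ?(eq_sym _ k) //=.
  by rewrite hornerD hornerX hornerC addNr mul0r mulr0.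
rewrite addr0 hornerZ horner_prod => /eqP; rewrite mulf_eq0 => /orP[/eqP //|].
move/prodf_eq0 => [k ki]; rewrite hornerD hornerX hornerC addrC subr_eq0 => /eqP e.
by case/eqP: ki; apply: val_inj; apply: b_inj e.
Qed.

Lemma pfrac_eq0 (a : nat -> F) N (i : nat) : (forall n k, (N <= n)%N -> (k < s)%N -> n%:R + b k != 0) ->
  (forall n, (N <= n)%N -> \sum_(i < s) a i / (n%:R + b i) = 0) -> (i < s)%N -> a i = 0.
Proof.
move=> h e; apply: pnum_eq0; apply: (@poly_vanish _ N) => n nN.
by rewrite pnumE ?e ?mulr0 // => k; apply: h.
Qed.

(** For the numerators, [p1(n) = c^n p2(n)] at all large [n]. Comparing [n] with [n + 1] eliminates
    the exponential: [p1(X+1) p2 = c p1 p2(X+1)], and leading coefficients give [c = 1]. *)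
Lemma pfrac_exp (a a' : nat -> F) c N (i : nat) : c != 0 -> (forall n k, (N <= n)%N -> (k < s)%N -> n%:R + b k != 0) ->
  (forall n, (N <= n)%N -> \sum_(i < s) a i / (n%:R + b i) = c ^+ n * \sum_(i < s) a' i / (n%:R + b i)) ->
  (i < s)%N -> a i != 0 -> c = 1.
Proof.
move=> c0 h e si ai; pose p1 := pnum a; pose p2 := pnum a'.
have p10 : p1 != 0 by apply: contraNneq ai => /pnum_eq0 ->.
have e1 n : (N <= n)%N -> p1.[n%:R] = c ^+ n * p2.[n%:R].
  move=> nN; have hn k : (k < s)%N -> n%:R + b k != 0 by apply: h.
  by rewrite !pnumE // e // mulrCA.
have p20 : p2 != 0.
  apply: contraNneq p10 => p20; apply/eqP/(@poly_vanish _ N) => n nN.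
  by rewrite e1 // p20 horner0 mulr0.
have XS n (p : {poly F}) : (p \Po ('X + 1%:P)).[n%:R] = p.[n.+1%:R].
  by rewrite horner_comp hornerD hornerX hornerC natr1.
have e2 : (p1 \Po ('X + 1%:P)) * p2 = c *: (p1 * (p2 \Po ('X + 1%:P))).
  apply/eqP; rewrite -subr_eq0; apply/eqP/(@poly_vanish _ N) => n nN.
  rewrite hornerD hornerN hornerZ !hornerM !XS !e1 ?leqW // exprS.
  by ring.
have sX : (1 < size (('X + 1%:P)%R : {poly F}))%N by rewrite size_XaddC.
have lX : lead_coef ('X + 1%:P : {poly F}) = 1 by rewrite lead_coefXaddC.
have := congr1 lead_coef e2; rewrite lead_coefZ !lead_coefM !lead_coef_comp // lX !expr1n !mulr1.
have : lead_coef p1 * lead_coef p2 != 0 by rewrite mulf_neq0 ?lead_coef_eq0.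
move: (_ * _) => l l0 /eqP; rewrite -{1}[l]mul1r -subr_eq0 -mulrBl mulf_eq0 (negPf l0) orbF subr_eq0.
by move/eqP.
Qed.
End PartialFractions.

Section Linear.
Variables (F : fieldType) (E : ratfun F).
Hypothesis ch0 : forall n, n.+1%:R != 0 :> F.
Notation der := (@rD F E).
Notation iota := (rI E).
Notation cst := (@cst F E).
Notation z := (rI E 'X).
Notation lau := (@lau F E).
Notation ct := (@ct F E).
Notation co := (@co F E).
Notation del := (@del F E).

(** All powers of [B1] divide the fixed numerator of [D], so [B1] has degree 0. *)
Lemma lau_pow_den (A B B1 : {poly F}) (D : E) b : coprimep A B -> B = B1 * 'X^b -> B1.[0] != 0 ->
  D != 0 -> (forall n : nat, lau (D * (iota A / iota B) ^+ n)) -> exists2 c, c != 0 & B1 = c%:P.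
Proof.
move=> cAB BE B10 D0 h.
have [p [s DE]] : lau D by have := h 0%N; rewrite expr0 mulr1.
have p0 : p != 0 by apply: contraNneq D0 => p0; rewrite DE p0 rmorph0 mul0r.
have B0 : B1 != 0 by apply: contraNneq B10 => ->; rewrite horner0.
have cAB1 : coprimep B1 A by move: cAB; rewrite BE coprimep_sym coprimepMl => /andP[].
have dv n : B1 ^+ n %| p.
  have [q [r e]] := h n.
  have e1 : p * A ^+ n * 'X^r = q * B ^+ n * 'X^s.
    apply/eqP; rewrite -subr_eq0 -(iota_eq0E E) rmorphB !rmorphM !rmorphXn /= subr_eq0; apply/eqP.
    have : iota B ^+ n != 0 by rewrite expf_neq0 ?iota_neq0 // BE mulf_neq0 // expf_neq0 ?polyX_eq0.
    have := z_neq0 E; move: e; rewrite DE expr_div_n.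
    move: (iota p) (iota q) (iota A ^+ n) (iota B ^+ n) z => P Q a b' w e w0 b0.
    have zs : w ^+ s != 0 by rewrite expf_neq0.
    have zr : w ^+ r != 0 by rewrite expf_neq0.
    rewrite -[Q](mulfK zr) -(mulrA Q) [w ^+ r * _]mulrC mulrA -e.
    move: (w ^+ s) (w ^+ r) zs zr => x y x0 y0.
    by field; rewrite x0 b0.
  have : B1 ^+ n %| p * A ^+ n * 'X^r.
    by rewrite e1 BE exprMn -!mulrA mulrCA dvdp_mulr.
  rewrite Gauss_dvdpl; last by rewrite coprimep_expl // mul_X_coprime.
  by rewrite Gauss_dvdpl // coprimep_expl // coprimep_expr.
have : (size B1 <= 1)%N.
  rewrite leqNgt; apply/negP => s1.
  have := dvdp_leq p0 (dv (size p)); apply/negP; rewrite -ltnNge.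
  have := size_exp B1 (size p); move: p0 s1; rewrite -size_poly_gt0.
  case: (size B1) => [//|[//|k]] + _ /=.
  by move: (size p) (size (B1 ^+ _)) => x [|m] /=; clear; nia.
move/size1_polyC => B1E; exists B1`_0 => //.
by rewrite -horner_coef0.
Qed.

(** [lau_pow_den] for [h] and for [1/h] leaves no zeros or poles away from 0 and infinity. *)
Lemma mono_of_bounded (D h : E) : D != 0 -> h != 0 -> (forall n : int, lau (D * h ^ n)) ->
  exists c M, c != 0 /\ h = cst c * z ^ M.
Proof.
move=> D0 h0 hl; have [A [B [B0 cAB hE]]] := frac_coprime h.
have A0 : A != 0 by apply: contraNneq h0 => A0; rewrite hE A0 rmorph0 mul0r.
have [b [B1 [B10 BE]]] := split_X B0; have [a [A1 [A10 AE]]] := split_X A0.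
have [c c0 cE] : exists2 c, c != 0 & B1 = c%:P.
  by apply: (lau_pow_den cAB BE B10 D0) => n; rewrite -hE exprnP.
have [d d0 dE] : exists2 c, c != 0 & A1 = c%:P.
  have cBA : coprimep B A by rewrite coprimep_sym.
  apply: (lau_pow_den cBA AE A10 D0) => n.
  by rewrite -invf_div -hE exprVn exprnN.
exists (d / c), (a%:Z - b%:Z); split; first by rewrite mulf_neq0 ?invr_neq0.
rewrite hE AE BE dE cE !rmorphM !rmorphXn /= -[iota c%:P]/(cst c) -[iota d%:P]/(cst d).
by rewrite fmorphV expfzDr ?z_neq0 // -exprnN mulf_div.
Qed.

(** High powers of the monomial push all exponents above 0; this discards the constant-term parts of
    [Q1] and [Q2] and isolates those with [j1]. *)
Lemma ct_large (c : F) e x : lau x ->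
  exists N, forall n : nat, (N <= n)%N -> ct (x * (cst c * z ^ e.+1%:Z) ^+ n) = 0.
Proof.
move: x; apply: lau_ind => [|a k x hx [N IH]]; first by exists 0%N => n _; rewrite mul0r /Laurent.ct lf0.
have lt n : lau (z ^ k * (cst c * z ^ e.+1%:Z) ^+ n).
  by apply: lauM; [apply: lau_zn|rewrite exprnP; apply: lau_mono].
exists (maxn N `|k|.+1) => n; rewrite geq_max => /andP[nN kn].
rewrite mulrDl -mulrA /Laurent.ct lfD; last first.
- by apply: lauM => //; rewrite exprnP; apply: lau_mono.
- by apply: lauM => //; apply: lau_cst.
rewrite -/(ct (x * _)) IH // addr0 lfZ // exprnP mono_exp mulrCA -expfzDr ?z_neq0 //.
rewrite lfZ ?lf_zn; last exact: lau_zn.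
suff -> : (k + e.+1%:Z * n%:Z == 0) = false by rewrite !mulr0.
apply/negP => /eqP; move: kn; clear; nia.
Qed.

Lemma ct1 : ct 1 = 1.
Proof. by rewrite -(expr0z z) /Laurent.ct lf_zn. Qed.

Section Transfer.
(** The path is [c_i (theta + u) + v_i] with [theta = log z] and [c_{i0}] the first nonzero slope.
    [Q0], [Q1], [Q2] are the moments weighted by 1, [theta + u] and its square; [j1 n] and [j2 n]
    are the means of [theta z^n] and [theta^2 z^n]. *)
Variables (v v' : nat -> E) (u u' : E) (c : nat -> F) (i0 : nat) (H : nat -> E).
Variables (j1 j2 : int -> F) (tau : F).
Hypotheses (lv : forall i, lau (v i)) (lv' : forall i, lau (v' i)) (lu : lau u) (lu' : lau u').
Hypothesis lH : forall n, lau (H n).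
Hypotheses (ci0 : c i0 != 0) (cle : forall i, (i < i0)%N -> c i = 0).
Hypotheses (tau0 : tau != 0) (j1E : forall n : int, n != 0 -> j1 n * n%:~R = tau).
Hypotheses (H0 : H 0%N = 1) (HS : forall n, del (H n.+1) =
  - \sum_(i < n.+1) (H (n - i)%N *+ (n - i).+1) * (cst (c i) * (1 + del u) + del (v i))).
Hypothesis Q0 : forall a a' b b', alg2 v v' a a' -> alg2 v v' b b' ->
  ct (a * del b) = ct (a' * del b').
Hypothesis Q1 : forall a a' b b', alg2 v v' a a' -> alg2 v v' b b' ->
  lf j1 (a * del b) + ct (u * (a * del b)) = lf j1 (a' * del b') + ct (u' * (a' * del b')).
Hypothesis Q2 : forall a a' b b', alg2 v v' a a' -> alg2 v v' b b' ->
  lf j2 (a * del b) + lf j1 (u * (a * del b)) *+ 2 + ct (u ^+ 2 * (a * del b)) =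
  lf j2 (a' * del b') + lf j1 (u' * (a' * del b')) *+ 2 + ct (u' ^+ 2 * (a' * del b')).

Lemma lau_nat x n : lau x -> lau (x *+ n).
Proof. by move=> h; rewrite -mulr_natl -(rmorph_nat cst); apply: lauM (lau_cst _ _) h. Qed.

(* The [H j] with [j <= i0] are iterated integrals of [v], and the constant term of [del (H i0.+1)], which is zero,
   equals [- c i0] up to residues of these. *)
Lemma some_residue : exists x i, ltow v x /\ ct (x * del (v i)) != 0.
Proof.
apply: Classical_Prop.NNPP => hn.
have hct x i : ltow v x -> ct (x * del (v i)) = 0.
  by move=> hx; apply/eqP/negPn/negP => h; apply: hn; exists x, i.
have tn x n : ltow v x -> ltow v (x *+ n).
  by move=> hx; rewrite -mulr_natl -(rmorph_nat cst); apply: ltM.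
have tH n : (n <= i0)%N -> ltow v (H n).
  elim/ltn_ind: n => -[|n] IH ni; first by rewrite H0 -(rmorph1 cst); apply: ltC.
  have hx i : ltow v (- (H (n - i)%N *+ (n - i).+1)).
    rewrite -mulN1r -(rmorphN1 cst); apply/ltM/tn/IH; first by rewrite ltnS leq_subr.
    by rewrite (leq_trans (leq_subr _ _)) // ltnW.
  apply: (ltI (n := n.+1) hx (lH _)); rewrite HS -sumrN; apply: eq_bigr => i _.
  by rewrite mulNr cle ?rmorph0 ?mul0r ?add0r // (leq_trans (ltn_ord i)).
pose S := \sum_(i < i0) (H (i0 - i)%N *+ (i0 - i).+1) * del (v i).
have lT i : lau ((H (i0 - i)%N *+ (i0 - i).+1) * del (v i)) by apply: lauM (lau_nat _ (lH _)) (lau_del (lv i)).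
have cS : ct S = 0.
  rewrite /S /Laurent.ct lf_sum // big1 // => i _.
  have [->|i0'] := eqVneq (nat_of_ord i) 0%N; last first.
    by apply/hct/tn/tH; rewrite leq_subr.
  by apply/hct/tn/tH; rewrite leq_subr.
have := ct_del (lH i0.+1); rewrite HS big_ord_recr /= subnn mulr1n H0 mul1r.
have -> : \sum_(i < i0) (H (i0 - i)%N *+ (i0 - i).+1) * (cst (c i) * (1 + del u) + del (v i)) = S.
  by apply: eq_bigr => i _; rewrite cle // rmorph0 mul0r add0r.
have l1 : lau (1 + del u) by apply: lauD (lau_del lu); rewrite -(rmorph1 cst); apply: lau_cst.
have l2 : lau (cst (c i0) * (1 + del u)) by apply: lauM => //; apply: lau_cst.
have l3 := lau_del (lv i0).
have lS : lau S by apply: lau_sum.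
rewrite /Laurent.ct lfN ?lfD ?lfZ //; try by do ?apply: lauD.
have cu : ct (1 + del u) = 1.
  have l1' : lau 1 by rewrite -(rmorph1 cst); apply: lau_cst.
  by rewrite /Laurent.ct lfD -?/(ct _) ?ct1 ?ct_del ?addr0 //; apply: lau_del.
rewrite -[lf _ S]/(ct S) cS -[lf _ (1 + _)]/(ct (1 + del u)) cu -[lf _ (del _)]/(ct (del (v i0))).
rewrite ct_del // addr0 add0r mulr1 => /eqP.
by rewrite oppr_eq0 (negPf ci0).
Qed.

(** A nonzero [x] paired with 0 would be a multiplier that kills all residues by [tow_residue],
    against [some_residue]. *)
Lemma pair_zero x : alg2 v v' x 0 -> x = 0.
Proof.
move=> hx; apply/eqP/negPn/negP => x0.
have [y [i [hy /eqP]]] := some_residue; case.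
apply: (tow_residue ch0 lv (alg2_left hx) x0) hy => a b ha hb.
have [a' ha'] := alg2_lift v' ha; have [b' hb'] := alg2_lift v' hb.
by rewrite (Q0 (alg2M hx ha') hb') !mul0r /Laurent.ct lf0.
Qed.

(** The partner [h'] of [h] is at first only a rational function; but all [D' h'^n] are polynomials
    in [v'], hence Laurent, so [h'] is a monomial. The square of the numerator of [D] provides
    [q]. *)
Lemma kummer_transfer : exists (e : nat) (cc : F) (M : int) D D' (q : {poly F}), let h := z ^+ e.+1 in
  let h' := cst cc * z ^ M in
  [/\ cc != 0, q != 0, forall n : int, alg2 v v' (D * h ^ n) (D' * h' ^ n),
    forall i, exists V j, v i = evt h V / h ^+ j /\ v' i = evt h' V / h' ^+ j &
    exists j, D ^+ 2 = evt h q / h ^+ j /\ D' ^+ 2 = evt h' q / h' ^+ j].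
Proof.
have [x [i [hx cx]]] := some_residue.
have [[m m0 hv]|[t [s [ts tt]]]] := two_sided_or v' lv.
  by move: cx; rewrite (half_residue ch0 i m0 hv hx) eqxx.
have dt := two_sided_der ch0 tt.
have sz : forall a b, alg2 v' v a b -> a = 0 -> b = 0.
  by move=> a b hab a0; move/alg2_sym: hab; rewrite a0; apply: pair_zero.
have [ds iffB'] := alg2_iff ch0 sz (alg2_sym ts) dt.
have iffB a b : alg2 v v' a b -> (a = 0 <-> b = 0).
  by move=> /alg2_sym /iffB' [h1 h2].
have [y hy] := ltow_frac2 ch0 iffB ts dt ds hx.
have hk := frac2M hy (frac2_der ch0 iffB ts dt ds (frac2_alg (alg2V v v' i))).
have xE : x * (der (v i) / der t) * del t = x * del (v i).
  by rewrite /Laurent.del; move: (der t) (der (v i)) dt => w w' w0; field.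
have lx : lau (x * del (v i)) by apply: lauM; [apply: ltow_lau hx|apply: lau_del].
have [] := kummer_pair ch0 lv iffB ts tt hk; rewrite ?xE //.
move=> e [h' [D [D' [hh hD D0 hDn hV]]]].
have h0 : z ^+ e.+1 != 0 by rewrite expf_neq0 ?z_neq0.
have h'0 := frac2_neq0 iffB hh h0.
have D'0 := alg2_neq0 iffB hD D0.
have lD' n : lau (D' * h' ^ n) := alg2_lau lv' (alg2_sym (hDn n)).
have [cc [M [cc0 h'E]]] := mono_of_bounded D'0 h'0 lD'.
have part a b V j : alg2 v v' a b -> a = evt (z ^+ e.+1) V / (z ^+ e.+1) ^+ j -> b = evt h' V / h' ^+ j.
  move=> hab aE; apply: (frac2_fun iffB (frac2_alg hab)); rewrite aE.
  by apply: (frac2f iffB); [apply: frac2_evt|apply: frac2X].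
have [V [j VE]] := hV _ _ hD.
exists e, cc, M, D, D', (V * V); rewrite -h'E; split=> //.
- apply: contraNneq D0 => /eqP; rewrite mulf_eq0 orbb => /eqP V0.
  by rewrite VE V0 rmorph0 mul0r.
- move=> k; have [W [l WE]] := hV _ _ (alg2V v v' k); exists W, l; split=> //.
  exact: (part _ _ _ _ (alg2V v v' k) WE).
exists (j + j)%N; rewrite !expr2 !rmorphM !exprD /= -!mulf_div -VE; split=> //.
by rewrite -(part _ _ _ _ hD VE).
Qed.

(* The weights 1, [theta + u] and [(theta + u)^2] successively determine the exponent of the monomial [h'],
   its coefficient, and [u]. *)
Theorem trig_transfer_linear : u = u' /\ forall i, v i = v' i.
Proof.
have [e [cc [M [D [D' [q [cc0 q0 hDn hV [j [DE D'E]]]]]]]]] := kummer_transfer.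
set h := z ^+ e.+1 in hDn hV DE; set h' := cst cc * z ^ M in hDn hV D'E.
have h0 : h != 0 by rewrite expf_neq0 ?z_neq0.
have h'0 : h' != 0 by rewrite mulf_neq0 ?fmorph_eq0 ?expfz_neq0 ?z_neq0.
have hE : h = cst 1 * z ^ e.+1%:Z by rewrite rmorph1 mul1r.
have dh : del h = cst e.+1%:R * h by rewrite /h exprnP del_zn rmorph_nat mulr_natl.
have dh' : del h' = cst M%:~R * h' by rewrite /h' delZ del_zn mulrCA rmorph_int mulrzl.
have lh n : lau (h ^ n) by rewrite hE; apply: lau_mono.
have lh' n : lau (h' ^ n) by apply: lau_mono.
have lq : lau (evt h q) by apply: lau_evt; have := lh 1.
have lq' : lau (evt h' q) by apply: lau_evt; have := lh' 1.
have lX n : lau (evt h q * h ^ n) by apply: lauM.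
have lX' n : lau (evt h' q * h' ^ n) by apply: lauM.
have key (L L' : E -> F) :
    (forall a x y, lau x -> lau y -> L (cst a * x - y) = a * L x - L y) ->
    (forall a x y, lau x -> lau y -> L' (cst a * x - y) = a * L' x - L' y) ->
    (forall a a' b b', alg2 v v' a a' -> alg2 v v' b b' -> L (a * del b) = L' (a' * del b')) ->
    forall n, e.+1%:R * L (evt h q * h ^ n) = M%:~R * L' (evt h' q * h' ^ n).
  move=> Ll Ll' HL n.
  have f1 := HL _ _ _ _ (hDn (n + j%:Z - 1)) (hDn 1).
  have f2 := HL _ _ _ _ (hDn (n + j%:Z)) (hDn 0).
  have aux (d w k : E) (a : F) : w != 0 -> del w = cst a * w -> d ^+ 2 = k / w ^+ j ->
     cst a * (k * w ^ n) = cst 1 * (d * w ^ (n + j%:Z - 1) * del (d * w ^ 1)) - d * w ^ (n + j%:Z) * del (d * w ^ 0).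
    move=> w0 dw dE; have kE : k = d ^+ 2 * w ^+ j by rewrite dE divfK // expf_neq0.
    have wE : w ^ (n + j%:Z) = w ^ (n + j%:Z - 1) * w by rewrite -{3}[w]expr1z -expfzDr // subrK.
    have jE : w ^+ j * w ^ n = w ^ (n + j%:Z - 1) * w by rewrite -wE exprnP -expfzDr // addrC.
    rewrite rmorph1 mul1r expr0z mulr1 expr1z delM dw kE -(mulrA (d ^+ 2)) jE wE.
    by move: (del d) (w ^ (n + j%:Z - 1)) => d1 w1; ring.
  have e1 := aux _ _ _ _ h0 dh DE; have e2 := aux _ _ _ _ h'0 dh' D'E.
  have lD k l : lau (D * h ^ k * del (D * h ^ l)) := lauM (alg2_lau lv (hDn k)) (lau_del (alg2_lau lv (hDn l))).
  have lD' k l : lau (D' * h' ^ k * del (D' * h' ^ l)) :=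
    lauM (alg2_lau lv' (alg2_sym (hDn k))) (lau_del (alg2_lau lv' (alg2_sym (hDn l)))).
  have g1 : L (cst e.+1%:R * (evt h q * h ^ n) - 0) = L' (cst M%:~R * (evt h' q * h' ^ n) - 0).
    by rewrite !subr0 e1 e2 Ll ?Ll' ?f1 ?f2.
  have L0 : L 0 = 0 by have := Ll 1 0 0 (lau0 _) (lau0 _); rewrite mulr0 subrr mul1r subrr.
  have L0' : L' 0 = 0 by have := Ll' 1 0 0 (lau0 _) (lau0 _); rewrite mulr0 subrr mul1r subrr.
  by move: g1; rewrite Ll ?Ll' ?L0 ?L0' ?subr0 //; apply: lau0.
have lin (w : E) (J : int -> F) (a : F) (x y : E) : lau w -> lau x -> lau y ->
    lf J (w * (cst a * x - y)) = a * lf J (w * x) - lf J (w * y).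
  move=> hw hx hy; have hwx := lauM hw hx; have hwy := lauM hw hy.
  rewrite mulrBr mulrCA lfD ?lfN ?lfZ //; [exact: lauM (lau_cst _ _) _|exact: lauN].
have k0 := key ct ct _ _ Q0.
have lin1 (J : int -> F) (a : F) (x y : E) : lau x -> lau y ->
    lf J (cst a * x - y) = a * lf J x - lf J y.
  have l1 : lau 1 by rewrite -(rmorph1 cst); apply: lau_cst.
  by move=> hx hy; have := lin 1 J a x y l1 hx hy; rewrite !mul1r.
have [i qi] : exists i, q`_i != 0.
  exists (size q).-1; rewrite -/(lead_coef q) lead_coef_eq0 //.
(* Weight 1: the exponent [-i] picks the nonzero coefficient [q_i] on both sides, so
   [(e+1) q_i = M q_i]; [M = 0] would make the right side vanish. *)
have {k0} ME : M = e.+1%:Z.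
  have := k0 (lin1 _) (lin1 _) (- i%:Z); rewrite hE ct_pick ?oner_neq0 //.
  have [->|M0] := eqVneq M 0.
    by rewrite mul0r => /eqP; rewrite mulf_eq0 (negPf qi) (negPf (ch0 e)).
  rewrite ct_pick // => /(mulIf qi) h1.
  apply/eqP; rewrite -subr_eq0; apply/negPn/negP => /(intr_neq0 ch0)/eqP; apply.
  by rewrite rmorphB /= -h1 -pmulrn subrr.
have e0 : e.+1%:R != 0 :> F := ch0 e.
pose w := u - u'.
(* Weight [theta + u]: for large [n] only the [j1] parts remain, and [j1(m) = tau / m] turns them
   into sums of [q_k / (n + k)], the right one with factors [cc^(n+k)]. *)
have cc1 : cc = 1.
  have k1 := key (fun x => lf j1 x + ct (u * x)) (fun x => lf j1 x + ct (u' * x)).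
  have {}k1 n : lf j1 (evt h q * h ^ n) + ct (u * (evt h q * h ^ n)) =
     lf j1 (evt h' q * h' ^ n) + ct (u' * (evt h' q * h' ^ n)).
    have f0 (x : E) : lau x -> forall a x1 y1, lau x1 -> lau y1 ->
        lf j1 (cst a * x1 - y1) + ct (x * (cst a * x1 - y1)) =
        a * (lf j1 x1 + ct (x * x1)) - (lf j1 y1 + ct (x * y1)).
      by move=> hx a x1 y1 hx1 hy1; rewrite /Laurent.ct lin // lin1 //; ring.
    by have := k1 (f0 u lu) (f0 u' lu') Q1 n; rewrite ME -pmulrn => /(mulfI e0).
  have [N1 c1] := @ct_large 1 e _ (lauM lu lq).
  have [N2 c2] := @ct_large cc e _ (lauM lu' lq').
  have h'E : h' = cst cc * z ^ e.+1%:Z by rewrite /h' ME.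
  rewrite -hE in c1; rewrite -h'E in c2.
  (* The 1 keeps the denominators [n + k] nonzero. *)
  pose N := maxn 1 (maxn N1 N2).
  have k2 (n : nat) : (N <= n)%N -> lf j1 (evt h q * h ^ n) = lf j1 (evt h' q * h' ^ n).
    rewrite /N !geq_max => /andP[_ /andP[n1 n2]]; have := k1 n; rewrite !mulrA -!exprnP.
    by rewrite c1 // c2 // !addr0.
  have nz n (k : nat) : (N <= n)%N -> (k < size q)%N -> n%:R + k%:R != 0 :> F.
    by rewrite geq_max => /andP[n0 _] _; rewrite -natrD -(prednK n0) addSn ch0.
  have j1n (n k : nat) : (N <= n)%N -> j1 (e.+1%:Z * (k%:Z + n%:Z)) = tau / e.+1%:R * (n%:R + k%:R)^-1.
    rewrite geq_max => /andP[n0 _].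
    have nk : n%:R + k%:R != 0 :> F by rewrite -natrD -(prednK n0) addSn ch0.
    have := j1E (n := e.+1%:Z * (k%:Z + n%:Z)) _; rewrite mulf_eq0 -PoszD !eqz_nat addn_eq0.
    rewrite [n == 0%N]eqn0Ngt n0 andbF /= => /(_ isT) <-.
    rewrite -PoszM -pmulrn natrM natrD [k%:R + _]addrC; move: (n%:R + _) nk => y y0.
    by move: (e.+1%:R : F) (e0) => g g0; field; rewrite y0 g0.
  apply: (@pfrac_exp _ ch0 (size q) (fun k => k%:R) _ (fun k => q`_k) (fun k => q`_k * cc ^+ k) cc N i) => //.
  - by move=> a b _ _ /(natr_inj0 ch0).
  - move=> n nN; apply: (mulfI (_ : tau / e.+1%:R != 0)); first by rewrite mulf_neq0 ?invr_neq0.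
    have := k2 n nN; rewrite [in X in X = _]hE !lf_evt ?oner_neq0 // ME => e1.
    transitivity (\sum_(k < size q) q`_k * (1 ^ (k%:Z + n%:Z) * j1 (e.+1%:Z * (k%:Z + n%:Z)))).
      by rewrite mulr_sumr; apply: eq_bigr => k _; rewrite exp1rz mul1r j1n // mulrCA.
    rewrite e1 !mulr_sumr; apply: eq_bigr => k _; rewrite j1n // expfzDr // -!exprnP.
    by ring.
  - by rewrite ltnNge; apply: contra qi => h1; rewrite nth_default.
have hh : h' = h by rewrite /h' ME cc1 rmorph1 mul1r.
have DD : D' ^+ 2 = D ^+ 2 by rewrite D'E DE hh.
split; last by move=> k; have [V [l [-> ->]]] := hV k; rewrite hh.
(* Weight [(theta + u)^2]: now [h' = h], so the [j2] parts cancel and the difference is linear in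
   [w = u - u'] up to a constant term that vanishes for large [n]. *)
have k2 (n : int) : lf j1 (w * (evt h q * h ^ n)) *+ 2 + ct ((u ^+ 2 - u' ^+ 2) * (evt h q * h ^ n)) = 0.
  have f0 (x : E) : lau x -> forall a x1 y1, lau x1 -> lau y1 ->
      lf j2 (cst a * x1 - y1) + lf j1 (x * (cst a * x1 - y1)) *+ 2 + ct (x ^+ 2 * (cst a * x1 - y1)) =
      a * (lf j2 x1 + lf j1 (x * x1) *+ 2 + ct (x ^+ 2 * x1)) - (lf j2 y1 + lf j1 (x * y1) *+ 2 + ct (x ^+ 2 * y1)).
    by move=> hx a x1 y1 hx1 hy1; rewrite /Laurent.ct !lin ?lin1 //; [ring|apply: lauX].
  have := key _ _ (f0 u lu) (f0 u' lu') Q2 n; rewrite ME -pmulrn hh => /(mulfI e0) e1.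
  have l1 := lauM lu (lX n); have l2 := lauM lu' (lX n).
  have l3 := lauM (lauX 2 lu) (lX n); have l4 := lauM (lauX 2 lu') (lX n).
  rewrite /Laurent.ct !mulrBl !lfD ?lfN //; try exact: lauN.
  move: e1; rewrite -!/(ct _); move: (lf j2 _) (lf j1 _) (lf j1 _) (ct _) (ct _) => x1 x2 x3 x4 x5 e1.
  have -> : (x3 - x2) *+ 2 + (x5 - x4) = (x1 + x3 *+ 2 + x5) - (x1 + x2 *+ 2 + x4) by ring.
  by rewrite e1 subrr.
have lw : lau w by apply: lauD => //; apply: lauN.
have luu : lau (u ^+ 2 - u' ^+ 2) by apply: lauD; [|apply: lauN]; apply: lauX.
have two : 2%:R != 0 :> F := ch0 1.
have [N1 c1] := @ct_large 1 e _ (lauM luu lq).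
rewrite -hE in c1.
have k3 (n : nat) : (N1 <= n)%N -> lf j1 (w * evt h q * h ^+ n) = 0.
  move=> nN; have := k2 n; rewrite !mulrA -exprnP c1 // addr0 -mulr_natl => /eqP.
  by rewrite mulf_eq0 (negPf two) => /eqP.
have [p [s pE]] := lauM lw lq.
have e0' : e.+1%:R != 0 :> E by rewrite natE.
(* The coefficients of [w q(h) = p / z^s] are the residues of a partial fraction vanishing at all
   large integers; [b k] is the shift of the exponent [k - s] in units of [e + 1]. *)
have p0 : p = 0.
  apply/polyP => k; rewrite coef0; have [sk|ks] := leqP (size p) k; first by rewrite nth_default.
  pose b (k : nat) : F := (k%:R - s%:R) / e.+1%:R.
  pose N := maxn N1 s.+1.
  have nb (n l : nat) : n%:R + b l = (e.+1%:Z * n%:Z + (l%:Z - s%:Z))%:~R / e.+1%:R.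
    rewrite /b rmorphD rmorphM rmorphB /= -!pmulrn.
    by move: (e.+1%:R : F) (e0) => g g0; field.
  have nz (n l : nat) : (N <= n)%N -> e.+1%:Z * n%:Z + (l%:Z - s%:Z) != 0.
    rewrite geq_max => /andP[_ sn]; apply/negP => /eqP; move: sn; clear; nia.
  apply: (@pfrac_eq0 _ ch0 (size p) b _ (fun k => p`_k) N k _ _ ks).
  - move=> x y _ _ /(mulIf (invr_neq0 e0))/addIr; exact: (natr_inj0 ch0).
  - move=> n l nN _; rewrite nb mulf_neq0 ?invr_neq0 //; exact/(intr_neq0 ch0)/nz.
  - move=> n nN; have nN1 : (N1 <= n)%N by move: nN; rewrite geq_max => /andP[].
    apply: (mulfI (_ : tau / e.+1%:R != 0)); first by rewrite mulf_neq0 ?invr_neq0.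
    rewrite mulr0 -[RHS](k3 n nN1) pE /h -exprM [z ^+ (_ * _)]exprnP lf_shift; last by eexists; eexists.
    rewrite lfE /pf mulr_sumr; apply: eq_bigr => l _.
    have := j1E (nz n l nN); rewrite PoszM [l%:Z - _ + _]addrC => <-.
    rewrite nb; have := intr_neq0 ch0 (nz n l nN); move: (_%:~R) => y y0.
    by move: (e.+1%:R : F) (e0) => g g0; field; rewrite y0 g0.
apply/eqP; rewrite -subr_eq0; apply/eqP.
have qq : evt h q != 0.
  apply: contraNneq qi => q1; rewrite -(@ct_pick _ E 1 e.+1%:Z q i) ?oner_neq0 // -hE q1 mul0r.
  by rewrite /Laurent.ct lf0.
by apply: (mulIf qq); rewrite pE p0 rmorph0 !mul0r.
Qed.
End Transfer.
End Linear.
End LinearGrowth.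

(** * Transfer of closed first integrals between polynomial paths *)

Module PolyTransfer.
Import all_boot all_algebra.
Import FracDer FunPair PolyPath Kummer Laurent LaurentPath.
Set Implicit Arguments. Unset Strict Implicit. Unset Printing Implicit Defensive.
Import GRing.Theory.
Local Open Scope ring_scope.

Section Transfer.
Variables (F : fieldType) (E : ratfun F).
Hypothesis ch0 : forall n, n.+1%:R != 0 :> F.
Notation der := (@rD F E).
Notation iota := (rI E).
Notation cst := (@cst F E).
Notation z := (rI E 'X).
Notation del := (@del F E).

Definition hseqP (v H : nat -> {poly F}) := H 0%N = 1 /\
  forall n, (H n.+1)^`() = - \sum_(i < n.+1) (H (n - i)%N *+ (n - i).+1) * (v i)^`().

Lemma del_iota p : del (iota p) = z * iota p^`().
Proof. by rewrite /Laurent.del der_iota. Qed.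

Lemma hseqP_hseq v H : hseqP v H <-> hseq (fun i => iota (v i)) (fun i => iota (H i)).
Proof.
have eq n : del (iota (H n.+1)) = - \sum_(i < n.+1) (iota (H (n - i)%N) *+ (n - i).+1) * del (iota (v i)) <->
    (H n.+1)^`() = - \sum_(i < n.+1) (H (n - i)%N *+ (n - i).+1) * (v i)^`().
  rewrite del_iota.
  have -> : - \sum_(i < n.+1) (iota (H (n - i)%N) *+ (n - i).+1) * del (iota (v i)) =
     z * iota (- \sum_(i < n.+1) (H (n - i)%N *+ (n - i).+1) * (v i)^`()).
    rewrite rmorphN rmorph_sum mulrN mulr_sumr; congr (- _); apply: eq_bigr => i _ /=.
    by rewrite del_iota mulrCA rmorphM rmorphMn.
  split=> [/(mulfI (z_neq0 E))|->] // e.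
  by apply/eqP; rewrite -subr_eq0 -(iota_eq0E E) rmorphB e subrr.
split=> -[h0 hS]; split.
- by rewrite h0 rmorph1.
- by move=> n; apply/eq.
- by apply/eqP; rewrite -subr_eq0 -(iota_eq0E E) rmorphB h0 rmorph1 subrr.
- by move=> n; apply/eq.
Qed.

(** The right side of the recursion is integrated term by term, since [towI] takes one product at a
    time. *)
Lemma hseqP_tow v : exists2 G, hseqP v G & forall n, tow v (G n).
Proof.
pose R (G : nat -> {poly F}) n y := if n is m.+1 then
  y^`() = - \sum_(i < m.+1) (G (m - i)%N *+ (m - i).+1) * (v i)^`() else y = 1.
have [||G hG] := @seq_choice {poly F} 0 (tow v) R.
- move=> [|n] G G' y e //= ->; congr (- _); apply: eq_bigr => i _.
  by rewrite e // ltnS leq_subr.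
- move=> [|n] G hG; first by exists 1; split=> //; apply: (towC v 1).
  suff h m : (m <= n.+1)%N -> exists y, tow v y /\
      y^`() = - \sum_(i < m) (G (n - i)%N *+ (n - i).+1) * (v i)^`() by apply: h.
  elim: m => [|m IH] mn.
    by exists 0; split; [have := towC v 0|rewrite big_ord0 deriv0 oppr0].
  have [y [ty ey]] := IH (ltnW mn).
  have [u eu] := poly_prim ch0 (- (G (n - m)%N *+ (n - m).+1) * (v m)^`()).
  exists (y + u); split; last by rewrite derivD ey eu big_ord_recr /= opprD mulNr.
  apply: towD => //; apply: towI eu; rewrite -mulr_natl -mulNr -(rmorph_nat (polyC)) -rmorphN.
  by apply: towM; apply: hG; rewrite ltnS leq_subr.
exists G => [|n]; last by case: (hG n).
by split=> [|n]; [case: (hG 0%N)|case: (hG n.+1)].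
Qed.

(** If some [x = 0] has a partner [y != 0], all integrals of [y a db] vanish and [tow_closed] with
    multiplier [y] closes every iterated integral of [q]. Otherwise the partners of the [H n] have
    polynomial derivatives, so they are polynomials, and [closed_transfer] compares their end
    values. *)
Theorem poly_transfer a0 a1 p q H :
  (forall a a' b b', alg2 (fun i => iota (p i)) (fun i => iota (q i)) a a' ->
     alg2 (fun i => iota (p i)) (fun i => iota (q i)) b b' -> bal a0 a1 (a * der b) (a' * der b')) ->
  hseqP p H -> (forall n, (H n).[a1] = (H n).[a0]) ->
  exists2 G, hseqP q G & forall n, (G n).[a1] = (G n).[a0].
Proof.
set f := fun i => iota (p i); set g := fun i => iota (q i).
move=> HB hH cH.
have [h0|] := Classical_Prop.classic (forall x y, alg2 f g x y -> x = 0 -> y = 0); last first.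
  move=> /Classical_Pred_Type.not_all_ex_not [x] /Classical_Pred_Type.not_all_ex_not [y h].
  have [hxy [x0 y0]] : alg2 f g x y /\ x = 0 /\ y <> 0.
    have [hxy h1] := Classical_Prop.imply_to_and _ _ h; split=> //.
    exact: Classical_Prop.imply_to_and h1.
  have hy : alg2 g g y y := alg2_left (alg2_sym hxy).
  have [G hG tG] := hseqP_tow q; exists G => // n.
  have y0' : y != 0 by apply/eqP.
  apply: (tow_closed ch0 y0' hy _ (tG n)) => a b ha' hb'.
  have [a1' /alg2_sym ha] := alg2_lift f ha'; have [b1' /alg2_sym hb] := alg2_lift f hb'.
  have [u [w [e1 e2 e3]]] := HB _ _ _ _ (alg2M hxy ha) hb.
  exists w => //; move: e1; rewrite x0 !mul0r der_iota => /esym/(@rI_eq0 _ E)/(deriv_eq0 ch0) [c uE].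
  by move: e3; rewrite uE !hornerC subrr => /esym/eqP; rewrite subr_eq0 => /eqP.
have [[i0 ds]|hc] := Classical_Prop.classic (exists i, (q i)^`() != 0); last first.
  exists (fun n => (n == 0%N)%:R) => [|n]; last by case: n => [|n]; rewrite ?horner0 // -[1%:R]/(1%:P) !hornerC.
  split=> // n; rewrite deriv0 big1 ?oppr0 // => i _.
  suff -> : (q i)^`() = 0 by rewrite mulr0.
  by apply/eqP/negPn/negP => h; apply: hc; exists i.
have ds' : der (g i0) != 0 by rewrite der_iota iota_neq0.
have [dt iffB] := alg2_iff ch0 h0 (alg2V f g i0) ds'.
have [G' [G0 GS] fG] := hseq_partner ch0 iffB (alg2V f g i0) dt ds' ((hseqP_hseq p H).1 hH).
have ex n : exists P, G' n = iota P.
  elim/ltn_ind: n => -[|n] IH; first by exists 1; rewrite G0 rmorph1.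
  suff [w hw] : exists w, del (G' n.+1) = z * iota w.
    by move: hw => /(mulfI (z_neq0 E)) /(poly_of_der ch0).
  rewrite GS; suff h m : (m <= n.+1)%N -> exists w, - \sum_(i < m) (G' (n - i)%N *+ (n - i).+1) * del (g i) = z * iota w.
    exact: h.
  elim: m => [|m IHm] mn; first by exists 0; rewrite big_ord0 oppr0 rmorph0 mulr0.
  have [w hw] := IHm (ltnW mn); have [|P hP] := IH (n - m)%N; first by rewrite ltnS leq_subr.
  exists (w - (P *+ (n - m).+1) * (q m)^`()); rewrite big_ord_recr /= opprD hw hP /g del_iota.
  by rewrite rmorphB mulrBr rmorphM rmorphMn mulrCA.
pose G n := ClassicalEpsilon.epsilon (inhabits 0) (fun P => G' n = iota P).
have GE n : G' n = iota (G n) by exact: (ClassicalEpsilon.epsilon_spec _ _ (ex n)).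
exists G => [|n].
  apply/hseqP_hseq; split; first by rewrite -GE.
  by move=> n; rewrite -GE GS; congr (- _); apply: eq_bigr => i _; rewrite GE.
apply: (closed_transfer ch0 iffB HB ds _ (cH n)).
by rewrite -GE; apply: fG.
Qed.

Theorem poly_universal a0 a1 q :
  (forall a b, alg2 (fun i => iota (q i)) (fun i => iota (q i)) a a ->
     alg2 (fun i => iota (q i)) (fun i => iota (q i)) b b -> bal1 a0 a1 0 (a * der b)) ->
  forall X, tow q X -> X.[a1] = X.[a0].
Proof.
move=> HB; apply: (tow_closed ch0 (oner_neq0 E)); first exact: alg2_1.
by move=> a b ha hb; rewrite mul1r; apply: HB.
Qed.
End Transfer.
End PolyTransfer.

(** * First integrals and centers *)

Module CxAnalysis.

(** The complex numbers as a real normed module, the structure over which [is_solution]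
    differentiates. *)
Notation CV := (prod_NormedModule R_AbsRing R_NormedModule R_NormedModule).
Notation cder := (@is_derive R_AbsRing CV).
Ltac cring := match goal with |- @eq _ ?a ?b => change (@eq CC a b) end; ring.
Definition ccont (f : R -> CC) (x : R) : Prop := continuous (f : R -> CV) x.
Notation cint := (RInt (V := C_R_CompleteNormedModule)).

Lemma cder_fst (f : R -> CC) (x : R) (l : CC) : cder f x l -> is_derive (fun t => fst (f t)) x (fst l).
Proof.
intros H.
apply (filterdiff_ext_lin _ (fun y : R => fst (scal (V := CV) y l))).
- apply (filterdiff_comp (K := R_AbsRing) (U := R_NormedModule) (V := CV) (W := R_NormedModule)
    f fst (fun y => scal y l) fst).
  + exact H.
  + apply filterdiff_linear. apply is_linear_fst.
- intros y. reflexivity.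
Qed.

Lemma cder_snd (f : R -> CC) (x : R) (l : CC) : cder f x l -> is_derive (fun t => snd (f t)) x (snd l).
Proof.
intros H.
apply (filterdiff_ext_lin _ (fun y : R => snd (scal (V := CV) y l))).
- apply (filterdiff_comp (K := R_AbsRing) (U := R_NormedModule) (V := CV) (W := R_NormedModule)
    f snd (fun y => scal y l) snd).
  + exact H.
  + apply filterdiff_linear. apply is_linear_snd.
- intros y. reflexivity.
Qed.

Lemma CV_split (c : CC) : c = plus (scal (V := CV) (fst c) ((1, 0) : CC)) (scal (V := CV) (snd c) ((0, 1) : CC)).
Proof.
destruct c as [u w]. unfold plus, scal; simpl.
unfold prod_plus, prod_scal, plus, scal; simpl. unfold mult; simpl. f_equal; ring.
Qed.

Lemma cder_pair (f : R -> CC) (x : R) (l : CC) :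
  is_derive (fun t => fst (f t)) x (fst l) -> is_derive (fun t => snd (f t)) x (snd l) -> cder f x l.
Proof.
intros H1 H2.
apply (is_derive_ext (fun t => plus (scal (V := CV) (fst (f t)) ((1, 0) : CC)) (scal (V := CV) (snd (f t)) ((0, 1) : CC)))).
- intros t. symmetry. apply CV_split.
- rewrite (CV_split l).
  apply (is_derive_plus (V := CV)); apply (is_derive_scal_l (V := CV)); assumption.
Qed.

Lemma cder_ext (f g : R -> CC) x l m : (forall t, f t = g t) -> l = m -> cder f x l -> cder g x m.
Proof. intros H -> H1. exact (is_derive_ext f g x m H H1). Qed.

Lemma cder_plus (f g : R -> CC) x l m : cder f x l -> cder g x m ->
  cder (fun t => Cplus (f t) (g t)) x (Cplus l m).
Proof. intros H1 H2. exact (is_derive_plus (V := CV) f g x l m H1 H2). Qed.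

Lemma cder_const c x : cder (fun _ => c) x (RtoC 0).
Proof. exact (is_derive_const (V := CV) c x). Qed.

Lemma cder_mult (f g : R -> CC) x l m : cder f x l -> cder g x m ->
  cder (fun t => Cmult (f t) (g t)) x (Cplus (Cmult l (g x)) (Cmult (f x) m)).
Proof.
intros H1 H2.
pose proof (cder_fst _ _ _ H1) as A. pose proof (cder_snd _ _ _ H1) as B.
pose proof (cder_fst _ _ _ H2) as A'. pose proof (cder_snd _ _ _ H2) as B'.
apply cder_pair; simpl.
- refine (eq_rect _ (fun z : R => is_derive _ x z) (is_derive_minus (V := R_NormedModule) _ _ _ _ _
    (Derive.is_derive_mult _ _ _ _ _ A A') (Derive.is_derive_mult _ _ _ _ _ B B')) _ _).
  unfold minus, plus, opp; simpl; ring.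
- refine (eq_rect _ (fun z : R => is_derive _ x z) (is_derive_plus (V := R_NormedModule) _ _ _ _ _
    (Derive.is_derive_mult _ _ _ _ _ A B') (Derive.is_derive_mult _ _ _ _ _ B A')) _ _).
  unfold plus; simpl; ring.
Qed.

Lemma cder_scal c (f : R -> CC) x l : cder f x l -> cder (fun t => Cmult c (f t)) x (Cmult c l).
Proof.
intros H. refine (cder_ext _ _ _ _ _ _ _ (cder_mult _ _ _ _ _ (cder_const c x) H)).
- reflexivity.
- cring.
Qed.

Lemma cder_opp (f : R -> CC) x l : cder f x l -> cder (fun t => Copp (f t)) x (Copp l).
Proof. intros H. exact (is_derive_opp (V := CV) f x l H). Qed.

Lemma ccont_eps (f : R -> CC) x : ccont f x <->
  forall e, 0 < e -> exists d, 0 < d /\ forall y, Rabs (y - x) < d -> Cmod (Cminus (f y) (f x)) < e.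
Proof.
split.
- intros H e He.
  destruct (proj1 (filterlim_locally_ball_norm (K := R_AbsRing) (U := CV) f (f x)) H (mkposreal e He)) as [d Hd].
  exists d. split; [apply cond_pos|]. intros y Hy. specialize (Hd y Hy).
  rewrite Cmod_norm. exact Hd.
- intros H. apply (proj2 (filterlim_locally_ball_norm (K := R_AbsRing) (U := CV) f (f x))).
  intros [e He]. destruct (H e He) as [d [Hd H1]]. exists (mkposreal d Hd). intros y Hy.
  specialize (H1 y Hy). rewrite Cmod_norm in H1. exact H1.
Qed.

Lemma ccont_cder (f : R -> CC) x l : cder f x l -> ccont f x.
Proof. intros H. apply (ex_derive_continuous (V := CV)). exists l. exact H. Qed.

Lemma ccont_const c x : ccont (fun _ => c) x.
Proof. apply continuous_const. Qed.

Lemma ccont_plus (f g : R -> CC) x : ccont f x -> ccont g x -> ccont (fun t => Cplus (f t) (g t)) x.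
Proof. intros H1 H2. exact (continuous_plus (V := CV) f g x H1 H2). Qed.

Lemma ccont_fst (f : R -> CC) x : ccont f x -> continuous (fun t => fst (f t)) x.
Proof. intros H. apply (continuous_comp f fst x H). apply continuous_fst. Qed.

Lemma ccont_snd (f : R -> CC) x : ccont f x -> continuous (fun t => snd (f t)) x.
Proof. intros H. apply (continuous_comp f snd x H). apply continuous_snd. Qed.

Lemma ccont_pair (f : R -> CC) x : continuous (fun t => fst (f t)) x -> continuous (fun t => snd (f t)) x ->
  ccont f x.
Proof.
intros H1 H2. apply (continuous_ext (fun t => plus (scal (V := CV) (fst (f t)) ((1, 0) : CC)) (scal (V := CV) (snd (f t)) ((0, 1) : CC)))).
- intros t. symmetry. apply CV_split.
- apply (continuous_plus (V := CV)); apply (continuous_scal_l (V := CV)); assumption.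
Qed.

Lemma ccont_mult (f g : R -> CC) x : ccont f x -> ccont g x -> ccont (fun t => Cmult (f t) (g t)) x.
Proof.
intros H1 H2.
pose proof (ccont_fst _ _ H1). pose proof (ccont_snd _ _ H1).
pose proof (ccont_fst _ _ H2). pose proof (ccont_snd _ _ H2).
apply ccont_pair; simpl.
- apply (continuous_minus (V := R_NormedModule)); apply (continuous_mult (K := R_AbsRing)); assumption.
- apply (continuous_plus (V := R_NormedModule)); apply (continuous_mult (K := R_AbsRing)); assumption.
Qed.

Lemma ccont_comp (f : R -> CC) (g : R -> R) x : continuous g x -> ccont f (g x) -> ccont (fun t => f (g t)) x.
Proof. intros H1 H2. exact (continuous_comp g f x H1 H2). Qed.

Lemma cint_exists (f : R -> CC) a b : (forall x, Rmin a b <= x <= Rmax a b -> ccont f x) ->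
  is_RInt (V := C_R_CompleteNormedModule) f a b (cint f a b).
Proof. intros H. apply RInt_correct. apply (ex_RInt_continuous (V := C_R_CompleteNormedModule)). exact H. Qed.

Lemma cint_cder (f : R -> CC) (a x : R) : (forall t, ccont f t) -> cder (fun t => cint f a t) x (f x).
Proof.
intros H.
apply (is_derive_RInt (V := CV) f (fun t => cint f a t) a x).
- exists (mkposreal 1 Rlt_0_1). intros y _. exact (cint_exists f a y (fun t _ => H t)).
- apply H.
Qed.

Lemma cint_point (f : R -> CC) a : cint f a a = RtoC 0.
Proof. exact (RInt_point (V := C_R_CompleteNormedModule) a f). Qed.

Lemma cint_ext (f g : R -> CC) a b : a <= b -> (forall x, a <= x <= b -> f x = g x) -> cint f a b = cint g a b.
Proof.
intros Hab H. apply (RInt_ext (V := C_R_CompleteNormedModule)). intros x Hx.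
rewrite Rmin_left, Rmax_right in Hx by assumption. apply H. lra.
Qed.

Lemma cint_FTC (F f : R -> CC) a b : a <= b -> (forall x, a <= x <= b -> cder F x (f x)) ->
  (forall x, a <= x <= b -> ccont f x) -> cint f a b = Cminus (F b) (F a).
Proof.
intros Hab H1 H2. apply (is_RInt_unique (V := C_R_CompleteNormedModule)).
apply (is_RInt_derive (V := C_R_CompleteNormedModule) F f a b);
  rewrite Rmin_left, Rmax_right by assumption; assumption.
Qed.

Lemma cint_bound (f : R -> CC) a b K : a <= b -> (forall x, a <= x <= b -> ccont f x) ->
  (forall x, a <= x <= b -> Cmod (f x) <= K) -> Cmod (cint f a b) <= (b - a) * K.
Proof.
intros Hab H1 H2. rewrite Cmod_norm.
apply (norm_RInt_le_const (V := CV) f a b (cint f a b) K Hab).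
- intros x Hx. rewrite <- Cmod_norm. apply H2. exact Hx.
- apply cint_exists. rewrite Rmin_left, Rmax_right by assumption. assumption.
Qed.

Lemma real_mvt (f df : R -> R) a b K : a <= b -> (forall x, a <= x <= b -> is_derive f x (df x)) ->
  (forall x, a <= x <= b -> Rabs (df x) <= K) -> Rabs (f b - f a) <= K * (b - a).
Proof.
intros Hab H1 H2.
destruct (MVT_gen f a b df) as [c [Hc E]].
- rewrite Rmin_left, Rmax_right by assumption. intros x Hx. apply H1. lra.
- rewrite Rmin_left, Rmax_right by assumption. intros x Hx. apply continuity_pt_filterlim.
  apply (ex_derive_continuous (V := R_NormedModule)). exists (df x). apply H1. exact Hx.
- rewrite Rmin_left, Rmax_right in Hc by assumption.
  rewrite E, Rabs_mult, (Rabs_pos_eq (b - a)) by lra.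
  apply Rmult_le_compat_r; [lra|]. apply H2. exact Hc.
Qed.

Lemma Cmod_le_sum (c : CC) : Cmod c <= Rabs (fst c) + Rabs (snd c).
Proof.
unfold Cmod. pose proof (Rabs_pos (fst c)). pose proof (Rabs_pos (snd c)).
rewrite <- (sqrt_Rsqr (Rabs (fst c) + Rabs (snd c))) by lra.
apply sqrt_le_1_alt. unfold Rsqr. rewrite <- (pow2_abs (fst c)), <- (pow2_abs (snd c)). nra.
Qed.

Lemma fst_le_Cmod (c : CC) : Rabs (fst c) <= Cmod c.
Proof. eapply Rle_trans; [apply Rmax_l|apply Rmax_Cmod]. Qed.
Lemma snd_le_Cmod (c : CC) : Rabs (snd c) <= Cmod c.
Proof. eapply Rle_trans; [apply Rmax_r|apply Rmax_Cmod]. Qed.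

(** The mean value theorem is applied to real and imaginary parts separately, whence the factor
    2. *)
Lemma cmvt (f df : R -> CC) a b K : a <= b -> (forall x, a <= x <= b -> cder f x (df x)) ->
  (forall x, a <= x <= b -> Cmod (df x) <= K) -> Cmod (Cminus (f b) (f a)) <= 2 * K * (b - a).
Proof.
intros Hab H1 H2. eapply Rle_trans; [apply Cmod_le_sum|]. simpl.
assert (A : Rabs (fst (f b) - fst (f a)) <= K * (b - a)).
{ apply (real_mvt (fun x => fst (f x)) (fun x => fst (df x))); [assumption| |].
  - intros x Hx. apply cder_fst. apply H1; assumption.
  - intros x Hx. eapply Rle_trans; [apply fst_le_Cmod|]. apply H2; assumption. }
assert (B : Rabs (snd (f b) - snd (f a)) <= K * (b - a)).
{ apply (real_mvt (fun x => snd (f x)) (fun x => snd (df x))); [assumption| |].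
  - intros x Hx. apply cder_snd. apply H1; assumption.
  - intros x Hx. eapply Rle_trans; [apply snd_le_Cmod|]. apply H2; assumption. }
unfold Rminus in *. lra.
Qed.

Lemma cder_zero_const (f : R -> CC) a b : a <= b -> (forall x, a <= x <= b -> cder f x (RtoC 0)) -> f a = f b.
Proof.
intros Hab H. destruct (Req_dec a b) as [->|Hne]; [reflexivity|].
apply (eq_is_derive (V := CV) f a b); [exact H|lra].
Qed.

Lemma cder_uniq_fun (f g d : R -> CC) a b : a <= b -> f a = g a ->
  (forall x, a <= x <= b -> cder f x (d x)) -> (forall x, a <= x <= b -> cder g x (d x)) ->
  forall x, a <= x <= b -> f x = g x.
Proof.
intros Hab E H1 H2 x Hx.
assert (A := cder_zero_const (fun t => Cplus (f t) (Copp (g t))) a x (proj1 Hx)).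
assert (B : Cplus (f a) (Copp (g a)) = Cplus (f x) (Copp (g x))).
{ apply A. intros t Ht. refine (cder_ext _ _ _ _ _ _ _ (cder_plus _ _ _ _ _ (H1 t _) (cder_opp _ _ _ (H2 t _)))); try lra.
  - reflexivity.
  - cring. }
rewrite E in B. replace (f x) with (Cplus (Cplus (f x) (Copp (g x))) (g x)) by ring.
rewrite <- B. ring.
Qed.

End CxAnalysis.

(** * Truncated first integrals along a solution *)

Module FirstIntegral.
Import CxAnalysis.

Fixpoint csum (n : nat) (f : nat -> CC) : CC :=
  match n with O => RtoC 0 | S m => Cplus (csum m f) (f m) end.

Lemma csum_S n f : csum (S n) f = Cplus (csum n f) (f n).
Proof. reflexivity. Qed.

Lemma csum_ext n f g : (forall i, (i < n)%nat -> f i = g i) -> csum n f = csum n g.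
Proof.
induction n as [|n IH]; intros H; [reflexivity|]. simpl.
rewrite (H n) by lia. f_equal. apply IH. intros i Hi. apply H. lia.
Qed.

Lemma csum_plus n f g : csum n (fun i => Cplus (f i) (g i)) = Cplus (csum n f) (csum n g).
Proof. induction n as [|n IH]; simpl; [ring|]. rewrite IH. ring. Qed.

Lemma csum_scal n c f : csum n (fun i => Cmult c (f i)) = Cmult c (csum n f).
Proof. induction n as [|n IH]; simpl; [ring|]. rewrite IH. ring. Qed.

Lemma csum_opp n f : csum n (fun i => Copp (f i)) = Copp (csum n f).
Proof. induction n as [|n IH]; simpl; [ring|]. rewrite IH. ring. Qed.

Lemma csum_bound n f K : (forall i, (i < n)%nat -> Cmod (f i) <= K) -> Cmod (csum n f) <= INR n * K.
Proof.
induction n as [|n IH]; intros H.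
- simpl. rewrite Cmod_0. lra.
- change (csum (S n) f) with (Cplus (csum n f) (f n)). rewrite S_INR.
  eapply Rle_trans; [apply Cmod_triangle|].
  assert (Cmod (csum n f) <= INR n * K) by (apply IH; intros i Hi; apply H; lia).
  assert (Cmod (f n) <= K) by (apply H; lia). lra.
Qed.

(** Both sides run over the pairs with [n + i < N], grouped by [n + i] on the left and by [n] on the
    right. *)
Lemma csum_triangle N (F : nat -> nat -> CC) :
  csum (S N) (fun n => match n with O => RtoC 0 | S m => csum (S m) (fun i => F (m - i)%nat i) end) =
  csum (S N) (fun n => csum (N - n) (fun i => F n i)).
Proof.
induction N as [|N IH]; [simpl; ring|].
change (csum (S (S N)) (fun n => match n with O => RtoC 0 | S m => csum (S m) (fun i => F (m - i)%nat i) end))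
  with (Cplus (csum (S N) (fun n => match n with O => RtoC 0 | S m => csum (S m) (fun i => F (m - i)%nat i) end))
          (csum (S N) (fun i => F (N - i)%nat i))).
rewrite IH. clear IH.
assert (E : forall k, (k <= S N)%nat -> Cplus (csum k (fun n => csum (N - n) (fun i => F n i))) (csum k (fun n => F n (N - n)%nat))
   = csum k (fun n => csum (S N - n) (fun i => F n i))).
{ intros k. induction k as [|k IHk]; intros Hk; [simpl; ring|]. rewrite !csum_S.
  rewrite <- IHk by lia. replace (S N - k)%nat with (S (N - k)) by lia. rewrite csum_S. ring. }
assert (R : forall k, (k <= S N)%nat -> csum (S N) (fun i => F (N - i)%nat i) =
   Cplus (csum (S N - k) (fun i => F (N - i)%nat i)) (csum k (fun n => F n (N - n)%nat))).
{ intros k. induction k as [|k IHk]; intros Hk.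
  - rewrite Nat.sub_0_r. simpl. ring.
  - rewrite IHk by lia. replace (S N - k)%nat with (S (S N - S k)) by lia. simpl csum.
    replace (N - (N - k))%nat with k by lia. ring. }
rewrite (R (S N)) by lia. replace (S N - S N)%nat with O by lia. simpl (csum 0 _).
change (csum (S (S N)) (fun n => csum (S N - n) (fun i => F n i))) with
 (Cplus (csum (S N) (fun n => csum (S N - n) (fun i => F n i))) (csum (S N - S N) (fun i => F (S N) i))).
replace (S N - S N)%nat with O by lia. simpl (csum 0 _).
rewrite <- (E (S N)) by lia. ring.
Qed.

Lemma Cpow_S z n : Defs.Cpow z (S n) = Cmult z (Defs.Cpow z n).
Proof. reflexivity. Qed.
Lemma Cpow_add z m n : Defs.Cpow z (m + n) = Cmult (Defs.Cpow z m) (Defs.Cpow z n).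
Proof. induction m as [|m IH]; simpl; [ring|]. rewrite IH. ring. Qed.
Lemma Cmod_pow z n : Cmod (Defs.Cpow z n) = Cmod z ^ n.
Proof. induction n as [|n IH]; simpl; [apply Cmod_1|]. rewrite Cmod_mult, IH. reflexivity. Qed.

Lemma cder_csum n (f d : nat -> R -> CC) x : (forall i, (i < n)%nat -> cder (f i) x (d i x)) ->
  cder (fun t => csum n (fun i => f i t)) x (csum n (fun i => d i x)).
Proof.
induction n as [|n IH]; intros H; simpl; [apply cder_const|].
apply cder_plus; [apply IH; intros; apply H; lia|apply H; lia].
Qed.

Lemma ccont_csum n (f : nat -> R -> CC) x : (forall i, (i < n)%nat -> ccont (f i) x) ->
  ccont (fun t => csum n (fun i => f i t)) x.
Proof.
induction n as [|n IH]; intros H; simpl; [apply ccont_const|].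
apply ccont_plus; [apply IH; intros; apply H; lia|apply H; lia].
Qed.

Lemma cder_pow (v : R -> CC) x l n : cder v x l ->
  cder (fun t => Defs.Cpow (v t) (S n)) x (Cmult (RtoC (INR (S n))) (Cmult (Defs.Cpow (v x) n) l)).
Proof.
intros H. induction n as [|n IH].
- refine (cder_ext _ _ _ _ _ _ _ H).
  + intros t. change (v t = Cmult (v t) (RtoC 1)). ring.
  + change (@eq CC l (Cmult (RtoC 1) (Cmult (RtoC 1) l))). generalize (l : CC). intros m. ring.
- refine (cder_ext _ _ _ _ _ _ _ (cder_mult _ _ _ _ _ H IH)).
  + reflexivity.
  + rewrite (S_INR (S n)), RtoC_plus. simpl (Defs.Cpow _ (S n)). cring.
Qed.

Lemma ccont_pow (v : R -> CC) x n : ccont v x -> ccont (fun t => Defs.Cpow (v t) n) x.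
Proof.
intros H. induction n as [|n IH]; [apply ccont_const|]. simpl. apply ccont_mult; assumption.
Qed.

Lemma series_eps (u : nat -> CC) (l : CC) : is_series (K := C_AbsRing) (V := C_NormedModule) u l ->
  forall e, 0 < e -> exists N, forall n, (N <= n)%nat -> Cmod (Cminus l (csum (S n) u)) < e.
Proof.
intros H e He.
destruct (proj1 (filterlim_locally_ball_norm (K := C_AbsRing) (U := C_NormedModule) (sum_n u) l) H (mkposreal e He)) as [N HN].
exists N. intros n Hn. specialize (HN n Hn). unfold ball_norm in HN.
replace (Cminus l (csum (S n) u)) with (Copp (Cminus (csum (S n) u) l)) by ring. rewrite Cmod_opp.
assert (E : csum (S n) u = sum_n u n).
{ clear. induction n as [|n IH]; [rewrite sum_O; simpl; ring|].
  rewrite sum_Sn. rewrite <- IH. reflexivity. }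
rewrite E. exact HN.
Qed.

Lemma geom_csum (u : nat -> CC) K q m n : 0 <= K -> 0 <= q <= / 2 -> (forall i, Cmod (u i) <= K * q ^ i) ->
  (m <= n)%nat -> Cmod (Cminus (csum n u) (csum m u)) <= 2 * K * q ^ m - 2 * K * q ^ n.
Proof.
intros HK Hq H Hmn. induction Hmn as [|n Hmn IH].
- replace (Cminus (csum m u) (csum m u)) with (RtoC 0) by ring. rewrite Cmod_0. lra.
- simpl csum. replace (Cminus (Cplus (csum n u) (u n)) (csum m u)) with (Cplus (Cminus (csum n u) (csum m u)) (u n)) by ring.
  eapply Rle_trans; [apply Cmod_triangle|]. specialize (H n). simpl.
  assert (0 <= q ^ n) by (apply pow_le; lra).
  assert (0 <= K * q ^ n) by (apply Rmult_le_pos; lra). nra.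
Qed.

(** For [q <= 1/2] the factor [1 / (1 - q)] of a geometric tail is at most 2. *)
Lemma series_tail (u : nat -> CC) l K q m : 0 <= K -> 0 <= q <= / 2 -> (forall i, Cmod (u i) <= K * q ^ i) ->
  is_series (K := C_AbsRing) (V := C_NormedModule) u l -> Cmod (Cminus l (csum m u)) <= 2 * K * q ^ m.
Proof.
intros HK Hq H Hs. apply Rnot_lt_le. intros Hlt.
set (e := Cmod (Cminus l (csum m u)) - 2 * K * q ^ m). assert (He : 0 < e) by (unfold e; lra).
destruct (series_eps u l Hs e He) as [N HN].
specialize (HN (max N m) ltac:(lia)).
assert (A := geom_csum u K q m (S (max N m)) HK Hq H ltac:(lia)).
assert (B : Cmod (Cminus l (csum m u)) <= Cmod (Cminus l (csum (S (max N m)) u)) + Cmod (Cminus (csum (S (max N m)) u) (csum m u))).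
{ eapply Rle_trans; [|apply Cmod_triangle]. apply Req_le. f_equal. ring. }
assert (0 <= q ^ S (max N m)) by (apply pow_le; lra).
assert (0 <= 2 * K * q ^ S (max N m)) by (apply Rmult_le_pos; lra).
unfold e in HN. lra.
Qed.

(** The derivative that [G n] must have for [sum G_n v^(n+1)] to be a first integral; the
    coefficients [a] are numbered from 1. *)
Definition gder (a G : nat -> R -> CC) (n : nat) (x : R) : CC :=
  match n with
  | O => RtoC 0
  | S m => Copp (csum (S m) (fun i => Cmult (Cmult (RtoC (INR (S (m - i)))) (G (m - i)%nat x)) (a (S i) x)))
  end.

Section Estimates.
Variables (T M : R) (a : nat -> R -> CC).
Hypotheses (HT : 0 < T) (HM : 1 <= M).
Hypothesis Ha : forall i x, (1 <= i)%nat -> 0 <= x <= T -> Cmod (a i x) <= M ^ i.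

Lemma rhs_bound x y rho n : 0 <= x <= T -> Cmod y <= rho ->
  Cmod (Cmult (a (S n) x) (Defs.Cpow y (n + 2))) <= M * rho ^ 2 * (M * rho) ^ n.
Proof.
intros Hx Hy. rewrite Cmod_mult, Cmod_pow.
assert (0 <= Cmod y) by apply Cmod_ge_0.
replace (M * rho ^ 2 * (M * rho) ^ n) with (M ^ S n * rho ^ (n + 2)).
- apply Rmult_le_compat; [apply Cmod_ge_0|apply pow_le; assumption|apply Ha; [lia|assumption]|].
  apply pow_incr. split; assumption.
- rewrite Rpow_mult_distr, pow_add. simpl. ring.
Qed.

Lemma rhs_tail x y rho l m : 0 <= x <= T -> Cmod y <= rho -> M * rho <= / 2 ->
  is_series (K := C_AbsRing) (V := C_NormedModule) (fun n => Cmult (a (S n) x) (Defs.Cpow y (n + 2))) l ->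
  Cmod (Cminus l (csum m (fun n => Cmult (a (S n) x) (Defs.Cpow y (n + 2))))) <= 2 * (M * rho ^ 2) * (M * rho) ^ m.
Proof.
intros Hx Hy Hr Hs. assert (0 <= rho) by (eapply Rle_trans; [apply Cmod_ge_0|exact Hy]).
apply series_tail; try assumption.
- apply Rmult_le_pos; [lra|]. apply pow_le. assumption.
- split; [apply Rmult_le_pos; lra|assumption].
- intros i. apply rhs_bound; assumption.
Qed.

(** In the derivative of the truncated sum the recursion cancels all powers of [v] up to the
    exponent [N + 1]. What remains are tails of the series for [v'], of order [rho^(N+2)], which the
    mean value inequality integrates over the interval. *)
Lemma first_integral (G : nat -> R -> CC) v rho B N :
  is_solution T a v -> (forall x, 0 <= x <= T -> Cmod (v x) <= rho) -> M * rho <= / 2 ->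
  (forall n x, (n <= N)%nat -> 0 <= x <= T -> Cmod (G n x) <= B) ->
  (forall n x, (n <= N)%nat -> 0 <= x <= T -> cder (G n) x (gder a G n x)) ->
  Cmod (Cminus (csum (S N) (fun n => Cmult (G n T) (Defs.Cpow (v T) (S n))))
               (csum (S N) (fun n => Cmult (G n 0) (Defs.Cpow (v 0) (S n)))))
  <= 4 * T * INR (S N) ^ 2 * B * M ^ S N * rho ^ (N + 2).
Proof.
intros Hv Hr Hrho HB HG.
assert (H0 : 0 <= rho) by (eapply Rle_trans; [apply Cmod_ge_0|apply (Hr 0); lra]).
assert (B0 : 0 <= B) by (eapply Rle_trans; [apply Cmod_ge_0|apply (HB O 0); [lia|lra]]).
set (K := 2 * INR (S N) ^ 2 * B * M ^ S N * rho ^ (N + 2)).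
assert (D : forall x, 0 <= x <= T -> exists d, cder (fun t => csum (S N) (fun n => Cmult (G n t) (Defs.Cpow (v t) (S n)))) x d /\ Cmod d <= K).
{ intros x Hx. destruct (Hv x Hx) as [l [Hl Hs]].
  set (u := fun n => Cmult (a (S n) x) (Defs.Cpow (v x) (n + 2))) in *.
  exists (csum (S N) (fun n => Cmult (Cmult (RtoC (INR (S n))) (G n x)) (Cmult (Defs.Cpow (v x) n) (Cminus l (csum (N - n) u))))).
  split.
  - refine (cder_ext _ _ _ _ _ (fun t => eq_refl) _
      (cder_csum (S N) (fun n t => Cmult (G n t) (Defs.Cpow (v t) (S n)))
       (fun n t => Cplus (Cmult (gder a G n t) (Defs.Cpow (v t) (S n)))
           (Cmult (G n t) (Cmult (RtoC (INR (S n))) (Cmult (Defs.Cpow (v t) n) l)))) x _)).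
    + rewrite csum_plus.
      set (F := fun n i => Cmult (Cmult (RtoC (INR (S n))) (G n x)) (Cmult (a (S i) x) (Defs.Cpow (v x) (n + i + 2)))).
      assert (E1 : csum (S N) (fun n => Cmult (gder a G n x) (Defs.Cpow (v x) (S n))) =
        Copp (csum (S N) (fun n => match n with O => RtoC 0 | S m => csum (S m) (fun i => F (m - i)%nat i) end))).
      { rewrite <- csum_opp. apply csum_ext. intros n Hn. destruct n as [|m]; [unfold gder; ring|].
        unfold gder. replace (Cmult (Copp (csum (S m) (fun i => Cmult (Cmult (RtoC (INR (S (m - i)))) (G (m - i)%nat x)) (a (S i) x)))) (Defs.Cpow (v x) (S (S m))))
          with (Copp (Cmult (Defs.Cpow (v x) (S (S m))) (csum (S m) (fun i => Cmult (Cmult (RtoC (INR (S (m - i)))) (G (m - i)%nat x)) (a (S i) x))))) by ring.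
        f_equal. rewrite <- csum_scal. apply csum_ext. intros i Hi. unfold F.
        replace (m - i + i + 2)%nat with (S (S m)) by lia. ring. }
      rewrite E1, csum_triangle. rewrite <- csum_opp, <- csum_plus. apply csum_ext. intros n Hn.
      assert (E2 : csum (N - n) (fun i => F n i) = Cmult (Cmult (RtoC (INR (S n))) (G n x)) (Cmult (Defs.Cpow (v x) n) (csum (N - n) u))).
      { rewrite <- !csum_scal. apply csum_ext. intros i Hi. unfold F, u.
        replace (n + i + 2)%nat with (n + (i + 2))%nat by lia. rewrite (Cpow_add _ n). ring. }
      rewrite E2. ring.
    + intros i Hi. apply cder_mult; [apply HG; [lia|assumption]|apply cder_pow; exact Hl].
  - assert (C : forall n, (n < S N)%nat -> Cmod (Cmult (Cmult (RtoC (INR (S n))) (G n x)) (Cmult (Defs.Cpow (v x) n) (Cminus l (csum (N - n) u))))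
        <= INR (S N) * B * (2 * M ^ S N * rho ^ (N + 2))).
    { intros n Hn. rewrite !Cmod_mult, Cmod_R, Cmod_pow, Rabs_pos_eq by apply pos_INR.
      assert (T1 := rhs_tail x (v x) rho l (N - n) Hx (Hr x Hx) Hrho Hs). fold u in T1.
      assert (P1 : INR (S n) <= INR (S N)) by (apply le_INR; lia).
      assert (P2 : Cmod (G n x) <= B) by (apply HB; [lia|assumption]).
      assert (P3 : Cmod (v x) ^ n <= rho ^ n) by (apply pow_incr; split; [apply Cmod_ge_0|apply Hr; assumption]).
      assert (Q1 : 0 <= Cmod (v x) ^ n) by (apply pow_le, Cmod_ge_0).
      assert (P4 : Cmod (v x) ^ n * Cmod (Cminus l (csum (N - n) u)) <= 2 * M ^ S N * rho ^ (N + 2)).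
      { apply Rle_trans with (rho ^ n * (2 * (M * rho ^ 2) * (M * rho) ^ (N - n))).
        - apply Rmult_le_compat; try assumption. apply Cmod_ge_0.
        - rewrite Rpow_mult_distr. replace (N + 2)%nat with (n + (N - n) + 2)%nat by lia. rewrite !pow_add.
          assert (Mle : M * M ^ (N - n) <= M ^ S N) by (change (M ^ S (N - n) <= M ^ S N); apply Rle_pow; [assumption|lia]).
          assert (R0 : 0 <= rho ^ n * rho ^ (N - n) * rho ^ 2) by (apply Rmult_le_pos; [apply Rmult_le_pos|]; apply pow_le; assumption).
          replace (rho ^ n * (2 * (M * rho ^ 2) * (M ^ (N - n) * rho ^ (N - n)))) with (2 * (M * M ^ (N - n)) * (rho ^ n * rho ^ (N - n) * rho ^ 2)) by ring.
          apply Rmult_le_compat_r; [assumption|]. lra. }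
      apply Rmult_le_compat; try assumption.
      - apply Rmult_le_pos; [apply pos_INR|apply Cmod_ge_0].
      - apply Rmult_le_pos; [assumption|apply Cmod_ge_0].
      - apply Rmult_le_compat; try assumption; [apply pos_INR|apply Cmod_ge_0]. }
    eapply Rle_trans; [apply (csum_bound _ _ _ C)|]. unfold K. apply Req_le. ring. }
assert (HC : forall x, exists d, 0 <= x <= T -> cder (fun t => csum (S N) (fun n => Cmult (G n t) (Defs.Cpow (v t) (S n)))) x d /\ Cmod d <= K).
{ intros x. destruct (Classical_Prop.classic (0 <= x <= T)) as [Hx|Hx].
  - destruct (D x Hx) as [d Hd]. exists d. intros _. exact Hd.
  - exists (RtoC 0). intros Hx'. contradiction. }
set (dd := fun x => proj1_sig (ClassicalEpsilon.constructive_indefinite_description _ (HC x))).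
assert (Hdd : forall x, 0 <= x <= T -> cder (fun t => csum (S N) (fun n => Cmult (G n t) (Defs.Cpow (v t) (S n)))) x (dd x) /\ Cmod (dd x) <= K).
{ intros x. unfold dd. destruct (ClassicalEpsilon.constructive_indefinite_description _ (HC x)) as [d Hd]. exact Hd. }
assert (Z := cmvt (fun t => csum (S N) (fun n => Cmult (G n t) (Defs.Cpow (v t) (S n)))) dd 0 T K ltac:(lra)
  (fun x Hx => proj1 (Hdd x Hx)) (fun x Hx => proj2 (Hdd x Hx))).
eapply Rle_trans; [exact Z|]. unfold K. apply Req_le. ring.
Qed.

End Estimates.
End FirstIntegral.

(** * Centers, flat return maps and closed first integrals *)

Module Criterion.
Import CxAnalysis FirstIntegral.

Ltac posc := repeat match goal with
  | |- 0 <= _ ^ _ => apply pow_le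
  | |- 0 <= INR _ => apply pos_INR
  | |- 0 <= exp _ => left; apply exp_pos
  | |- 0 <= Cmod _ => apply Cmod_ge_0
  | |- 0 <= _ * _ => apply Rmult_le_pos
  end; try lra.

Lemma Cmod_sub_le x y : Cmod x <= Cmod y + Cmod (Cminus x y).
Proof. replace x with (Cplus y (Cminus x y)) at 1 by ring. apply Cmod_triangle. Qed.

Lemma Cminus_sym x y : Cmod (Cminus x y) = Cmod (Cminus y x).
Proof. replace (Cminus x y) with (Copp (Cminus y x)) by ring. apply Cmod_opp. Qed.

Lemma real_mvt_dom (f df g dg : R -> R) a b : a <= b -> (forall x, a <= x <= b -> is_derive f x (df x)) ->
  (forall x, a <= x <= b -> is_derive g x (dg x)) -> (forall x, a <= x <= b -> Rabs (df x) <= dg x) ->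
  Rabs (f b - f a) <= g b - g a.
Proof.
assert (K : forall f df, a <= b -> (forall x, a <= x <= b -> is_derive f x (df x)) ->
  (forall x, a <= x <= b -> is_derive g x (dg x)) -> (forall x, a <= x <= b -> df x <= dg x) -> f b - f a <= g b - g a).
{ clear f df. intros f df Hab H1 H2 H3.
  destruct (MVT_gen (fun x => g x - f x) a b (fun x => dg x - df x)) as [c [Hc E]].
  - rewrite Rmin_left, Rmax_right by assumption. intros x Hx.
    apply (is_derive_minus (V := R_NormedModule)); [apply H2|apply H1]; lra.
  - rewrite Rmin_left, Rmax_right by assumption. intros x Hx. apply continuity_pt_filterlim.
    apply (ex_derive_continuous (V := R_NormedModule) (fun x => g x - f x)). exists (dg x - df x).
    apply (is_derive_minus (V := R_NormedModule)); [apply H2|apply H1]; lra.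
  - rewrite Rmin_left, Rmax_right in Hc by assumption. specialize (H3 c Hc).
    assert (0 <= (dg c - df c) * (b - a)) by (apply Rmult_le_pos; lra). lra. }
intros Hab H1 H2 H3. apply Rabs_le. split.
- assert (A := K (fun x => - f x) (fun x => - df x) Hab).
  assert (- f b - - f a <= g b - g a); [|lra]. apply A; [|assumption|].
  + intros x Hx. apply (is_derive_opp (V := R_NormedModule)). apply H1; assumption.
  + intros x Hx. specialize (H3 x Hx). apply Rabs_le_between in H3. lra.
- apply (K f df Hab H1 H2). intros x Hx. specialize (H3 x Hx). apply Rabs_le_between in H3. lra.
Qed.

Lemma cmvt_dom (f df : R -> CC) (g dg : R -> R) a b : a <= b -> (forall x, a <= x <= b -> cder f x (df x)) ->
  (forall x, a <= x <= b -> is_derive g x (dg x)) -> (forall x, a <= x <= b -> Cmod (df x) <= dg x) ->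
  Cmod (Cminus (f b) (f a)) <= 2 * (g b - g a).
Proof.
intros Hab H1 H2 H3. eapply Rle_trans; [apply Cmod_le_sum|]. simpl.
assert (A : Rabs (fst (f b) - fst (f a)) <= g b - g a).
{ apply (real_mvt_dom (fun x => fst (f x)) (fun x => fst (df x)) g dg); try assumption.
  - intros x Hx. apply cder_fst. apply H1; assumption.
  - intros x Hx. eapply Rle_trans; [apply fst_le_Cmod|]. apply H3; assumption. }
assert (B : Rabs (snd (f b) - snd (f a)) <= g b - g a).
{ apply (real_mvt_dom (fun x => snd (f x)) (fun x => snd (df x)) g dg); try assumption.
  - intros x Hx. apply cder_snd. apply H1; assumption.
  - intros x Hx. eapply Rle_trans; [apply snd_le_Cmod|]. apply H3; assumption. }
unfold Rminus in *. lra.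
Qed.

Lemma le_all_zero x C : 0 <= x -> (forall e, 0 < e -> x <= C * e) -> x = 0.
Proof.
intros Hx H. destruct (Rle_lt_or_eq_dec 0 x Hx) as [Hl|]; [|congruence]. exfalso.
assert (HC : 0 < Rabs C + 1) by (pose proof (Rabs_pos C); lra).
specialize (H (x / (2 * (Rabs C + 1))) ltac:(apply Rdiv_lt_0_compat; lra)).
assert (C * (x / (2 * (Rabs C + 1))) <= (Rabs C + 1) * (x / (2 * (Rabs C + 1)))).
{ apply Rmult_le_compat_r; [apply Rlt_le, Rdiv_lt_0_compat; lra|]. pose proof (Rle_abs C). lra. }
replace ((Rabs C + 1) * (x / (2 * (Rabs C + 1)))) with (x / 2) in H0 by (field; lra). lra.
Qed.

Section Crit.
Variables (T M : R) (a : nat -> R -> CC).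
Hypotheses (HT : 0 < T) (HM : 1 <= M).
Hypothesis Ha : forall i x, (1 <= i)%nat -> 0 <= x <= T -> Cmod (a i x) <= M ^ i.

(** Continuity argument: as long as [|v| <= 2 d], the size of [v'] forces the strict inequality, so
    the supremum of the good initial intervals is [T]. *)
Lemma apriori v d : is_solution T a v -> Cmod (v 0) < d -> 4 * M * d <= 1 -> 16 * M * T * d < 1 ->
  forall x, 0 <= x <= T -> Cmod (v x) <= 2 * d.
Proof.
intros Hv H0 H1 H2.
assert (d0 : 0 < d) by (eapply Rle_lt_trans; [apply Cmod_ge_0|exact H0]).
assert (Hc : forall x, 0 <= x <= T -> ccont v x).
{ intros x Hx. destruct (Hv x Hx) as [l [Hl _]]. exact (ccont_cder _ _ _ Hl). }
assert (step : forall s, 0 <= s <= T -> (forall y, 0 <= y <= s -> Cmod (v y) <= 2 * d) -> Cmod (v s) < 2 * d).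
{ intros s Hs Hb.
  assert (ex : forall x, exists l, 0 <= x <= s -> cder v x l /\ Cmod l <= 8 * M * d ^ 2).
  { intros x. destruct (Classical_Prop.classic (0 <= x <= s)) as [Hx|Hx]; [|exists (RtoC 0); intros; contradiction].
    destruct (Hv x) as [l [Hl Hser]]; [lra|]. exists l. intros _. split; [exact Hl|].
    assert (A := rhs_tail T M a HM Ha x (v x) (2 * d) l 0 ltac:(lra) (Hb x Hx) ltac:(lra) Hser).
    simpl csum in A. replace (Cminus l (RtoC 0)) with l in A by ring. simpl in A. simpl. lra. }
  set (dv := fun x => proj1_sig (ClassicalEpsilon.constructive_indefinite_description _ (ex x))).
  assert (Hdv : forall x, 0 <= x <= s -> cder v x (dv x) /\ Cmod (dv x) <= 8 * M * d ^ 2).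
  { intros x. unfold dv. destruct (ClassicalEpsilon.constructive_indefinite_description _ (ex x)) as [l Hl]. exact Hl. }
  assert (A := cmvt v dv 0 s (8 * M * d ^ 2) ltac:(lra) (fun x Hx => proj1 (Hdv x Hx)) (fun x Hx => proj2 (Hdv x Hx))).
  assert (B := Cmod_sub_le (v s) (v 0)).
  assert (E1 : 16 * M * d ^ 2 * s <= 16 * M * d ^ 2 * T) by (apply Rmult_le_compat_l; [simpl; nra|lra]).
  assert (16 * M * d ^ 2 * T < d) by (replace (16 * M * d ^ 2 * T) with ((16 * M * T * d) * d) by ring; nra).
  lra. }
set (E := fun x => 0 <= x <= T /\ forall y, 0 <= y <= x -> Cmod (v y) <= 2 * d).
assert (E0 : E 0) by (split; [lra|]; intros y Hy; replace y with 0 by lra; lra).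
destruct (completeness E) as [s [Hub Hlub]].
{ exists T. intros x [Hx _]. lra. }
{ exists 0. exact E0. }
assert (s0 : 0 <= s) by (apply Hub; exact E0).
assert (sT : s <= T) by (apply Hlub; intros x [Hx _]; lra).
assert (below : forall y, 0 <= y < s -> Cmod (v y) <= 2 * d).
{ intros y Hy. apply Rnot_lt_le. intros Hn.
  assert (s <= y); [|lra]. apply Hlub. intros x [Hx Hx2]. apply Rnot_lt_le. intros Hxy.
  specialize (Hx2 y ltac:(lra)). lra. }
assert (ats : Cmod (v s) <= 2 * d).
{ destruct (Rle_lt_or_eq_dec 0 s s0) as [sp|<-]; [|lra].
  apply Rnot_lt_le. intros Hn.
  destruct (proj1 (ccont_eps v s) (Hc s ltac:(lra)) (Cmod (v s) - 2 * d) ltac:(lra)) as [e [He Hd]].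
  set (y := Rmax 0 (s - e / 2)).
  assert (Hy : 0 <= y < s) by (unfold y; split; [apply Rmax_l|apply Rmax_lub_lt; lra]).
  assert (Hy2 : Rabs (y - s) < e).
  { assert (s - e / 2 <= y) by apply Rmax_r. apply Rabs_def1; lra. }
  specialize (Hd y Hy2). specialize (below y Hy). assert (B := Cmod_sub_le (v s) (v y)).
  rewrite Cminus_sym in B. lra. }
assert (upto : forall y, 0 <= y <= s -> Cmod (v y) <= 2 * d).
{ intros y Hy. destruct (Req_dec y s) as [->|Hne]; [exact ats|]. apply below. lra. }
assert (sE : s = T).
{ apply Rle_antisym; [exact sT|]. apply Rnot_lt_le. intros Hlt.
  assert (Hs := step s ltac:(lra) upto).
  destruct (proj1 (ccont_eps v s) (Hc s ltac:(lra)) (2 * d - Cmod (v s)) ltac:(lra)) as [e [He Hd]].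
  set (s' := Rmin T (s + e / 2)).
  assert (s < s') by (unfold s'; apply Rmin_glb_lt; lra).
  assert (s' <= T) by apply Rmin_l. assert (s' <= s + e / 2) by apply Rmin_r.
  assert (E s').
  { split; [lra|]. intros y Hy. destruct (Rle_dec y s) as [Hys|Hys]; [apply upto; lra|].
    specialize (Hd y ltac:(apply Rabs_def1; lra)). assert (B := Cmod_sub_le (v y) (v s)). lra. }
  assert (s' <= s) by (apply Hub; assumption). lra. }
intros x Hx. apply upto. lra.
Qed.

Variable H : nat -> R -> CC.
Hypothesis H00 : forall x, 0 <= x <= T -> H O x = RtoC 1.
Hypothesis H0 : forall n, H (S n) 0 = RtoC 0.
Hypothesis Hd : forall n x, 0 <= x <= T -> cder (H n) x (gder a H n x).

(** Integrating [n exp(n x)] absorbs the factor [n] of the recursion, and the powers of 4 absorb the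
    sum over [i] together with the factor 2 of the mean value inequality. *)
Lemma hseq_bound n x : 0 <= x <= T -> Cmod (H n x) <= (4 * M) ^ n * exp (INR n * x).
Proof.
revert x. induction n as [n IH] using lt_wf_ind. intros x Hx. destruct n as [|n].
{ rewrite H00 by assumption. simpl. rewrite Rmult_0_l, exp_0, Cmod_1. lra. }
assert (B : forall t, 0 <= t <= x -> Cmod (gder a H (S n) t) <= (4 * M) ^ S n / 2 * (INR (S n) * exp (INR (S n) * t))).
{ intros t Ht. unfold gder. rewrite Cmod_opp.
  set (f := fun i => Cmult (Cmult (RtoC (INR (S (n - i)))) (H (n - i)%nat t)) (a (S i) t)).
  set (C := INR (S n) * exp (INR (S n) * t)).
  assert (C0 : 0 <= C) by (apply Rmult_le_pos; [apply pos_INR|apply Rlt_le, exp_pos]).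
  assert (M0 : 0 < M ^ S n) by (apply pow_lt; lra).
  assert (fi : forall i, (i <= n)%nat -> Cmod (f i) <= C * M ^ S n * 4 ^ (n - i)).
  { intros i Hi. unfold f. rewrite !Cmod_mult, Cmod_R, Rabs_pos_eq by apply pos_INR.
    assert (P1 : INR (S (n - i)) <= INR (S n)) by (apply le_INR; lia).
    assert (P2 : Cmod (H (n - i)%nat t) <= (4 * M) ^ (n - i) * exp (INR (S n) * t)).
    { eapply Rle_trans; [apply IH; [lia|lra]|]. apply Rmult_le_compat_l; [apply pow_le; lra|].
      assert (INR (n - i) * t <= INR (S n) * t) by (apply Rmult_le_compat_r; [lra|apply le_INR; lia]).
      destruct (Rle_lt_or_eq_dec _ _ H1) as [Hl|He]; [left; apply exp_increasing; exact Hl|rewrite He; lra]. }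
    assert (P3 : Cmod (a (S i) t) <= M ^ S i) by (apply Ha; [lia|lra]).
    apply Rle_trans with (INR (S n) * ((4 * M) ^ (n - i) * exp (INR (S n) * t)) * M ^ S i).
    - repeat apply Rmult_le_compat; try assumption; try apply Cmod_ge_0; try apply pos_INR.
      apply Rmult_le_pos; [apply pos_INR|apply Cmod_ge_0].
    - apply Req_le. unfold C. rewrite Rpow_mult_distr. replace (M ^ S n) with (M ^ (n - i) * M ^ S i) by (rewrite <- pow_add; f_equal; lia). ring. }
  assert (S1 : forall k, (k <= S n)%nat -> Cmod (csum k f) <= C * M ^ S n * ((4 ^ S n - 4 ^ (S n - k)) / 3)).
  { intros k. induction k as [|k IHk]; intros Hk.
    - simpl csum. rewrite Cmod_0, Nat.sub_0_r. apply Req_le. field.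
    - rewrite csum_S. eapply Rle_trans; [apply Cmod_triangle|].
      specialize (IHk ltac:(lia)). specialize (fi k ltac:(lia)).
      replace (S n - k)%nat with (S (n - k)) in IHk by lia. replace (S n - S k)%nat with (n - k)%nat by lia.
      rewrite <- (tech_pow_Rmult 4 (n - k)) in IHk.
      apply Rle_trans with (C * M ^ S n * ((4 ^ S n - 4 * 4 ^ (n - k)) / 3) + C * M ^ S n * 4 ^ (n - k)); [lra|].
      apply Req_le. field. }
  specialize (S1 (S n) ltac:(lia)). eapply Rle_trans; [exact S1|].
  rewrite Rpow_mult_distr, Nat.sub_diag. simpl (4 ^ 0).
  assert (0 <= 4 ^ S n) by (apply pow_le; lra).
  assert (0 <= C * M ^ S n) by (apply Rmult_le_pos; lra).
  replace (4 ^ S n * M ^ S n / 2 * C) with (C * M ^ S n * (4 ^ S n / 2)) by field.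
  apply Rmult_le_compat_l; [assumption|]. lra. }
assert (A := cmvt_dom (H (S n)) (gder a H (S n)) (fun t => (4 * M) ^ S n / 2 * exp (INR (S n) * t))
  (fun t => (4 * M) ^ S n / 2 * (INR (S n) * exp (INR (S n) * t))) 0 x ltac:(lra)).
assert (A' := A (fun t Ht => Hd (S n) t ltac:(lra))). clear A.
rewrite H0 in A'. replace (Cminus (H (S n) x) (RtoC 0)) with (H (S n) x) in A' by ring.
eapply Rle_trans; [apply A'|].
- intros t Ht. generalize (INR (S n)) ((4 * M) ^ S n / 2). intros c C. auto_derive; [exact I|]. ring.
- exact B.
- rewrite Rmult_0_r, exp_0. assert (0 <= (4 * M) ^ S n) by (apply pow_le; lra). lra.
Qed.

Lemma csum_closed (c : nat -> CC) y n : c O = RtoC 1 -> (forall k, (1 <= k < S n)%nat -> c k = RtoC 0) ->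
  csum (S n) (fun k => Cmult (c k) (Defs.Cpow y (S k))) = y.
Proof.
intros c0 ck. induction n as [|n IH].
- rewrite csum_S. simpl. rewrite c0. ring.
- rewrite csum_S, IH by (intros k Hk; apply ck; lia). rewrite ck by lia. ring.
Qed.

Lemma sq_le_pow4 N : INR (S N) ^ 2 <= 4 ^ N.
Proof.
assert (A : INR (S N) <= 2 ^ N).
{ induction N as [|N IH]; [simpl; lra|]. rewrite S_INR. simpl (2 ^ S N).
  assert (1 <= 2 ^ N) by (apply pow_R1_Rle; lra). lra. }
replace 4 with (2 ^ 2) by ring. rewrite <- pow_mult, Nat.mul_comm, pow_mult.
apply pow_incr. split; [apply pos_INR|exact A].
Qed.

(** The truncated first integrals equal [v] itself at both ends, so [first_integral] bounds
    [v T - v 0] for every [N]; by [hseq_bound] the bounds decay geometrically. *)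
Lemma center_of_closed : (forall n, H (S n) T = RtoC 0) -> is_center T a.
Proof.
intros Hcl.
assert (e1 : 1 <= exp T) by (rewrite <- exp_0; left; apply exp_increasing; lra).
(* Small enough for [apriori] and for [32 M^2 e^T d <= 1/2], the ratio that gives the powers of one
   half. *)
set (d := / (64 * M ^ 2 * exp T * (1 + T))).
assert (D0 : 0 < 64 * M ^ 2 * exp T * (1 + T)) by (repeat apply Rmult_lt_0_compat; try lra; apply pow_lt; lra).
assert (d0 : 0 < d) by (apply Rinv_0_lt_compat; exact D0).
assert (dE : 64 * M ^ 2 * exp T * (1 + T) * d = 1) by (apply Rinv_r; lra).
assert (Me : 0 <= M * exp T * d) by (apply Rmult_le_pos; [apply Rmult_le_pos|]; lra).
assert (c1 : 64 * M * d * (1 + T) <= 1).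
{ assert (X0 : 0 <= 64 * M * d * (1 + T)) by posc.
  assert (XE : 64 * M * d * (1 + T) * (M * exp T) = 1) by (transitivity (64 * M ^ 2 * exp T * (1 + T) * d); [ring|exact dE]).
  assert (1 <= M * exp T) by nra. nra. }
assert (Md : 0 < M * d) by (apply Rmult_lt_0_compat; lra).
assert (c2 : 64 * M ^ 2 * exp T * d <= 1).
{ assert (0 <= 64 * M ^ 2 * exp T * d) by posc.
  assert (64 * M ^ 2 * exp T * d * (1 + T) = 1) by (transitivity (64 * M ^ 2 * exp T * (1 + T) * d); [ring|exact dE]).
  nra. }
exists d. split; [exact d0|]. intros v Hv0 Hv.
assert (Hb := apriori v d Hv Hv0 ltac:(nra) ltac:(nra)).
assert (key : forall N, Cmod (Cminus (v T) (v 0)) <= 16 * T * M * d ^ 2 * (/ 2) ^ N).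
{ intros N.
  assert (A := first_integral T M a HT HM Ha H v (2 * d) ((4 * M) ^ N * exp (INR N * T)) N Hv Hb ltac:(nra)).
  rewrite (csum_closed (fun n => H n T)), (csum_closed (fun n => H n 0)) in A.
  - eapply Rle_trans; [apply A|].
    + intros n x Hn Hx. eapply Rle_trans; [apply hseq_bound; exact Hx|].
      apply Rmult_le_compat; [apply pow_le; lra|apply Rlt_le, exp_pos|apply Rle_pow; [lra|exact Hn]|].
      assert (L : INR n * x <= INR N * T) by (apply Rmult_le_compat; [apply pos_INR|lra|apply le_INR; exact Hn|lra]).
      destruct (Rle_lt_or_eq_dec _ _ L) as [Hl|He]; [left; apply exp_increasing; exact Hl|rewrite He; lra].
    + intros n x _ Hx. apply Hd. exact Hx.
    + assert (EN : exp (INR N * T) = exp T ^ N).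
      { clear. induction N as [|N IH]; [simpl; rewrite Rmult_0_l; apply exp_0|].
        rewrite S_INR, Rmult_plus_distr_r, exp_plus, IH, Rmult_1_l. simpl. ring. }
      rewrite EN. pose proof (sq_le_pow4 N) as S4.
      replace (16 * T * M * d ^ 2 * (/ 2) ^ N) with (16 * T * M * d ^ 2 * (/ 2) ^ N * 1) by ring.
      assert (Q : (32 * M ^ 2 * exp T * d) ^ N <= (/ 2) ^ N).
      { apply pow_incr. split; [repeat apply Rmult_le_pos; try lra; apply pow_le; lra|lra]. }
      replace (4 * T * INR (S N) ^ 2 * ((4 * M) ^ N * exp T ^ N) * M ^ S N * (2 * d) ^ (N + 2))
        with ((16 * T * M * d ^ 2) * (INR (S N) ^ 2 * (8 * M ^ 2 * exp T * d) ^ N)).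
      * apply Rle_trans with ((16 * T * M * d ^ 2) * (4 ^ N * (8 * M ^ 2 * exp T * d) ^ N)).
        -- apply Rmult_le_compat_l; [repeat apply Rmult_le_pos; try lra; apply pow_le; lra|].
           apply Rmult_le_compat_r; [apply pow_le; repeat apply Rmult_le_pos; try lra; apply pow_le; lra|exact S4].
        -- rewrite <- Rpow_mult_distr. replace (4 * (8 * M ^ 2 * exp T * d)) with (32 * M ^ 2 * exp T * d) by ring.
           rewrite Rmult_1_r. apply Rmult_le_compat_l; [repeat apply Rmult_le_pos; try lra; apply pow_le; lra|exact Q].
      * replace (8 * M ^ 2 * exp T * d) with ((4 * M) * exp T * M * (2 * d)) by ring.
        rewrite pow_add, !Rpow_mult_distr. simpl (M ^ S N). ring.
  - apply H00. lra.
  - intros k Hk. destruct k as [|k]; [lia|]. apply H0.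
  - apply H00. lra.
  - intros k Hk. destruct k as [|k]; [lia|]. apply Hcl. }
assert (Z : Cmod (Cminus (v T) (v 0)) = 0).
{ apply (le_all_zero _ (16 * T * M * d ^ 2)); [apply Cmod_ge_0|]. intros e He.
  destruct (pow_lt_1_zero (/ 2) ltac:(rewrite Rabs_pos_eq; lra) e He) as [N HN].
  specialize (HN N (le_n N)). rewrite Rabs_pos_eq in HN by (apply pow_le; lra).
  eapply Rle_trans; [apply (key N)|]. apply Rmult_le_compat_l; [|lra].
  repeat apply Rmult_le_pos; try lra; apply pow_le; lra. }
apply Cmod_eq_0 in Z. replace (v T) with (Cplus (Cminus (v T) (v 0)) (v 0)) by ring. rewrite Z. ring.
Qed.

(** The return map agrees with the identity to infinite order at 0 along positive reals. A first
    integral without bounds uniform in [n] yields only this, yet it suffices to close the normalized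
    one. *)
Definition flat := forall N, exists K r0, 0 < r0 /\ 0 <= K /\ forall v r, 0 < r < r0 -> is_solution T a v ->
  v 0 = RtoC r -> Cmod (Cminus (v T) (v 0)) <= K * r ^ (N + 2).

Lemma flat_of_center : is_center T a -> flat.
Proof.
intros [e [He Hc]] N. exists 0, e. split; [exact He|]. split; [lra|]. intros v r Hr Hv E.
rewrite (Hc v); [|rewrite E, Cmod_R, Rabs_pos_eq; lra|exact Hv].
replace (Cminus (v 0) (v 0)) with (RtoC 0) by ring. rewrite Cmod_0. lra.
Qed.

Hypothesis exists_sol : exists r1, 0 < r1 /\ forall r, 0 < r < r1 -> exists v, is_solution T a v /\ v 0 = RtoC r.

(** For the first coefficient [H_N(T)] not yet known to vanish, the truncated first integral and
    flatness give [|H_N(T)| |v(T)|^(N+1) = O(r^(N+2))], while [|v(T)| >= r/2]; let [r] tend to 0. *)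
Lemma closed_of_flat : flat -> forall n, H (S n) T = RtoC 0.
Proof.
intros Hf n. induction n as [n IH] using lt_wf_ind.
destruct (Hf (S n)) as [K [r0 [Hr0 [HK Hflat]]]]. destruct exists_sol as [r1 [Hr1 Hsol]].
assert (e1 : 1 <= exp T) by (rewrite <- exp_0; left; apply exp_increasing; lra).
set (N := S n). set (B := (4 * M) ^ N * exp (INR N * T)).
assert (HBp : 0 <= B) by (apply Rmult_le_pos; [apply pow_le; lra|apply Rlt_le, exp_pos]).
set (C := 4 * T * INR (S N) ^ 2 * B * M ^ S N * 4 ^ (N + 2)).
assert (C0 : 0 <= C).
{ unfold C. posc. }
apply Cmod_eq_0. apply (le_all_zero _ (2 ^ S N * (C + K))); [apply Cmod_ge_0|]. intros e He.
(* The bounds by [r0] and [r1] allow flatness and existence, [e] is the final accuracy, and the last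
   bound serves [apriori] and makes [K r <= 1/2]. *)
set (r := Rmin (Rmin (r0 / 2) (r1 / 2)) (Rmin (Rmin e 1) (/ (64 * M * (1 + T) * (1 + K))))).
assert (D0 : 0 < 64 * M * (1 + T) * (1 + K)) by (repeat apply Rmult_lt_0_compat; lra).
assert (rp : 0 < r).
{ unfold r. repeat apply Rmin_glb_lt; try lra. apply Rinv_0_lt_compat. exact D0. }
assert (rr0 : r <= r0 / 2) by (unfold r; eapply Rle_trans; [apply Rmin_l|apply Rmin_l]).
assert (rr1 : r <= r1 / 2) by (unfold r; eapply Rle_trans; [apply Rmin_l|apply Rmin_r]).
assert (re : r <= e) by (unfold r; eapply Rle_trans; [apply Rmin_r|eapply Rle_trans; [apply Rmin_l|apply Rmin_l]]).
assert (r1' : r <= 1) by (unfold r; eapply Rle_trans; [apply Rmin_r|eapply Rle_trans; [apply Rmin_l|apply Rmin_r]]).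
assert (rD : r <= / (64 * M * (1 + T) * (1 + K))) by (unfold r; eapply Rle_trans; [apply Rmin_r|apply Rmin_r]).
assert (rD' : 64 * M * (1 + T) * (1 + K) * r <= 1).
{ apply Rmult_le_compat_l with (r := 64 * M * (1 + T) * (1 + K)) in rD; [|lra]. rewrite Rinv_r in rD by lra. exact rD. }
assert (Mr : 0 < M * r) by (apply Rmult_lt_0_compat; lra).
assert (MTr : 0 < M * T * r) by (repeat apply Rmult_lt_0_compat; lra).
assert (p1 : 64 * (M * r) + 64 * (M * T * r) <= 1).
{ assert (0 <= K * (64 * M * (1 + T) * r)) by (apply Rmult_le_pos; [lra|]; repeat apply Rmult_le_pos; lra). nra. }
assert (p2 : K * r <= / 2).
{ assert (K * r <= K * (M * r)) by (apply Rmult_le_compat_l; nra).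
  assert (0 <= K * (M * r)) by (apply Rmult_le_pos; lra).
  assert (0 <= K * (M * T * r)) by (apply Rmult_le_pos; lra). nra. }
destruct (Hsol r ltac:(lra)) as [v [Hv Hv0]].
assert (Hfl := Hflat v r ltac:(lra) Hv Hv0). fold N in Hfl.
assert (Hb := apriori v (2 * r) Hv ltac:(rewrite Hv0, Cmod_R, Rabs_pos_eq; lra) ltac:(nra) ltac:(nra)).
assert (A := first_integral T M a HT HM Ha H v (2 * (2 * r)) B N Hv Hb ltac:(nra)).
assert (A1 : Cmod (Cminus (csum (S N) (fun n0 => Cmult (H n0 T) (Defs.Cpow (v T) (S n0)))) (csum (S N) (fun n0 => Cmult (H n0 0) (Defs.Cpow (v 0) (S n0))))) <= C * r ^ (N + 2)).
{ eapply Rle_trans; [apply A|].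
  - intros k x Hk Hx. unfold B. eapply Rle_trans; [apply hseq_bound; exact Hx|].
    apply Rmult_le_compat; [apply pow_le; lra|apply Rlt_le, exp_pos|apply Rle_pow; [lra|exact Hk]|].
    assert (L : INR k * x <= INR N * T) by (apply Rmult_le_compat; [apply pos_INR|lra|apply le_INR; exact Hk|lra]).
    destruct (Rle_lt_or_eq_dec _ _ L) as [Hl|Hee]; [left; apply exp_increasing; exact Hl|rewrite Hee; lra].
  - intros k x _ Hx. apply Hd. exact Hx.
  - apply Req_le. unfold C. replace (2 * (2 * r)) with (4 * r) by ring. rewrite (Rpow_mult_distr 4 r). ring. }
clear A. rewrite (csum_closed (fun n => H n 0)) in A1; [|apply H00; lra|intros k Hk; destruct k; [lia|apply H0]].
rewrite csum_S in A1. unfold N in A1. rewrite (csum_closed (fun n => H n T)) in A1;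
  [|apply H00; lra|intros k Hk; destruct k as [|k]; [lia|apply IH; lia]].
fold N in A1.
assert (A2 : Cmod (H N T) * Cmod (v T) ^ S N <= (C + K) * r ^ (N + 2)).
{ rewrite <- Cmod_pow, <- Cmod_mult.
  replace (Cmult (H N T) (Defs.Cpow (v T) (S N))) with
    (Cplus (Cminus (Cplus (v T) (Cmult (H N T) (Defs.Cpow (v T) (S N)))) (v 0)) (Copp (Cminus (v T) (v 0)))) by ring.
  eapply Rle_trans; [apply Cmod_triangle|]. rewrite Cmod_opp. lra. }
assert (rN : r ^ (N + 2) = r ^ S N * r) by (replace (N + 2)%nat with (S (S N)) by lia; simpl; ring).
assert (rN0 : 0 < r ^ S N) by (apply pow_lt; exact rp).
assert (vT : r / 2 <= Cmod (v T)).
{ assert (A3 := Cmod_sub_le (v 0) (v T)). rewrite Cminus_sym in A3. rewrite Hv0 in A3 at 1.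
  rewrite Cmod_R, Rabs_pos_eq in A3 by lra.
  assert (K * r ^ (N + 2) <= r / 2); [|unfold N in *; lra].
  rewrite rN. assert (r ^ S N <= r).
  { change (r * r ^ N <= r). assert (r ^ N <= 1) by (rewrite <- (pow1 N); apply pow_incr; lra).
    assert (0 <= r ^ N) by (apply pow_le; lra). nra. }
  assert (r ^ S N * r <= r * r) by (apply Rmult_le_compat_r; lra).
  apply Rle_trans with (K * (r * r)); [apply Rmult_le_compat_l; lra|]. nra. }
assert (A4 : Cmod (H N T) * (r / 2) ^ S N <= (C + K) * (r ^ S N * r)).
{ rewrite <- rN. eapply Rle_trans; [|exact A2]. apply Rmult_le_compat_l; [apply Cmod_ge_0|]. apply pow_incr. lra. }
assert (A5 : Cmod (H N T) <= 2 ^ S N * (C + K) * r).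
{ apply Rmult_le_reg_r with ((r / 2) ^ S N); [apply pow_lt; lra|].
  eapply Rle_trans; [exact A4|]. apply Req_le. unfold Rdiv. rewrite Rpow_mult_distr.
  replace ((C + K) * (r ^ S N * r)) with ((C + K) * (r ^ S N * r) * (2 ^ S N * (/ 2) ^ S N)).
  - ring.
  - rewrite <- Rpow_mult_distr, Rinv_r, pow1 by lra. ring. }
eapply Rle_trans; [exact A5|]. apply Rmult_le_compat_l; [|exact re].
apply Rmult_le_pos; [apply pow_le; lra|lra].
Qed.

Lemma pow_lip y y' rho n : Cmod y <= rho -> Cmod y' <= rho ->
  Cmod (Cminus (Defs.Cpow y (S n)) (Defs.Cpow y' (S n))) <= INR (S n) * rho ^ n * Cmod (Cminus y y').
Proof.
intros H1 H2. assert (rho0 : 0 <= rho) by (eapply Rle_trans; [apply Cmod_ge_0|exact H1]).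
induction n as [|n IH].
- simpl. replace (Cminus (Cmult y (RtoC 1)) (Cmult y' (RtoC 1))) with (Cminus y y') by ring. lra.
- rewrite (Cpow_S y (S n)), (Cpow_S y' (S n)).
  replace (Cminus (Cmult y (Defs.Cpow y (S n))) (Cmult y' (Defs.Cpow y' (S n)))) with
    (Cplus (Cmult y (Cminus (Defs.Cpow y (S n)) (Defs.Cpow y' (S n)))) (Cmult (Cminus y y') (Defs.Cpow y' (S n)))) by ring.
  eapply Rle_trans; [apply Cmod_triangle|]. rewrite !Cmod_mult, Cmod_pow.
  assert (A : Cmod y * Cmod (Cminus (Defs.Cpow y (S n)) (Defs.Cpow y' (S n))) <= rho * (INR (S n) * rho ^ n * Cmod (Cminus y y'))).
  { apply Rmult_le_compat; try assumption; apply Cmod_ge_0. }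
  assert (B : Cmod (Cminus y y') * Cmod y' ^ S n <= Cmod (Cminus y y') * rho ^ S n).
  { apply Rmult_le_compat_l; [apply Cmod_ge_0|]. apply pow_incr. split; [apply Cmod_ge_0|exact H2]. }
  rewrite (S_INR (S n)). simpl (rho ^ S n) in *. lra.
Qed.

(** Let [Phi(y)] be the sum of [G_n(T) y^(n+1)] over [n <= N]. Closedness makes
    [Phi(v T) - Phi(v 0)] of order [r^(N+2)], and since [Phi] is tangent to the identity at 0,
    [v T - v 0] is at most twice as large. *)
Lemma flat_of_first_integral (G : nat -> R -> CC) : (forall x, 0 <= x <= T -> G O x = RtoC 1) ->
  (forall n, exists B, forall x, 0 <= x <= T -> Cmod (G n x) <= B) ->
  (forall n x, 0 <= x <= T -> cder (G n) x (gder a G n x)) -> (forall n, G n T = G n 0) -> flat.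
Proof.
intros G0 GB Gd Gc N.
assert (HB : exists B, 0 <= B /\ forall n x, (n <= N)%nat -> 0 <= x <= T -> Cmod (G n x) <= B).
{ clear -GB. induction N as [|N [B [HB IH]]].
  - destruct (GB O) as [B HB]. exists (Rabs B). split; [apply Rabs_pos|]. intros n x Hn Hx. replace n with O by lia.
    eapply Rle_trans; [apply HB; exact Hx|apply Rle_abs].
  - destruct (GB (S N)) as [B' HB']. exists (Rmax B B'). split; [eapply Rle_trans; [exact HB|apply Rmax_l]|].
    intros n x Hn Hx. destruct (Nat.eq_dec n (S N)) as [->|Hne].
    + eapply Rle_trans; [apply HB'; exact Hx|apply Rmax_r].
    + eapply Rle_trans; [apply IH; [lia|exact Hx]|apply Rmax_l]. }
destruct HB as [B [B0 HB]].
set (C := 4 * T * INR (S N) ^ 2 * B * M ^ S N * 4 ^ (N + 2)).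
assert (C0 : 0 <= C).
{ unfold C. posc. }
set (L := INR (S N) * (B * INR (S N))).
assert (L0 : 0 <= L) by (unfold L; repeat apply Rmult_le_pos; try assumption; apply pos_INR).
set (D := 64 * M * (1 + T) * (1 + L)).
assert (D0 : 0 < D) by (unfold D; repeat apply Rmult_lt_0_compat; lra).
exists (2 * C), (/ D). split; [apply Rinv_0_lt_compat; exact D0|]. split; [lra|].
intros v r Hr Hv Hv0.
assert (rD' : D * r <= 1).
{ destruct Hr as [_ Hr]. apply Rlt_le in Hr. apply Rmult_le_compat_l with (r := D) in Hr; [|lra]. rewrite Rinv_r in Hr by lra. exact Hr. }
unfold D in rD'.
assert (Mr : 0 < M * r) by (apply Rmult_lt_0_compat; lra).
assert (MTr : 0 < M * T * r) by (repeat apply Rmult_lt_0_compat; lra).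
assert (p1 : 64 * (M * r) + 64 * (M * T * r) <= 1).
{ assert (0 <= L * (64 * M * (1 + T) * r)) by (apply Rmult_le_pos; [lra|]; repeat apply Rmult_le_pos; lra). nra. }
assert (p2 : 64 * (L * r) <= 1).
{ assert (L * r <= L * (M * r)) by (apply Rmult_le_compat_l; nra).
  assert (0 <= L * (M * r)) by (apply Rmult_le_pos; lra).
  assert (0 <= L * (M * T * r)) by (apply Rmult_le_pos; lra). nra. }
assert (Hb := apriori v (2 * r) Hv ltac:(rewrite Hv0, Cmod_R, Rabs_pos_eq; lra) ltac:(nra) ltac:(nra)).
assert (A := first_integral T M a HT HM Ha G v (2 * (2 * r)) B N Hv Hb ltac:(nra) HB (fun n x _ Hx => Gd n x Hx)).
rewrite (csum_ext _ (fun n => Cmult (G n 0) (Defs.Cpow (v 0) (S n))) (fun n => Cmult (G n T) (Defs.Cpow (v 0) (S n)))) in A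
  by (intros; rewrite Gc; reflexivity).
assert (r4 : 2 * (2 * r) <= 1) by nra.
set (y := v T) in *. set (y' := v 0) in *.
assert (Hy : Cmod y <= 2 * (2 * r)) by (apply Hb; lra).
assert (Hy' : Cmod y' <= 2 * (2 * r)) by (apply Hb; lra).
assert (E : forall n, (n <= N)%nat -> Cmod (Cminus (Cminus (csum (S n) (fun k => Cmult (G k T) (Defs.Cpow y (S k)))) (csum (S n) (fun k => Cmult (G k T) (Defs.Cpow y' (S k))))) (Cminus y y'))
   <= INR n * (B * INR (S N) * (2 * (2 * r)) * Cmod (Cminus y y'))).
{ intros n. induction n as [|n IH]; intros Hn.
  - rewrite !csum_S. simpl. rewrite G0 by lra.
    match goal with |- Cmod ?c <= _ => replace c with (RtoC 0) by ring end. rewrite Cmod_0. lra.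
  - rewrite (csum_S (S n)), (csum_S (S n) (fun k => Cmult (G k T) (Defs.Cpow y' (S k)))).
    match goal with |- Cmod (Cminus (Cminus (Cplus ?s ?u) (Cplus ?s' ?u')) ?w) <= _ =>
      replace (Cminus (Cminus (Cplus s u) (Cplus s' u')) w) with (Cplus (Cminus (Cminus s s') w) (Cminus u u')) by ring end.
    eapply Rle_trans; [apply Cmod_triangle|]. specialize (IH ltac:(lia)). rewrite (S_INR n).
    assert (P : Cmod (Cminus (Cmult (G (S n) T) (Defs.Cpow y (S (S n)))) (Cmult (G (S n) T) (Defs.Cpow y' (S (S n)))))
       <= B * INR (S N) * (2 * (2 * r)) * Cmod (Cminus y y')).
    { replace (Cminus (Cmult (G (S n) T) (Defs.Cpow y (S (S n)))) (Cmult (G (S n) T) (Defs.Cpow y' (S (S n)))))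
        with (Cmult (G (S n) T) (Cminus (Defs.Cpow y (S (S n))) (Defs.Cpow y' (S (S n))))) by ring.
      rewrite Cmod_mult.
      assert (P1 := pow_lip y y' (2 * (2 * r)) (S n) Hy Hy').
      assert (P2 : Cmod (G (S n) T) <= B) by (apply HB; [lia|lra]).
      assert (P3 : INR (S (S n)) * (2 * (2 * r)) ^ S n * Cmod (Cminus y y') <= INR (S N) * (2 * (2 * r)) * Cmod (Cminus y y')).
      { apply Rmult_le_compat_r; [apply Cmod_ge_0|]. apply Rmult_le_compat; [apply pos_INR|apply pow_le; lra|apply le_INR; lia|].
        simpl. rewrite <- (Rmult_1_r (2 * (2 * r))) at 3. apply Rmult_le_compat_l; [lra|]. rewrite <- (pow1 n). apply pow_incr. lra. }
      apply Rle_trans with (B * (INR (S N) * (2 * (2 * r)) * Cmod (Cminus y y'))); [|apply Req_le; ring].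
      apply Rmult_le_compat; try apply Cmod_ge_0; lra. }
    lra. }
specialize (E N (le_n N)). set (s := Cminus (csum (S N) _) _) in *.
assert (F1 := Cmod_sub_le (Cminus y y') s). rewrite (Cminus_sym (Cminus y y') s) in F1.
assert (F2 : INR N * (B * INR (S N) * (2 * (2 * r)) * Cmod (Cminus y y')) <= / 2 * Cmod (Cminus y y')).
{ rewrite <- !Rmult_assoc. apply Rmult_le_compat_r; [apply Cmod_ge_0|].
  assert (INR N * (B * INR (S N)) <= L).
  { unfold L. apply Rmult_le_compat_r; [apply Rmult_le_pos; [exact B0|apply pos_INR]|]. rewrite S_INR. lra. }
  assert (INR N * (B * INR (S N)) * r <= L * r) by (apply Rmult_le_compat_r; lra). nra. }
assert (F3 : Cmod s <= C * r ^ (N + 2)).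
{ eapply Rle_trans; [exact A|]. unfold C. replace (2 * (2 * r)) with (4 * r) by ring. rewrite (Rpow_mult_distr 4 r). apply Req_le. ring. }
lra.
Qed.

End Crit.
End Criterion.

(** * Existence of small solutions by Picard iteration *)

Module Picard.
Import CxAnalysis FirstIntegral Criterion.

Section Rhs.
Variables (M rho : R) (b : nat -> R -> CC).
Hypotheses (HM : 1 <= M) (Hrho : 0 <= rho) (Hs : 4 * (M * rho) <= 1).
Hypothesis Hb : forall i x, (1 <= i)%nat -> Cmod (b i x) <= M ^ i.
Hypothesis Hc : forall i x, (1 <= i)%nat -> ccont (b i) x.

Definition term (s : R) (y : CC) (n : nat) : CC := Cmult (b (S n) s) (Defs.Cpow y (n + 2)).

(** The sum of the series, meaningful in the disc [|y| <= rho], where [rhs_series] applies. *)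
Definition rhs (s : R) (y : CC) : CC :=
  ClassicalEpsilon.epsilon (inhabits (RtoC 0))
    (fun l => is_series (K := C_AbsRing) (V := C_NormedModule) (term s y) l).

Lemma term_bound s y n : Cmod y <= rho -> Cmod (term s y n) <= M * rho ^ 2 * (M * rho) ^ n.
Proof.
intros Hy. unfold term. rewrite Cmod_mult, Cmod_pow.
replace (M * rho ^ 2 * (M * rho) ^ n) with (M ^ S n * rho ^ (n + 2)).
- apply Rmult_le_compat; [apply Cmod_ge_0|apply pow_le, Cmod_ge_0|apply Hb; lia|].
  apply pow_incr. split; [apply Cmod_ge_0|exact Hy].
- rewrite Rpow_mult_distr, pow_add. simpl. ring.
Qed.

Lemma series_exists (u : nat -> CC) K q : 0 <= K -> 0 <= q <= / 2 -> (forall n, Cmod (u n) <= K * q ^ n) ->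
  exists l, is_series (K := C_AbsRing) (V := C_NormedModule) u l.
Proof.
intros HK Hq H.
apply (ex_series_le (K := C_AbsRing) (V := C_CompleteNormedModule) u (fun n => K * q ^ n)).
- intros n. apply H.
- apply (ex_series_scal_l (K := R_AbsRing) (V := R_NormedModule) K (fun n => q ^ n)). apply ex_series_geom.
  rewrite Rabs_pos_eq; lra.
Qed.

Lemma q_bounds : 0 <= M * rho <= / 2.
Proof. split; [apply Rmult_le_pos; lra|lra]. Qed.

Lemma rhs_series s y : Cmod y <= rho -> is_series (K := C_AbsRing) (V := C_NormedModule) (term s y) (rhs s y).
Proof.
intros Hy. unfold rhs.
apply (ClassicalEpsilon.epsilon_spec (inhabits (RtoC 0)) (fun l => is_series (K := C_AbsRing) (V := C_NormedModule) (term s y) l)).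
apply (series_exists _ (M * rho ^ 2) (M * rho)); [posc|apply q_bounds|].
intros n. apply term_bound. exact Hy.
Qed.

Lemma rhs_tail' s y m : Cmod y <= rho -> Cmod (Cminus (rhs s y) (csum m (term s y))) <= 2 * (M * rho ^ 2) * (M * rho) ^ m.
Proof.
intros Hy. apply series_tail; [posc|apply q_bounds| |apply rhs_series; exact Hy].
intros n. apply term_bound. exact Hy.
Qed.

Lemma rhs_le s y : Cmod y <= rho -> Cmod (rhs s y) <= 2 * (M * rho ^ 2).
Proof.
intros Hy. assert (A := rhs_tail' s y 0 Hy). simpl csum in A.
replace (Cminus (rhs s y) (RtoC 0)) with (rhs s y) in A by ring. rewrite pow_O in A. lra.
Qed.

Lemma rhs_lip s y y' : Cmod y <= rho -> Cmod y' <= rho ->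
  Cmod (Cminus (rhs s y) (rhs s y')) <= 4 * (M * rho) * Cmod (Cminus y y').
Proof.
intros Hy Hy'.
assert (S1 := rhs_series s y Hy). assert (S2 := rhs_series s y' Hy').
assert (S3 := is_series_minus (K := C_AbsRing) (V := C_NormedModule) _ _ _ _ S1 S2).
assert (T1 : forall n, Cmod (Cminus (term s y n) (term s y' n)) <= 2 * (M * rho) * Cmod (Cminus y y') * (2 * (M * rho)) ^ n).
{ intros n. unfold term. replace (Cminus (Cmult (b (S n) s) (Defs.Cpow y (n + 2))) (Cmult (b (S n) s) (Defs.Cpow y' (n + 2))))
    with (Cmult (b (S n) s) (Cminus (Defs.Cpow y (n + 2)) (Defs.Cpow y' (n + 2)))) by ring.
  rewrite Cmod_mult. replace (n + 2)%nat with (S (S n)) by lia.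
  assert (P1 := pow_lip y y' rho (S n) Hy Hy').
  assert (P2 : Cmod (b (S n) s) <= M ^ S n) by (apply Hb; lia).
  assert (P3 : INR (S (S n)) <= 2 * 2 ^ n).
  { clear. induction n as [|n IH]; [simpl; lra|]. rewrite S_INR. simpl (2 ^ S n).
    assert (1 <= 2 ^ n) by (apply pow_R1_Rle; lra). lra. }
  apply Rle_trans with (M ^ S n * (INR (S (S n)) * rho ^ S n * Cmod (Cminus y y'))).
  - apply Rmult_le_compat; try assumption; apply Cmod_ge_0.
  - apply Rle_trans with (M ^ S n * (2 * 2 ^ n * rho ^ S n * Cmod (Cminus y y'))).
    + apply Rmult_le_compat_l; [posc|]. apply Rmult_le_compat_r; [posc|]. apply Rmult_le_compat_r; [posc|exact P3].
    + apply Req_le. rewrite !Rpow_mult_distr. simpl. ring. }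
assert (Mr := q_bounds).
assert (A := series_tail _ _ (2 * (M * rho) * Cmod (Cminus y y')) (2 * (M * rho)) 0
  ltac:(apply Rmult_le_pos; [lra|apply Cmod_ge_0]) ltac:(lra) T1 S3).
simpl csum in A. rewrite pow_O in A.
change (plus (rhs s y) (opp (rhs s y'))) with (Cminus (rhs s y) (rhs s y')) in A.
replace (Cminus (Cminus (rhs s y) (rhs s y')) (RtoC 0)) with (Cminus (rhs s y) (rhs s y')) in A by ring. lra.
Qed.

Lemma ccont_unif (f : R -> CC) x : (forall e, 0 < e -> exists g, ccont g x /\ forall t, Cmod (Cminus (f t) (g t)) <= e) -> ccont f x.
Proof.
intros H. apply ccont_eps. intros e He. destruct (H (e / 4) ltac:(lra)) as [g [Hg Hfg]].
destruct (proj1 (ccont_eps g x) Hg (e / 4) ltac:(lra)) as [d [Hd H1]].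
exists d. split; [exact Hd|]. intros y Hy. specialize (H1 y Hy).
replace (Cminus (f y) (f x)) with (Cplus (Cplus (Cminus (f y) (g y)) (Cminus (g y) (g x))) (Copp (Cminus (f x) (g x)))) by ring.
eapply Rle_lt_trans; [apply Cmod_triangle|]. rewrite Cmod_opp.
assert (A := Hfg y). assert (B := Hfg x).
assert (C := Cmod_triangle (Cminus (f y) (g y)) (Cminus (g y) (g x))). lra.
Qed.

Lemma rhs_cont (y : R -> CC) x : (forall t, Cmod (y t) <= rho) -> ccont y x -> ccont (fun s => rhs s (y s)) x.
Proof.
intros Hy Hcy. apply ccont_unif. intros e He.
assert (Mr := q_bounds).
destruct (pow_lt_1_zero (M * rho) ltac:(rewrite Rabs_pos_eq; lra) (e / (2 * (M * rho ^ 2) + 1))) as [N HN].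
{ apply Rdiv_lt_0_compat; [lra|]. assert (0 <= M * rho ^ 2) by posc. lra. }
specialize (HN N (le_n N)). rewrite Rabs_pos_eq in HN by (apply pow_le; lra).
exists (fun s => csum N (term s (y s))). split.
- apply (ccont_csum N (fun n s => term s (y s) n)). intros i Hi. unfold term.
  apply ccont_mult; [apply Hc; lia|]. apply ccont_pow. exact Hcy.
- intros t. eapply Rle_trans; [apply rhs_tail'; apply Hy|].
  assert (P0 : 0 <= M * rho ^ 2) by posc.
  apply Rle_trans with (2 * (M * rho ^ 2) * (e / (2 * (M * rho ^ 2) + 1))); [apply Rmult_le_compat_l; lra|].
  apply Rmult_le_reg_r with (2 * (M * rho ^ 2) + 1); [lra|].
  replace (2 * (M * rho ^ 2) * (e / (2 * (M * rho ^ 2) + 1)) * (2 * (M * rho ^ 2) + 1)) with (2 * (M * rho ^ 2) * e) by (field; lra).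
  nra.
Qed.
End Rhs.

Section Clamp.
Variable T : R.
Hypothesis HT : 0 < T.
(** [is_solution] asks for two-sided derivatives at 0 and [T], so coefficients are frozen outside
    the interval and the iteration runs on the whole line. *)
Definition clamp (x : R) : R := Rmax 0 (Rmin x T).

Lemma clamp_in x : 0 <= clamp x <= T.
Proof.
unfold clamp. split; [apply Rmax_l|]. apply Rmax_lub; [lra|apply Rmin_r].
Qed.

Lemma clamp_id x : 0 <= x <= T -> clamp x = x.
Proof. intros Hx. unfold clamp. rewrite Rmin_left by lra. apply Rmax_right. lra. Qed.

Lemma clamp_cont x : continuous clamp x.
Proof.
apply (filterlim_locally_ball_norm (K := R_AbsRing) (U := R_NormedModule) clamp (clamp x)).
intros [e He]. exists (mkposreal e He). intros y Hy.
change (Rabs (y - x) < e) in Hy. change (Rabs (clamp y - clamp x) < e).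
assert (K : forall u w : R, Rabs (w - u) < e -> Rabs (clamp w - clamp u) < e); [|exact (K x y Hy)].
clear x y Hy. intros u w Hy.
apply Rabs_def2 in Hy. unfold clamp, Rmin. destruct (Rle_dec w T), (Rle_dec u T); unfold Rmax;
repeat match goal with |- context [Rle_dec ?u ?w] => destruct (Rle_dec u w) end; apply Rabs_def1; lra.
Qed.
End Clamp.

Section Exist.
Variables (T M : R) (a b : nat -> R -> CC).
Hypotheses (HT : 0 < T) (HM : 1 <= M).
Hypothesis Hb : forall i x, (1 <= i)%nat -> Cmod (b i x) <= M ^ i.
Hypothesis Hc : forall i x, (1 <= i)%nat -> ccont (b i) x.
Hypothesis Hab : forall i x, (1 <= i)%nat -> 0 <= x <= T -> b i x = a i x.
Variable r : R.
Hypotheses (Hr : 0 < r) (Hr1 : 16 * M * (1 + T) * r <= 1).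

Notation rho := (2 * r).
Notation f := (rhs b).

Lemma small1 : 4 * (M * rho) <= 1.
Proof. assert (0 < M * r) by (apply Rmult_lt_0_compat; lra). assert (0 < M * T * r) by (repeat apply Rmult_lt_0_compat; lra). nra. Qed.
Lemma small2 : T * (4 * (M * rho)) <= / 2.
Proof. assert (0 < M * r) by (apply Rmult_lt_0_compat; lra). assert (0 < M * T * r) by (repeat apply Rmult_lt_0_compat; lra). nra. Qed.
Lemma small3 : T * (2 * (M * rho ^ 2)) <= r.
Proof. assert (A := small2). simpl. nra. Qed.

(** The Picard operator on functions bounded by [2 r]: [small3] keeps the bound, and [small2] makes
    it contract by one half. Clamping the upper limit makes both estimates uniform on the line. *)
Definition next (y : R -> CC) (x : R) : CC := Cplus (RtoC r) (cint (fun s => f s (y s)) 0 (clamp T x)).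

Definition admissible (y : R -> CC) := (forall x, ccont y x) /\ forall x, Cmod (y x) <= rho.

Lemma rhs_admissible y x : admissible y -> ccont (fun s => f s (y s)) x.
Proof. intros [H1 H2]. apply (rhs_cont M rho b HM ltac:(lra) small1 Hb Hc y x H2 (H1 x)). Qed.

Lemma next_admissible y : admissible y -> admissible (next y).
Proof.
intros Hy. split.
- intros x. apply ccont_plus; [apply ccont_const|].
  apply (ccont_comp (fun t => cint (fun s => f s (y s)) 0 t) (clamp T)); [apply clamp_cont; exact HT|].
  apply (ccont_cder _ _ (f (clamp T x) (y (clamp T x)))).
  apply (cint_cder (fun s => f s (y s))). intros t. apply rhs_admissible. exact Hy.
- intros x. destruct (clamp_in T HT x) as [c0 c1]. unfold next.
  eapply Rle_trans; [apply Cmod_triangle|]. rewrite Cmod_R, Rabs_pos_eq by lra.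
  assert (A := cint_bound (fun s => f s (y s)) 0 (clamp T x) (2 * (M * rho ^ 2)) c0
    (fun t _ => rhs_admissible y t Hy)
    (fun t _ => rhs_le M rho b HM ltac:(lra) small1 Hb t (y t) (proj2 Hy t))).
  assert (0 <= 2 * (M * rho ^ 2)) by posc.
  assert ((clamp T x - 0) * (2 * (M * rho ^ 2)) <= T * (2 * (M * rho ^ 2))) by (apply Rmult_le_compat_r; lra).
  assert (B := small3). lra.
Qed.

Lemma cint_minus (g h : R -> CC) x y : (forall t, ccont g t) -> (forall t, ccont h t) ->
  Cminus (cint g x y) (cint h x y) = cint (fun t => Cminus (g t) (h t)) x y.
Proof.
intros Hg Hh. symmetry. apply (is_RInt_unique (V := C_R_CompleteNormedModule)).
apply (is_RInt_minus (V := C_R_CompleteNormedModule)); apply cint_exists; intros; [apply Hg|apply Hh].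
Qed.

Lemma next_contract y y' d : admissible y -> admissible y' -> (forall x, Cmod (Cminus (y x) (y' x)) <= d) ->
  forall x, Cmod (Cminus (next y x) (next y' x)) <= d / 2.
Proof.
intros Hy Hy' Hd x. destruct (clamp_in T HT x) as [c0 c1]. unfold next.
assert (d0 : 0 <= d) by (eapply Rle_trans; [apply Cmod_ge_0|apply (Hd 0)]).
match goal with |- Cmod (Cminus (Cplus ?c ?u) (Cplus ?c ?w)) <= _ => replace (Cminus (Cplus c u) (Cplus c w)) with (Cminus u w) by ring end.
rewrite cint_minus by (intros; apply rhs_admissible; assumption).
eapply Rle_trans; [apply (cint_bound _ 0 (clamp T x) (4 * (M * rho) * d) c0)|].
- intros t _. unfold Cminus. apply ccont_plus; [apply rhs_admissible; assumption|].
  apply (continuous_opp (V := CV)). apply rhs_admissible; assumption.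
- intros t _. eapply Rle_trans; [exact (rhs_lip M rho b HM ltac:(lra) small1 Hb t (y t) (y' t) (proj2 Hy t) (proj2 Hy' t))|].
  apply Rmult_le_compat_l; [posc|apply Hd].
- assert (A := small2). assert (0 <= 4 * (M * rho) * d) by posc.
  assert ((clamp T x - 0) * (4 * (M * rho) * d) <= T * (4 * (M * rho) * d)) by (apply Rmult_le_compat_r; lra).
  nra.
Qed.

Fixpoint iter (n : nat) : R -> CC := match n with O => fun _ => RtoC r | S m => next (iter m) end.

Lemma iter_admissible n : admissible (iter n).
Proof.
induction n as [|n IH]; [|apply next_admissible; exact IH].
split; intros x; [apply ccont_const|]. simpl. rewrite Cmod_R, Rabs_pos_eq; lra.
Qed.

Lemma iter_diff n x : Cmod (Cminus (iter (S n) x) (iter n x)) <= 3 * r * (/ 2) ^ n.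
Proof.
revert x. induction n as [|n IH]; intros x.
- assert (A := proj2 (iter_admissible 1) x). rewrite pow_O. simpl (iter 0 x).
  unfold Cminus. eapply Rle_trans; [apply Cmod_triangle|]. rewrite Cmod_opp, Cmod_R, Rabs_pos_eq by lra. lra.
- assert (A := next_contract _ _ _ (iter_admissible (S n)) (iter_admissible n) IH x).
  simpl (iter (S (S n))). simpl (iter (S n)) in *. eapply Rle_trans; [exact A|]. simpl. lra.
Qed.

Lemma iter_limit : exists y, forall n x, Cmod (Cminus (y x) (iter n x)) <= 6 * r * (/ 2) ^ n.
Proof.
set (u := fun x n => Cminus (iter (S n) x) (iter n x)).
assert (E : forall x, exists l, is_series (K := C_AbsRing) (V := C_NormedModule) (u x) l).
{ intros x. apply (series_exists _ (3 * r) (/ 2)); [lra|lra|]. intros n. apply iter_diff. }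
set (l := fun x => proj1_sig (ClassicalEpsilon.constructive_indefinite_description _ (E x))).
assert (Hl : forall x, is_series (K := C_AbsRing) (V := C_NormedModule) (u x) (l x)).
{ intros x. unfold l. destruct (ClassicalEpsilon.constructive_indefinite_description _ (E x)) as [z Hz]. exact Hz. }
exists (fun x => Cplus (RtoC r) (l x)). intros n x.
assert (A := series_tail (u x) (l x) (3 * r) (/ 2) n ltac:(lra) ltac:(lra) (fun i => iter_diff i x) (Hl x)).
assert (S1 : csum n (u x) = Cminus (iter n x) (RtoC r)).
{ clear A. induction n as [|n IH]; [simpl; ring|]. rewrite csum_S, IH. unfold u. ring. }
rewrite S1 in A. replace (Cminus (Cplus (RtoC r) (l x)) (iter n x)) with (Cminus (l x) (Cminus (iter n x) (RtoC r))) by ring.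
lra.
Qed.

Lemma half_pow_small e C : 0 < e -> 0 <= C -> exists n, C * (/ 2) ^ n <= e.
Proof.
intros He HC. destruct (pow_lt_1_zero (/ 2) ltac:(rewrite Rabs_pos_eq; lra) (e / (C + 1))) as [N HN].
{ apply Rdiv_lt_0_compat; lra. }
specialize (HN N (le_n N)). rewrite Rabs_pos_eq in HN by (apply pow_le; lra). exists N.
apply Rle_trans with (C * (e / (C + 1))); [apply Rmult_le_compat_l; lra|].
apply Rmult_le_reg_r with (C + 1); [lra|]. replace (C * (e / (C + 1)) * (C + 1)) with (C * e) by (field; lra). nra.
Qed.

Lemma solution_exists : exists v, is_solution T a v /\ v 0 = RtoC r.
Proof.
destruct iter_limit as [y Hy].
assert (Ay : admissible y).
{ split.
  - intros x. apply ccont_unif. intros e He. destruct (half_pow_small e (6 * r) He ltac:(lra)) as [n Hn].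
    exists (iter n). split; [apply iter_admissible|]. intros t. eapply Rle_trans; [apply Hy|exact Hn].
  - intros x. apply Rnot_lt_le. intros Hlt.
    destruct (half_pow_small ((Cmod (y x) - rho) / 2) (6 * r) ltac:(lra) ltac:(lra)) as [n Hn].
    assert (A := Cmod_sub_le (y x) (iter n x)). assert (B := Hy n x). assert (C := proj2 (iter_admissible n) x). lra. }
assert (fix_y : forall x, y x = next y x).
{ intros x. assert (Z : Cmod (Cminus (y x) (next y x)) = 0).
  { apply (le_all_zero _ 2); [apply Cmod_ge_0|]. intros e He.
    destruct (half_pow_small e (6 * r) He ltac:(lra)) as [n Hn].
    assert (A := Hy (S n) x). assert (B := next_contract _ _ _ Ay (iter_admissible n) (Hy n) x).
    rewrite Cminus_sym in B.
    replace (Cminus (y x) (next y x)) with (Cplus (Cminus (y x) (iter (S n) x)) (Cminus (next (iter n) x) (next y x))) by (simpl; ring).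
    eapply Rle_trans; [apply Cmod_triangle|]. simpl in A. simpl (iter (S n)).
    assert (0 <= (/ 2) ^ n) by (apply pow_le; lra). nra. }
  apply Cmod_eq_0 in Z. replace (y x) with (Cplus (Cminus (y x) (next y x)) (next y x)) by ring. rewrite Z. ring. }
(* The same integral without the clamp agrees with the fixed point on the interval and is
   differentiable at the endpoints as well. *)
set (v := fun x => Cplus (RtoC r) (cint (fun s => f s (y s)) 0 x)).
assert (vy : forall x, 0 <= x <= T -> v x = y x).
{ intros x Hx. rewrite fix_y. unfold v, next. rewrite clamp_id by exact Hx. reflexivity. }
exists v. split.
- intros x Hx. exists (f x (y x)). split.
  + refine (cder_ext _ _ _ _ _ (fun t => eq_refl) _ (cder_plus _ _ _ _ _ (cder_const (RtoC r) x)
      (cint_cder (fun s => f s (y s)) 0 x (fun t => rhs_admissible y t Ay)))). cring.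
  + refine (is_series_ext (K := C_AbsRing) (V := C_NormedModule) _ _ _ _
      (rhs_series M rho b HM ltac:(lra) small1 Hb x (y x) (proj2 Ay x))).
    intros n. unfold term. rewrite vy by exact Hx. rewrite Hab by (lia || exact Hx). reflexivity.
- unfold v. rewrite cint_point. ring.
Qed.

End Exist.
End Picard.

(** * Algebraic geometry over the complex numbers *)

Module RealsUncountable.

Section Cantor.
Variable e : nat -> R.

(** Cantor's nested intervals: keep the outer third on the side of the midpoint away from [e n]. *)
Definition shrink (n : nat) (p : R * R) : R * R :=
  let (a, b) := p in
  if Rle_dec (e n) ((a + b) / 2) then ((a + 2 * b) / 3, b) else (a, (2 * a + b) / 3).

Fixpoint nest (n : nat) : R * R := match n with O => (0, 1) | S m => shrink m (nest m) end.

Lemma nest_lt n : fst (nest n) < snd (nest n).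
Proof.
induction n as [|n IH]; simpl; [lra|]. unfold shrink. destruct (nest n) as [a b]. simpl in *.
destruct (Rle_dec (e n) ((a + b) / 2)); simpl; lra.
Qed.

Lemma nest_step n : fst (nest n) <= fst (nest (S n)) /\ snd (nest (S n)) <= snd (nest n) /\
  (e n < fst (nest (S n)) \/ snd (nest (S n)) < e n).
Proof.
assert (A := nest_lt n). simpl. unfold shrink. destruct (nest n) as [a b]. simpl in *.
destruct (Rle_dec (e n) ((a + b) / 2)); simpl; lra.
Qed.

Lemma nest_mono m n : (m <= n)%nat -> fst (nest m) <= fst (nest n) /\ snd (nest n) <= snd (nest m).
Proof.
induction 1 as [|n H IH]; [lra|]. assert (A := nest_step n). lra.
Qed.

Lemma nest_cross m n : fst (nest m) < snd (nest n).
Proof.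
assert (A := nest_mono m (max m n) ltac:(lia)). assert (B := nest_mono n (max m n) ltac:(lia)).
assert (C := nest_lt (max m n)). lra.
Qed.

Lemma not_enumerable : exists x, forall n, e n <> x.
Proof.
destruct (completeness (fun y => exists n, y = fst (nest n))) as [x [Hub Hl]].
- exists (snd (nest 0)). intros y [n ->]. left. apply nest_cross.
- exists (fst (nest 0)). exists O. reflexivity.
- exists x. intros n En.
  assert (A : fst (nest (S n)) <= x) by (apply Hub; exists (S n); reflexivity).
  assert (B : x <= snd (nest (S n))) by (apply Hl; intros y [m ->]; left; apply nest_cross).
  assert (C := nest_step n). lra.
Qed.
End Cantor.
End RealsUncountable.

(** * The complex numbers as an algebraically closed, uncountable field *)

Module CField.
Import all_boot all_algebra Rstruct complex.
Set Implicit Arguments. Unset Strict Implicit. Unset Printing Implicit Defensive.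
Import GRing.Theory.
Local Open Scope ring_scope.

(* A separate name, because [Complex.C] unfolds to [R * R], for which the product ring structure would be inferred. *)
Definition CF := Complex.C.
HB.instance Definition _ := Choice.copy CF (Rdefinitions.R * Rdefinitions.R)%type.

Lemma CF_addA : associative (Cplus : CF -> CF -> CF).
Proof. exact: Cplus_assoc. Qed.
Lemma CF_addC : commutative (Cplus : CF -> CF -> CF).
Proof. exact: Cplus_comm. Qed.
Lemma CF_add0 : left_id (RtoC 0 : CF) Cplus.
Proof. exact: Cplus_0_l. Qed.
Lemma CF_addN : left_inverse (RtoC 0 : CF) Copp Cplus.
Proof. by move=> x; rewrite Cplus_comm Cplus_opp_r. Qed.
HB.instance Definition _ := GRing.isZmodule.Build CF CF_addA CF_addC CF_add0 CF_addN.

Lemma CF_mulA : associative (Cmult : CF -> CF -> CF).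
Proof. exact: Cmult_assoc. Qed.
Lemma CF_mulC : commutative (Cmult : CF -> CF -> CF).
Proof. exact: Cmult_comm. Qed.
Lemma CF_mul1 : left_id (RtoC 1 : CF) Cmult.
Proof. exact: Cmult_1_l. Qed.
Lemma CF_mulD : left_distributive (Cmult : CF -> CF -> CF) +%R.
Proof. by move=> x y t; apply: Cmult_plus_distr_r. Qed.
Lemma CF_one : (RtoC 1 : CF) != 0.
Proof. by apply/eqP => -[] /R1_neq_R0. Qed.
HB.instance Definition _ := GRing.Zmodule_isComNzRing.Build CF CF_mulA CF_mulC CF_mul1 CF_mulD CF_one.

Lemma CF_mulV (x : CF) : x != 0 -> (Cinv x : CF) * x = 1.
Proof. by move/eqP => x0; exact: (Cinv_l x x0). Qed.
Lemma CF_inv0 : Cinv (0 : CF) = 0 :> CF.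
Proof.
rewrite /Cinv /=; congr pair; rewrite /Rdiv ?Ropp_0 Rmult_0_l //.
Qed.
HB.instance Definition _ := GRing.ComNzRing_isField.Build CF CF_mulV CF_inv0.

Lemma CF_ch0 n : n.+1%:R != 0 :> CF.
Proof.
suff h m : (m%:R : CF) = RtoC (INR m).
  rewrite h; apply/eqP => -[] e; apply: (not_0_INR n.+1) e; exact: PeanoNat.Nat.neq_succ_0.
elim: m => // m IH; rewrite -natr1 IH.
by rewrite S_INR RtoC_plus.
Qed.

Definition toRi (x : CF) : R[i] := (fst x +i* snd x)%C.
Definition ofRi (x : R[i]) : CF := let: (a +i* b)%C := x in (a, b).
Lemma toRi_zmod : zmod_morphism toRi.
Proof. by move=> [a b] [c d]. Qed.
Lemma toRi_monoid : monoid_morphism toRi.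
Proof. by split=> // -[a b] [c d]; rewrite /toRi /=; congr (_ +i* _)%C; rewrite addrC. Qed.
HB.instance Definition _ := GRing.isZmodMorphism.Build CF R[i] toRi toRi_zmod.
HB.instance Definition _ := GRing.isMonoidMorphism.Build CF R[i] toRi toRi_monoid.

(** Transported from [R[i]], which is algebraically closed, along the bijective morphism [toRi]. *)
Lemma CF_closed (p : {poly CF}) : size p != 1%N -> exists x, root p x.
Proof.
move=> sp; have : size (map_poly toRi p) != 1%N by rewrite size_map_poly.
case/closed_rootP => y; have -> : y = toRi (ofRi y) by case: y.
by rewrite fmorph_root => h; exists (ofRi y).
Qed.

Lemma CF_uncountable (e : nat -> CF) : exists x, forall n, e n <> x.
Proof.
have [x hx] := RealsUncountable.not_enumerable (fun n => fst (e n)).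
by exists (RtoC x) => n en; apply: (hx n); rewrite en.
Qed.
End CField.

(** * Hilbert's basis theorem *)

Module Noetherian.
Import all_boot all_algebra mpoly zify.
Import LaurentPath.
Set Implicit Arguments. Unset Strict Implicit. Unset Printing Implicit Defensive.
Import GRing.Theory.
Local Open Scope ring_scope.

Definition spanned (R : comNzRingType) (n : nat) (a : nat -> R) (x : R) :=
  exists u : nat -> R, x = \sum_(i < n) u i * a i.

(* Equivalent to the ascending chain condition on ideals. *)
Definition noeth (R : comNzRingType) := forall a : nat -> R, exists N, spanned N a (a N).

Section Span.
Variable R : comNzRingType.
Implicit Types (a b : nat -> R) (x y : R).

Lemma spannedD n a x y : spanned n a x -> spanned n a y -> spanned n a (x + y).
Proof.
move=> [u ->] [v ->]; exists (fun i => u i + v i); rewrite -big_split.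
by apply: eq_bigr => i _; rewrite mulrDl.
Qed.
Lemma spannedM n a c x : spanned n a x -> spanned n a (c * x).
Proof.
move=> [u ->]; exists (fun i => c * u i); rewrite mulr_sumr.
by apply: eq_bigr => i _; rewrite mulrA.
Qed.
Lemma spanned0 n a : spanned n a 0.
Proof. by exists (fun=> 0); rewrite big1 // => i _; rewrite mul0r. Qed.
Lemma spanned_gen n a i : (i < n)%N -> spanned n a (a i).
Proof.
move=> ni; exists (fun j => (j == i)%:R); rewrite (bigD1 (Ordinal ni)) //= eqxx mul1r big1 ?addr0 // => j.
by rewrite -val_eqE /= => /negPf ->; rewrite mul0r.
Qed.
Lemma spanned_sum n a m (x : 'I_m -> R) : (forall i, spanned n a (x i)) -> spanned n a (\sum_i x i).
Proof.
move=> h; apply: (big_ind (spanned n a)) => //; [exact: spanned0|exact: spannedD].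
Qed.
Lemma spanned_le m n a x : (m <= n)%N -> spanned m a x -> spanned n a x.
Proof.
move=> mn [u ->]; apply: spanned_sum => i; apply: spannedM; apply: spanned_gen.
exact: leq_trans mn.
Qed.
Lemma spanned_trans m n a b x : (forall i, (i < m)%N -> spanned n b (a i)) -> spanned m a x -> spanned n b x.
Proof. by move=> h [u ->]; apply: spanned_sum => i; apply/spannedM/h. Qed.
End Span.

Lemma noeth_field (F : fieldType) : noeth F.
Proof.
move=> a; have [a0|a0] := eqVneq (a 0%N) 0.
  by exists 0%N, (fun=> 0); rewrite big_ord0.
by exists 1%N, (fun=> a 1%N / a 0%N); rewrite big_ord1 divfK.
Qed.

Lemma noeth_surj (S R : comNzRingType) (f : {rmorphism S -> R}) : (forall y, exists x, f x = y) ->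
  noeth S -> noeth R.
Proof.
move=> sf nS a; pose b n := ClassicalEpsilon.epsilon (inhabits 0) (fun x => f x = a n).
have fb n : f (b n) = a n := ClassicalEpsilon.epsilon_spec (inhabits 0) _ (sf (a n)).
have [N [u e]] := nS b; exists N, (fun i => f (u i)).
by rewrite -fb e rmorph_sum; apply: eq_bigr => i _; rewrite rmorphM fb.
Qed.

(** From the ideal [I] generated by a bad sequence choose repeatedly an element [g n] of least
    degree outside the span of its predecessors. A relation among the leading coefficients yields
    [g N - y] of smaller degree, still outside that span. *)
Lemma noeth_poly (R : comNzRingType) : noeth R -> noeth {poly R}.
Proof.
move=> nR f; apply: Classical_Prop.NNPP => nf.
have {}nf N : ~ spanned N f (f N) by move=> h; apply: nf; exists N.
pose I x := exists M, spanned M f x.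
have II m (g : nat -> {poly R}) : (forall i, (i < m)%N -> I (g i)) -> exists M, forall i, (i < m)%N -> spanned M f (g i).
  elim: m => [|m IH] h; first by exists 0%N.
  have [|M hM] := IH; first by move=> i im; apply: h; apply: ltnW.
  have [M' hM'] := h m (ltnSn m); exists (maxn M M') => i; rewrite ltnS leq_eqVlt => /orP[/eqP->|im].
    by apply: spanned_le hM'; apply: leq_maxr.
  by apply: spanned_le (hM i im); apply: leq_maxl.
pose Q n (g : nat -> {poly R}) y := ~ spanned n g y /\ forall x, I x -> ~ spanned n g x -> (size y <= size x)%N.
have [||g hg] := @seq_choice {poly R} 0 I (fun g n y => Q n g y).
- move=> n g g' y e [h1 h2].
  have eS x : spanned n g x <-> spanned n g' x.
    by split=> -[u ->]; exists u; apply: eq_bigr => i _; rewrite e.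
  by split=> [/eS //|x Ix /eS]; apply: h2.
- move=> n g Ig.
  have [M hM] := II n g Ig.
  have [s] : exists s x, I x /\ ~ spanned n g x /\ size x = s.
    exists (size (f M)), (f M); split; last split=> //.
    - by exists M.+1; apply: spanned_gen.
    - by move=> h; apply: (nf M); apply: spanned_trans h.
  elim/ltn_ind: s => s IH [x [Ix [nx sx]]].
  have [[y [Iy [ny ly]]]|h] := Classical_Prop.classic (exists y, I y /\ ~ spanned n g y /\ (size y < size x)%N).
    by apply: (IH (size y)); [rewrite -sx|exists y].
  exists x; split=> //; split=> // y Iy ny; rewrite leqNgt; apply/negP => l.
  by apply: h; exists y.
have [N [u e]] := nR (fun n => lead_coef (g n)).
have [IN [nN minN]] := hg N.
have szle i : (i < N)%N -> (size (g i) <= size (g N))%N.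
  move=> iN; have [_ [_ h]] := hg i; apply: h => // hs; apply: nN.
  by apply: spanned_le hs; apply: ltnW.
pose y := \sum_(i < N) (u i *: 'X^(size (g N) - size (g i))) * g i.
have yS : spanned N g y by exists (fun i => u i *: 'X^(size (g N) - size (g i))).
have gN0 : g N != 0.
  by apply/eqP => g0; apply: nN; rewrite g0; apply: spanned0.
have nz i : g i != 0.
  have [_ [h _]] := hg i; apply/eqP => g0; apply: h; rewrite g0; exact: spanned0.
have cy : y`_(size (g N)).-1 = lead_coef (g N).
  rewrite e coef_sum; apply: eq_bigr => i _; rewrite -scalerAl coefZ coefXnM.
  have si : (0 < size (g i))%N by rewrite size_poly_gt0.
  have sl := szle i (ltn_ord i).
  have [h1 h2] : ((size (g N) - size (g i) <= (size (g N)).-1) /\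
      (size (g N)).-1 - (size (g N) - size (g i)) = (size (g i)).-1)%N.
    by move: si sl; move: (size (g i)) (size (g N)) => p q; lia.
  by rewrite ltnNge h1 /= h2.
have sy : (size y <= size (g N))%N.
  apply: leq_trans (size_sum _ _ _) _; apply/bigmax_leqP => i _.
  have si : (0 < size (g i))%N by rewrite size_poly_gt0.
  rewrite -scalerAl; apply: leq_trans (size_scale_leq _ _) _; apply: leq_trans (size_polyMleq _ _) _.
  rewrite size_polyXn; have := szle i (ltn_ord i); lia.
have lt : (size (g N - y)%R < size (g N))%N.
  have : (size (g N - y)%R <= size (g N))%N.
    by rewrite (leq_trans (size_polyD _ _)) // size_polyN geq_max leqnn.
  rewrite leq_eqVlt => /orP[/eqP es|//]; have : lead_coef (g N - y) = 0.
    by rewrite lead_coefE es coefB cy subrr.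
  move/eqP; rewrite lead_coef_eq0 => /eqP h0; move: es; rewrite h0 size_poly0 => /esym/eqP.
  by rewrite size_poly_eq0 (negPf gN0).
have : ~ (size (g N) <= size (g N - y)%R)%N by rewrite leqNgt lt.
apply; apply: minN.
  have [M hM] := II N g (fun i _ => (hg i).1); have [M' hM'] := IN.
  exists (maxn M M'); apply: spannedD; first by apply: spanned_le hM'; apply: leq_maxr.
  rewrite -mulN1r; apply: spannedM; apply: spanned_le (leq_maxl _ _) _; exact: spanned_trans yS.
by move=> h; apply: nN; rewrite -[g N](subrK y); apply: spannedD.
Qed.

Section MPoly.
Variable F : fieldType.

Lemma mpoly_closed_gen n (P : {mpoly F[n]} -> Prop) : (forall c, P c%:MP) -> (forall i, P 'X_i) ->
  (forall p q, P p -> P q -> P (p + q)) -> (forall p q, P p -> P q -> P (p * q)) -> forall p, P p.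
Proof.
move=> hC hX hD hM p; rewrite [p]mpolyE.
apply: (big_ind P); [by rewrite -mpolyC0|exact: hD|].
move=> m _; rewrite -mul_mpolyC; apply: (hM) => //; rewrite mpolyXE_id.
apply: (big_ind P); [by rewrite -mpolyC1|exact: hM|].
move=> i _; elim: (m i) => [|k IH]; first by rewrite expr0 -mpolyC1.
by rewrite exprS; apply: (hM).
Qed.

(** The outer variable becomes the last one; surjectivity suffices to pass the Noetherian property
    to one more variable. *)
Definition mlift n (p : {poly {mpoly F[n]}}) : {mpoly F[n.+1]} := (map_poly (@mwiden n F) p).['X_ord_max].
Lemma mlift_zmod n : zmod_morphism (@mlift n).
Proof. by move=> p q; rewrite /mlift rmorphB hornerD hornerN. Qed.
Lemma mlift_monoid n : monoid_morphism (@mlift n).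
Proof. by split=> [|p q]; rewrite /mlift ?rmorph1 ?hornerC // rmorphM hornerM. Qed.
HB.instance Definition _ n := GRing.isZmodMorphism.Build {poly {mpoly F[n]}} {mpoly F[n.+1]} (@mlift n) (@mlift_zmod n).
HB.instance Definition _ n := GRing.isMonoidMorphism.Build {poly {mpoly F[n]}} {mpoly F[n.+1]} (@mlift n) (@mlift_monoid n).

Lemma mlift_surj n (p : {mpoly F[n.+1]}) : exists q, mlift q = p.
Proof.
elim/mpoly_closed_gen: p => [c|i|p q [p' <-] [q' <-]|p q [p' <-] [q' <-]].
- by exists (c%:MP)%:P; rewrite /mlift map_polyC hornerC /= mwidenC.
- case: (unliftP ord_max i) => [j ->|->].
    exists ('X_j)%:P; rewrite /mlift map_polyC hornerC /= /mwiden mmapX mmap1U.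
    by congr ('X_ _); apply: val_inj; rewrite /= /bump leqNgt ltn_ord.
  by exists 'X; rewrite /mlift map_polyX hornerX.
- by exists (p' + q'); rewrite rmorphD.
- by exists (p' * q'); rewrite rmorphM.
Qed.

Lemma noeth_mpoly n : noeth {mpoly F[n]}.
Proof.
elim: n => [|n IH]; last exact: noeth_surj (@mlift_surj n) (noeth_poly IH).
move=> a; have h (p : {mpoly F[0]}) : exists c, p = c%:MP.
  elim/mpoly_closed_gen: p => [c|[]//|p q [c ->] [d ->]|p q [c ->] [d ->]]; first by exists c.
  - by exists (c + d); rewrite mpolyCD.
  - by exists (c * d); rewrite mpolyCM.
have sf : forall y : {mpoly F[0]}, exists x : F, (@mpolyC 0 F) x = y by move=> y; have [c ->] := h y; exists c.
exact: (noeth_surj (f := @mpolyC 0 F) sf (@noeth_field F)).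
Qed.

(** Otherwise one could choose members of [P] forever, each nonzero at some common zero of its
    predecessors; none would be spanned by the earlier ones. *)
Lemma finite_zero_basis n (P : {mpoly F[n]} -> Prop) : exists N (f : nat -> {mpoly F[n]}),
  (forall i, (i < N)%N -> P (f i)) /\
  forall x, (forall i, (i < N)%N -> (f i).@[x] = 0) -> forall p, P p -> p.@[x] = 0.
Proof.
apply: Classical_Prop.NNPP => hn.
pose R (f : nat -> {mpoly F[n]}) N p := exists x, (forall i, (i < N)%N -> (f i).@[x] = 0) /\ p.@[x] != 0.
have [||f hf] := @seq_choice {mpoly F[n]} 0 P R.
- by move=> N f g p e [x [h1 h2]]; exists x; split=> // i iN; rewrite -e // h1.
- move=> N f hf; apply: Classical_Prop.NNPP => h; apply: hn; exists N, f; split=> // x hx p Pp.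
  by apply/eqP/negPn/negP => nz; apply: h; exists p; split=> //; exists x.
have [N [u e]] := noeth_mpoly f; have [_ [x [h1]]] := hf N.
by rewrite e rmorph_sum big1 ?eqxx // => i _; rewrite rmorphM /= h1 ?mulr0.
Qed.
End MPoly.
End Noetherian.

(** * The weak Nullstellensatz over an uncountable field *)

Module Nullstellensatz.
Import all_boot all_algebra mpoly ring.
Import Noetherian.
Set Implicit Arguments. Unset Strict Implicit. Unset Printing Implicit Defensive.
Import GRing.Theory.
Local Open Scope ring_scope.

Section Null.
Variable F : fieldType.
Hypothesis Fcl : forall p : {poly F}, size p != 1%N -> exists x, root p x.
Hypothesis Func : forall e : nat -> F, exists x, forall n, e n <> x.
Variable n : nat.
Notation A := {mpoly F[n]}.

Definition ideal (I : A -> Prop) :=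
  [/\ I 0, forall p q, I p -> I q -> I (p + q) & forall p q, I q -> I (p * q)].

Lemma ideal_sum I m (f : 'I_m -> A) : ideal I -> (forall i, I (f i)) -> I (\sum_i f i).
Proof. by move=> [I0 ID _] h; apply: (big_ind I). Qed.

Lemma finite_or_large (P : F -> Prop) : (exists s : seq F, forall x, P x -> x \in s) \/
  (forall m, exists s : seq F, [/\ uniq s, size s = m & forall x, x \in s -> P x]).
Proof.
have [h|h] := Classical_Prop.classic (exists s : seq F, forall x, P x -> x \in s); [by left|right].
elim=> [|m [s [us ss hs]]]; first by exists [::].
have [x [Px xs]] : exists x, P x /\ x \notin s.
  apply: Classical_Prop.NNPP => h'; apply: h; exists s => x Px; apply/negPn/negP => xs.
  by apply: h'; exists x.
exists (x :: s); split=> /=; rewrite ?xs ?ss // => y; rewrite inE => /orP[/eqP->//|]; exact: hs.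
Qed.

(** If every fibre were finite, pairs of a value and a position in the list of its fibre would
    enumerate the field. *)
Lemma large_fibre (r : F -> nat) : exists d, forall m, exists s : seq F,
  [/\ uniq s, size s = m & forall x, x \in s -> r x = d].
Proof.
apply: Classical_Prop.NNPP => h.
have fin d : exists s : seq F, forall x, r x = d -> x \in s.
  have [//|h'] := finite_or_large (fun x => r x = d).
  by case: h; exists d.
pose s d := ClassicalEpsilon.epsilon (inhabits [::]) (fun s : seq F => forall x, r x = d -> x \in s).
have hs d : forall x, r x = d -> x \in s d := ClassicalEpsilon.epsilon_spec (inhabits [::]) _ (fin d).
have [x hx] := Func (fun k => if @unpickle (nat * nat)%type k is Some (d, i) then nth 0 (s d) i else 0).
apply: (hx (pickle (r x, index x (s (r x))))).
by rewrite pickleK nth_index // hs.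
Qed.

Lemma lin_dep d (s : seq F) (r : F -> A) : (forall x, x \in s -> (msize (r x) <= d)%N) ->
  (#|{: 'X_{1..n < d}}| < size s)%N ->
  exists c : 'I_(size s) -> F, (exists i, c i != 0) /\ \sum_i c i *: r s`_i = 0.
Proof.
move=> hd hs; pose M := \matrix_(i < size s, j < #|{: 'X_{1..n < d}}|) (r s`_i)@_(bmnm (enum_val j)).
have : ~~ row_free M by rewrite -row_leq_rank -ltnNge; apply: leq_ltn_trans (rank_leq_col _) hs.
rewrite -kermx_eq0 => /rowV0Pn[v /sub_kermxP hv v0].
exists (fun i => v 0 i); split.
  by have /rV0Pn[i hi] := v0; exists i.
apply/mpolyP => m; rewrite mcoeff0 raddf_sum /=.
have [md|md] := ltnP (mdeg m) d; last first.
  rewrite big1 // => i _; rewrite mcoeffZ memN_msupp_eq0 ?mulr0 //.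
  apply/negP => /msize_mdeg_lt; rewrite ltnNge => /negP; apply; apply: leq_trans md.
  exact/hd/mem_nth.
have := congr1 (fun B : 'rV_ _ => B 0 (enum_rank (BMultinom md))) hv.
rewrite !mxE => e; rewrite -[RHS]e; apply: eq_bigr => i _.
by rewrite mcoeffZ !mxE enum_rankK.
Qed.

Definition ev (j : 'I_n) (q : {poly F}) : A := (map_poly (@mpolyC n F) q).['X_j].
Lemma evM j p q : ev j (p * q) = ev j p * ev j q.
Proof. by rewrite /ev rmorphM hornerM. Qed.
Lemma evC j c : ev j c%:P = c%:MP.
Proof. by rewrite /ev map_polyC hornerC. Qed.
Lemma ev_lin j c : ev j ('X - c%:P) = 'X_j - c%:MP.
Proof. by rewrite /ev rmorphB /= map_polyX map_polyC hornerXsubC. Qed.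
Lemma ev_sum j m (f : 'I_m -> {poly F}) : ev j (\sum_i f i) = \sum_i ev j (f i).
Proof. by rewrite /ev rmorph_sum horner_sum. Qed.
Lemma ev_prod j (s : seq F) : ev j (\prod_(x <- s) ('X - x%:P)) = \prod_(x <- s) ('X_j - x%:MP).
Proof.
elim: s => [|x s IH]; first by rewrite !big_nil evC mpolyC1.
by rewrite !big_cons evM IH ev_lin.
Qed.

(* If every [w_j - c] were invertible modulo [I], uncountably many inverses would lie in a countable union of
   finite-dimensional spaces; a linear relation between them puts a nonzero polynomial in [w_j], hence 1, in [I]. *)
Lemma ideal_step (I : A -> Prop) (j : 'I_n) : ideal I -> ~ I 1 ->
  exists c, ~ exists q r, I q /\ 1 = q + r * ('X_j - c%:MP).
Proof.
move=> Iid I1; apply: Classical_Prop.NNPP => h.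
have {}h c : exists r, I (1 - r * ('X_j - c%:MP)).
  apply: Classical_Prop.NNPP => h1; apply: h; exists c => -[q [r [Iq e]]]; apply: h1.
  by exists r; rewrite e addrK.
have [I0 ID IM] := Iid.
pose r c := ClassicalEpsilon.epsilon (inhabits 0) (fun r => I (1 - r * ('X_j - c%:MP))).
have hr c : I (1 - r c * ('X_j - c%:MP)) := ClassicalEpsilon.epsilon_spec (inhabits 0) _ (h c).
(* Split off linear factors one by one: each is invertible modulo [I] by [h], and at the end a
   nonzero constant would lie in [I]. *)
have kill (q : {poly F}) : q != 0 -> ~ I (ev j q).
  move: {2}(size q) (leqnn (size q)) => m; elim: m q => [|m IH] q.
    by rewrite leqn0 size_poly_eq0 => ->.
  move=> sq q0 Iq; have [sz|sz] := eqVneq (size q) 1%N.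
    have [c c0 e] : exists2 c, c != 0 & q = c%:P.
      by have /size_poly1P[c] := introT eqP sz; exists c.
    apply: I1; rewrite -[1](_ : (c^-1)%:MP * ev j q = 1); first exact: IM.
    by rewrite e evC -mpolyCM mulVf.
  have [x /factor_theorem[p e]] := Fcl sz.
  have p0 : p != 0 by apply: contraNneq q0; rewrite e => ->; rewrite mul0r.
  apply: (IH p _ p0); first by move: sq; rewrite e size_Mmonic ?monicXsubC // size_XsubC addn2.
  rewrite (_ : ev j p = ev j p * (1 - r x * ('X_j - x%:MP)) + r x * ev j q).
    by apply: ID; apply: IM.
  by rewrite e evM ev_lin; ring.
have [d hd] := large_fibre (fun c => msize (r c)).
have [s [us ss hs]] := hd #|{: 'X_{1..n < d}}|.+1.
have [||c [[i0 ci0] hc]] := @lin_dep d s r; first by move=> x /hs->.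
  by rewrite ss.
(* The relation between the inverses multiplied by all the [X_j - x]: modulo [I] each inverse
   cancels its own factor. At the node [s_{i0}] only one term survives, so [Q] is nonzero. *)
pose Q := \sum_i (c i)%:P * \prod_(x <- rem s`_i s) ('X - x%:P).
have sI (i : 'I_(size s)) : s`_i \in s by apply: mem_nth.
apply: (kill Q).
  apply: contraNneq ci0 => Q0; have := congr1 (fun p => p.[s`_i0]) Q0; rewrite horner0 horner_sum.
  rewrite (bigD1 i0) //= [X in _ + X]big1 ?addr0 => [|i ni].
    rewrite hornerM hornerC => /eqP; rewrite mulf_eq0 => /orP[//|].
    rewrite -/(root _ _) root_prod_XsubC.
    by rewrite mem_rem_uniq // !inE eqxx.
  rewrite hornerM; apply/eqP; rewrite mulf_eq0; apply/orP; right.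
  rewrite -/(root _ _) root_prod_XsubC mem_rem_uniq // !inE sI andbT.
  by rewrite nth_uniq // eq_sym.
rewrite ev_sum.
have -> : \sum_i ev j ((c i)%:P * \prod_(x <- rem s`_i s) ('X - x%:P)) =
   \sum_i ((c i)%:MP * \prod_(x <- rem s`_i s) ('X_j - x%:MP)) * (1 - r s`_i * ('X_j - (s`_i)%:MP)).
  apply/eqP; rewrite -subr_eq0 -sumrB; apply/eqP.
  have := congr1 (fun p => (\prod_(x <- s) ('X_j - x%:MP)) * p) hc; rewrite /= mulr0 mulr_sumr => e0.
  rewrite -[RHS]e0; apply: eq_bigr => i _; rewrite evM evC ev_prod (perm_big _ (perm_to_rem (sI i))) big_cons /=.
  by rewrite -mul_mpolyC; ring.
by apply: ideal_sum => // i; apply: IM.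
Qed.

(** A proper ideal stays proper after adjoining suitable [X_j - c_j] one variable at a time; modulo
    the result every polynomial equals its value at the point [c], which is then a common zero. *)
Lemma nullstellensatz (I : A -> Prop) : ideal I -> (forall x, exists p, I p /\ p.@[x] != 0) -> I 1.
Proof.
move=> Iid hx; apply: Classical_Prop.NNPP => I1.
have st (s : seq 'I_n) : exists (J : A -> Prop) x, [/\ ideal J, forall p, I p -> J p, ~ J 1 &
    forall j, j \in s -> J ('X_j - (x j)%:MP)].
  elim: s => [|j s [J [x [Jid IJ J1 Js]]]]; first by exists I, (fun=> 0).
  have [c hc] := ideal_step j Jid J1; have [J0 JD JM] := Jid.
  exists (fun p => exists q r, J q /\ p = q + r * ('X_j - c%:MP)), (fun i => if i == j then c else x i).
  split.
  - split.
    + by exists 0, 0; rewrite mul0r addr0.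
    + move=> _ _ [q [r [Jq ->]]] [q' [r' [Jq' ->]]]; exists (q + q'), (r + r'); split; first exact: JD.
      by ring.
    + move=> p _ [q [r [Jq ->]]]; exists (p * q), (p * r); split; first exact: JM.
      by ring.
  - by move=> p /IJ Jp; exists p, 0; rewrite mul0r addr0.
  - by [].
  - move=> i; rewrite inE; have [-> _|_ /= /Js Ji] := eqVneq i j.
      by exists 0, 1; rewrite mul1r add0r.
    by exists ('X_i - (x i)%:MP), 0; rewrite mul0r addr0.
have [J [x [Jid IJ J1 Js]]] := st (enum 'I_n); have [J0 JD JM] := Jid.
have Jev p : J (p - (p.@[x])%:MP).
  elim/mpoly_closed_gen: p => [c|i|p q Jp Jq|p q Jp Jq].
  - by rewrite mevalC subrr.
  - by rewrite mevalXU; apply: Js; rewrite mem_enum.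
  - rewrite mevalD mpolyCD (_ : _ - _ = (p - (p.@[x])%:MP) + (q - (q.@[x])%:MP)); [exact: JD|ring].
  - rewrite mevalM mpolyCM (_ : _ - _ = p * (q - (q.@[x])%:MP) + (q.@[x])%:MP * (p - (p.@[x])%:MP)); last by ring.
    by apply: JD; apply: JM.
have [p [Ip px]] := hx x; apply: J1.
rewrite (_ : 1 = ((p.@[x])^-1)%:MP * (p + (-1) * (p - (p.@[x])%:MP))).
  by apply/JM/JD; [apply: IJ|apply: JM].
rewrite (_ : p + _ = (p.@[x])%:MP); last by ring.
by rewrite -mpolyCM mulVf.
Qed.
End Null.
End Nullstellensatz.

(** * Weighted homogeneous systems and finite modules *)

Module WeightedHomogeneous.
Import all_boot all_algebra mpoly ring zify.
Import Noetherian Nullstellensatz.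
Set Implicit Arguments. Unset Strict Implicit. Unset Printing Implicit Defensive.
Import GRing.Theory.
Local Open Scope ring_scope.

Section Weighted.
Variable F : fieldType.
Variable n : nat.
Notation A := {mpoly F[n]}.
Variable wt : 'I_n -> nat.

Definition wd (m : 'X_{1..n}) : nat := \sum_(i < n) wt i * m i.

Inductive whomog (d : nat) : A -> Prop :=
| whomog_zero : whomog d 0
| whomog_add c m p : wd m = d -> whomog d p -> whomog d (c *: 'X_[m] + p).

Lemma whomogD d p q : whomog d p -> whomog d q -> whomog d (p + q).
Proof.
move=> hp hq; elim: hp => [|c m p' wm _ IH]; first by rewrite add0r.
by rewrite -addrA; apply: whomog_add.
Qed.
Lemma whomog_mono d c m : wd m = d -> whomog d (c *: 'X_[m]).
Proof. by move=> wm; rewrite -[_ *: _]addr0; apply: whomog_add => //; apply: whomog_zero. Qed.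
Lemma wdD m m' : wd (m + m')%MM = (wd m + wd m')%N.
Proof. by rewrite /wd -big_split /=; apply: eq_bigr => i _; rewrite mnmDE mulnDr. Qed.
Lemma whomogM d e p q : whomog d p -> whomog e q -> whomog (d + e) (p * q).
Proof.
move=> hp; elim: hp q => [|c m p' wm _ IH] q hq; first by rewrite mul0r; apply: whomog_zero.
rewrite mulrDl; apply: whomogD; last exact: IH.
elim: hq => [|c' m' q' wm' _ IH']; first by rewrite mulr0; apply: whomog_zero.
rewrite mulrDr -scalerAl -scalerAr -mpolyXD scalerA.
by apply: whomogD => //; apply: whomog_mono; rewrite wdD wm wm'.
Qed.
Lemma whomog_sum d m (f : 'I_m -> A) : (forall i, whomog d (f i)) -> whomog d (\sum_i f i).
Proof. by move=> h; apply: (big_ind (whomog d)) => //; [exact: whomog_zero|exact: whomogD]. Qed.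
Lemma whomog_varX j e : whomog (wt j * e) ('X_j ^+ e).
Proof.
rewrite -[_ ^+ _]scale1r mpolyXn; apply: whomog_mono; rewrite /wd (bigD1 j) //= big1 ?addn0.
  by rewrite mulmnE mnm1E eqxx mul1n.
by move=> i /negPf; rewrite mulmnE mnm1E eq_sym => ->; rewrite mul0n muln0.
Qed.

(* [grad] substitutes [X_j := X_j t^(wt j)]; the coefficient of [t^d] is the component of weighted degree [d]. *)
Definition grad : A -> {poly A} :=
  mmap (polyC \o @mpolyC n F) (fun j => ('X_j)%:P * 'X^(wt j)).
HB.instance Definition _ := GRing.RMorphism.on grad.

Lemma gradX m : grad 'X_[m] = ('X_[m])%:P * 'X^(wd m).
Proof.
rewrite /grad mmapX /mmap1 /wd.
under eq_bigr => i _ do rewrite exprMn -exprM -rmorphXn.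
rewrite big_split /= -(rmorph_prod (@polyC A)) /= -mpolyXE_id; congr (_ * _).
by rewrite expr_sum.
Qed.
Lemma gradZX c m : grad (c *: 'X_[m]) = (c *: 'X_[m])%:P * 'X^(wd m).
Proof. by rewrite -mul_mpolyC rmorphM /= gradX /grad mmapC /= mulrA -polyCM. Qed.

Lemma grad_whomog d p : whomog d p -> grad p = p%:P * 'X^d.
Proof.
elim=> [|c m p' wm _ IH]; first by rewrite rmorph0 mul0r.
by rewrite rmorphD /= gradZX wm IH polyCD mulrDl.
Qed.

Lemma whomog_grad p e : whomog e (grad p)`_e.
Proof.
rewrite [p]mpolyE rmorph_sum coef_sum.
apply: (big_ind (whomog e)); [exact: whomog_zero|exact: whomogD|] => m _.
rewrite /= gradZX coefCM coefXn; case: eqP => [->|_]; rewrite ?mulr0 ?mulr1; last exact: whomog_zero.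
exact: whomog_mono.
Qed.

Section Power.
Variables (j : 'I_n) (wj : (0 < wt j)%N) (N : nat).
(* Substitutes [t := X_j^(-1/wt j)] and multiplies by [X_j^N], dropping fractional and negative powers. *)
Definition phi (q : {poly A}) : A := \sum_(e < N.+1) 'X_j ^+ (N - e) * q`_(wt j * e).

Lemma phiD p q : phi (p + q) = phi p + phi q.
Proof. by rewrite /phi -big_split /=; apply: eq_bigr => e _; rewrite coefD mulrDr. Qed.
Lemma phi_sum m (f : 'I_m -> {poly A}) : phi (\sum_i f i) = \sum_i phi (f i).
Proof.
apply: (big_morph phi phiD); rewrite /phi big1 // => e _; by rewrite coef0 mulr0.
Qed.
Lemma phiZ a q : phi (a%:P * q) = a * phi q.
Proof. by rewrite /phi mulr_sumr; apply: eq_bigr => e _; rewrite coefCM; ring. Qed.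
Lemma phi1 : phi 1 = 'X_j ^+ N.
Proof.
rewrite /phi big_ord_recl /= subn0 muln0 coef1 eqxx mulr1 big1 ?addr0 // => e _.
rewrite coef1 /bump /= (_ : (_ == _) = false) ?mulr0 //; apply/eqP; move: wj; move: (wt j) => w; lia.
Qed.
(** The second factor is zero under the substitution. The sum defining [phi] telescopes, and the
    size bound removes its last term. *)
Lemma phi_kill (q : {poly A}) : (size q <= wt j * N)%N -> phi (q * (('X_j)%:P * 'X^(wt j) - 1)) = 0.
Proof.
move=> sq; have cf e : (q * (('X_j)%:P * 'X^(wt j) - 1))`_(wt j * e) =
    (if e is e'.+1 then 'X_j * q`_(wt j * e') else 0) - q`_(wt j * e).
  rewrite mulrBr mulr1 coefB; congr (_ - _).
  rewrite mulrCA coefCM coefMXn; case: e => [|e]; first by rewrite muln0 wj mulr0.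
  by rewrite mulnS ltnNge leq_addr /= addKn.
rewrite /phi; under eq_bigr => e _ do rewrite cf mulrBr.
rewrite sumrB big_ord_recl big_ord_recr /= mulr0 add0r subnn expr0 mul1r nth_default // addr0.
apply/eqP; rewrite subr_eq0; apply/eqP; apply: eq_bigr => e _; rewrite /bump /= add1n mulrA -exprSr.
by congr (_ ^+ _ * _); have := ltn_ord e; lia.
Qed.
Lemma phi_whomog g d : whomog (wt j * N - d) (phi (grad g * 'X^d)).
Proof.
apply: whomog_sum => e; rewrite coefMXn; case: ltnP => h; first by rewrite mulr0; apply: whomog_zero.
have := whomogM (whomog_varX j (N - e)) (whomog_grad g (wt j * e - d)).
congr (whomog _ _); have := ltn_ord e; move: h; move: (nat_of_ord e) (wt j) => e' w; nia.
Qed.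
End Power.

Hypothesis Fcl : forall p : {poly F}, size p != 1%N -> exists x, root p x.
Hypothesis Func : forall e : nat -> F, exists x, forall n, e n <> x.
Hypothesis wt0 : forall j, (0 < wt j)%N.

Variables (r : nat) (M : 'I_r -> A) (dg : 'I_r -> nat).
Hypothesis dg0 : forall i, (0 < dg i)%N.
Hypothesis Mhom : forall i, whomog (dg i) (M i).
Hypothesis Mzero : forall x, (forall i, (M i).@[x] = 0) -> forall j, x j = 0.

Definition mev x : 'I_r -> F := fun i => (M i).@[x].

(** The [M i] have no common zero with [X_j = 1], so 1 lies in the ideal of the [M i] and [X_j - 1].
    Grading this identity and applying [phi] makes it homogeneous; the term with [X_j - 1]
    disappears once [N] exceeds its degree. *)
Lemma power_in_ideal (j : 'I_n) : exists N0, forall N, (N0 <= N)%N -> exists G : 'I_r -> A,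
  (forall i, whomog (wt j * N - dg i) (G i)) /\ 'X_j ^+ N = \sum_i M i * G i.
Proof.
pose I (p : A) := exists g h, p = \sum_i M i * g i + h * ('X_j - 1).
have Iid : ideal I.
  split.
  - by exists (fun=> 0), 0; rewrite mul0r addr0 big1 // => i _; rewrite mulr0.
  - move=> _ _ [g [h ->]] [g' [h' ->]]; exists (fun i => g i + g' i), (h + h').
    under [in RHS]eq_bigr => i _ do rewrite mulrDr.
    by rewrite big_split /=; ring.
  - move=> p _ [g [h ->]]; exists (fun i => p * g i), (p * h); rewrite mulrDr mulr_sumr mulrA.
    by congr (_ + _); apply: eq_bigr => i _; ring.
have [|g [h e]] := nullstellensatz Fcl Func Iid.
  move=> x; have [xj|xj] := eqVneq (x j) 1; last first.
    exists ('X_j - 1); split; last by rewrite mevalB mevalXU meval1 subr_eq0.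
    by exists (fun=> 0), 1; rewrite mul1r big1 ?add0r // => i _; rewrite mulr0.
  have [i Mi] : exists i, (M i).@[x] != 0.
    apply: Classical_Prop.NNPP => h; have := oner_neq0 F; rewrite -xj Mzero ?eqxx // => i.
    by apply/eqP/negPn/negP => nz; apply: h; exists i.
  exists (M i); split=> //; exists (fun k => (k == i)%:R), 0; rewrite mul0r addr0.
  rewrite (bigD1 i) //= eqxx mulr1 big1 ?addr0 // => k /negPf->.
  by rewrite mulr0.
exists (size (grad h)) => N hN; exists (fun i => phi j N (grad (g i) * 'X^(dg i))); split.
  by move=> i; apply: phi_whomog.
rewrite -phi1 // -(rmorph1 grad) e rmorphD rmorph_sum phiD phi_sum rmorphM rmorphB rmorph1 /=.
rewrite -['X_j]scale1r gradZX scale1r.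
have -> : wd U_(j) = wt j.
  rewrite /wd (bigD1 j) //= big1 ?addn0 ?mnm1E ?eqxx ?muln1 // => i /negPf.
  by rewrite mnm1E eq_sym => ->; rewrite muln0.
rewrite phi_kill ?addr0; last 2 first.
- exact: wt0.
- by apply: leq_trans hN _; apply/leq_pmull/wt0.
  apply: eq_bigr => i _; rewrite rmorphM /= (grad_whomog (Mhom i)) -phiZ; congr phi; ring.
Qed.

(** Membership in the module over the algebra of the [M i] generated by monomials of degree below
    [B], stated through values, the form in which the determinant trick uses it. *)
Definition finspan B (f : A) := exists s : 'X_{1..n < B} -> {mpoly F[r]},
  forall x, f.@[x] = \sum_nu (s nu).@[mev x] * ('X_[nu] : A).@[x].

Lemma finspan0 B : finspan B 0.
Proof. by exists (fun=> 0) => x; rewrite meval0 big1 // => i _; rewrite meval0 mul0r. Qed.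
Lemma finspanD B f g : finspan B f -> finspan B g -> finspan B (f + g).
Proof.
move=> [s hs] [t ht]; exists (fun nu => s nu + t nu) => x; rewrite mevalD hs ht -big_split /=.
by apply: eq_bigr => i _; rewrite mevalD mulrDl.
Qed.
Lemma finspan_sum B m (f : 'I_m -> A) : (forall i, finspan B (f i)) -> finspan B (\sum_i f i).
Proof. by move=> h; apply: (big_ind (finspan B)) => //; [exact: finspan0|exact: finspanD]. Qed.
Lemma finspanM B i f : finspan B f -> finspan B (M i * f).
Proof.
move=> [s hs]; exists (fun nu => 'X_i * s nu) => x; rewrite mevalM hs mulr_sumr.
by apply: eq_bigr => nu _; rewrite mevalM mevalXU mulrA.
Qed.
Lemma finspanZ B c f : finspan B f -> finspan B (c *: f).
Proof.
move=> [s hs]; exists (fun nu => c *: s nu) => x; rewrite mevalZ hs mulr_sumr.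
by apply: eq_bigr => nu _; rewrite mevalZ mulrA.
Qed.
Lemma finspan_basis B (nu : 'X_{1..n < B}) : finspan B 'X_[nu].
Proof.
exists (fun k => (k == nu)%:R) => x; rewrite (bigD1 nu) //= eqxx meval1 mul1r big1 ?addr0 // => k /negPf->.
by rewrite meval0 mul0r.
Qed.

(** Graded Nakayama: a monomial of large degree contains some [X_j^N], which [power_in_ideal]
    replaces by [sum M_i G_i], and the cofactors have smaller weighted degree. *)
Lemma finspan_all : exists B, (0 < B)%N /\ forall f, finspan B f.
Proof.
have [N0 hN0] := fin_all_exists power_in_ideal.
pose N := (\max_j N0 j).+1.
have hN j : exists G : 'I_r -> A, (forall i, whomog (wt j * N - dg i) (G i)) /\ 'X_j ^+ N = \sum_i M i * G i.
  by apply: hN0; apply: leqW; apply: leq_bigmax.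
exists (n * N).+1; split=> //.
have hom_all D : (forall m, wd m = D -> finspan (n * N).+1 'X_[m]) -> forall f, whomog D f -> finspan (n * N).+1 f.
  move=> h f; elim=> [|c m p wm _ IH]; first exact: finspan0.
  by apply: finspanD => //; apply/finspanZ/h.
have mono m : finspan (n * N).+1 'X_[m].
  move: {2}(wd m) (erefl (wd m)) => D; elim/ltn_ind: D m => D IH m wm.
  have [md|md] := ltnP (mdeg m) (n * N).+1; first exact: finspan_basis (BMultinom md).
  have [j hj] : exists j, (N <= m j)%N.
    apply: Classical_Prop.NNPP => h; move: md; rewrite ltnNge => /negP; apply.
    rewrite mdegE -[n in (n * _)%N]card_ord -sum_nat_const; apply: leq_sum => i _.
    by rewrite leqNgt; apply/negP => /ltnW hi; apply: h; exists i.
  have em : m = ((m - U_(j) *+ N) + U_(j) *+ N)%MM.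
    apply/mnmP => i; rewrite mnmDE mnmBE mulmnE mnm1E; have [<-|_] := eqVneq j i; rewrite /= ?mul1n ?subnK //.
  have [G [hG eG]] := hN j.
  have wm' : wd (m - U_(j) *+ N)%MM + wt j * N = D.
    rewrite -wm [in RHS]em wdD; congr addn.
    rewrite /wd (bigD1 j) //= big1 ?addn0 ?mulmnE ?mnm1E ?eqxx ?mul1n // => i /negPf.
    by rewrite mulmnE mnm1E eq_sym => ->; rewrite muln0.
  rewrite em mpolyXD -mpolyXn eG mulr_sumr; apply: finspan_sum => i; rewrite mulrCA; apply: finspanM.
  (* Strict also when the subtraction is truncated at 0, because [wt j], [N] and [dg i] are all
     positive. *)
  have hD : (wd (m - U_(j) *+ N)%MM + (wt j * N - dg i) < D)%N.
    have := dg0 i; have := wt0 j; rewrite -wm'; move: (wt j) (dg i) => a b; rewrite /N; nia.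
  apply: (hom_all _ (fun m' wm'' => IH _ hD m' wm'')).
  by apply: whomogM (hG i); rewrite -[X in whomog _ X]scale1r; apply: whomog_mono.
move=> f; rewrite [f]mpolyE; apply: (big_ind (finspan _)); [exact: finspan0|exact: finspanD|].
by move=> m _; apply: finspanZ.
Qed.

(* On the zero set of [cs] the vector of generators of the module is fixed by a matrix whose entries lie in the
   ideal of the [M i - M i (x0)]; the determinant of its difference with the identity is the required equation. *)
Lemma separating_equation (cs : A -> Prop) (x0 : 'I_n -> F) :
  (forall x, (forall c, cs c -> c.@[x] = 0) -> exists i, (M i).@[x] != (M i).@[x0]) ->
  exists D : {mpoly F[r]}, (forall x, (forall c, cs c -> c.@[x] = 0) -> D.@[mev x] = 0) /\ D.@[mev x0] != 0.
Proof.
move=> hx0; pose Z x := forall c, cs c -> c.@[x] = 0.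
pose I (p : A) := exists g : 'I_r -> A, forall x, Z x ->
  p.@[x] = \sum_i ((M i).@[x] - (M i).@[x0]) * (g i).@[x].
have Iid : ideal I.
  split.
  - exists (fun=> 0) => x _; rewrite big1 => [|i _]; by rewrite meval0 ?mulr0.
  - move=> p q [g hg] [g' hg']; exists (fun i => g i + g' i) => x Zx.
    rewrite mevalD hg // hg' // -big_split /=; apply: eq_bigr => i _; by rewrite mevalD mulrDr.
  - move=> p q [g hg]; exists (fun i => p * g i) => x Zx; rewrite mevalM hg // mulr_sumr.
    by apply: eq_bigr => i _; rewrite mevalM; ring.
have [|g hg] := nullstellensatz Fcl Func Iid.
  move=> x; have [Zx|nZ] := Classical_Prop.classic (Z x).
    have [i hi] := hx0 x Zx; exists (M i - ((M i).@[x0])%:MP); split; last by rewrite mevalB mevalC subr_eq0.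
    exists (fun k => (k == i)%:R) => y _; rewrite (bigD1 i) //= eqxx meval1 mulr1 mevalB mevalC.
    by rewrite big1 ?addr0 // => k /negPf->; rewrite meval0 mulr0.
  have [c [cc cx]] : exists c, cs c /\ c.@[x] != 0.
    apply: Classical_Prop.NNPP => h; apply: nZ => c cc; apply/eqP/negPn/negP => nz; apply: h.
    by exists c.
  exists c; split=> //; exists (fun=> 0) => y Zy; rewrite Zy // big1 // => i _.
  by rewrite meval0 mulr0.
have [B [B0 hB]] := finspan_all.
pose I0 : finType := 'X_{1..n < B}.
have z0p : (mdeg (0%MM : 'X_{1..n}) < B)%N by rewrite mdeg0.
pose z0 : I0 := BMultinom z0p.
have [s hs] := fin_all_exists (fun q : 'I_r * I0 => hB (g q.1 * 'X_[q.2])).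
pose E (mu nu : I0) : {mpoly F[r]} := \sum_i ('X_i - ((M i).@[x0])%:MP) * s (i, mu) nu.
pose K : 'M[{mpoly F[r]}]_#|I0| := 1%:M - \matrix_(a < #|I0|, b < #|I0|) E (enum_val b) (enum_val a).
have evE x mu nu : (E mu nu).@[mev x] = \sum_i ((M i).@[x] - (M i).@[x0]) * (s (i, mu) nu).@[mev x].
  rewrite rmorph_sum; apply: eq_bigr => i _; rewrite rmorphM /=; congr (_ * _).
  by rewrite mevalB mevalXU mevalC.
exists (\det K); split=> [x Zx|].
  rewrite -det_map_mx; apply/eqP/det0P; exists (\row_(a < #|I0|) ('X_[(enum_val a : I0)] : A).@[x]).
    apply/eqP => /rowP/(_ (enum_rank z0)); rewrite !mxE enum_rankK mevalX big1 => [/eqP|i _].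
      by rewrite oner_eq0.
    by rewrite /= mnm0E expr0.
  rewrite /K map_mxB map_mx1 mulmxBr mulmx1; apply/eqP; rewrite subr_eq0; apply/eqP/rowP => b; rewrite !mxE.
  rewrite -[LHS]mul1r -(meval1 x) hg // mulr_suml.
  under eq_bigr => i _ do rewrite -mulrA -mevalM (hs (i, enum_val b)) mulr_sumr.
  rewrite exchange_big (reindex (fun a : 'I_#|I0| => enum_val a : I0)) /=; last exact/onW_bij/enum_val_bij.
  apply: eq_bigr => a _; rewrite !mxE evE mulr_sumr; apply: eq_bigr => i _; ring.
rewrite -det_map_mx (_ : map_mx _ K = 1%:M) ?det1 ?oner_neq0 //.
rewrite /K map_mxB map_mx1 -[RHS]subr0; congr (_ - _); apply/matrixP => a b; rewrite !mxE [LHS]evE.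
by rewrite big1 // => i _; rewrite subrr mul0r.
Qed.

(** By [sat] a point outside the zero set shares its values of the [M i] with no point of it, so
    [separating_equation] gives an equation there; [finite_zero_basis] keeps finitely many. *)
Theorem separated_set_equations (cs : A -> Prop) :
  (forall x x0, (forall i, (M i).@[x] = (M i).@[x0]) -> (forall c, cs c -> c.@[x] = 0) ->
     forall c, cs c -> c.@[x0] = 0) ->
  exists N (f : nat -> {mpoly F[r]}), forall x,
    (forall c, cs c -> c.@[x] = 0) <-> (forall i, (i < N)%N -> (f i).@[mev x] = 0).
Proof.
move=> sat; pose P (D : {mpoly F[r]}) := forall x, (forall c, cs c -> c.@[x] = 0) -> D.@[mev x] = 0.
have [N [f [hf h]]] := finite_zero_basis P; exists N, f => x0; split=> [Zx i iN|hx].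
  exact: hf.
apply: Classical_Prop.NNPP => nZ.
have [|D [D0 /eqP Dx]] := @separating_equation cs x0; last by apply: Dx; apply: h.
move=> x Zx; apply: Classical_Prop.NNPP => h1; apply: nZ; apply: (sat x) => // i.
by apply/eqP/negPn/negP => nz; apply: h1; exists i.
Qed.
End Weighted.
End WeightedHomogeneous.

(** * Moments and first integrals of a homogeneous family *)

Module PathMoments.
Import CxAnalysis.

Section Prim.
Variable T : R.

(** The integral from 0 to [T] as a relation: it is linear without integrability conditions, and
    [prim_uniq] makes it single-valued. *)
Definition prim (phi : R -> CC) (c : CC) : Prop :=
  exists P, (forall x, cder P x (phi x)) /\ Cminus (P T) (P 0) = c.

Lemma prim_ext phi psi c : (forall x, phi x = psi x) -> prim phi c -> prim psi c.
Proof. intros e [P [H1 H2]]. exists P. split; [|exact H2]. intros x. rewrite <- e. apply H1. Qed.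

Lemma prim_plus phi psi c d : prim phi c -> prim psi d -> prim (fun x => Cplus (phi x) (psi x)) (Cplus c d).
Proof.
intros [P [H1 H2]] [Q [H3 H4]]. exists (fun x => Cplus (P x) (Q x)). split.
- intros x. apply cder_plus; [apply H1|apply H3].
- rewrite <- H2, <- H4. cring.
Qed.

Lemma prim_scal k phi c : prim phi c -> prim (fun x => Cmult k (phi x)) (Cmult k c).
Proof.
intros [P [H1 H2]]. exists (fun x => Cmult k (P x)). split.
- intros x. apply cder_scal, H1.
- rewrite <- H2. cring.
Qed.

Lemma prim_zero : prim (fun _ => RtoC 0) (RtoC 0).
Proof. exists (fun _ => RtoC 0). split; [intros x; apply cder_const|cring]. Qed.

Lemma prim_of_cont phi : (forall x, ccont phi x) -> prim phi (cint phi 0 T).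
Proof.
intros H. exists (fun x => cint phi 0 x). split.
- intros x. apply cint_cder, H.
- rewrite cint_point. cring.
Qed.

Lemma prim_der P d : (forall x, cder P x (d x)) -> prim d (Cminus (P T) (P 0)).
Proof. intros H. exists P. split; [exact H|reflexivity]. Qed.

Lemma prim_uniq phi c d : 0 <= T -> prim phi c -> prim phi d -> c = d.
Proof.
intros HT [P [H1 H2]] [Q [H3 H4]].
assert (E : Cplus (P 0) (Copp (Q 0)) = Cplus (P T) (Copp (Q T))).
{ apply (cder_zero_const (fun x => Cplus (P x) (Copp (Q x))) 0 T HT). intros x _.
  eapply cder_ext; [reflexivity| |exact (cder_plus _ _ _ _ _ (H1 x) (cder_opp _ _ _ (H3 x)))]. cring. }
rewrite <- H2, <- H4.
transitivity (Cplus (Cplus (P T) (Copp (Q T))) (Cminus (Q T) (P 0))); [ring|]. rewrite <- E. ring.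
Qed.
End Prim.

Fixpoint mon (f : nat -> R -> CC) (l : list nat) (x : R) : CC :=
  match l with nil => RtoC 1 | cons i l' => Cmult (f i x) (mon f l' x) end.

Lemma mon_app f l l' x : mon f (l ++ l') x = Cmult (mon f l x) (mon f l' x).
Proof. induction l as [|i l IH]; simpl; [|rewrite IH]; ring. Qed.

Section Pair.
Variables (T : R) (f g A B : nat -> R -> CC).
Hypothesis Hmom : forall l j, exists c, prim T (fun x => Cmult (mon f l x) (A j x)) c /\
  prim T (fun x => Cmult (mon g l x) (B j x)) c.

(* Pairs [(P(f), P(g))] for one and the same polynomial [P]. *)
Inductive sp : (R -> CC) -> (R -> CC) -> Prop :=
| sp_nil phi psi : (forall x, phi x = RtoC 0) -> (forall x, psi x = RtoC 0) -> sp phi psi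
| sp_cons c l phi psi phi' psi' : sp phi psi -> (forall x, phi' x = Cplus (Cmult c (mon f l x)) (phi x)) ->
    (forall x, psi' x = Cplus (Cmult c (mon g l x)) (psi x)) -> sp phi' psi'.

Lemma sp_ext phi psi phi' psi' : (forall x, phi x = phi' x) -> (forall x, psi x = psi' x) ->
  sp phi psi -> sp phi' psi'.
Proof.
intros e1 e2 H. destruct H as [phi psi H1 H2|c l phi psi phi1 psi1 H H1 H2].
- apply sp_nil; intros x; [rewrite <- e1|rewrite <- e2]; auto.
- apply (sp_cons c l phi psi); [exact H| |]; intros x; [rewrite <- e1|rewrite <- e2]; auto.
Qed.

Lemma sp_plus phi psi phi' psi' : sp phi psi -> sp phi' psi' ->
  sp (fun x => Cplus (phi x) (phi' x)) (fun x => Cplus (psi x) (psi' x)).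
Proof.
intros H H'. induction H as [phi psi H1 H2|c l phi psi phi1 psi1 H IH H1 H2].
- apply (sp_ext phi' psi'); [| |exact H']; intros x; rewrite ?H1, ?H2; ring.
- apply (sp_cons c l _ _ _ _ IH); intros x; rewrite ?H1, ?H2; ring.
Qed.

Lemma sp_mon c l phi psi : sp phi psi ->
  sp (fun x => Cmult (Cmult c (mon f l x)) (phi x)) (fun x => Cmult (Cmult c (mon g l x)) (psi x)).
Proof.
intros H. induction H as [phi psi H1 H2|c' l' phi psi phi1 psi1 H IH H1 H2].
- apply sp_nil; intros x; rewrite ?H1, ?H2; ring.
- apply (sp_cons (Cmult c c') (l ++ l') _ _ _ _ IH); intros x; rewrite ?H1, ?H2, mon_app; ring.
Qed.

Lemma sp_mult phi psi phi' psi' : sp phi psi -> sp phi' psi' ->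
  sp (fun x => Cmult (phi x) (phi' x)) (fun x => Cmult (psi x) (psi' x)).
Proof.
intros H H'. induction H as [phi psi H1 H2|c l phi psi phi1 psi1 H IH H1 H2].
- apply sp_nil; intros x; rewrite ?H1, ?H2; ring.
- apply (sp_ext (fun x => Cplus (Cmult (Cmult c (mon f l x)) (phi' x)) (Cmult (phi x) (phi' x)))
    (fun x => Cplus (Cmult (Cmult c (mon g l x)) (psi' x)) (Cmult (psi x) (psi' x)))).
  + intros x. rewrite H1. ring.
  + intros x. rewrite H2. ring.
  + apply sp_plus; [apply sp_mon; exact H'|exact IH].
Qed.

Lemma sp_const c : sp (fun _ => c) (fun _ => c).
Proof. apply (sp_cons c nil (fun _ => RtoC 0) (fun _ => RtoC 0)); [apply sp_nil; auto| |]; intros x; simpl; ring. Qed.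

Lemma sp_gen i : sp (f i) (g i).
Proof.
apply (sp_cons (RtoC 1) (cons i nil) (fun _ => RtoC 0) (fun _ => RtoC 0)); [apply sp_nil; auto| |];
  intros x; simpl; ring.
Qed.

Definition same_prim (phi psi : R -> CC) : Prop := exists c, prim T phi c /\ prim T psi c.

Lemma same_prim_ext phi psi phi' psi' : (forall x, phi x = phi' x) -> (forall x, psi x = psi' x) ->
  same_prim phi psi -> same_prim phi' psi'.
Proof. intros e1 e2 [c [H1 H2]]. exists c. split; eapply prim_ext; eauto. Qed.

Lemma same_prim_plus phi psi phi' psi' : same_prim phi psi -> same_prim phi' psi' ->
  same_prim (fun x => Cplus (phi x) (phi' x)) (fun x => Cplus (psi x) (psi' x)).
Proof. intros [c [H1 H2]] [d [H3 H4]]. exists (Cplus c d). split; apply prim_plus; assumption. Qed.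

Lemma same_prim_gen phi psi j : sp phi psi ->
  same_prim (fun x => Cmult (phi x) (A j x)) (fun x => Cmult (psi x) (B j x)).
Proof.
intros H. induction H as [phi psi H1 H2|c l phi psi phi1 psi1 H IH H1 H2].
- exists (RtoC 0). split; (eapply prim_ext; [|apply prim_zero]); intros x; rewrite ?H1, ?H2; ring.
- destruct (Hmom l j) as [d [M1 M2]].
  apply (same_prim_ext (fun x => Cplus (Cmult c (Cmult (mon f l x) (A j x))) (Cmult (phi x) (A j x)))
    (fun x => Cplus (Cmult c (Cmult (mon g l x) (B j x))) (Cmult (psi x) (B j x)))).
  + intros x. rewrite H1. ring.
  + intros x. rewrite H2. ring.
  + apply same_prim_plus; [|exact IH]. exists (Cmult c d). split; apply prim_scal; assumption.
Qed.

(* As [sp], together with the pair of derivatives. *)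
Inductive dsp : (R -> CC) -> (R -> CC) -> (R -> CC) -> (R -> CC) -> Prop :=
| dsp_const c : dsp (fun _ => c) (fun _ => c) (fun _ => RtoC 0) (fun _ => RtoC 0)
| dsp_gen i : dsp (f i) (g i) (A i) (B i)
| dsp_plus p q dp dq p' q' dp' dq' : dsp p q dp dq -> dsp p' q' dp' dq' ->
    dsp (fun x => Cplus (p x) (p' x)) (fun x => Cplus (q x) (q' x))
        (fun x => Cplus (dp x) (dp' x)) (fun x => Cplus (dq x) (dq' x))
| dsp_mult p q dp dq p' q' dp' dq' : dsp p q dp dq -> dsp p' q' dp' dq' ->
    dsp (fun x => Cmult (p x) (p' x)) (fun x => Cmult (q x) (q' x))
        (fun x => Cplus (Cmult (dp x) (p' x)) (Cmult (p x) (dp' x)))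
        (fun x => Cplus (Cmult (dq x) (q' x)) (Cmult (q x) (dq' x)))
| dsp_ext p q dp dq p' q' dp' dq' : dsp p q dp dq -> (forall x, p x = p' x) -> (forall x, q x = q' x) ->
    (forall x, dp x = dp' x) -> (forall x, dq x = dq' x) -> dsp p' q' dp' dq'.

Lemma dsp_sp p q dp dq : dsp p q dp dq -> sp p q.
Proof.
intros H. induction H as [c|i|p q dp dq p' q' dp' dq' H1 IH1 H2 IH2|p q dp dq p' q' dp' dq' H1 IH1 H2 IH2
  |p q dp dq p' q' dp' dq' H IH e1 e2 e3 e4].
- apply sp_const.
- apply sp_gen.
- apply sp_plus; assumption.
- apply sp_mult; assumption.
- apply (sp_ext p q); assumption.
Qed.

(** By the Leibniz rule every [P(f) dQ(f)] is a sum of terms [R(f) df_j], to which the moment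
    hypothesis applies. *)
Lemma dsp_same_prim p q dp dq phi psi : dsp p q dp dq -> sp phi psi ->
  same_prim (fun x => Cmult (phi x) (dp x)) (fun x => Cmult (psi x) (dq x)).
Proof.
intros H. revert phi psi. induction H as [c|i|p q dp dq p' q' dp' dq' H1 IH1 H2 IH2|p q dp dq p' q' dp' dq' H1 IH1 H2 IH2
  |p q dp dq p' q' dp' dq' H IH e1 e2 e3 e4]; intros phi psi Hs.
- exists (RtoC 0). split; (eapply prim_ext; [|apply prim_zero]); intros x; simpl; ring.
- apply same_prim_gen, Hs.
- eapply same_prim_ext; [| |exact (same_prim_plus _ _ _ _ (IH1 _ _ Hs) (IH2 _ _ Hs))]; intros x; simpl; ring.
- assert (S1 := sp_mult _ _ _ _ Hs (dsp_sp _ _ _ _ H2)). assert (S2 := sp_mult _ _ _ _ Hs (dsp_sp _ _ _ _ H1)).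
  eapply same_prim_ext; [| |exact (same_prim_plus _ _ _ _ (IH1 _ _ S1) (IH2 _ _ S2))]; intros x; simpl; ring.
- eapply same_prim_ext; [| |exact (IH _ _ Hs)]; intros x; simpl; rewrite ?e3, ?e4; reflexivity.
Qed.
End Pair.

Section Shuffle.
Variables (T : R) (HT : 0 <= T) (A F : nat -> R -> CC) (J : list nat -> R -> CC).
Hypotheses (Fd : forall i x, cder (F i) x (A i x)) (F0 : forall i, F i 0 = RtoC 0).
Hypotheses (Jnil : forall x, J nil x = RtoC 1) (Jd : forall i l x, cder (J (i :: l)) x (Cmult (A i x) (J l x))).
Hypotheses (J0 : forall i l, J (i :: l) 0 = RtoC 0).

Fixpoint inserts (i : nat) (l : list nat) : list (list nat) :=
  match l with nil => (i :: nil) :: nil | j :: l' => (i :: j :: l') :: map (cons j) (inserts i l') end.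

Lemma cder_csum_list (L : list (list nat)) j x :
  cder (fun t => Csum (map (fun l => J (j :: l) t) L)) x (Cmult (A j x) (Csum (map (fun l => J l x) L))).
Proof.
induction L as [|l L IH]; simpl.
- eapply cder_ext; [reflexivity| |apply cder_const]. cring.
- eapply cder_ext; [reflexivity| |exact (cder_plus _ _ _ _ _ (Jd j l x) IH)]. cring.
Qed.

Lemma csum_list_0 (L : list (list nat)) j : Csum (map (fun l => J (j :: l) 0) L) = RtoC 0.
Proof. induction L as [|l L IH]; simpl; [reflexivity|]. rewrite IH, J0. ring. Qed.

(** The shuffle product of an iterated integral with a single one; both sides vanish at 0 when [l]
    is nonempty and have the same derivative by induction. *)
Lemma shuffle i l x : 0 <= x -> Cmult (F i x) (J l x) = Csum (map (fun l' => J l' x) (inserts i l)).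
Proof.
intros Hx. revert x Hx. induction l as [|j l IH]; intros x Hx.
- simpl. rewrite Jnil. transitivity (F i x); [ring|]. transitivity (J (i :: nil) x); [|simpl; ring].
  apply (cder_uniq_fun (F i) (J (i :: nil)) (A i) 0 x Hx); [rewrite F0, J0; reflexivity| | |lra]; intros t Ht; [apply Fd|].
  eapply cder_ext; [reflexivity| |apply Jd]. rewrite Jnil. cring.
- apply (cder_uniq_fun (fun t => Cmult (F i t) (J (j :: l) t)) (fun t => Csum (map (fun l' => J l' t) (inserts i (j :: l))))
    (fun t => Cplus (Cmult (A i t) (J (j :: l) t)) (Cmult (F i t) (Cmult (A j t) (J l t)))) 0 x Hx); [| | |lra].
  + simpl. rewrite F0, map_map, csum_list_0, !J0. ring.
  + intros t Ht. apply cder_mult; [apply Fd|apply Jd].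
  + intros t Ht. simpl. eapply cder_ext; [intros s; rewrite map_map; reflexivity| |].
    2: exact (cder_plus _ _ _ _ _ (Jd i (j :: l) t) (cder_csum_list (inserts i l) j t)).
    rewrite <- IH by lra. cring.
Qed.

Lemma mon_iterated l : exists L, forall x, 0 <= x -> mon F l x = Csum (map (fun l' => J l' x) L).
Proof.
induction l as [|i l [L IH]].
- exists (nil :: nil). intros x _. simpl. rewrite Jnil. ring.
- exists (flat_map (inserts i) L). intros x Hx. simpl. rewrite (IH x Hx). clear IH.
  induction L as [|l' L IH]; simpl; [ring|].
  assert (E : forall a b : list CC, Csum (a ++ b) = Cplus (Csum a) (Csum b)).
  { intros a b. induction a as [|y a IHa]; simpl; [|rewrite IHa]; ring. }
  rewrite map_app, E, <- (shuffle i l' x Hx), <- IH. ring.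
Qed.

(** Expanding the product of primitives into iterated integrals makes a moment a sum of iterated
    integrals of positive length. *)
Lemma moment_of_iterated l j : (forall i x, ccont (A i) x) -> (forall i l', J (i :: l') T = RtoC 0) ->
  cint (fun x => Cmult (mon F l x) (A j x)) 0 T = RtoC 0.
Proof.
intros Ac HJ. destruct (mon_iterated l) as [L HL].
transitivity (cint (fun x => Cmult (A j x) (Csum (map (fun l' => J l' x) L))) 0 T).
- apply cint_ext; [exact HT|]. intros x Hx. rewrite HL by lra. ring.
- rewrite (cint_FTC (fun t => Csum (map (fun l => J (j :: l) t) L)) _ 0 T HT).
  + rewrite csum_list_0. replace (Csum _) with (RtoC 0); [cring|].
    clear HL. induction L as [|l' L IH]; simpl; [reflexivity|]. rewrite HJ. rewrite <- IH. ring.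
  + intros x _. apply cder_csum_list.
  + intros x _. apply ccont_mult; [apply Ac|]. clear HL. induction L as [|[|i l'] L IH]; simpl.
    * apply ccont_const.
    * apply ccont_plus; [|exact IH]. apply (continuous_ext (fun _ => RtoC 1 : CV)); [intros t; symmetry; apply Jnil|].
      apply ccont_const.
    * apply ccont_plus; [|exact IH]. eapply ccont_cder. apply Jd.
Qed.
End Shuffle.
End PathMoments.

(** * Polynomial dependence on the parameter *)

Module HomogeneousFamily.
Import all_boot all_algebra mpoly.
Import LaurentPath CField WeightedHomogeneous CxAnalysis FirstIntegral PathMoments.
Set Implicit Arguments. Unset Strict Implicit. Unset Printing Implicit Defensive.
Import GRing.Theory.
Local Open Scope ring_scope.

Notation RR := Rdefinitions.R.
Notation r0 := (Rdefinitions.IZR BinNums.Z0).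

Lemma csum_big n (f : nat -> CF) : csum n f = \sum_(i < n) f i.
Proof. by elim: n => [|n IH]; rewrite ?big_ord0 // big_ord_recr /= IH. Qed.

Lemma natC n : (n%:R : CF) = RtoC (INR n).
Proof. by elim: n => // n IH; rewrite -natr1 IH S_INR RtoC_plus. Qed.

Lemma Cpow_expr (x : CF) n : Defs.Cpow x n = x ^+ n.
Proof. by elim: n => // n IH; rewrite exprS /= IH. Qed.

Section Family.
Variable k : nat.
Notation A := {mpoly CF[k]}.
Implicit Types (w : nat -> CF) (Phi : RR -> A).

Definition ev w (p : A) : CF := p.@[fun j : 'I_k => w j].

Lemma evD w p q : ev w (p + q) = ev w p + ev w q. Proof. exact: mevalD. Qed.
Lemma evM w p q : ev w (p * q) = ev w p * ev w q. Proof. exact: mevalM. Qed.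
Lemma evZ w c p : ev w (c *: p) = c * ev w p. Proof. exact: mevalZ. Qed.
Lemma ev0 w : ev w 0 = 0. Proof. exact: meval0. Qed.
Lemma ev1 w : ev w 1 = 1. Proof. exact: meval1. Qed.

(* Polynomials in [w], with exponents in [Q], whose coefficients depend continuously on [x]. *)
Inductive pathpoly (Q : 'X_{1..k} -> Prop) : (RR -> A) -> Prop :=
| pathpoly_zero Phi : (forall x, Phi x = 0) -> pathpoly Q Phi
| pathpoly_add c m Phi Phi' : (forall x, ccont c x) -> Q m -> pathpoly Q Phi ->
    (forall x, Phi' x = (c x : CF) *: 'X_[m] + Phi x) -> pathpoly Q Phi'.

Lemma pathpoly_ext Q Phi Phi' : (forall x, Phi x = Phi' x) -> pathpoly Q Phi -> pathpoly Q Phi'.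
Proof.
move=> e h; case: h e => [Psi h|c m Psi Psi' cc Qm h e'] e.
  by apply: pathpoly_zero => x; rewrite -e.
by apply: (pathpoly_add cc Qm h) => x; rewrite -e e'.
Qed.

Lemma pathpolyD Q Phi Psi : pathpoly Q Phi -> pathpoly Q Psi -> pathpoly Q (fun x => Phi x + Psi x).
Proof.
move=> h h'; elim: h => [Phi1 e|c m Phi1 Phi' cc Qm _ IH e].
  by apply: pathpoly_ext h' => x; rewrite e add0r.
by apply: (pathpoly_add cc Qm IH) => x; rewrite e addrA.
Qed.

Lemma pathpolyM (Q Q' Q'' : 'X_{1..k} -> Prop) Phi Psi : (forall m m', Q m -> Q' m' -> Q'' (m + m')%MM) ->
  pathpoly Q Phi -> pathpoly Q' Psi -> pathpoly Q'' (fun x => Phi x * Psi x).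
Proof.
move=> hQ h h'; elim: h => [Phi1 e|c m Phi1 Phi' cc Qm _ IH e].
  by apply: pathpoly_zero => x; rewrite e mul0r.
apply: (@pathpoly_ext _ (fun x => (c x : CF) *: 'X_[m] * Psi x + Phi1 x * Psi x)).
  by move=> x; rewrite e mulrDl.
apply: pathpolyD => //; elim: h' => [Psi1 e'|c' m' Psi1 Psi' cc' Qm' _ IH' e'].
  by apply: pathpoly_zero => x; rewrite e' mulr0.
apply: (@pathpoly_add _ (fun x => Cmult (c x) (c' x)) (m + m')%MM _ _ _ (hQ _ _ Qm Qm') IH').
  by move=> x; apply: ccont_mult.
move=> x; rewrite e' mulrDr; congr (_ + _).
by rewrite -scalerAl -scalerAr scalerA mpolyXD.
Qed.

Lemma pathpoly_const (Q : 'X_{1..k} -> Prop) (c : CF) : Q 0%MM -> pathpoly Q (fun _ => c%:MP).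
Proof.
move=> Q0; apply: (@pathpoly_add _ (fun _ => c) 0%MM (fun _ => 0)) => // [x||x].
- exact: ccont_const.
- exact: pathpoly_zero.
- by rewrite addr0 mpolyX0 -mul_mpolyC mulr1.
Qed.

Lemma pathpoly_cont Q Phi w x : pathpoly Q Phi -> ccont (fun t => ev w (Phi t)) x.
Proof.
elim=> [Phi1 e|c m Phi1 Phi' cc Qm _ IH e].
  apply: (continuous_ext (fun _ => RtoC 0 : CV)); last exact: ccont_const.
  by move=> t; rewrite e ev0.
apply: (continuous_ext (fun t => Cplus (Cmult (c t) (ev w 'X_[m])) (ev w (Phi1 t)) : CV)).
  by move=> t; rewrite e evD evZ.
by apply: ccont_plus => //; apply: ccont_mult => //; apply: ccont_const.
Qed.

Lemma pathpoly_prim Q Phi : pathpoly Q Phi -> exists Psi, [/\ pathpoly Q Psi, Psi r0 = 0 &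
  forall w x, cder (fun t => ev w (Psi t)) x (ev w (Phi x))].
Proof.
elim=> [Phi1 e|c m Phi1 Phi' cc Qm _ [Psi [hP P0 dP]] e].
  exists (fun _ => 0); split=> // [|w x]; first exact: pathpoly_zero.
  by apply: (cder_ext _ _ _ _ _ _ _ (cder_const (RtoC 0) x)) => [t|]; rewrite ?e ev0.
exists (fun x => (cint c r0 x : CF) *: 'X_[m] + Psi x); split.
- apply: (@pathpoly_add Q (fun x => cint c r0 x) m Psi _ _ Qm hP) => // x.
  exact: (ccont_cder _ _ _ (cint_cder c r0 x cc)).
- by rewrite P0 cint_point scale0r addr0.
- move=> w x.
  apply: (cder_ext _ _ _ _ _ _ _ (cder_plus _ _ _ _ _ (cder_mult _ _ _ _ _ (cint_cder c r0 x cc)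
    (cder_const (ev w 'X_[m]) x)) (dP w x))) => [t|].
    by rewrite evD evZ.
  by rewrite e evD evZ Cmult_0_r Cplus_0_r.
Qed.

Lemma pathpoly_whomog wt d Phi x : pathpoly (fun m => wd wt m = d) Phi -> whomog wt d (Phi x).
Proof.
elim=> [Phi1 e|c m Phi1 Phi' cc Qm _ IH e]; rewrite e; first exact: whomog_zero.
exact: whomog_add.
Qed.

Variables (T : RR) (wt : 'I_k -> nat) (P F : nat -> RR -> A) (d : nat -> nat).
Hypothesis hP : forall i, pathpoly (fun m => wd wt m = d i) (P i).
Hypothesis hF : forall i, pathpoly (fun m => wd wt m = d i) (F i).
Hypothesis Fd : forall i w x, cder (fun t => ev w (F i t)) x (ev w (P i x)).

Fixpoint wlen (l : seq nat) : nat := if l is i :: l' then (d i + wlen l')%N else 0.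

Lemma pathpoly_mon l : exists Phi, pathpoly (fun m => wd wt m = wlen l) Phi /\
  forall w x, ev w (Phi x) = mon (fun i t => ev w (F i t)) l x.
Proof.
elim: l => [|i l [Phi [h e]]].
  exists (fun _ => 1%:MP); split=> [|w x]; last by rewrite mpolyC1 ev1.
  by apply: pathpoly_const; rewrite /wd big1 // => j _; rewrite mnm0E muln0.
exists (fun x => F i x * Phi x); split=> [|w x]; last by rewrite evM e.
by apply: pathpolyM (hF i) h => m m' /= <- <-; rewrite wdD.
Qed.

(** Integration in [x] acts on the coefficients and leaves the exponents in [w] alone, so weights
    add as in a product. *)
Lemma moment_poly l j : exists p, whomog wt (wlen l + d j) p /\ forall w,
  prim T (fun x => Cmult (mon (fun i t => ev w (F i t)) l x) (ev w (P j x))) (ev w p).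
Proof.
have [Phi [hPhi e]] := pathpoly_mon l.
have hM : pathpoly (fun m => wd wt m = (wlen l + d j)%N) (fun x => Phi x * P j x).
  by apply: pathpolyM hPhi (hP j) => m m' <- <-; rewrite wdD.
have [Psi [hPsi P0 dPsi]] := pathpoly_prim hM.
exists (Psi T); split=> [|w]; first exact: pathpoly_whomog.
exists (fun t => ev w (Psi t)); split=> [x|].
  by apply: (cder_ext _ _ _ _ _ _ _ (dPsi w x)) => //; rewrite evM e.
by rewrite P0 ev0; exact: (subr0 (ev w (Psi T))).
Qed.

(** The recursion is solved once, over polynomials in [w], so that the values [H n.+1 T] become the
    equations of the center set. [P i] is the coefficient numbered [i + 1]. *)
Lemma first_integral_polys : exists H : nat -> RR -> A, [/\ forall x, H 0%N x = 1, forall n, H n.+1 r0 = 0 &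
  forall n w x, cder (fun t => ev w (H n t)) x (gder (fun i t => ev w (P i.-1 t)) (fun i t => ev w (H i t)) n x)].
Proof.
pose rhs (G : nat -> RR -> A) n x := - \sum_(i < n.+1) (G (n - i)%N x *+ (n - i).+1) * P i x.
pose Q := pathpoly (fun=> True).
pose Rel (G : nat -> RR -> A) n y := if n is n'.+1 then y r0 = 0 /\
   forall w x, cder (fun t => ev w (y t)) x (ev w (rhs G n' x)) else forall x, y x = 1.
have hP' i : pathpoly (fun=> True) (P i).
  by elim: (hP i) => [Phi e|c m Phi Phi' cc _ _ IH e]; [exact: pathpoly_zero|exact: pathpoly_add e].
have [||H hH] := @seq_choice (RR -> A) (fun=> 0) Q Rel.
- case=> // n G G' y e [y0 hy]; split=> // w x.
  apply: (cder_ext _ _ _ _ _ _ _ (hy w x)) => //; congr ev; congr (- _).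
  by apply: eq_bigr => i _; rewrite e // ltnS leq_subr.
- case=> [|n] G hG.
    by exists (fun _ => 1%:MP); split=> [|x]; [exact: pathpoly_const|exact: mpolyC1].
  have hr : pathpoly (fun=> True) (rhs G n).
    apply: (@pathpoly_ext _ (fun x => (-1)%:MP * \sum_(i < n.+1) ((n - i).+1%:R)%:MP * G (n - i)%N x * P i x)).
      move=> x; rewrite rmorphN rmorph1 mulN1r; congr (- _); apply: eq_bigr => i _.
      by rewrite rmorph_nat mulr_natl.
    have hc c : pathpoly (fun=> True) (fun=> c%:MP) by apply: pathpoly_const.
    have hM Phi Psi := @pathpolyM (fun=> True) (fun=> True) (fun=> True) Phi Psi (fun _ _ _ _ => I).
    apply: (hM) => //; set m := n.+1; have : (m <= n.+1)%N by [].
    elim: m => [|m IH] mn; first by apply: pathpoly_zero => x; rewrite big_ord0.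
    apply: (@pathpoly_ext _ (fun x => \sum_(i < m) ((n - i).+1%:R)%:MP * G (n - i)%N x * P i x +
       ((n - m).+1%:R)%:MP * G (n - m)%N x * P m x)); first by move=> x; rewrite big_ord_recr.
    apply: pathpolyD; first exact/IH/ltnW.
    by apply: (hM) => //; apply: (hM) => //; apply: hG; rewrite ltnS leq_subr.
  by have [Psi [h1 h2 h3]] := pathpoly_prim hr; exists Psi.
exists H; split=> [x|n|[|n] w x].
- exact: (hH 0%N).2.
- exact: (hH n.+1).2.1.
- apply: (cder_ext _ _ _ _ _ _ _ (cder_const (RtoC 1) x)) => // t.
  by rewrite (hH 0%N).2 ev1.
- apply: (cder_ext _ _ _ _ _ _ _ ((hH n.+1).2.2 w x)) => //.
  rewrite /rhs /gder csum_big /ev mevalN rmorph_sum; apply: (f_equal (Copp : CF -> CF)); apply: eq_bigr => i _ /=.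
  rewrite mevalM mevalMn -mulr_natl natC; reflexivity.
Qed.
End Family.
End HomogeneousFamily.

(** * From moments to pairs of polynomial paths *)

Module PolynomialCoefficients.
Import all_boot all_algebra.
Import FracDer FunPair PolyPath PolyTransfer CField CxAnalysis PathMoments.
Set Implicit Arguments. Unset Strict Implicit. Unset Printing Implicit Defensive.
Import GRing.Theory.
Local Open Scope ring_scope.
Notation RR := Rdefinitions.R.
Notation r0 := (Rdefinitions.IZR BinNums.Z0).
Notation E := (frac_ratfun CF).

Definition pe (p : {poly CF}) (x : RR) : CF := p.[(RtoC x : CF)].

Lemma cder_RtoC x : cder RtoC x (RtoC 1).
Proof.
apply: cder_pair; first exact: (is_derive_id (K := R_AbsRing)).
exact: (is_derive_const (K := R_AbsRing) (V := R_NormedModule)).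
Qed.

Lemma pe_cder p x : cder (pe p) x (pe p^`() x).
Proof.
elim/poly_ind: p => [|p c IH].
  apply: (cder_ext _ _ _ _ _ _ _ (cder_const (RtoC 0) x)) => [t|]; by rewrite /pe ?deriv0 horner0.
apply: (cder_ext _ _ _ _ _ _ _ (cder_plus _ _ _ _ _ (cder_mult _ _ _ _ _ IH (cder_RtoC x)) (cder_const c x))) => [t|].
  by rewrite /pe !hornerE.
by rewrite Cplus_0_r Cmult_1_r /pe derivD derivM derivX derivC addr0 mulr1 hornerD hornerM hornerX.
Qed.

Lemma poly_prim0 (w : {poly CF}) : exists P : {poly CF}, P^`() = w /\ P.[(RtoC r0 : CF)] = 0.
Proof.
have [P <-] := poly_prim CF_ch0 w; exists (P - P.[(RtoC r0 : CF)]%:P).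
by rewrite derivB derivC subr0 hornerD hornerN hornerC subrr.
Qed.

Section Transfer.
Variables (T : RR) (p q : nat -> {poly CF}).
Hypothesis HT : Rle r0 T.
Notation f := (fun i => pe (p i)).
Notation g := (fun i => pe (q i)).
Notation A := (fun i => pe (p i)^`()).
Notation B := (fun i => pe (q i)^`()).

(** The bridge between algebraic pairs in [F(X)] and pairs of functions of a real variable with
    their derivatives. *)
Lemma alg2_dsp x y : alg2 (fun i => rI E (p i)) (fun i => rI E (q i)) x y ->
  exists X Y, [/\ x = rI E X, y = rI E Y & dsp f g A B (pe X) (pe Y) (pe X^`()) (pe Y^`())].
Proof.
elim=> [c|i|_ _ _ _ _ [X [Y [-> -> h]]] _ [X' [Y' [-> -> h']]]|_ _ _ _ _ [X [Y [-> -> h]]] _ [X' [Y' [-> -> h']]]].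
- exists c%:P, c%:P; split=> //.
  by apply: dsp_ext (dsp_const _ _ _ _ c) _ _ _ _ => t; rewrite /pe ?derivC ?hornerC ?horner0.
- by exists (p i), (q i); split=> //; apply: (dsp_gen f g A B i).
- exists (X + X'), (Y + Y'); rewrite !rmorphD; split=> //.
  by apply: dsp_ext (dsp_plus _ _ _ _ _ _ _ _ _ _ _ _ h h') _ _ _ _ => t; rewrite /pe ?derivD hornerD.
- exists (X * X'), (Y * Y'); rewrite !rmorphM; split=> //.
  by apply: dsp_ext (dsp_mult _ _ _ _ _ _ _ _ _ _ _ _ h h') _ _ _ _ => t; rewrite /pe ?derivM ?hornerD !hornerM.
Qed.

Hypothesis Hmom : forall l j, exists c, prim T (fun x => Cmult (mon f l x) (A j x)) c /\
  prim T (fun x => Cmult (mon g l x) (B j x)) c.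

Lemma moments_bal a a' b b' : alg2 (fun i => rI E (p i)) (fun i => rI E (q i)) a a' ->
  alg2 (fun i => rI E (p i)) (fun i => rI E (q i)) b b' ->
  bal (RtoC r0 : CF) (RtoC T : CF) (a * rD b) (a' * rD b').
Proof.
move=> /alg2_dsp[X [Y [-> -> h]]] /alg2_dsp[X' [Y' [-> -> h']]].
have [u [eu _]] := poly_prim0 (X * X'^`()); have [v [ev _]] := poly_prim0 (Y * Y'^`()).
exists u, v; rewrite !der_iota eu ev !rmorphM; split=> //.
have [c [h1 h2]] := dsp_same_prim T _ _ _ _ Hmom _ _ _ _ _ _ h' (dsp_sp _ _ _ _ _ _ _ _ h).
have e1 := prim_uniq T _ _ _ HT h1 (prim_ext _ _ _ _ _ (prim_der T _ _ (pe_cder u))).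
have e2 := prim_uniq T _ _ _ HT h2 (prim_ext _ _ _ _ _ (prim_der T _ _ (pe_cder v))).
have {}e1 : c = Cminus (pe u T) (pe u r0) by apply: e1 => x; rewrite eu /pe hornerM.
have {}e2 : c = Cminus (pe v T) (pe v r0) by apply: e2 => x; rewrite ev /pe hornerM.
by rewrite e1 in e2.
Qed.

Lemma closed_first_integral H : hseqP p H -> (forall n, pe (H n) T = pe (H n) r0) ->
  exists2 G, hseqP q G & forall n, pe (G n) T = pe (G n) r0.
Proof. exact: (poly_transfer (E := E) CF_ch0 moments_bal). Qed.
End Transfer.

(** Vanishing moments are the moments of the zero path, so [moments_bal] for the pair of [p] and 0
    shows that every integral of [a db] vanishes, as the partner of [b] is constant. *)
Lemma universal_of_moments (T : RR) (p : nat -> {poly CF}) : Rle r0 T ->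
  (forall l j, prim T (fun x => Cmult (mon (fun i => pe (p i)) l x) (pe (p j)^`() x)) (RtoC r0)) ->
  exists X : seq nat -> {poly CF}, [/\ X [::] = 1, forall i l, (X (i :: l))^`() = X l * (p i)^`(),
    forall i l, pe (X (i :: l)) r0 = RtoC r0 & forall i l, pe (X (i :: l)) T = RtoC r0].
Proof.
move=> HT hm; pose pr w := ClassicalEpsilon.epsilon (inhabits 0)
  (fun P : {poly CF} => P^`() = w /\ P.[(RtoC r0 : CF)] = 0).
have hpr w : (pr w)^`() = w /\ (pr w).[(RtoC r0 : CF)] = 0 := ClassicalEpsilon.epsilon_spec (inhabits 0) _ (poly_prim0 w).
pose X := fix X (l : seq nat) : {poly CF} := if l is i :: l' then pr (X l' * (p i)^`()) else 1.
have X1 i l : (X (i :: l))^`() = X l * (p i)^`() := (hpr _).1.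
have X2 i l : pe (X (i :: l)) r0 = RtoC r0 := (hpr _).2.
have tX l : tow p (X l) by elim: l => [|i l IH]; [exact: towC|exact: towI (X1 i l)].
exists X; split=> // i l; rewrite -[RHS](X2 i l).
apply: (poly_universal (E := E) CF_ch0 _ (tX (i :: l))) => a b ha hb.
have hm0 l' j : exists c, prim T (fun x => Cmult (mon (fun i => pe (p i)) l' x) (pe (p j)^`() x)) c /\
    prim T (fun x => Cmult (mon (fun i => pe (p i)) l' x) (pe (p j)^`() x)) c by exists (RtoC r0).
have hm1 l' j : exists c, prim T (fun x => Cmult (mon (fun i => pe (p i)) l' x) (pe (p j)^`() x)) c /\
    prim T (fun x => Cmult (mon (fun i => pe 0) l' x) (pe (0 : {poly CF})^`() x)) c.
  exists (RtoC r0); split=> //; apply: (prim_ext _ _ _ _ _ (prim_zero T)) => x.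
  by rewrite /pe deriv0 horner0 Cmult_0_r.
have [a' ha'] := alg2_lift (fun i => rI E 0) ha; have [b' hb'] := alg2_lift (fun i => rI E 0) hb.
have [u [v [eu ev e]]] := moments_bal HT hm1 ha' hb'.
exists u => //; apply/eqP; rewrite -subr_eq0 e.
have cst_der x y : alg2 (fun i => rI E (p i)) (fun i => rI E 0) x y -> exists c, y = rI E c%:P.
  elim=> [c|j|x1 y1 x2 y2 _ [c1 ->] _ [c2 ->]|x1 y1 x2 y2 _ [c1 ->] _ [c2 ->]].
  - by exists c.
  - by exists 0; rewrite polyC0.
  - by exists (c1 + c2); rewrite polyCD rmorphD.
  - by exists (c1 * c2); rewrite polyCM rmorphM.
have [c ec] := cst_der _ _ hb'; move: ev; rewrite ec der_iota derivC rmorph0 mulr0 der_iota => /esym/eqP.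
rewrite iota_eq0E => /eqP/(deriv_eq0 CF_ch0)[d ->].
by rewrite !hornerC subrr.
Qed.
End PolynomialCoefficients.

(** * Exponentials of period [T] *)

Module TrigPaths.
Import CxAnalysis.

Definition freq (T : R) (r : R) : CC := (0, 2 * PI * r / T).
Definition wave (T : R) (x : R) (r : R) : CC := Defs.cis (r * (2 * PI * x / T)).

Lemma wave_add T x r s : wave T x (r + s) = Cmult (wave T x r) (wave T x s).
Proof.
unfold wave, Defs.cis, Cmult; simpl. rewrite Rmult_plus_distr_r, cos_plus, sin_plus. f_equal; ring.
Qed.

Lemma wave_0 T x : wave T x 0 = RtoC 1.
Proof. unfold wave, Defs.cis. rewrite Rmult_0_l, cos_0, sin_0. reflexivity. Qed.

Lemma wave_cder T r x : T <> 0 -> cder (fun t => wave T t r) x (Cmult (freq T r) (wave T x r)).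
Proof.
intros HT. unfold wave, Defs.cis, freq, Cmult, Rdiv. apply cder_pair; simpl.
- auto_derive; [exact I|ring].
- auto_derive; [exact I|ring].
Qed.

Lemma cis_wave T x n : Defs.cis (2 * PI * IZR n * x / T) = wave T x (IZR n).
Proof. unfold wave. f_equal. unfold Rdiv. ring. Qed.

Lemma wave_period T n : T <> 0 -> wave T T (IZR n) = wave T 0 (IZR n).
Proof.
intros HT. unfold wave. replace (IZR n * (2 * PI * T / T)) with (0 + 2 * IZR n * PI) by (field; exact HT).
replace (IZR n * (2 * PI * 0 / T)) with 0 by (field; exact HT).
assert (P : forall k x, Defs.cis (x + 2 * INR k * PI) = Defs.cis x).
{ intros k x. unfold Defs.cis. rewrite cos_period, sin_period. reflexivity. }
destruct (Z_le_gt_dec 0 n) as [H|H].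
- replace n with (Z.of_nat (Z.to_nat n)) by lia. rewrite <- INR_IZR_INZ. apply P.
- rewrite <- (P (Z.to_nat (- n)) (0 + 2 * IZR n * PI)). f_equal.
  rewrite INR_IZR_INZ, Z2Nat.id by lia. rewrite opp_IZR. ring.
Qed.

Lemma eq_of_cder (f g d : R -> CC) : f 0 = g 0 -> (forall x, cder f x (d x)) -> (forall x, cder g x (d x)) ->
  forall x, f x = g x.
Proof.
intros E H1 H2 x. assert (D : forall t, cder (fun t => Cplus (f t) (Copp (g t))) t (RtoC 0)).
{ intros t. eapply cder_ext; [reflexivity| |exact (cder_plus _ _ _ _ _ (H1 t) (cder_opp _ _ _ (H2 t)))]. cring. }
assert (Z : Cplus (f x) (Copp (g x)) = RtoC 0).
{ replace (RtoC 0) with (Cplus (f 0) (Copp (g 0))) by (rewrite E; ring).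
  destruct (Rle_dec 0 x) as [Hx|Hx].
  - symmetry. apply (cder_zero_const (fun t => Cplus (f t) (Copp (g t))) 0 x Hx). auto.
  - apply (cder_zero_const (fun t => Cplus (f t) (Copp (g t))) x 0); [lra|auto]. }
replace (f x) with (Cplus (Cplus (f x) (Copp (g x))) (g x)) by ring. rewrite Z. ring.
Qed.
End TrigPaths.

(** * Trigonometric polynomials as Laurent polynomials *)

Module TrigCoefficients.
Import all_boot all_algebra ring zify ssrZ.
Import FracDer FunPair PolyPath Kummer Laurent LaurentPath LinearGrowth.
Import CField CxAnalysis FirstIntegral PathMoments TrigPaths.
Set Implicit Arguments. Unset Strict Implicit. Unset Printing Implicit Defensive.
Import GRing.Theory.
Local Open Scope ring_scope.
Notation RR := Rdefinitions.R.
Notation r0 := (Rdefinitions.IZR BinNums.Z0).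
Notation r1 := (Rdefinitions.IZR (BinNums.Zpos BinNums.xH)).
Notation E := (frac_ratfun CF).
Notation z := (rI E 'X).
Notation cst := (@cst CF E).
Notation del := (@del CF E).
Notation ct := (@ct CF E).
Notation lau := (@lau CF E).

Definition rint (n : int) : RR := IZR (Z_of_int n).

Lemma rintD m n : rint (m + n) = Rplus (rint m) (rint n).
Proof. by rewrite /rint -plus_IZR; congr IZR; lia. Qed.

Lemma intC n : (n%:~R : CF) = RtoC (rint n).
Proof.
have natC m : (m%:R : CF) = RtoC (INR m) by elim: m => // m IH; rewrite -natr1 IH S_INR RtoC_plus.
case: n => n; rewrite /rint.
  by rewrite -pmulrn natC INR_IZR_INZ; congr (RtoC (IZR _)); lia.
rewrite NegzE mulrNz -pmulrn natC INR_IZR_INZ.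
rewrite -[LHS]RtoC_opp -opp_IZR; congr (RtoC (IZR _)); lia.
Qed.

Definition rc (x : RR) : CF := RtoC x.

(** [prim] retyped over [CF], so that the field operations are found in its statements. *)
Definition rprim (T : RR) (f : RR -> CF) (c : CF) : Prop := prim T f c.

Section Wrappers.
Variable T : RR.
Implicit Types (f g : RR -> CF) (c d l m : CF).
Lemma cder_eq f g x l m : f =1 g -> l = m -> cder f x l -> cder g x m.
Proof. exact: cder_ext. Qed.
Lemma cderD f g x l m : cder f x l -> cder g x m -> cder (fun t => f t + g t) x (l + m).
Proof. exact: cder_plus. Qed.
Lemma cderM f g x l m : cder f x l -> cder g x m -> cder (fun t => f t * g t) x (l * g x + f x * m).
Proof. exact: cder_mult. Qed.
Lemma cderZ c f x l : cder f x l -> cder (fun t => c * f t) x (c * l).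
Proof. exact: cder_scal. Qed.
Lemma cder_cst c x : cder (fun=> c) x (0 : CF).
Proof. exact: cder_const. Qed.
Lemma cder_rc x : cder rc x (1 : CF).
Proof. exact: PolynomialCoefficients.cder_RtoC. Qed.
Lemma primE f g c d : f =1 g -> c = d -> rprim T f c -> rprim T g d.
Proof. by move=> e <-; exact: prim_ext. Qed.
Lemma primD f g c d : rprim T f c -> rprim T g d -> rprim T (fun x => f x + g x) (c + d).
Proof. exact: prim_plus. Qed.
Lemma primZ k f c : rprim T f c -> rprim T (fun x => k * f x) (k * c).
Proof. exact: prim_scal. Qed.
Lemma prim0 : rprim T (fun=> 0 : CF) (0 : CF).
Proof. exact: prim_zero. Qed.
Lemma prim_primitive f g : (forall x, cder f x (g x)) -> rprim T g (f T - f r0).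
Proof. exact: prim_der. Qed.
End Wrappers.

Section Eval.
Variable T : RR.
Hypothesis HT : Rlt r0 T.

Let T0 : T <> r0. Proof. by move=> e; move: HT; rewrite e; apply: Rlt_irrefl. Qed.
Let HT' : Rle r0 T. Proof. exact: Rlt_le. Qed.

Lemma rprim_uniq (f : RR -> CF) (c d : CF) : rprim T f c -> rprim T f d -> c = d.
Proof. exact: prim_uniq. Qed.

Definition wv (x : RR) (n : int) : CF := wave T x (rint n).
Definition kap : CF := freq T r1.
Lemma kap0 : kap != 0.
Proof.
apply/eqP; rewrite /kap /freq => -[].
apply: Rmult_integral_contrapositive_currified; last exact: Rinv_neq_0_compat.
by apply: Rmult_integral_contrapositive_currified; [apply: Rgt_not_eq; have := PI_RGT_0; lra|lra].
Qed.
Lemma rcT0 : rc T != 0.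
Proof. by apply/eqP => -[] /T0. Qed.
Lemma freqE n : (freq T (rint n) : CF) = kap * n%:~R.
Proof.
rewrite intC; apply: injective_projections; rewrite /= /Rdiv !(Rmult_0_l, Rmult_0_r, Rmult_1_r, Rminus_0_r, Rplus_0_l, Rplus_0_r) //.
by rewrite !Rmult_assoc (Rmult_comm (rint n)).
Qed.
Lemma wv_cder n x : cder (wv^~ n) x (kap * n%:~R * wv x n).
Proof. by rewrite -freqE; exact: wave_cder. Qed.
Lemma wvD x m n : wv x (m + n) = wv x m * wv x n.
Proof. by rewrite /wv rintD wave_add. Qed.

(** The value at [x] under [z = exp(2 pi i x / T)]; [kap = 2 pi i / T] links the real derivative
    with [del]. *)
Definition le (y : E) (x : RR) : CF := lf (wv x) y.

Lemma leS c n y x : lau y -> le (cst c * z ^ n + y) x = c * wv x n + le y x.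
Proof. exact: lfS. Qed.
Lemma le0 x : le 0 x = 0. Proof. exact: lf0. Qed.
Lemma leD y y' x : lau y -> lau y' -> le (y + y') x = le y x + le y' x.
Proof. exact: lfD. Qed.
Lemma leN y x : lau y -> le (- y) x = - le y x.
Proof. exact: lfN. Qed.
Lemma leZ c y x : lau y -> le (cst c * y) x = c * le y x.
Proof. exact: lfZ. Qed.
Lemma leM y y' x : lau y -> lau y' -> le (y * y') x = le y x * le y' x.
Proof. exact/lf_mul/wvD. Qed.
Lemma le_cst c x : le (cst c) x = c.
Proof.
have := leS c 0 x (lau0 E); rewrite expr0z mulr1 addr0 le0 addr0 => ->.
by rewrite /wv /rint (wave_0 T x) -[RHS]mulr1.
Qed.
Lemma le_sum n (f : 'I_n -> E) x : (forall i, lau (f i)) -> le (\sum_i f i) x = \sum_i le (f i) x.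
Proof.
move=> h; suff [] : lau (\sum_i f i) /\ le (\sum_i f i) x = \sum_i le (f i) x by [].
apply: (big_ind2 (fun y c => lau y /\ le y x = c)) => //.
- by split; [exact: lau0|exact: le0].
- by move=> y c y' c' [h1 <-] [h2 <-]; split; [exact: lauD|exact: leD].
Qed.

Lemma le_cder y x : lau y -> cder (le y) x (kap * le (del y) x).
Proof.
move: y; apply: lau_ind => [|c n y hy IH].
  by apply: (cder_eq _ _ (cder_cst 0 x)) => [t|]; rewrite ?del0 le0 ?mulr0.
apply: (cder_eq _ _ (cderD (cderZ c (wv_cder n x)) IH)) => [t|]; first by rewrite leS.
by rewrite delD del_term leS; [ring|exact: lau_del].
Qed.

Lemma le_period y : lau y -> le y T = le y r0.
Proof.
move: y; apply: lau_ind => [|c n y hy IH]; first by rewrite !le0.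
by rewrite !leS // IH /wv /rint wave_period.
Qed.

Lemma prim_le y : lau y -> rprim T (le y) (rc T * ct y).
Proof.
move=> hy; have [Y hY e] := lau_prim CF_ch0 hy.
have hd x : cder (fun x => kap^-1 * le Y x + ct y * rc x) x (le y x).
  apply: (cder_eq _ _ (cderD (cderZ kap^-1 (le_cder x hY)) (cderZ (ct y) (cder_rc x)))) => //.
  rewrite {2}e leD ?le_cst; [|exact: lau_del|exact: lau_cst].
  by rewrite mulr1 mulKf // kap0.
apply: (primE _ _ (prim_primitive T hd)) => //.
by rewrite le_period // [rc r0](_ : _ = 0) // mulr0; ring.
Qed.

(** The integral of [y z^(-n)] over a period recovers the coefficient of [z^n]. *)
Lemma le_inj y y' : lau y -> lau y' -> (forall x, le y x = le y' x) -> y = y'.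
Proof.
move=> hy hy' e; have hB : lau (y - y') by apply: lauD => //; apply: lauN.
apply/eqP; rewrite -subr_eq0; apply/eqP/lau_eq0 => // n.
have lz : lau (z ^ (- n)) by apply: lau_zn.
have h1 : rprim T (le ((y - y') * z ^ (- n))) 0.
  apply: (primE _ _ (prim0 T)) => // x.
  by rewrite leM // leD ?leN //; [rewrite e subrr mul0r|exact: lauN].
have := rprim_uniq h1 (prim_le (lauM hB lz)) => /esym/eqP.
rewrite mulf_eq0 (negPf rcT0) /Laurent.ct lf_shift // => /eqP h.
by rewrite -[RHS]h; apply: eq_lf => m; rewrite subr_eq0.
Qed.

Lemma le_cont y x : lau y -> ccont (le y) x.
Proof. by move=> hy; exact: ccont_cder (le_cder x hy). Qed.

(** The logarithm of [z], the only part of a path outside Laurent polynomials. *)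
Definition theta (x : RR) : CF := kap * rc x.
Lemma theta_cder x : cder theta x kap.
Proof. by apply: (cder_eq _ _ (cderZ kap (cder_rc x))) => //; rewrite mulr1. Qed.

Definition jm (phi : RR -> CF) (n : int) : CF := (rc T)^-1 * cint (fun x => phi x * wv x n) r0 T.
Lemma prim_jm (phi : RR -> CF) y : (forall x, ccont phi x) -> lau y ->
  rprim T (fun x => phi x * le y x) (rc T * lf (jm phi) y).
Proof.
move=> hphi; move: y; apply: lau_ind => [|c n y hy IH].
  by apply: (primE _ _ (prim0 T)) => [x|]; rewrite ?le0 ?lf0 mulr0.
have h : rprim T (fun x => phi x * wv x n) (rc T * jm phi n).
  rewrite /jm mulVKf ?rcT0 //; apply: prim_of_cont => x; apply: ccont_mult => //.
  exact: (ccont_cder _ _ _ (wv_cder n x)).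
apply: (primE _ _ (primD (primZ c h) IH)) => [x|].
  by rewrite leS //; ring.
by rewrite lfS //; ring.
Qed.

(** Integrate the derivative of [x z^n] over a period: the boundary term is [T], and the mean of
    [z^n] is 0. *)
Lemma jm_theta n : n != 0 -> jm theta n * n%:~R = 1.
Proof.
move=> n0; have lz : lau (z ^ n) by exact: lau_zn.
have lez x : le (z ^ n) x = wv x n by rewrite /le lf_zn.
have theta_cont x : ccont theta x := ccont_cder _ _ _ (theta_cder x).
have h1 := prim_jm theta_cont lz; rewrite lf_zn in h1.
have h2 := prim_primitive T (fun x => cderM (cder_rc x) (le_cder x lz)).
have h3 := primD (prim_le lz) (primZ n%:~R h1).
have e : rc T * le (z ^ n) T - rc r0 * le (z ^ n) r0 = rc T * ct (z ^ n) + n%:~R * (rc T * jm theta n).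
  apply: (rprim_uniq _ h3); apply: (primE _ erefl h2) => x.
  have := @del_term CF E 1 n; rewrite rmorph1 !mul1r => ->; rewrite leZ // /theta; ring.
have lT : le (z ^ n) T = 1.
  rewrite le_period // lez /wv /wave /Defs.cis /Rdiv Rmult_0_r Rmult_0_l Rmult_0_r cos_0 sin_0; reflexivity.
move: e; rewrite lT [rc r0](_ : _ = 0) // mul0r subr0 /Laurent.ct lf_zn (negPf n0) mulr0 add0r mulrCA => e.
by apply: (mulfI rcT0); rewrite mulrC [_ * n%:~R]mulrC mulrC -e.
Qed.

Section Path.
Variable al : nat -> E.
Hypothesis lal : forall i, lau (al i).

(* The coefficient [a_i] in the variable [theta], that is, divided by [d theta / dx]; its mean is [drift i]. *)
Definition velocity i : E := cst kap^-1 * al i.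
Definition drift i : CF := ct (velocity i).

Lemma lau_velocity i : lau (velocity i).
Proof. by apply: lauM => //; apply: lau_cst. Qed.

Lemma oscillation_exists i : exists y, [/\ lau y, del y = velocity i - cst (drift i) & le y r0 = 0].
Proof.
have [Y hY e] := lau_prim CF_ch0 (lau_velocity i).
exists (Y - cst (le Y r0)); split.
- by apply: lauD => //; apply/lauN/lau_cst.
- by rewrite delD delN del_cst oppr0 addr0 {1}e addrK.
- by rewrite leD ?leN ?le_cst ?subrr //; [exact: lau_cst|apply/lauN/lau_cst].
Qed.

Definition oscillation i : E := ClassicalEpsilon.epsilon (inhabits 0)
  (fun y => [/\ lau y, del y = velocity i - cst (drift i) & le y r0 = 0]).
Lemma oscillationP i : [/\ lau (oscillation i), del (oscillation i) = velocity i - cst (drift i) &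
  le (oscillation i) r0 = 0].
Proof. exact: (ClassicalEpsilon.epsilon_spec _ _ (oscillation_exists i)). Qed.

Definition path i (x : RR) : CF := drift i * theta x + le (oscillation i) x.

Lemma path_cder i x : cder (path i) x (le (al i) x).
Proof.
have [lo dl _] := oscillationP i.
apply: (cder_eq _ _ (cderD (cderZ (drift i) (theta_cder x)) (le_cder x lo))) => //.
rewrite dl leD ?leN ?le_cst; [|exact: lau_cst|exact: lau_velocity|apply/lauN/lau_cst].
by rewrite /velocity leZ // mulrDr mulVKf ?kap0 //; ring.
Qed.
Lemma path0 i : path i r0 = 0.
Proof. by have [_ _ e] := oscillationP i; rewrite /path e /theta [rc r0](_ : _ = 0) // !mulr0 addr0. Qed.

Definition hseqE (H : nat -> E) := H 0%N = 1 /\ forall n,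
  del (H n.+1) = - \sum_(i < n.+1) (H (n - i)%N *+ (n - i).+1) * velocity i.

Lemma lau_rhs (H : nat -> E) n : (forall k, (k <= n)%N -> lau (H k)) ->
  lau (- \sum_(i < n.+1) (H (n - i)%N *+ (n - i).+1) * velocity i).
Proof.
move=> h; apply/lauN/lau_sum => i _; apply: lauM; last exact: lau_velocity.
by apply: lau_nat; apply: h; apply: leq_subr.
Qed.

Lemma le_rhs (H : nat -> E) n x : (forall k, (k <= n)%N -> lau (H k)) ->
  kap * le (- \sum_(i < n.+1) (H (n - i)%N *+ (n - i).+1) * velocity i) x =
  gder (fun i t => le (al i.-1) t) (fun i t => le (H i) t) n.+1 x.
Proof.
move=> h; have li i : lau (H (n - i)%N *+ (n - i).+1 * velocity i).
  by apply: lauM (lau_velocity i); apply: lau_nat; apply: h; apply: leq_subr.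
rewrite leN; last by apply: lau_sum.
rewrite mulrN le_sum //.
rewrite /gder HomogeneousFamily.csum_big; apply: (f_equal (Copp : CF -> CF)).
rewrite mulr_sumr; apply: eq_bigr => i _.
have lH : lau (H (n - i)%N) by apply: h; apply: leq_subr.
rewrite leM ?leZ //; [|exact: lau_nat|exact: lau_velocity].
rewrite -[H (n - i)%N *+ _]mulr_natl -(rmorph_nat cst) leZ // mulrCA mulVKf ?kap0 //.
by rewrite HomogeneousFamily.natC.
Qed.

Lemma hseqE_cder H : hseqE H -> (forall n, lau (H n)) -> forall n x,
  cder (le (H n)) x (gder (fun i t => le (al i.-1) t) (fun i t => le (H i) t) n x).
Proof.
move=> [H0 HS] lH [|n] x.
  by apply: (cder_eq _ _ (cder_cst 1 x)) => // t; rewrite H0 -(rmorph1 cst) le_cst.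
by rewrite -le_rhs // -HS; apply: le_cder.
Qed.

(** Equal end values of [H n.+1] say that its derivative has constant term 0, so at each stage the
    primitive is again Laurent. *)
Lemma lau_of_closed (H : nat -> RR -> CF) : (forall x, H 0%N x = 1) ->
  (forall n x, cder (H n) x (gder (fun i t => le (al i.-1) t) H n x)) ->
  (forall n, H n.+1 r0 = 0) -> (forall n, H n.+1 T = 0) -> exists2 G, hseqE G & forall n, lau (G n).
Proof.
move=> H0 Hd Hz HTz.
pose P n y := lau y /\ forall x, le y x = H n x.
pose G n := ClassicalEpsilon.epsilon (inhabits 0) (P n).
have step n : (forall k, (k <= n)%N -> P k (G k)) -> exists y, P n.+1 y /\
    del y = - \sum_(i < n.+1) (G (n - i)%N *+ (n - i).+1) * velocity i.
  move=> hG; pose r := - \sum_(i < n.+1) (G (n - i)%N *+ (n - i).+1) * velocity i.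
  have lr : lau r by apply: lau_rhs => k /hG[].
  have er x : kap * le r x = gder (fun i t => le (al i.-1) t) H n.+1 x.
    rewrite le_rhs; last by move=> k /hG[].
    apply: (f_equal (Copp : CF -> CF)); apply: csum_ext => i iN.
    by have [_ ->] := hG (n - i)%N (leq_subr _ _).
  have c0 : ct r = 0.
    have h1 : rprim T (fun x => kap * le r x) 0.
      by apply: (primE _ _ (prim_primitive T (Hd n.+1))) => [x|]; rewrite ?er // HTz Hz subrr.
    have := rprim_uniq h1 (primZ kap (prim_le lr)); move/esym/eqP.
    by rewrite !mulf_eq0 (negPf kap0) (negPf rcT0) => /eqP.
  have [Y lY eY] := lau_prim CF_ch0 lr; rewrite c0 rmorph0 addr0 in eY.
  have lY' : lau (Y - cst (le Y r0)) by apply: lauD => //; apply/lauN/lau_cst.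
  exists (Y - cst (le Y r0)); split; last by rewrite delD delN del_cst oppr0 addr0 -eY.
  split=> // x; apply: (eq_of_cder (le (Y - cst (le Y r0))) (H n.+1) (fun x => kap * le r x)) => [|t|t].
  - by rewrite leD ?leN ?le_cst ?subrr ?Hz //; [exact: lau_cst|apply/lauN/lau_cst].
  - apply: (cder_eq _ _ (le_cder t lY')) => //.
    by rewrite delD delN del_cst oppr0 addr0 -eY.
  - by rewrite er.
have hG n : P n (G n).
  elim/ltn_ind: n => -[|n] IH; apply: ClassicalEpsilon.epsilon_spec.
    by exists (cst 1); split=> [|x]; [exact: lau_cst|rewrite le_cst H0].
  by have [|y [hy _]] := step n; [move=> k kn; apply: IH|exists y].
exists G => [|n]; last by case: (hG n).
split=> [|n].
  apply/le_inj => [||x]; [by case: (hG 0%N)|by rewrite -(rmorph1 cst); apply: lau_cst|].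
  by rewrite (hG 0%N).2 H0 -(rmorph1 cst) le_cst.
have [y [[ly hy] <-]] := step n (fun k _ => hG k); congr del.
by apply/le_inj => // [|x]; [case: (hG n.+1)|rewrite hy (hG n.+1).2].
Qed.
End Path.
End Eval.
End TrigCoefficients.

(** * Transfer of closed first integrals between trigonometric paths *)

Module TrigTransfer.
Import all_boot all_algebra ring.
Import FracDer FunPair PolyPath Kummer Laurent LaurentPath LinearGrowth.
Import CField CxAnalysis FirstIntegral PathMoments TrigPaths TrigCoefficients.
Set Implicit Arguments. Unset Strict Implicit. Unset Printing Implicit Defensive.
Import GRing.Theory.
Local Open Scope ring_scope.

Ltac laurent := repeat match goal with
  | |- Laurent.lau (_ + _) => apply: lauD
  | |- Laurent.lau (- _) => apply: lauN
  | |- Laurent.lau (_ * _) => apply: lauM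
  | |- Laurent.lau (Laurent.del _) => apply: lau_del
  end; first [exact: lau_cst | done].

Ltac cf := match goal with |- @eq _ ?a ?b => change (@eq CF a b) end.

Section Transfer.
Variables (T : RR) (HT : Rlt r0 T) (al al' : nat -> E).
Hypotheses (lal : forall i, lau (al i)) (lal' : forall i, lau (al' i)).
Notation le := (le T).
Notation kap := (kap T).
Notation theta := (theta T).
Notation f := (path T al).
Notation g := (path T al').
Notation A := (fun i => le (al i)).
Notation B := (fun i => le (al' i)).
Hypothesis Hmom : forall l j, exists c, prim T (fun x => Cmult (mon f l x) (le (al j) x)) c /\
  prim T (fun x => Cmult (mon g l x) (le (al' j) x)) c.

Let same (phi psi : RR -> CF) := exists c, rprim T phi c /\ rprim T psi c.

Lemma le_comb y w c x : lau y -> lau w -> le (y - cst c * w) x = le y x - c * le w x.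
Proof.
move=> ly lw; have lcw : lau (cst c * w) by laurent.
by rewrite leD ?leN ?leZ //; exact: lauN.
Qed.

(** The moment with empty product is [T] times the constant term of the coefficient. *)
Lemma drift_eq i : drift T al i = drift T al' i.
Proof.
have [c [h1 h2]] := Hmom [::] i.
have e (a : nat -> E) : (forall j, lau (a j)) -> prim T (fun x => Cmult (RtoC r1) (le (a i) x)) c -> c = rc T * ct (a i) :> CF.
  move=> la h; apply: (rprim_uniq HT _ (prim_le HT (la i))).
  by apply: (primE _ _ h) => // x; exact: Cmult_1_l.
have : rc T * ct (al i) = rc T * ct (al' i) by rewrite -(e al lal h1) -(e al' lal' h2).
move/(mulfI (rcT0 HT)) => e1.
by rewrite /drift /velocity /Laurent.ct !lfZ // -/(ct (al i)) e1.
Qed.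

Section Generators.
Variables v v' : nat -> E.
Hypotheses (lv : forall i, lau (v i)) (lv' : forall i, lau (v' i)).
Hypothesis hv : forall i, dsp f g A B (le (v i)) (le (v' i)) (fun x => kap * le (del (v i)) x) (fun x => kap * le (del (v' i)) x).

Lemma alg2_trig x y : alg2 v v' x y -> [/\ lau x, lau y &
  dsp f g A B (le x) (le y) (fun t => kap * le (del x) t) (fun t => kap * le (del y) t)].
Proof.
elim=> [c|i|x1 y1 x2 y2 _ [l1 l1' h1] _ [l2 l2' h2]|x1 y1 x2 y2 _ [l1 l1' h1] _ [l2 l2' h2]].
- split; [exact: lau_cst|exact: lau_cst|].
  by apply: dsp_ext (dsp_const _ _ _ _ c) _ _ _ _ => t; rewrite ?le_cst ?del_cst ?le0 ?mulr0.
- by split.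
- split; [exact: lauD|exact: lauD|].
  by apply: dsp_ext (dsp_plus _ _ _ _ _ _ _ _ _ _ _ _ h1 h2) _ _ _ _ => t;
    rewrite ?delD leD ?mulrDr //; exact: lau_del.
- split; [exact: lauM|exact: lauM|].
  apply: dsp_ext (dsp_mult _ _ _ _ _ _ _ _ _ _ _ _ h1 h2) _ _ _ _ => t; [by rewrite leM|by rewrite leM| |].
  + rewrite delM leD ?(leM T t (lau_del l1) l2, leM T t l1 (lau_del l2)); try laurent.
    by rewrite -[LHS]/((kap * le (del x1) t) * le x2 t + le x1 t * (kap * le (del x2) t)); cf; ring.
  + rewrite delM leD ?(leM T t (lau_del l1') l2', leM T t l1' (lau_del l2')); try laurent.
    by rewrite -[LHS]/((kap * le (del y1) t) * le y2 t + le y1 t * (kap * le (del y2) t)); cf; ring.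
Qed.

Lemma same_moment (phi psi : RR -> CF) a a' b b' : sp f g phi psi -> alg2 v v' a a' -> alg2 v v' b b' ->
  same (fun x => phi x * le (a * del b) x) (fun x => psi x * le (a' * del b') x).
Proof.
move=> hs /alg2_trig[la la' ha] /alg2_trig[lb lb' hb].
have [c [h1 h2]] := dsp_same_prim T _ _ _ _ Hmom _ _ _ _ _ _ hb (sp_mult _ _ _ _ _ _ hs (dsp_sp _ _ _ _ _ _ _ _ ha)).
exists (kap^-1 * (c : CF)); split.
- apply: (primE _ _ (primZ kap^-1 h1)) => // x; rewrite leM //; last exact: lau_del.
  rewrite -[LHS]/(kap^-1 * ((phi x * le a x) * (kap * le (del b) x))).
  by rewrite mulrCA mulKf ?kap0 // mulrA.
- apply: (primE _ _ (primZ kap^-1 h2)) => // x; rewrite leM //; last exact: lau_del.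
  rewrite -[LHS]/(kap^-1 * ((psi x * le a' x) * (kap * le (del b') x))).
  by rewrite mulrCA mulKf ?kap0 // mulrA.
Qed.

Lemma lau_alg2 a a' b b' : alg2 v v' a a' -> alg2 v v' b b' -> lau (a * del b) /\ lau (a' * del b').
Proof.
by move=> /alg2_trig[la la' _] /alg2_trig[lb lb' _]; split; apply: lauM => //; apply: lau_del.
Qed.

Lemma same_ct a a' b b' : alg2 v v' a a' -> alg2 v v' b b' -> ct (a * del b) = ct (a' * del b').
Proof.
move=> ha hb; have [ly ly'] := lau_alg2 ha hb.
have [c [h1 h2]] := same_moment (sp_const f g (1 : CF)) ha hb.
apply: (mulfI (rcT0 HT)).
rewrite -(rprim_uniq HT (primE _ erefl h1) (prim_le HT ly)) => [|x]; last by rewrite mul1r.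
by rewrite -(rprim_uniq HT (primE _ erefl h2) (prim_le HT ly')) // => x; rewrite mul1r.
Qed.
End Generators.

Section Periodic.
Hypothesis c0 : forall i, drift T al i = 0.
Notation v := (oscillation T al).
Notation v' := (oscillation T al').

Lemma lau_osc i : lau (v i). Proof. by have [] := oscillationP T lal i. Qed.
Lemma lau_osc' i : lau (v' i). Proof. by have [] := oscillationP T lal' i. Qed.
Lemma del_osc i : del (v i) = velocity T al i.
Proof. by have [_ -> _] := oscillationP T lal i; rewrite c0 rmorph0 subr0. Qed.
Lemma del_osc' i : del (v' i) = velocity T al' i.
Proof. by have [_ -> _] := oscillationP T lal' i; rewrite -drift_eq c0 rmorph0 subr0. Qed.

Lemma osc_ct a a' b b' : alg2 v v' a a' -> alg2 v v' b b' -> ct (a * del b) = ct (a' * del b').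
Proof.
apply: same_ct lau_osc lau_osc' _ _ _ _ _ => i; apply: dsp_ext (dsp_gen f g A B i) _ _ _ _ => x.
- by rewrite /path c0 mul0r add0r.
- by rewrite /path -drift_eq c0 mul0r add0r.
- by rewrite del_osc /velocity leZ // mulVKf ?kap0.
- by rewrite del_osc' /velocity leZ // mulVKf ?kap0.
Qed.

Lemma periodic_transfer H : hseqE T al H -> (forall n, lau (H n)) ->
  exists2 G, hseqE T al' G & forall n, lau (G n).
Proof.
move=> [H0 HS] lH; have [|G [G0 GS] lG] := trig_transfer_periodic CF_ch0 lau_osc lau_osc' osc_ct (H := H) _ lH.
- split=> // n; rewrite HS; congr (- _); apply: eq_bigr => i _; by rewrite del_osc.
- exists G => //; split=> // n; rewrite GS; congr (- _); apply: eq_bigr => i _; by rewrite del_osc'.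
Qed.
End Periodic.

Lemma linear_transfer H i0 : drift T al i0 != 0 -> (forall i, (i < i0)%N -> drift T al i = 0) ->
  hseqE T al H -> (forall n, lau (H n)) -> exists2 G, hseqE T al' G & forall n, lau (G n).
Proof.
move=> ci0 cle [H0 HS] lH; pose c := drift T al.
pose o := oscillation T al; pose o' := oscillation T al'.
have lo i : lau (o i) by have [] := oscillationP T lal i.
have lo' i : lau (o' i) by have [] := oscillationP T lal' i.
have dlo i : del (o i) = velocity T al i - cst (c i) by have [_ -> _] := oscillationP T lal i.
have dlo' i : del (o' i) = velocity T al' i - cst (c i) by have [_ -> _] := oscillationP T lal' i; rewrite -drift_eq.
(* Now [f_{i0} = c_{i0} (theta + u)], so [theta + u] is a multiple of a path component, and
   [v_i = f_i - (c_i / c_{i0}) f_{i0}] is a combination of components free of [theta]. *)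
pose u := cst (c i0)^-1 * o i0; pose u' := cst (c i0)^-1 * o' i0.
pose v i := o i - cst (c i) * u; pose v' i := o' i - cst (c i) * u'.
have lu : lau u by apply: lauM => //; apply: lau_cst.
have lu' : lau u' by apply: lauM => //; apply: lau_cst.
have lv i : lau (v i) by apply: lauD => //; apply/lauN/lauM => //; apply: lau_cst.
have lv' i : lau (v' i) by apply: lauD => //; apply/lauN/lauM => //; apply: lau_cst.
have ev x : f i0 x = c i0 * (theta x + le u x).
  by rewrite /u leZ // /path mulrDr mulVKf.
have ev' x : g i0 x = c i0 * (theta x + le u' x).
  by rewrite /u' leZ // /path -drift_eq mulrDr mulVKf.
have lcu i : lau (cst (c i) * u) by apply: lauM => //; apply: lau_cst.
have lcu' i : lau (cst (c i) * u') by apply: lauM => //; apply: lau_cst.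
have dv i : del (v i) = velocity T al i - cst (c i / c i0) * velocity T al i0.
  rewrite delD delN !delZ !dlo mulrBr mulrBr !mulrA -!rmorphM mulfVK //; ring.
have dv' i : del (v' i) = velocity T al' i - cst (c i / c i0) * velocity T al' i0.
  rewrite delD delN !delZ !dlo' mulrBr mulrBr !mulrA -!rmorphM mulfVK //; ring.
have lvel i : lau (velocity T al i) := lau_velocity T lal i.
have lvel' i : lau (velocity T al' i) := lau_velocity T lal' i.
have hv i : dsp f g A B (le (v i)) (le (v' i)) (fun x => kap * le (del (v i)) x) (fun x => kap * le (del (v' i)) x).
  have h1 := dsp_mult f g A B _ _ _ _ _ _ _ _ (dsp_const f g A B (- (c i / c i0) : CF)) (dsp_gen f g A B i0).
  apply: dsp_ext (dsp_plus f g A B _ _ _ _ _ _ _ _ (dsp_gen f g A B i) h1) _ _ _ _ => x.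
  - rewrite (le_comb _ _ (lo i) lu).
    rewrite -[LHS]/(f i x + - (c i / c i0) * f i0 x) ev /path -/(c i) -/(o i).
    by cf; field.
  - rewrite (le_comb _ _ (lo' i) lu').
    rewrite -[LHS]/(g i x + - (c i / c i0) * g i0 x) ev' /path -drift_eq -/(c i) -/(o' i).
    by cf; field.
  - rewrite dv (le_comb _ _ (lvel i) (lvel i0)).
    rewrite -[LHS]/(le (al i) x + (0 * f i0 x + - (c i / c i0) * le (al i0) x)).
    rewrite /velocity !leZ //; have := kap0 HT; move: (TrigCoefficients.kap T) => kk kk0; by cf; field; rewrite kk0.
  - rewrite dv' (le_comb _ _ (lvel' i) (lvel' i0)).
    rewrite -[LHS]/(le (al' i) x + (0 * g i0 x + - (c i / c i0) * le (al' i0) x)).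
    rewrite /velocity !leZ //; have := kap0 HT; move: (TrigCoefficients.kap T) => kk kk0; by cf; field; rewrite kk0.
have sp1 : sp f g (fun x => theta x + le u x) (fun x => theta x + le u' x).
  apply: sp_ext (sp_mult _ _ _ _ _ _ (sp_const f g ((c i0)^-1 : CF)) (sp_gen f g i0)) => x.
  - by rewrite ev -[LHS]/((c i0)^-1 * (c i0 * (theta x + le u x))) mulKf.
  - by rewrite ev' -[LHS]/((c i0)^-1 * (c i0 * (theta x + le u' x))) mulKf.
have sm phi psi a a' b b' := @same_moment v v' lv lv' hv phi psi a a' b b'.
have cth x : ccont theta x := ccont_cder _ _ _ (theta_cder T x).
have Q1 a a' b b' : alg2 v v' a a' -> alg2 v v' b b' ->
    lf (jm T theta) (a * del b) + ct (u * (a * del b)) = lf (jm T theta) (a' * del b') + ct (u' * (a' * del b')).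
  move=> ha hb; have [ly ly'] := lau_alg2 lv lv' hv ha hb; have [d [h1 h2]] := sm _ _ _ _ _ _ sp1 ha hb.
  apply: (mulfI (rcT0 HT)).
  have e1 := primD (prim_jm HT cth ly) (prim_le HT (lauM lu ly)).
  have e2 := primD (prim_jm HT cth ly') (prim_le HT (lauM lu' ly')).
  rewrite !mulrDr -(rprim_uniq HT (primE _ erefl h1) e1) => [|x]; last by rewrite (leM T x lu ly) mulrDl.
  by rewrite -(rprim_uniq HT (primE _ erefl h2) e2) // => x; rewrite (leM T x lu' ly') mulrDl.
have Q2 a a' b b' : alg2 v v' a a' -> alg2 v v' b b' ->
    lf (jm T (fun x => theta x ^+ 2)) (a * del b) + lf (jm T theta) (u * (a * del b)) *+ 2 + ct (u ^+ 2 * (a * del b)) =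
    lf (jm T (fun x => theta x ^+ 2)) (a' * del b') + lf (jm T theta) (u' * (a' * del b')) *+ 2 + ct (u' ^+ 2 * (a' * del b')).
  move=> ha hb; have [ly ly'] := lau_alg2 lv lv' hv ha hb.
  have [d [h1 h2]] := sm _ _ _ _ _ _ (sp_mult _ _ _ _ _ _ sp1 sp1) ha hb.
  have cth2 x : ccont (fun x => theta x ^+ 2) x by apply: ccont_mult.
  apply: (mulfI (rcT0 HT)).
  have aux w y : lau w -> lau y -> rprim T (fun x => (theta x + le w x) * (theta x + le w x) * le y x)
     (rc T * (lf (jm T (fun x => theta x ^+ 2)) y + lf (jm T theta) (w * y) *+ 2 + ct (w ^+ 2 * y))).
    move=> lw ly0; have lwy := lauM lw ly0.
    apply: (primE _ _ (primD (primD (prim_jm HT cth2 ly0) (primZ 2%:R (prim_jm HT cth lwy)))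
      (prim_le HT (lauM (lauX 2 lw) ly0)))) => [x|]; last by ring.
    by rewrite (leM T x lw ly0) (leM T x (lauX 2 lw) ly0) expr2 (leM T x lw lw); ring.
  rewrite -(rprim_uniq HT h1 (aux u _ lu ly)); exact: (rprim_uniq HT h2 (aux u' _ lu' ly')).
have HS' n : del (H n.+1) = - \sum_(i < n.+1) (H (n - i)%N *+ (n - i).+1) * (cst (c i) * (1 + del u) + del (v i)).
  rewrite HS; congr (- _); apply: eq_bigr => i _; congr (_ * _).
  by rewrite /v delD delN delZ dlo; ring.
have [eu evv] := trig_transfer_linear CF_ch0 lv lv' lu lu' lH ci0 cle (oner_neq0 _) (jm_theta HT) H0 HS'
  (@same_ct v v' lv lv' hv) Q1 Q2.
exists H => //; split=> // n; rewrite HS; congr (- _); apply: eq_bigr => i _; congr (_ * _).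
have oe : o i = o' i by have := evv i; rewrite /v /v' eu => /addIr.
by have := congr1 del oe; rewrite dlo dlo' => /addIr.
Qed.

Theorem closed_first_integral H : hseqE T al H -> (forall n, lau (H n)) ->
  exists2 G, hseqE T al' G & forall n, lau (G n).
Proof.
move=> hH lH; have [h|] := Classical_Prop.classic (forall i, drift T al i = 0).
  exact: (periodic_transfer h hH lH).
move/Classical_Pred_Type.not_all_ex_not => [i hi].
have ex : exists i, drift T al i != 0 by exists i; apply/eqP.
case: (ex_minnP ex) => i0 ci0 min0; apply: (linear_transfer ci0 _ hH lH) => k ki.
by apply/eqP/negPn/negP => /min0; rewrite leqNgt ki.
Qed.
End Transfer.

(** Comparison with the zero path removes all drifts and all constant terms of [a del b];
    [tow_residue] with multiplier 1 then lets every iterated integral stay Laurent. *)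
Lemma universal_of_moments (T : RR) (al : nat -> E) : Rlt r0 T -> (forall i, lau (al i)) ->
  (forall l j, prim T (fun x => Cmult (mon (path T al) l x) (le T (al j) x)) (RtoC r0)) ->
  exists X : seq nat -> E, [/\ X [::] = 1, forall l, lau (X l),
    forall i l, del (X (i :: l)) = X l * velocity T al i & forall i l, le T (X (i :: l)) r0 = 0].
Proof.
move=> HT lal hm; pose zero := fun _ : nat => 0 : E.
have lz i : lau (zero i) := lau0 E.
have hm1 l j : exists c, prim T (fun x => Cmult (mon (path T al) l x) (le T (al j) x)) c /\
    prim T (fun x => Cmult (mon (path T zero) l x) (le T (zero j) x)) c.
  exists (RtoC r0); split=> //; apply: (prim_ext _ _ _ _ _ (prim_zero T)) => x.
  by rewrite /zero le0 Cmult_0_r.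
have vz i : velocity T zero i = 0 by rewrite /velocity mulr0.
have c0 i : drift T al i = 0 by rewrite (drift_eq HT lal lz hm1) /drift vz /Laurent.ct lf0.
have hct a b : alg2 (oscillation T al) (oscillation T al) a a -> alg2 (oscillation T al) (oscillation T al) b b ->
    ct (1 * a * del b) = 0.
  move=> /(alg2_lift (oscillation T zero))[a' ha] /(alg2_lift (oscillation T zero))[b' hb].
  rewrite mul1r (osc_ct HT lal lz hm1 c0 ha hb).
  suff -> : del b' = 0 by rewrite mulr0 /Laurent.ct lf0.
  elim: hb => [c|j|x1 y1 x2 y2 _ e1 _ e2|x1 y1 x2 y2 _ e1 _ e2]; first exact: del_cst.
  - by rewrite (del_osc' HT lal lz hm1 c0).
  - by rewrite delD e1 e2 addr0.
  - by rewrite delM e1 e2 mul0r mulr0 addr0.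
have res := tow_residue CF_ch0 (lau_osc T lal) (alg2_1 _ _) (oner_neq0 E) hct.
pose P w y := [/\ lau y, del y = w & le T y r0 = 0].
pose pr w := ClassicalEpsilon.epsilon (inhabits 0) (P w).
have prP w : lau w -> ct w = 0 -> P w (pr w).
  move=> lw w0; apply: ClassicalEpsilon.epsilon_spec; have [Y lY] := lau_prim CF_ch0 lw.
  rewrite w0 rmorph0 addr0 => e; have lc : lau (- cst (le T Y r0)) by apply/lauN/lau_cst.
  exists (Y - cst (le T Y r0)); split; first exact: lauD.
    by rewrite delD delN del_cst oppr0 addr0.
  by rewrite leD ?leN ?le_cst ?subrr //; exact: lau_cst.
pose X := fix X (l : seq nat) : E := if l is i :: l' then pr (X l' * velocity T al i) else 1.
have tX l : ltow (oscillation T al) (X l) /\ (forall i, P (X l * velocity T al i) (X (i :: l))).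
  have tP l' : ltow (oscillation T al) (X l') -> forall i, P (X l' * velocity T al i) (X (i :: l')).
    move=> h i; apply: prP; first by apply: lauM; [exact: ltow_lau h|exact: lau_velocity].
    by rewrite -(del_osc lal c0) res.
  elim: l => [|i l [h hP]]; first by have h := ltC (oscillation T al) 1; rewrite rmorph1 in h; split=> //; apply: tP.
  suff h1 : ltow (oscillation T al) (X (i :: l)) by split=> //; apply: tP.
  have [l1 d1 _] := hP i.
  (* A single product [X l del v_i] is presented as a sum over [j <= i] whose other terms are 0. *)
  apply: (@ltI _ _ _ i.+1 (fun j => if j == i then X l else 0) _ _ l1).
    move=> j; case: eqP => // _; have := ltC (oscillation T al) 0; by rewrite rmorph0.
  rewrite d1 -(del_osc lal c0) (bigD1 ord_max) //= eqxx big1 ?addr0 // => j.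
  by rewrite -val_eqE /= => /negPf->; rewrite mul0r.
exists X; split=> // [l|i l|i l]; have [h hP] := tX l.
- exact: ltow_lau h.
- by have [] := hP i.
- by have [] := hP i.
Qed.
End TrigTransfer.

(** * The center criterion and iterated integrals for the given equation *)

Module CenterCriterion.
Import CxAnalysis FirstIntegral Criterion Picard.

Lemma gder_ext a b G n x : (forall i, (1 <= i)%nat -> a i x = b i x) -> gder a G n x = gder b G n x.
Proof.
intros H. destruct n as [|n]; [reflexivity|]. unfold gder. f_equal. apply csum_ext. intros i _.
rewrite H by lia. reflexivity.
Qed.

Section Criterion.
Variables (T M : R) (a b : nat -> R -> CC).
Hypotheses (HT : 0 < T) (HM : 1 <= M).
Hypothesis Ha : forall i x, (1 <= i)%nat -> 0 <= x <= T -> Cmod (a i x) <= M ^ i.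
Hypothesis Hb : forall i x, (1 <= i)%nat -> ccont (b i) x.
Hypothesis Hab : forall i x, (1 <= i)%nat -> 0 <= x <= T -> a i x = b i x.

Definition first_integral_coeffs (G : nat -> R -> CC) : Prop :=
  (forall x, G O x = RtoC 1) /\ forall n x, cder (G n) x (gder b G n x).

(** Freezing [b] outside the interval extends the bounds [M^i], given only on it, to the whole line,
    as the Picard iteration requires. *)
Lemma small_solutions : exists r1, 0 < r1 /\ forall r, 0 < r < r1 -> exists v, is_solution T a v /\ v 0 = RtoC r.
Proof.
assert (D : 0 < 16 * M * (1 + T)) by (repeat apply Rmult_lt_0_compat; lra).
exists (/ (16 * M * (1 + T))). split; [apply Rinv_0_lt_compat; exact D|]. intros r Hr.
assert (16 * M * (1 + T) * r <= 1).
{ apply Rmult_le_reg_l with (/ (16 * M * (1 + T))); [apply Rinv_0_lt_compat; exact D|].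
  rewrite <- Rmult_assoc, Rinv_l by lra. lra. }
apply (solution_exists T M a (fun i x => b i (clamp T x))); try assumption; try lra.
- intros i x Hi. rewrite <- Hab by (try assumption; apply clamp_in; lra). apply Ha; [exact Hi|apply clamp_in; lra].
- intros i x Hi. apply ccont_comp; [apply clamp_cont; lra|apply Hb, Hi].
- intros i x Hi Hx. rewrite clamp_id by exact Hx. symmetry. apply Hab; assumption.
Qed.

Lemma coeffs_cder G n x : first_integral_coeffs G -> 0 <= x <= T -> cder (G n) x (gder a G n x).
Proof.
intros [_ H] Hx. rewrite (gder_ext a b); [apply H|]. intros i Hi. apply Hab; assumption.
Qed.

Lemma closed_of_center H : first_integral_coeffs H -> (forall n, H (S n) 0 = RtoC 0) -> is_center T a ->
  forall n, H (S n) T = RtoC 0.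
Proof.
intros HH H0 Hc. apply (closed_of_flat T M a HT HM Ha H).
- intros x _. apply (proj1 HH).
- exact H0.
- intros n x Hx. apply coeffs_cder; assumption.
- exact small_solutions.
- apply (flat_of_center T a). exact Hc.
Qed.

Lemma center_of_closed_coeffs H : first_integral_coeffs H -> (forall n, H (S n) 0 = RtoC 0) ->
  (forall n, H (S n) T = RtoC 0) -> is_center T a.
Proof.
intros HH H0 Hc. apply (center_of_closed T M a HT HM Ha H).
- intros x _. apply (proj1 HH).
- exact H0.
- intros n x Hx. apply coeffs_cder; assumption.
- exact Hc.
Qed.

(** [G] gives flatness, flatness closes the normalized [H], and the growth bounds of [H] give a
    center. *)
Lemma center_of_first_integral G H : first_integral_coeffs H -> (forall n, H (S n) 0 = RtoC 0) ->
  first_integral_coeffs G -> (forall n, G n T = G n 0) -> is_center T a.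
Proof.
intros HH H0 HG Gc. apply (center_of_closed_coeffs H HH H0).
apply (closed_of_flat T M a HT HM Ha H).
- intros x _. apply (proj1 HH).
- exact H0.
- intros n x Hx. apply coeffs_cder; assumption.
- exact small_solutions.
- apply (flat_of_first_integral T M a HT HM Ha G).
  + intros x _. apply (proj1 HG).
  + intros n. destruct (bounded_continuity (V := CV) (G n) 0 T) as [B HB].
    * intros x Hx. exact (ccont_cder _ _ _ (proj2 HG n x)).
    * exists B. intros x Hx. rewrite Cmod_norm. left. apply HB, Hx.
  + intros n x Hx. apply coeffs_cder; assumption.
  + exact Gc.
Qed.

Lemma iter_int_eq (J : list nat -> R -> CC) : (forall x, J nil x = RtoC 1) ->
  (forall i l x, cder (J (cons i l)) x (Cmult (b (S i) x) (J l x))) -> (forall i l, J (cons i l) 0 = RtoC 0) ->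
  forall l t, 0 <= t <= T -> iter_int_rev a (map S l) t = J l t.
Proof.
intros J1 Jd J0 l. induction l as [|i l IH]; intros t Ht; simpl; [symmetry; apply J1|].
transitivity (cint (fun s => Cmult (b (S i) s) (J l s)) 0 t).
- apply cint_ext; [lra|]. intros x Hx. rewrite IH by lra. rewrite Hab by (lia || lra). reflexivity.
- rewrite (cint_FTC (J (cons i l))); [| lra | |].
  + rewrite J0. cring.
  + intros x _. apply Jd.
  + intros x _. apply ccont_mult; [apply Hb; lia|]. destruct l as [|j l].
    * apply (continuous_ext (fun _ => RtoC 1 : CV)); [intros s; symmetry; apply J1|apply ccont_const].
    * eapply ccont_cder. apply Jd.
Qed.

Lemma universal_of_closed (J : list nat -> R -> CC) : (forall x, J nil x = RtoC 1) ->
  (forall i l x, cder (J (cons i l)) x (Cmult (b (S i) x) (J l x))) -> (forall i l, J (cons i l) 0 = RtoC 0) ->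
  (forall i l, J (cons i l) T = RtoC 0) -> is_universal_center T a.
Proof.
intros J1 Jd J0 JT l Hl Hi. unfold iter_int.
assert (E : exists i l', rev l = map S (cons i l')).
{ assert (Hr : rev l <> nil) by (intros e; apply Hl; rewrite <- (rev_involutive l), e; reflexivity).
  assert (Hi' : forall i, In i (rev l) -> (1 <= i)%nat) by (intros i Hin; apply Hi, in_rev, Hin).
  clear Hl Hi. destruct (rev l) as [|i l']; [congruence|]. exists (pred i), (map pred l'). simpl. f_equal.
  - assert (1 <= i)%nat by (apply Hi'; left; reflexivity). lia.
  - rewrite map_map. rewrite <- (map_id l') at 1. apply map_ext_in. intros j Hj.
    assert (1 <= j)%nat by (apply Hi'; right; exact Hj). lia. }
destruct E as [i [l' ->]]. rewrite (iter_int_eq J J1 Jd J0) by lra. apply JT.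
Qed.

Lemma closed_of_universal (J : list nat -> R -> CC) : (forall x, J nil x = RtoC 1) ->
  (forall i l x, cder (J (cons i l)) x (Cmult (b (S i) x) (J l x))) -> (forall i l, J (cons i l) 0 = RtoC 0) ->
  is_universal_center T a -> forall i l, J (cons i l) T = RtoC 0.
Proof.
intros J1 Jd J0 HU i l. rewrite <- (iter_int_eq J J1 Jd J0) by lra.
assert (E := HU (rev (map S (cons i l)))). unfold iter_int in E. rewrite rev_involutive in E. apply E.
- intros e. apply (f_equal (@length nat)) in e. rewrite length_rev, length_map in e. discriminate.
- intros j Hj. apply in_rev in Hj. apply in_map_iff in Hj. destruct Hj as [j' [<- _]]. lia.
Qed.
End Criterion.

Lemma in_X_bound T a : in_X T a ->
  exists M, 1 <= M /\ forall i x, (1 <= i)%nat -> 0 <= x <= T -> Cmod (a i x) <= M ^ i.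
Proof.
intros [M HM]. exists (Rmax 1 (Rabs M)). split; [apply Rmax_l|]. intros i x Hi Hx.
eapply Rle_trans; [apply HM; assumption|]. eapply Rle_trans; [apply Rle_abs|]. rewrite <- RPow_abs.
apply pow_incr. split; [apply Rabs_pos|apply Rmax_r].
Qed.

Fixpoint iterated (A : nat -> R -> CC) (l : list nat) (t : R) : CC :=
  match l with nil => RtoC 1 | cons i l' => cint (fun s => Cmult (A i s) (iterated A l' s)) 0 t end.

Lemma iterated_cder (A : nat -> R -> CC) i l x : (forall i x, ccont (A i) x) ->
  cder (iterated A (i :: l)) x (Cmult (A i x) (iterated A l x)).
Proof.
intros HA. assert (C : forall l t, ccont (iterated A l) t).
{ intros l'. induction l' as [|j l' IH]; intros t; simpl; [apply ccont_const|].
  eapply ccont_cder. apply cint_cder. intros s. apply ccont_mult; [apply HA|apply IH]. }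
simpl. apply (cint_cder (fun s => Cmult (A i s) (iterated A l s))). intros s. apply ccont_mult; [apply HA|apply C].
Qed.
End CenterCriterion.

(** * The center variety *)

Module CenterVariety.
Import all_boot all_algebra mpoly ssrZ.
Import FracDer Laurent Noetherian WeightedHomogeneous CField CxAnalysis PathMoments HomogeneousFamily.
Import FirstIntegral LaurentPath PolyPath PolyTransfer PolynomialCoefficients TrigPaths TrigCoefficients CenterCriterion.
Set Implicit Arguments. Unset Strict Implicit. Unset Printing Implicit Defensive.
Import GRing.Theory.
Local Open Scope ring_scope.

Lemma choice_fun (A B : Type) (R : A -> B -> Prop) : (forall x, exists y, R x y) -> exists f, forall x, R x (f x).
Proof.
by move=> h; exists (fun x => proj1_sig (ClassicalEpsilon.constructive_indefinite_description _ (h x))) => x;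
  exact: proj2_sig (ClassicalEpsilon.constructive_indefinite_description _ (h x)).
Qed.

(** Equality of values at [u] and [v] is the vanishing of [Mm q (x) - Mm q (y)] in doubled
    variables, to which [finite_zero_basis] applies. *)
Lemma finite_equality (F : fieldType) n (Idx : Type) (q0 : Idx) (V : Idx -> Prop) (Mm : Idx -> {mpoly F[n]}) :
  exists N (qs : nat -> Idx), (forall i, (i < N)%N -> V (qs i)) /\ forall u v : 'I_n -> F,
    (forall i, (i < N)%N -> (Mm (qs i)).@[u] = (Mm (qs i)).@[v]) -> forall q, V q -> (Mm q).@[u] = (Mm q).@[v].
Proof.
pose dl (p : {mpoly F[n]}) : {mpoly F[n + n]} := p \mPo [tuple 'X_(lshift n i) | i < n].
pose dr (p : {mpoly F[n]}) : {mpoly F[n + n]} := p \mPo [tuple 'X_(rshift n i) | i < n].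
pose P f := exists q, V q /\ f = dl (Mm q) - dr (Mm q).
have [N [f [hf hz]]] := finite_zero_basis P.
pose qs i := ClassicalEpsilon.epsilon (inhabits q0) (fun q => V q /\ f i = dl (Mm q) - dr (Mm q)).
have hqs i : (i < N)%N -> V (qs i) /\ f i = dl (Mm (qs i)) - dr (Mm (qs i)).
  by move=> iN; exact: (ClassicalEpsilon.epsilon_spec _ _ (hf i iN)).
exists N, qs; split=> [i /hqs[]//|u v e q Vq].
pose x (i : 'I_(n + n)) := match split i with inl j => u j | inr j => v j end.
have el p : (dl p).@[x] = p.@[u].
  rewrite comp_mpoly_meval; apply: meval_eq => j; rewrite tnth_mktuple mevalXU /x.
  by rewrite -[lshift n j]/(unsplit (inl j)) unsplitK.
have er p : (dr p).@[x] = p.@[v].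
  rewrite comp_mpoly_meval; apply: meval_eq => j; rewrite tnth_mktuple mevalXU /x.
  by rewrite -[rshift n j]/(unsplit (inr j)) unsplitK.
have := hz x _ (dl (Mm q) - dr (Mm q)); rewrite mevalB el er => h.
apply/eqP; rewrite -subr_eq0 h //; last by exists q.
by move=> i iN; have [_ ->] := hqs i iN; rewrite mevalB el er e // subrr.
Qed.

Lemma whomog0_const (F : fieldType) n (wt : 'I_n -> nat) (p : {mpoly F[n]}) u v : (forall j, (0 < wt j)%N) ->
  whomog wt 0 p -> p.@[u] = p.@[v].
Proof.
move=> wt0; elim=> [|c m q hm _ IH]; first by rewrite !meval0.
rewrite !mevalD IH !mevalZ !mevalX; congr (_ * _ + _); apply: eq_bigr => i _.
suff -> : m i = 0%N by rewrite !expr0.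
move/eqP: hm; rewrite sum_nat_eq0 => /forallP/(_ i)/=; rewrite muln_eq0 => /orP[/eqP h|/eqP//].
by have := wt0 i; rewrite h.
Qed.

Lemma mono_prod k beta (w : nat -> CF) : mono k beta w = \prod_(i < k) w i ^+ beta i.
Proof. by elim: k => [|k IH]; rewrite ?big_ord0 // big_ord_recr /= IH Cpow_expr. Qed.

Lemma wdeg_sum k alpha beta : wdeg k alpha beta = (\sum_(i < k) alpha i * beta i)%N.
Proof. by elim: k => [|k IH]; rewrite ?big_ord0 // big_ord_recr /= IH. Qed.

Lemma Csum_map (I : Type) (l : list I) (f : I -> CF) : Csum (List.map f l) = \sum_(p <- l) f p.
Proof. by elim: l => [|p l IH]; rewrite ?big_nil // big_cons /= IH. Qed.

Section Coefficients.
Variables (T : RR) (HT : Rlt r0 T).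

Definition kind (b : bool) (c : RR -> CF) : Prop :=
  if b then exists p, forall x, c x = pe p x else exists y, lau y /\ forall x, c x = le T y x.

Lemma kind_of_coef b c : coef_kind T b c -> kind b c.
Proof.
case: b => /= -[l e].
  exists (\sum_(q <- l) (q.1 : CF) *: 'X^(q.2)) => x; rewrite e Csum_map /pe horner_sum; apply: eq_bigr => q _.
  by rewrite hornerZ hornerXn -Cpow_expr; congr Cmult; elim: (q.2) => //= n <-; rewrite RtoC_mult.
exists (\sum_(q <- l) cst q.1 * rI E 'X ^ (int_of_Z q.2)).
elim: l c e => [|q l IH] c e; first by rewrite big_nil; split=> [|x]; [exact: lau0|rewrite e le0].
rewrite big_cons; have [ly h] := IH _ (fun x => erefl); split.
  by apply: lauD => //; apply: lauM; [exact: lau_cst|exact: lau_zn].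
move=> x; rewrite leS // -h e /=; congr (_ + _); congr (_ * _).
by rewrite /wv /rint int_of_ZK cis_wave.
Qed.

Lemma kind_ext b c c' : c =1 c' -> kind b c -> kind b c'.
Proof. by case: b => e /= [y h]; exists y; [move=> x; rewrite -e|case: h => ly h; split=> // x; rewrite -e]. Qed.
Lemma kindD b c c' : kind b c -> kind b c' -> kind b (fun x => c x + c' x).
Proof.
case: b => /=; first by move=> [p e] [p' e']; exists (p + p') => x; rewrite /pe hornerD e e'.
by move=> [y [ly e]] [y' [ly' e']]; exists (y + y'); split=> [|x]; [exact: lauD|rewrite leD // e e'].
Qed.
Lemma kindZ b (k : CF) c : kind b c -> kind b (fun x => k * c x).
Proof.
case: b => /=; first by move=> [p e]; exists (k *: p) => x; rewrite /pe hornerZ e.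
move=> [y [ly e]]; exists (cst k * y); split=> [|x]; last by rewrite leZ // e.
by apply: lauM => //; apply: lau_cst.
Qed.
Lemma kind0 b : kind b (fun=> 0).
Proof.
by case: b; [exists 0 => x; rewrite /pe horner0|exists 0; split=> [|x]; [exact: lau0|rewrite le0]].
Qed.
Lemma kind_cont b c x : kind b c -> ccont c x.
Proof.
case: b => /= [[p e]|[y [ly e]]].
- apply: (continuous_ext (pe p : RR -> CV)) => //; exact: ccont_cder (pe_cder p x).
- by apply: (continuous_ext (le T y : RR -> CV)) => //; exact: le_cont.
Qed.

Lemma homogeneous_pathpoly k alpha b (f : (nat -> CF) -> RR -> CF) : alpha_homog T k alpha b f ->
  exists dP : nat * (RR -> {mpoly CF[k]}), [/\ pathpoly (fun m => wd (fun j : 'I_k => alpha j) m = dP.1) dP.2,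
    forall w x, Rle r0 x /\ Rle x T -> f w x = ev w (dP.2 x) & forall w, kind b (fun x => ev w (dP.2 x))].
Proof.
move=> [d [l [hl hf]]].
have : exists P : RR -> {mpoly CF[k]}, [/\ pathpoly (fun m => wd (fun j : 'I_k => alpha j) m = d) P,
    forall w x, Csum (List.map (fun p => Cmult (fst p x) (mono k (snd p) w)) l) = ev w (P x) &
    forall w, kind b (fun x => ev w (P x))].
  elim: l hl {hf} => [|[c beta] l IH] hl.
    exists (fun=> 0); split=> [|w x|w]; [exact: pathpoly_zero|by rewrite ev0|].
    by apply: kind_ext (kind0 b) => x; rewrite ev0.
  have [P [hP eP kP]] := IH (fun c' beta' h => hl c' beta' (or_intror h)).
  have [hd /kind_of_coef hc] := hl c beta (or_introl erefl).
  pose m := [multinom beta i | i < k].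
  have em w : ev w 'X_[m] = mono k beta w.
    by rewrite /ev mevalX mono_prod; apply: eq_bigr => i _; rewrite mnmE.
  exists (fun x => (c x : CF) *: 'X_[m] + P x); split.
  - apply: (@pathpoly_add _ _ c m P) => // [x|]; first exact: kind_cont hc.
    by rewrite -hd wdeg_sum /wd; apply: eq_bigr => i _; rewrite mnmE.
  - by move=> w x; rewrite /= eP evD evZ em.
  - by move=> w; apply: kind_ext (kindD (kindZ (ev w 'X_[m]) hc) (kP w)) => x; rewrite evD evZ mulrC.
by move=> [P [h1 h2 h3]]; exists (d, P); split=> // w x hx; rewrite hf // h2.
Qed.
End Coefficients.

Lemma mon_cont (f : nat -> RR -> CC) l x : (forall i x, ccont (f i) x) -> ccont (mon f l) x.
Proof.
move=> h; elim: l => [|i l IH]; first exact: ccont_const.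
exact: ccont_mult (h i x) IH.
Qed.

Lemma mon_ext (f g : nat -> RR -> CC) l x : (forall i, f i x = g i x) -> mon f l x = mon g l x.
Proof. by move=> e; elim: l => //= i l ->; rewrite e. Qed.

Definition moment_index : Type := (seq nat * nat)%type.
(** A power of a primitive is expressed by repeating its index, so all exponents are 1; the shift by
    one accounts for coefficients numbered from 1. *)
Definition moment_datum (q : moment_index) : moment_data := (List.map (fun i => (S i, 1%N)) q.1, S q.2).

Section Family.
Variables (T : RR) (HT : Rlt r0 T) (k : nat) (wt : 'I_k -> nat) (b : bool).
Variables (P F : nat -> RR -> {mpoly CF[k]}) (a : nat -> (nat -> CC) -> RR -> CC).
Hypothesis cP : forall i w x, ccont (fun t => ev w (P i t)) x.
Hypotheses (F0 : forall i, F i r0 = 0) (Fd : forall i w x, cder (fun t => ev w (F i t)) x (ev w (P i x))).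
Hypothesis kP : forall i w, kind T b (fun x => ev w (P i x)).
Hypothesis ea : forall i w x, Rle r0 x /\ Rle x T -> a (S i) w x = ev w (P i x).
Hypothesis aX : forall w, in_X T (fun i => a i w).
Variable H : nat -> RR -> {mpoly CF[k]}.
Hypotheses (H0 : forall x, H 0%N x = 1) (H1 : forall n, H n.+1 r0 = 0).
Hypothesis H2 : forall n w x, cder (fun t => ev w (H n t)) x
  (gder (fun i t => ev w (P i.-1 t)) (fun i t => ev w (H i t)) n x).
Variable Mm : moment_index -> {mpoly CF[k]}.
Hypothesis MmP : forall q w,
  prim T (fun x => Cmult (mon (fun i t => ev w (F i t)) q.1 x) (ev w (P q.2 x))) (ev w (Mm q)).

Let HT' : Rle r0 T. Proof. exact: Rlt_le. Qed.
Let B w (i : nat) (x : RR) : CC := ev w (P i.-1 x).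
Let HB w i x : (1 <= i)%coq_nat -> ccont (B w i) x. Proof. by move=> _; exact: cP. Qed.
Let Hab w i x : (1 <= i)%coq_nat -> Rle r0 x /\ Rle x T -> a i w x = B w i x.
Proof. by case: i => [/PeanoNat.Nat.nle_succ_0|i _ hx]; rewrite ?ea. Qed.
Let Hcoef w : first_integral_coeffs (B w) (fun n t => ev w (H n t)).
Proof. by split=> [x|n x]; [rewrite H0 ev1|exact: H2]. Qed.
Let Hzero w n : ev w (H n.+1 r0) = RtoC r0. Proof. by rewrite H1 ev0. Qed.

Lemma center_closed w : is_center T (fun i => a i w) <-> forall n, ev w (H n.+1 T) = 0.
Proof.
have [M [M1 hM]] := in_X_bound _ _ (aX w); split.
- exact: (closed_of_center T M _ _ HT M1 hM (@HB w) (@Hab w) _ (Hcoef w) (Hzero w)).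
- exact: (center_of_closed_coeffs T M _ _ HT M1 hM (@Hab w) _ (Hcoef w) (Hzero w)).
Qed.

Lemma center_from w G : first_integral_coeffs (B w) G -> (forall n, G n T = G n r0) -> is_center T (fun i => a i w).
Proof.
have [M [M1 hM]] := in_X_bound _ _ (aX w).
exact: (center_of_first_integral T M _ _ HT M1 hM (@HB w) (@Hab w) _ _ (Hcoef w) (Hzero w)).
Qed.

Lemma moment_ev w q : moment T (moment_datum q) (fun i => a i w) = ev w (Mm q).
Proof.
have cF i x : ccont (fun t => ev w (F i t)) x := ccont_cder _ _ _ (Fd i w x).
have hc x : ccont (fun x => Cmult (mon (fun i t => ev w (F i t)) q.1 x) (ev w (P q.2 x))) x.
  by apply: ccont_mult; [exact: mon_cont|exact: cP].
rewrite -(prim_uniq _ _ _ _ HT' (prim_of_cont T _ hc) (MmP q w)).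
apply: cint_ext => // x hx; rewrite /= ea //; congr Cmult.
have eF i : atilde (fun i => a i w) (S i) x = ev w (F i x).
  have h : cint (fun t => ev w (P i t)) r0 x = ev w (F i x).
    rewrite (cint_FTC (fun t => ev w (F i t)) _ _ _ hx.1); last by move=> t _; exact: cP.
      by rewrite F0 ev0; exact: (subr0 (ev w (F i x))).
    by move=> t _; exact: Fd.
  rewrite -h; apply: cint_ext => [|t ht]; [exact: hx.1|apply: ea].
  by split; [exact: ht.1|exact: Rle_trans ht.2 hx.2].
elim: (q.1) => //= i l ->; congr Cmult; rewrite eF; exact: Cmult_1_r.
Qed.

Lemma poly_data w : b = true -> exists p : nat -> {poly CF},
  (forall i x, ev w (P i x) = pe (p i)^`() x) /\ forall i x, ev w (F i x) = pe (p i) x.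
Proof.
move=> bt; have h i : exists p : {poly CF}, (forall x, ev w (P i x) = pe p^`() x) /\ p.[(RtoC r0 : CF)] = 0.
  by have := kP i w; rewrite bt => -[c ec]; have [p [ep e0]] := poly_prim0 c; exists p; rewrite ep.
have [p hp] := choice_fun h; exists p; split=> [i x|i]; first by case: (hp i).
apply: (eq_of_cder (fun t => ev w (F i t)) (pe (p i)) (fun x => ev w (P i x))).
- by rewrite F0 ev0; have [_ e] := hp i; rewrite /pe e.
- exact: Fd.
- by move=> x; have [-> _] := hp i; exact: pe_cder.
Qed.

Lemma trig_data w : b = false -> exists al : nat -> E, [/\ forall i, lau (al i),
  forall i x, ev w (P i x) = le T (al i) x & forall i x, ev w (F i x) = path T al i x].
Proof.
move=> bf; have h i : exists y, lau y /\ forall x, ev w (P i x) = le T y x.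
  by have := kP i w; rewrite bf.
have [al hal] := choice_fun h; have lal i : lau (al i) by case: (hal i).
exists al; split=> // [i x|i]; first by case: (hal i).
apply: (eq_of_cder (fun t => ev w (F i t)) (path T al i) (fun x => ev w (P i x))).
- by rewrite F0 ev0 path0.
- exact: Fd.
- by move=> x; have [_ ->] := hal i; apply: path_cder.
Qed.

Lemma hseqP_coeffs w p G : (forall i x, ev w (P i x) = pe (p i)^`() x) -> hseqP p G ->
  first_integral_coeffs (B w) (fun n => pe (G n)).
Proof.
move=> eP [G0 GS]; split=> [x|[|n] x]; first by rewrite G0 /pe hornerC.
  by apply: (cder_eq _ _ (cder_cst 1 x)) => // t; rewrite G0 /pe hornerC.
apply: (cder_eq _ _ (pe_cder (G n.+1) x)) => //.
rewrite GS /pe hornerN horner_sum /gder csum_big; apply: (f_equal (Copp : CF -> CF)); apply: eq_bigr => i _.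
rewrite hornerM hornerMn -[_ *+ _]mulr_natl natC /B eP; reflexivity.
Qed.

Lemma hseqE_coeffs w al G : (forall i, lau (al i)) -> (forall i x, ev w (P i x) = le T (al i) x) ->
  hseqE T al G -> (forall n, lau (G n)) -> first_integral_coeffs (B w) (fun n => le T (G n)).
Proof.
move=> lal eP hG lG; split=> [x|n x]; first by rewrite hG.1 -(rmorph1 cst) le_cst.
rewrite (gder_ext _ (fun i t => le T (al i.-1) t)); first exact: hseqE_cder.
by move=> i _; rewrite /B eP.
Qed.

Lemma same_moments w w' : (forall q, ev w (Mm q) = ev w' (Mm q)) -> forall l j, exists c,
  prim T (fun x => Cmult (mon (fun i t => ev w (F i t)) l x) (ev w (P j x))) c /\
  prim T (fun x => Cmult (mon (fun i t => ev w' (F i t)) l x) (ev w' (P j x))) c.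
Proof.
move=> e l j; exists (ev w (Mm (l, j))); split; first exact: (MmP (l, j) w).
by rewrite e; exact: (MmP (l, j) w').
Qed.

Lemma prim_data w (A' f' : nat -> RR -> CC) l j c : (forall i x, ev w (P i x) = A' i x) ->
  (forall i x, ev w (F i x) = f' i x) ->
  prim T (fun x => Cmult (mon (fun i t => ev w (F i t)) l x) (ev w (P j x))) c ->
  prim T (fun x => Cmult (mon f' l x) (A' j x)) c.
Proof.
move=> eA ef; apply: prim_ext => x; rewrite eA; congr Cmult; exact: mon_ext.
Qed.

(** The closed first integral at [w] is realized inside polynomials or Laurent polynomials,
    transferred to [w'] by the algebraic theorem, and read back as a first integral with equal end
    values. *)
Lemma center_transfer w w' : (forall q, ev w (Mm q) = ev w' (Mm q)) ->
  is_center T (fun i => a i w) -> is_center T (fun i => a i w').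
Proof.
move=> /same_moments hm cw; case bE: b.
  have [p [eP eF]] := poly_data w bE; have [p' [eP' eF']] := poly_data w' bE.
  have [G hG G0] : exists2 G, hseqP p G & forall n, pe (G n.+1) r0 = RtoC r0.
    pose R (G : nat -> {poly CF}) n y := if n is m.+1 then
      y^`() = - \sum_(i < m.+1) (G (m - i)%N *+ (m - i).+1) * (p i)^`() /\ y.[(RtoC r0 : CF)] = 0 else y = 1.
    have [||G hG] := @seq_choice {poly CF} 0 (fun=> True) R.
    - move=> [|n] G G' y e //= [-> ->]; split=> //; congr (- _); apply: eq_bigr => i _.
      by rewrite e // ltnS leq_subr.
    - move=> [|n] G _; first by exists 1.
      by have [y [h1 h2]] := poly_prim0 (- \sum_(i < n.+1) (G (n - i)%N *+ (n - i).+1) * (p i)^`()); exists y.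
    by exists G => [|n]; [split=> [|n]; [case: (hG 0%N)|case: (hG n.+1) => _ []]|case: (hG n.+1) => _ []].
  have [M [M1 hM]] := in_X_bound _ _ (aX w).
  have Gc := closed_of_center T M _ _ HT M1 hM (@HB w) (@Hab w) _ (hseqP_coeffs eP hG) G0 cw.
  have [||G' hG' cG'] := PolynomialCoefficients.closed_first_integral HT' _ hG (q := p').
  - move=> l j; have [c [h1 h2]] := hm l j; exists c; split; [exact: (prim_data eP eF h1)|exact: (prim_data eP' eF' h2)].
  - by case=> [|n]; [rewrite hG.1 /pe !hornerC|rewrite Gc G0].
  exact: center_from (hseqP_coeffs eP' hG') cG'.
have [al [lal eP eF]] := trig_data w bE; have [al' [lal' eP' eF']] := trig_data w' bE.
have [G hG lG] : exists2 G, hseqE T al G & forall n, lau (G n).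
  apply: (lau_of_closed HT lal (H := fun n t => ev w (H n t))) => [x|n x|n|n].
  - by rewrite H0 ev1.
  - rewrite (gder_ext _ (fun i t => ev w (P i.-1 t))); first exact: H2.
    by move=> i _; rewrite eP.
  - by rewrite H1 ev0.
  - exact: (center_closed w).1.
have [|G' hG' lG'] := TrigTransfer.closed_first_integral HT lal lal' _ hG lG.
  move=> l j; have [c [h1 h2]] := hm l j; exists c; split; [exact: (prim_data eP eF h1)|exact: (prim_data eP' eF' h2)].
by apply: center_from (hseqE_coeffs lal' eP' hG' lG') _ => n; apply: le_period.
Qed.

Lemma universal_of_zero w : (forall q, ev w (Mm q) = 0) -> is_universal_center T (fun i => a i w).
Proof.
move=> hz; have hm l j : prim T (fun x => Cmult (mon (fun i t => ev w (F i t)) l x) (ev w (P j x))) (RtoC r0).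
  by have := MmP (l, j) w; rewrite hz.
case bE: b.
  have [p [eP eF]] := poly_data w bE.
  have [|X [X1 X2 X3 X4]] := PolynomialCoefficients.universal_of_moments (p := p) HT'.
    by move=> l j; exact: (prim_data eP eF (hm l j)).
  apply: (universal_of_closed T _ (B w) HT (@HB w) (@Hab w) (fun l => pe (X l))) => // [x|i l x].
    by rewrite X1 /pe hornerC.
  by apply: (cder_eq _ _ (pe_cder _ x)) => //; rewrite X2 /pe hornerM /B eP mulrC.
have [al [lal eP eF]] := trig_data w bE.
have [|X [X1 lX X2 X3]] := TrigTransfer.universal_of_moments HT lal.
  by move=> l j; exact: (prim_data eP eF (hm l j)).
apply: (universal_of_closed T _ (B w) HT (@HB w) (@Hab w) (fun l => le T (X l))) => // [x|i l x|i l].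
- by rewrite X1 -(rmorph1 cst) le_cst.
- apply: (cder_eq _ _ (le_cder HT x (lX _))) => //.
  rewrite X2 leM //; last exact: lau_velocity.
  by rewrite /velocity leZ // /B eP mulrCA mulVKf ?kap0 // mulrC.
- by rewrite le_period // X3.
Qed.

Lemma zero_of_universal w : is_universal_center T (fun i => a i w) -> forall q, ev w (Mm q) = 0.
Proof.
move=> hu [l j]; pose A i x : CC := ev w (P i x).
have hA i x : ccont (A i) x by exact: cP.
have Jd i l' x : cder (iterated A (i :: l')) x (Cmult (B w (S i) x) (iterated A l' x)).
  exact: iterated_cder.
have J0 i l' : iterated A (i :: l') r0 = RtoC r0 by exact: cint_point.
have JT := closed_of_universal T _ (B w) HT (@HB w) (@Hab w) (iterated A) (fun=> erefl) Jd J0 hu.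
have hc x : ccont (fun x => Cmult (mon (fun i t => ev w (F i t)) l x) (A j x)) x.
  by apply: ccont_mult => //; apply: mon_cont => i t; exact: ccont_cder (Fd i w t).
rewrite -(prim_uniq _ _ _ _ HT' (prim_of_cont T _ hc) (MmP (l, j) w)).
apply: (moment_of_iterated T HT' A (fun i t => ev w (F i t)) (iterated A)) => //.
by move=> i; rewrite F0 ev0.
Qed.
End Family.

Definition coeff_list N (p : {mpoly CF[N]}) : list (CC * (nat -> nat)) :=
  [seq (p@_m : CC, fun j => if insub j is Some i then m (i : 'I_N) else 0%N) | m <- msupp p].

Lemma eval_coeff_list N NN (p : {mpoly CF[N]}) (z : nat -> CF) : (N <= NN)%N ->
  eval_poly NN (coeff_list p) z = p.@[fun i : 'I_N => z i].
Proof.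
move=> hN; rewrite /eval_poly Csum_map big_map mevalE; apply: eq_bigr => m _; congr Cmult.
rewrite mono_prod /= -(subnKC hN) big_split_ord /= [X in _ * X]big1 ?mulr1 => [|i _].
  by apply: eq_bigr => i _; rewrite valK.
by rewrite insubF ?expr0 //= ltnNge leq_addr.
Qed.

Theorem centers_by_moments (T : RR) (k : nat) (alpha : nat -> nat) (a : nat -> (nat -> CC) -> RR -> CC) :
  Rlt r0 T -> (forall j, (j < k)%coq_nat -> (0 < alpha j)%coq_nat) ->
  (exists b : bool, forall i, (1 <= i)%coq_nat -> alpha_homog T k alpha b (a i)) ->
  (forall w, in_X T (fun i => a i w)) ->
  (forall w, is_universal_center T (fun i => a i w) <-> (forall j, (j < k)%coq_nat -> w j = RtoC r0)) ->
  exists (N : nat) (m : nat -> moment_data) (p : nat -> list (CC * (nat -> nat))),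
    (forall n, (n < N)%coq_nat -> valid_moment (m n)) /\
    forall w, is_center T (fun i => a i w) <->
      (forall n, (n < N)%coq_nat -> eval_poly N (p n) (fun j => moment T (m j) (fun i => a i w)) = RtoC r0).
Proof.
move=> HT al0 [b hb] aX hU; pose wt (j : 'I_k) := alpha j.
have wt0 j : (0 < wt j)%N by apply/ltP/al0/ltP.
have [dP hdP] := choice_fun (fun i => homogeneous_pathpoly HT (hb (S i) (le_n_S _ _ (PeanoNat.Nat.le_0_l i)))).
pose d i := (dP i).1; pose P i := (dP i).2.
have hP i : pathpoly (fun m => wd wt m = d i) (P i) by case: (hdP i).
have [F hF] := choice_fun (fun i => pathpoly_prim (hP i)).
have hF1 i : pathpoly (fun m => wd wt m = d i) (F i) by case: (hF i).
have F0 i : F i r0 = 0 by case: (hF i).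
have Fd i w x : cder (fun t => ev w (F i t)) x (ev w (P i x)) by case: (hF i).
have [H [H0 H1 H2]] := first_integral_polys hP.
have [Mm hMm] := choice_fun (fun q : moment_index => moment_poly T hP hF1 q.1 q.2).
have MmP q := (hMm q).2.
have kP i w : kind T b (fun x => ev w (P i x)) by case: (hdP i).
have ea i w x : Rle r0 x /\ Rle x T -> a (S i) w x = ev w (P i x) by case: (hdP i) => _ + _; apply.
have cP i w x : ccont (fun t => ev w (P i t)) x by exact: pathpoly_cont (hP i).
pose dg (q : moment_index) := (wlen d q.1 + d q.2)%N.
have Mh q : whomog wt (dg q) (Mm q) := (hMm q).1.
(* Parameters of the statement are sequences; a point with [k] coordinates is extended by 0. *)
pose wof (x : 'I_k -> CF) (j : nat) : CF := if insub j is Some i then x i else 0.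
have evw x p : ev (wof x) p = p.@[x] by apply: meval_eq => j; rewrite /wof valK.
have origin q : (Mm q).@[fun=> 0] = 0.
  rewrite -evw; apply: (zero_of_universal HT cP F0 Fd ea MmP); apply/hU => j /ltP jk.
  by rewrite /wof insubT.
(* Moments of weighted degree 0 are constant in [w], so those of positive degree, as the finiteness
   theorem demands, already determine equality of all moments. *)
have [N [qs [Vqs sep]]] := finite_equality ([::], 0%N) (fun q => 0 < dg q)%N Mm.
pose M (i : 'I_N) := Mm (qs i).
have Msep x y : (forall i, (M i).@[x] = (M i).@[y]) -> forall q, (Mm q).@[x] = (Mm q).@[y].
  move=> e q; have [dq|dq] := ltnP 0 (dg q).
    by apply: sep => // i iN; exact: (e (Ordinal iN)).
  by apply: whomog0_const wt0 _; move: (Mh q); move: dq; rewrite leqn0 => /eqP->.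
have Mz x : (forall i, (M i).@[x] = 0) -> forall j, x j = 0.
  move=> e j; have hz q : ev (wof x) (Mm q) = 0.
    by rewrite evw -[RHS](origin q); apply: Msep => i; rewrite e /M origin.
  have := (hU (wof x)).1 (universal_of_zero HT cP F0 Fd kP ea MmP hz) j (elimT ltP (ltn_ord j)).
  by rewrite /wof valK.
pose cs (c : {mpoly CF[k]}) := exists n, c = H n.+1 T.
have ctr w : is_center T (fun i => a i w) <-> forall c, cs c -> ev w c = 0.
  rewrite (center_closed HT cP ea aX H0 H1 H2 w); split=> [h c [n ->]|h n]; first exact: h.
  by apply: h; exists n.
have sat x x0 : (forall i, (M i).@[x] = (M i).@[x0]) -> (forall c, cs c -> c.@[x] = 0) -> forall c, cs c -> c.@[x0] = 0.
  move=> /Msep e hx c hc; rewrite -evw; move: c hc; apply: (ctr (wof x0)).1.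
  apply: (center_transfer HT cP F0 Fd kP ea aX H0 H1 H2 MmP (w := wof x)) => [q|]; first by rewrite !evw.
  by apply: (ctr (wof x)).2 => c hc; rewrite -[RHS](hx c hc) -evw.
have [s [f hf]] := separated_set_equations CF_closed CF_uncountable wt0 (fun i => Vqs i (ltn_ord i))
   (fun i => Mh (qs i)) Mz sat.
(* The statement wants equally many moments and polynomials; the shorter list is padded, with the
   integral of the first coefficient or with the zero polynomial. *)
pose NN := maxn N s.
exists NN, (fun n => if (n < N)%N then moment_datum (qs n) else ([::], 1%N)),
  (fun n => if (n < s)%N then coeff_list (f n) else [::]).
split=> [n _|w].
  case: ifP => _; last by split=> //=.
  rewrite /moment_datum; split=> /= [p|]; last by apply/leP.
  by move=> /in_map_iff[i [<- _]] /=; split; apply/leP.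
have ez i : (i < N)%N -> moment T (if (i < N)%N then moment_datum (qs i) else ([::], 1%N)) (fun i => a i w) = ev w (Mm (qs i)).
  by move=> iN; rewrite iN; exact: (moment_ev HT cP F0 Fd ea MmP).
have em n : eval_poly NN (coeff_list (f n))
    (fun j => moment T (if (j < N)%N then moment_datum (qs j) else ([::], 1%N)) (fun i => a i w)) =
    (f n).@[mev M (fun j : 'I_k => w j : CF)] :> CF.
  rewrite eval_coeff_list ?leq_maxl //.
  by apply: (@meval_eq _ _ _ (mev M (fun j : 'I_k => w j : CF)) (f n)) => i; apply: ez.
rewrite ctr (hf (fun j : 'I_k => w j : CF)); split=> [h n _|h n ns].
  by case: ifP => [ns|//]; rewrite em h.
have nNN : (n < NN)%N by apply: leq_trans ns (leq_maxr _ _).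
by have := h n (elimT ltP nNN); rewrite ns em.
Qed.
End CenterVariety.

Theorem theorem2p3
  (T : R) (k : nat) (alpha : nat -> nat)
  (a : nat -> (nat -> CC) -> R -> CC) :
  0 < T ->
  (forall j, (j < k)%nat -> (0 < alpha j)%nat) ->
  (exists b : bool, forall i, (1 <= i)%nat -> alpha_homog T k alpha b (a i)) ->
  (forall w : nat -> CC, in_X T (fun i => a i w)) ->
  (forall w : nat -> CC,
     is_universal_center T (fun i => a i w) <-> (forall j, (j < k)%nat -> w j = RtoC 0)) ->
  exists (N : nat) (m : nat -> moment_data) (p : nat -> list (CC * (nat -> nat))),
    (forall n, (n < N)%nat -> valid_moment (m n)) /\
    forall w : nat -> CC,
      is_center T (fun i => a i w) <->
      (forall n, (n < N)%nat ->
         eval_poly N (p n) (fun j => moment T (m j) (fun i => a i w)) = RtoC 0).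
Proof.
intros HT Hal Hb HX HU. exact (CenterVariety.centers_by_moments HT Hal Hb HX HU).
Qed.
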